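(* Let $\Omega_1$ and $\Omega_2$ be domains in the Riemann sphere $\hat{\mathbb{C}}$ such that $\Omega_1\cap\Omega_2\neq\emptyset$ and $\Omega_1\cup\Omega_2$ is hyperbolic. Then $$\frac{\lambda_{\Omega_1}(z)\,\lambda_{\Omega_2}(z)}{\lambda_{\Omega_1\cup\Omega_2}(z)\,\lambda_{\Omega_1\cap\Omega_2}(z)}\ge 1\quad\text{for all } z\in\Omega_1\cap\Omega_2 .$$ If equality holds at one point $z\in\Omega_1\cap\Omega_2$, then $\Omega_1\subseteq\Omega_2$ or $\Omega_2\subseteq\Omega_1$, and in this case equality holds at every point of $\Omega_1\cap\Omega_2$.
   Context: An open set $\Omega\subseteq\hat{\mathbb{C}}$ is called hyperbolic if $\hat{\mathbb{C}}\setminus\Omega$ contains at least three distinct points. Such a set carries a unique complete conformal Riemannian metric $\lambda_\Omega(z)\,|dz|$ of constant Gaussian curvature $-1$ (the hyperbolic or Poincaré metric); in local coordinates $\Delta\log\lambda_\Omega=\lambda_\Omega^2$. If $\Omega$ is a disconnected open set, $\lambda_\Omega$ is defined on each connected component as the Poincaré metric of that component. Although the density of a conformal metric at a point of $\hat{\mathbb{C}}$ is coordinate-dependent, the quotient of two conformal metric densities at a point is well defined, so the left-hand side above (a product of two such quotients) is meaningful; at finite points one may simply use the standard coordinate $z$. *)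

(* Defs.v *)
From Stdlib Require Import Reals Lra.
Open Scope R_scope.

(** Points of the plane (= C) and of the Riemann sphere.
    [None] is the point at infinity. *)
Definition Pt := (R * R)%type.
Definition Sphere := option Pt.

Definition norm2 (z : Pt) : R := fst z * fst z + snd z * snd z.
Definition pdist (z w : Pt) : R :=
  sqrt ((fst z - fst w) * (fst z - fst w) + (snd z - snd w) * (snd z - snd w)).

Definition cinv (w : Pt) : Pt := (fst w / norm2 w, - snd w / norm2 w).

Definition chart_inf (w : Pt) : Sphere :=
  if Req_EM_T (norm2 w) 0 then None else Some (cinv w).

Definition chart (c : bool) (w : Pt) : Sphere :=
  if c then chart_inf w else Some w.

(** A conformal metric is encoded by rho : Sphere -> R, where rho (Some z) is
    the density in the coordinate z and rho None is the density at infinity in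
    the coordinate w = 1/z.  [dens c rho] is the density in chart c:
    in the w-chart the density is rho(1/w) / |w|^2 (since |dz| = |dw|/|w|^2). *)
Definition dens (c : bool) (rho : Sphere -> R) (w : Pt) : R :=
  if c then
    (if Req_EM_T (norm2 w) 0 then rho None else rho (Some (cinv w)) / norm2 w)
  else rho (Some w).

Definition open_sph (U : Sphere -> Prop) : Prop :=
  (forall z, U (Some z) -> exists r, 0 < r /\ forall z', pdist z z' < r -> U (Some z')) /\
  (U None -> exists M, 0 < M /\ forall z, M < sqrt (norm2 z) -> U (Some z)).

Definition connected_sph (U : Sphere -> Prop) : Prop :=
  forall A B : Sphere -> Prop, open_sph A -> open_sph B ->
    (forall p, U p <-> (A p \/ B p)) -> (forall p, ~ (A p /\ B p)) ->
    (forall p, ~ A p) \/ (forall p, ~ B p).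

Definition domain (U : Sphere -> Prop) : Prop :=
  open_sph U /\ connected_sph U /\ exists p, U p.

Definition hyperbolic (U : Sphere -> Prop) : Prop :=
  open_sph U /\
  exists a b c, a <> b /\ a <> c /\ b <> c /\ ~ U a /\ ~ U b /\ ~ U c.

Definition union (U V : Sphere -> Prop) : Sphere -> Prop := fun p => U p \/ V p.
Definition inter (U V : Sphere -> Prop) : Sphere -> Prop := fun p => U p /\ V p.
Definition subset (U V : Sphere -> Prop) : Prop := forall p, U p -> V p.

Definition partial_x (f g : Pt -> R) (W : Pt -> Prop) : Prop :=
  forall p, W p -> derivable_pt_lim (fun t => f (t, snd p)) (fst p) (g p).
Definition partial_y (f g : Pt -> R) (W : Pt -> Prop) : Prop :=
  forall p, W p -> derivable_pt_lim (fun t => f (fst p, t)) (snd p) (g p).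
Definition cont_on (f : Pt -> R) (W : Pt -> Prop) : Prop :=
  forall p, W p -> forall e, 0 < e -> exists d, 0 < d /\
    forall q, pdist p q < d -> Rabs (f q - f p) < e.

Definition C2_on (f : Pt -> R) (W : Pt -> Prop) : Prop :=
  exists fx fy fxx fxy fyx fyy : Pt -> R,
    partial_x f fx W /\ partial_y f fy W /\
    partial_x fx fxx W /\ partial_y fx fxy W /\
    partial_x fy fyx W /\ partial_y fy fyy W /\
    cont_on f W /\ cont_on fx W /\ cont_on fy W /\
    cont_on fxx W /\ cont_on fxy W /\ cont_on fyx W /\ cont_on fyy W.

Definition curvature_minus_one (f : Pt -> R) (W : Pt -> Prop) : Prop :=
  exists ux uy uxx uyy : Pt -> R,
    partial_x (fun p => ln (f p)) ux W /\ partial_y (fun p => ln (f p)) uy W /\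
    partial_x ux uxx W /\ partial_y uy uyy W /\
    forall p, W p -> uxx p + uyy p = f p * f p.

Definition conformal_metric_curv_m1 (O : Sphere -> Prop) (rho : Sphere -> R) : Prop :=
  (forall p, O p -> 0 < rho p) /\
  forall c : bool,
    C2_on (dens c rho) (fun w => O (chart c w)) /\
    curvature_minus_one (dens c rho) (fun w => O (chart c w)).

Definition segment_ok (O : Sphere -> Prop) (rho : Sphere -> R) (c : bool)
  (gx gy dx dy : R -> R) (L : R) : Prop :=
  (forall t, derivable_pt_lim gx t (dx t)) /\
  (forall t, derivable_pt_lim gy t (dy t)) /\
  continuity dx /\ continuity dy /\
  (forall t, 0 <= t <= 1 -> O (chart c (gx t, gy t))) /\
  exists pr : Riemann_integrable
      (fun t => dens c rho (gx t, gy t) * sqrt (dx t * dx t + dy t * dy t)) 0 1,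
    RiemannInt pr = L.

Inductive path_len (O : Sphere -> Prop) (rho : Sphere -> R) :
  Sphere -> Sphere -> R -> Prop :=
| path_nil : forall p, path_len O rho p p 0
| path_cons : forall c gx gy dx dy L1 q L2,
    segment_ok O rho c gx gy dx dy L1 ->
    path_len O rho (chart c (gx 1, gy 1)) q L2 ->
    path_len O rho (chart c (gx 0, gy 0)) q (L1 + L2).

Definition dist_lt (O : Sphere -> Prop) (rho : Sphere -> R) (p q : Sphere) (e : R) : Prop :=
  exists L, path_len O rho p q L /\ L < e.

Definition complete_metric (O : Sphere -> Prop) (rho : Sphere -> R) : Prop :=
  forall x : nat -> Sphere, (forall n, O (x n)) ->
    (forall e, 0 < e -> exists N, forall m n, (N <= m)%nat -> (N <= n)%nat ->
       dist_lt O rho (x m) (x n) e) ->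
    exists p, O p /\ forall e, 0 < e -> exists N, forall n, (N <= n)%nat ->
       dist_lt O rho (x n) p e.

(** rho is the hyperbolic (Poincare) metric of the hyperbolic open set O:
    complete conformal metric of constant curvature -1 (on each component). *)
Definition hyperbolic_metric (O : Sphere -> Prop) (rho : Sphere -> R) : Prop :=
  conformal_metric_curv_m1 O rho /\ complete_metric O rho.

(* Main.v *)
(**
Let a Moebius map move a point outside [O1] and [O2] to infinity, so that all four sets are planar.
Write [u = ln lambda], so that [Laplacian u = exp (2 u)].  A complete such metric on [W] is developed onto
[W] from the unit disc: for [p0] in [W] there is a holomorphic local isometry [F] of the Poincaré
disc with [F 0 = p0].  It is obtained, without monodromy, by integrating along every ray of the disc the
equation satisfied by [G = F'], namely [G' = 2 (d_z ln lambda_disc) G - 2 (d_z u)(F) G^2]; the curvature equation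
is exactly what makes the value at time 1 depend holomorphically on the ray, and completeness keeps the solutions alive.

Monotonicity of the metric and the product inequality follow from one maximum principle.  Given
developing maps [F1], [F2] of [O1], [O2], consider
[uI + uU - u1 - u2] at [p = F1 z1 = F2 z2], corrected by the logarithms of the ratios of the densities
of the discs [|z| < a] and [|z| < 1] at [z1] and [z2]; these corrections force a maximum on the compact set
[|z1|, |z2| < a, F1 z1 = F2 z2].  There the Laplacian is nonpositive, and the inequality
[(lambda1^2 - lambdaU^2)(lambda2^2 - lambdaU^2) >= 0] bounds [lambdaI lambdaU / (lambda1 lambda2)] by [1 / a^2];
then [a] tends to 1.

In the equality case the same second derivative test at the given point gives [lambdaU = lambda1] or
[lambdaU = lambda2] there.  Hopf's strong maximum principle spreads, say, the first equality over [O1]; then a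
segment running from [O1] to a boundary point of [O1] inside [O2] would have finite length, against the completeness
of [O1], so connectedness gives that [O2] is contained in [O1].
*)

From Stdlib Require Import Reals Lra Lia Classical ClassicalEpsilon.
From Coquelicot Require Import Coquelicot.
Require Import Defs.
Open Scope R_scope.

(** The product inequality resists a maximum principle on the intersection itself: near a boundary
    point of [O1] inside [O2], both [lambdaI] and [lambda1] tend to infinity, and nothing is known
    beforehand about their quotient. On pairs [(z1, z2)] with [F1 z1 = F2 z2] the boundary
    disappears: a pair in the closed bidisc of radius [a < 1] always lands inside both sets, and the
    correcting factors vanish when [|z1| = a] or [|z2| = a]. Completeness enters the inequality only
    through the existence of [F1] and [F2]; these are used as local isometries defined on the whole
    disc, never as surjective coverings.

    The argument presupposes [lambdaU <= lambda1] and [lambdaU <= lambda2], which is Ahlfors' lemma.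
    There is no circle: Ahlfors' lemma is the instance of the same inequality in which the two sets
    coincide and three of the four metrics are equal, and there the presupposition is trivial. *)

(** * Derivatives as linear approximations, and moduli of complex numbers *)

(** Without the division by [h], the increment 0 is allowed and the same form serves for complex
    values and for two variables. *)
Lemma is_derive_eps (f : R -> R) (x l : R) :
  is_derive f x l <->
  (forall e, 0 < e -> exists d, 0 < d /\
     forall h, Rabs h < d -> Rabs (f (x + h) - f x - l * h) <= e * Rabs h).
Proof.
split.
- intros H e He.
  apply is_derive_Reals in H. destruct (H e He) as [d Hd].
  exists d; split; [apply cond_pos|]. intros h Hh.
  destruct (Req_dec h 0) as [->|Hn].
  + rewrite Rplus_0_r, Rmult_0_r, !Rminus_diag, Rabs_R0. lra.
  + specialize (Hd h Hn Hh).
    replace (f (x + h) - f x - l * h) with (((f (x + h) - f x) / h - l) * h) by (field; auto).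
    rewrite Rabs_mult. apply Rmult_le_compat_r; [apply Rabs_pos|lra].
- intros H. apply is_derive_Reals. intros e He.
  destruct (H (e / 2)) as [d [Hd Hh]]; [lra|].
  exists (mkposreal d Hd). intros h Hn Hlt. simpl in Hlt.
  specialize (Hh h Hlt).
  replace ((f (x + h) - f x) / h - l) with ((f (x + h) - f x - l * h) / h) by (field; auto).
  unfold Rdiv. rewrite Rabs_mult, Rabs_inv.
  assert (0 < Rabs h) by (apply Rabs_pos_lt; auto).
  apply Rmult_lt_reg_r with (Rabs h); auto.
  rewrite Rmult_assoc, Rinv_l, Rmult_1_r by lra.
  apply Rle_lt_trans with (1 := Hh). nra.
Qed.

Lemma fst_le_Cmod (z : C) : Rabs (fst z) <= Cmod z.
Proof. eapply Rle_trans; [apply Rmax_l | apply Rmax_Cmod]. Qed.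

Lemma snd_le_Cmod (z : C) : Rabs (snd z) <= Cmod z.
Proof. eapply Rle_trans; [apply Rmax_r | apply Rmax_Cmod]. Qed.

Lemma Cmod_le_sum (z : C) : Cmod z <= Rabs (fst z) + Rabs (snd z).
Proof.
destruct z as [x y]; simpl.
replace ((x, y) : C) with (RtoC x + RtoC y * Ci)%C.
- eapply Rle_trans; [apply Cmod_triangle|].
  rewrite Cmod_mult, !Cmod_R, Cmod_Ci. lra.
- apply injective_projections; simpl; ring.
Qed.

Lemma Cmod_sqr (z : C) : Cmod z ^ 2 = fst z * fst z + snd z * snd z.
Proof. rewrite Cmod2_alt. destruct z; simpl; ring. Qed.

Lemma Cmod_minus_sym (a b : C) : Cmod (a - b) = Cmod (b - a).
Proof. rewrite <- Cmod_opp. f_equal; ring. Qed.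

Lemma Cmod_triangle_sub (a b c : C) : Cmod (a - c) <= Cmod (a - b) + Cmod (b - c).
Proof. replace (a - c)%C with ((a - b) + (b - c))%C by ring. apply Cmod_triangle. Qed.

Lemma Cmod_minus_le (a b : C) : Cmod (a - b) <= Cmod a + Cmod b.
Proof. unfold Cminus. rewrite <- (Cmod_opp b). apply Cmod_triangle. Qed.

Lemma Cmod_le_add (a b : C) : Cmod a <= Cmod b + Cmod (a - b).
Proof. replace a with (b + (a - b))%C at 1 by ring. apply Cmod_triangle. Qed.

Ltac split_min := repeat match goal with
  | H : _ < Rmin _ _ |- _ => apply Rmin_Rgt_l in H; unfold Rgt in H; destruct H end.

Ltac cring := cbv beta; match goal with |- ?a = ?b => change (@eq C a b) end; ring.
Ltac req := cbv beta; match goal with |- ?a = ?b => change (@eq R a b) end.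

(** * Complex-valued functions of a real variable *)

Definition vder (f : R -> C) (t : R) (l : C) : Prop :=
  is_derive (fun s => fst (f s)) t (fst l) /\ is_derive (fun s => snd (f s)) t (snd l).

Lemma vder_eps (f : R -> C) (x : R) (l : C) :
  vder f x l <->
  (forall e, 0 < e -> exists d, 0 < d /\
     forall h, Rabs h < d -> Cmod (f (x + h) - f x - l * h) <= e * Rabs h).
Proof.
split.
- intros [H1 H2] e He.
  rewrite is_derive_eps in H1. rewrite is_derive_eps in H2.
  destruct (H1 (e/2)) as [d1 [Hd1 K1]]; [lra|].
  destruct (H2 (e/2)) as [d2 [Hd2 K2]]; [lra|].
  exists (Rmin d1 d2); split; [now apply Rmin_pos|]. intros h Hh.
  eapply Rle_trans; [apply Cmod_le_sum|].
  specialize (K1 h (Rlt_le_trans _ _ _ Hh (Rmin_l _ _))).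
  specialize (K2 h (Rlt_le_trans _ _ _ Hh (Rmin_r _ _))).
  simpl.
  replace (fst (f (x + h)) + - fst (f x) + - (fst l * h - snd l * 0))
    with (fst (f (x + h)) - fst (f x) - fst l * h) by ring.
  replace (snd (f (x + h)) + - snd (f x) + - (fst l * 0 + snd l * h))
    with (snd (f (x + h)) - snd (f x) - snd l * h) by ring.
  lra.
- intros H; split; apply is_derive_eps; intros e He; destruct (H e He) as [d [Hd K]];
  exists d; split; auto; intros h Hh; eapply Rle_trans; [|now apply K| |now apply K].
  + eapply Rle_trans; [|apply fst_le_Cmod]. simpl. right; f_equal; ring.
  + eapply Rle_trans; [|apply snd_le_Cmod]. simpl. right; f_equal; ring.
Qed.

Lemma vder_const (c : C) t : vder (fun _ => c) t 0.
Proof. split; simpl; apply is_derive_Reals, derivable_pt_lim_const. Qed.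

Lemma vder_RtoC f t l : is_derive f t l -> vder (fun s => RtoC (f s)) t (RtoC l).
Proof. intros H; split; simpl; auto. apply is_derive_Reals, derivable_pt_lim_const. Qed.

Lemma vder_id t : vder (fun s => RtoC s) t 1.
Proof. apply (vder_RtoC (fun s => s)). apply is_derive_Reals, derivable_pt_lim_id. Qed.

Lemma vder_plus f g t l m : vder f t l -> vder g t m -> vder (fun s => f s + g s)%C t (l + m)%C.
Proof.
intros [H1 H2] [K1 K2]; split; simpl.
- apply (is_derive_plus (fun s => fst (f s)) (fun s => fst (g s))); auto.
- apply (is_derive_plus (fun s => snd (f s)) (fun s => snd (g s))); auto.
Qed.

Lemma vder_opp f t l : vder f t l -> vder (fun s => - f s)%C t (- l)%C.
Proof.
intros [H1 H2]; split; simpl.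
- apply (is_derive_opp (fun s => fst (f s))); auto.
- apply (is_derive_opp (fun s => snd (f s))); auto.
Qed.

Lemma vder_minus f g t l m : vder f t l -> vder g t m -> vder (fun s => f s - g s)%C t (l - m)%C.
Proof. intros; apply vder_plus; auto. now apply vder_opp. Qed.

Lemma is_derive_mult_R (f g : R -> R) t l m :
  is_derive f t l -> is_derive g t m -> is_derive (fun s => f s * g s) t (l * g t + f t * m).
Proof.
intros H K. apply (is_derive_mult f g t l m H K). intros; simpl; unfold mult; simpl; ring.
Qed.

Lemma is_derive_eq (f : R -> R) t l m : is_derive f t l -> l = m -> is_derive f t m.
Proof. now intros H <-. Qed.

Lemma vder_eq f t l m : vder f t l -> l = m -> vder f t m.
Proof. now intros H <-. Qed.

Lemma is_derive_ext_R (f g : R -> R) t l :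
  (forall s, f s = g s) -> is_derive f t l -> is_derive g t l.
Proof. intros H; apply is_derive_ext; auto. Qed.

Lemma vder_mult f g t l m : vder f t l -> vder g t m ->
  vder (fun s => f s * g s)%C t (l * g t + f t * m)%C.
Proof.
intros [H1 H2] [K1 K2]; split; simpl.
- eapply is_derive_eq.
  apply (is_derive_minus (fun s => fst (f s) * fst (g s)) (fun s => snd (f s) * snd (g s)));
  apply is_derive_mult_R; eauto.
  unfold minus, plus, opp; simpl; ring.
- eapply is_derive_eq.
  apply (is_derive_plus (fun s => fst (f s) * snd (g s)) (fun s => snd (f s) * fst (g s)));
  apply is_derive_mult_R; eauto.
  unfold plus; simpl; ring.
Qed.

Lemma vder_ext f g t l : (forall s, f s = g s) -> vder f t l -> vder g t l.
Proof.
intros H [K1 K2]; split; [eapply is_derive_ext_R, K1|eapply is_derive_ext_R, K2];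
 intros; simpl; now rewrite H.
Qed.

Lemma vder_ext_loc f g t l (r : R) :
  0 < r -> (forall s, Rabs (s - t) < r -> f s = g s) -> vder f t l -> vder g t l.
Proof.
intros Hr H [K1 K2].
split; [eapply is_derive_ext_loc, K1|eapply is_derive_ext_loc, K2];
 exists (mkposreal r Hr); intros y Hy; rewrite H; auto.
Qed.

Lemma vder_inv (f : R -> C) t l : f t <> 0%C -> vder f t l -> vder (fun s => / f s)%C t (- l / (f t * f t))%C.
Proof.
intros Hn [H1 H2].
assert (Hq : fst (f t) ^ 2 + snd (f t) ^ 2 <> 0).
{ intros E. apply Hn. destruct (f t) as [x y]; simpl in *.
  assert (x = 0) by nra. assert (y = 0) by nra. now subst. }
assert (Hd : is_derive (fun s => fst (f s) ^ 2 + snd (f s) ^ 2) t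
   (2 * fst (f t) * fst l + 2 * snd (f t) * snd l)).
{ eapply is_derive_ext_R with (f := fun s => fst (f s) * fst (f s) + snd (f s) * snd (f s)).
  intros; ring.
  eapply is_derive_eq. apply (is_derive_plus (fun s => fst (f s) * fst (f s)) (fun s => snd (f s) * snd (f s)));
  apply is_derive_mult_R; eauto. unfold plus; simpl; ring. }
(* The squared modulus of [f t * f t], which appears as a denominator once the division is unfolded;
   it is the square of the quantity in [Hq]. *)
assert (Hq2 : (fst (f t) * fst (f t) - snd (f t) * snd (f t)) * (fst (f t) * fst (f t) - snd (f t) * snd (f t))
   + (fst (f t) * snd (f t) + snd (f t) * fst (f t)) * (fst (f t) * snd (f t) + snd (f t) * fst (f t)) <> 0).
{ intros E. apply Hq.
  assert (E' : (fst (f t) ^ 2 + snd (f t) ^ 2) ^ 2 = 0). { rewrite <- E. ring. }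
  apply Rsqr_0_uniq. unfold Rsqr. rewrite <- E'. ring. }
split; simpl.
- eapply is_derive_eq. apply (is_derive_div (fun s => fst (f s)) _ t _ _ H1 Hd Hq).
  req. simpl in Hq. field_simplify_eq; [ring|]. repeat split; auto; intros E; (apply Hq2 + apply Hq); (lra || nra).
- eapply is_derive_eq. apply (is_derive_div (fun s => - snd (f s)) _ t _ _ (is_derive_opp (fun s => snd (f s)) _ _ H2)
    Hd Hq).
  req. unfold opp; simpl. simpl in Hq. field_simplify_eq; [ring|].
  repeat split; auto; intros E; (apply Hq2 + apply Hq); (lra || nra).
Qed.

(** * Differentiability and continuity of functions of two real variables *)

(** Total differentiability instead of a pair of partial derivatives: only the former composes with
    curves and with maps of the plane. *)
Definition grad (f : C -> R) (p : C) (a b : R) : Prop :=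
  forall e, 0 < e -> exists d, 0 < d /\ forall q, Cmod (q - p) < d ->
    Rabs (f q - f p - (a * (fst q - fst p) + b * (snd q - snd p))) <= e * Cmod (q - p).

Lemma fst_minus (a b : C) : fst (a - b)%C = fst a - fst b.
Proof. reflexivity. Qed.
Lemma snd_minus (a b : C) : snd (a - b)%C = snd a - snd b.
Proof. reflexivity. Qed.

Lemma grad_lip f p a b : grad f p a b -> exists d, 0 < d /\ forall q, Cmod (q - p) < d ->
  Rabs (f q - f p) <= (Rabs a + Rabs b + 1) * Cmod (q - p).
Proof.
intros H. destruct (H 1) as [d [Hd K]]; [lra|]. exists d; split; auto.
intros q Hq. specialize (K q Hq).
replace (f q - f p) with ((f q - f p - (a * (fst q - fst p) + b * (snd q - snd p)))
  + a * fst (q - p)%C + b * snd (q - p)%C) by (rewrite fst_minus, snd_minus; ring).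
eapply Rle_trans; [apply Rabs_triang|].
eapply Rle_trans; [apply Rplus_le_compat_r, Rabs_triang|].
rewrite !Rabs_mult.
pose proof (fst_le_Cmod (q - p)). pose proof (snd_le_Cmod (q - p)).
pose proof (Rabs_pos a). pose proof (Rabs_pos b). nra.
Qed.

Definition fcont (f : C -> R) (p : C) : Prop :=
  forall e, 0 < e -> exists d, 0 < d /\ forall q, Cmod (q - p) < d -> Rabs (f q - f p) < e.

Lemma grad_cont f p a b : grad f p a b -> fcont f p.
Proof.
intros H e He. destruct (grad_lip _ _ _ _ H) as [d [Hd K]].
set (M := Rabs a + Rabs b + 1) in *.
assert (0 < M) by (pose proof (Rabs_pos a); pose proof (Rabs_pos b); unfold M; lra).
exists (Rmin d (e / (2 * M))). split.
{ apply Rmin_pos; auto. apply Rdiv_lt_0_compat; lra. }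
intros q Hq. eapply Rle_lt_trans. apply K. eapply Rlt_le_trans; [apply Hq|apply Rmin_l].
assert (Cmod (q - p) < e / (2 * M)) by (eapply Rlt_le_trans; [apply Hq|apply Rmin_r]).
apply Rmult_lt_compat_l with (r := M) in H1; auto.
replace (M * (e / (2 * M))) with (e / 2) in H1 by (field; lra). lra.
Qed.

Lemma vder_lip f t l : vder f t l -> exists d, 0 < d /\ forall h, Rabs (h - t) < d ->
  Cmod (f h - f t) <= (Cmod l + 1) * Rabs (h - t).
Proof.
intros H. rewrite vder_eps in H. destruct (H 1) as [d [Hd K]]; [lra|].
exists d; split; auto. intros h Hh. specialize (K (h - t) Hh).
replace (t + (h - t)) with h in K by ring.
replace (f h - f t)%C with ((f h - f t - l * RtoC (h - t)) + l * RtoC (h - t))%C by ring.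
eapply Rle_trans; [apply Cmod_triangle|]. rewrite Cmod_mult, Cmod_R. lra.
Qed.

Lemma vder_cont f t l : vder f t l ->
  forall e, 0 < e -> exists d, 0 < d /\ forall h, Rabs (h - t) < d -> Cmod (f h - f t) < e.
Proof.
intros H e He. destruct (vder_lip _ _ _ H) as [d [Hd K]].
set (M := Cmod l + 1) in *. assert (0 < M) by (pose proof (Cmod_ge_0 l); unfold M; lra).
exists (Rmin d (e / (2 * M))). split.
{ apply Rmin_pos; auto. apply Rdiv_lt_0_compat; lra. }
intros h Hh. eapply Rle_lt_trans. apply K. eapply Rlt_le_trans; [apply Hh|apply Rmin_l].
assert (H1 : Rabs (h - t) < e / (2 * M)) by (eapply Rlt_le_trans; [apply Hh|apply Rmin_r]).
apply Rmult_lt_compat_l with (r := M) in H1; auto.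
replace (M * (e / (2 * M))) with (e / 2) in H1 by (field; lra). lra.
Qed.

Lemma grad_curve f (g : R -> C) t a b l : grad f (g t) a b -> vder g t l ->
  is_derive (fun s => f (g s)) t (a * fst l + b * snd l).
Proof.
intros H K. apply is_derive_eps. intros e He.
set (M := Cmod l + 1). assert (HM : 0 < M) by (pose proof (Cmod_ge_0 l); unfold M; lra).
set (N := Rabs a + Rabs b + 1). assert (HN : 0 < N) by (pose proof (Rabs_pos a); pose proof (Rabs_pos b); unfold N;
  lra).
destruct (H (e / (2 * M))) as [d1 [Hd1 H1]]. { apply Rdiv_lt_0_compat; lra. }
destruct (vder_cont _ _ _ K d1 Hd1) as [d2 [Hd2 H2]].
destruct (vder_lip _ _ _ K) as [d3 [Hd3 H3]].
rewrite vder_eps in K. destruct (K (e / (2 * N))) as [d4 [Hd4 H4]]. { apply Rdiv_lt_0_compat; lra. }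
exists (Rmin d2 (Rmin d3 d4)). split. { repeat apply Rmin_pos; auto. }
intros h Hh.
assert (Rabs h < d2 /\ Rabs h < d3 /\ Rabs h < d4) as [H0 [H6 H7]] by (split_min; auto).
specialize (H2 (t + h)). specialize (H3 (t + h)). specialize (H4 h).
replace (t + h - t) with h in * by ring.
specialize (H2 H0). specialize (H3 H6). specialize (H4 H7).
specialize (H1 _ H2).
replace (f (g (t + h)) - f (g t) - (a * fst l + b * snd l) * h) with
  ((f (g (t + h)) - f (g t) - (a * (fst (g (t + h)) - fst (g t)) + b * (snd (g (t + h)) - snd (g t))))
   + (a * fst (g (t + h)%R - g t - l * h)%C + b * snd (g (t + h)%R - g t - l * h)%C))
 by (simpl; ring).
eapply Rle_trans; [apply Rabs_triang|].
assert (A : Rabs (a * fst (g (t + h)%R - g t - l * h)%C + b * snd (g (t + h)%R - g t - l * h)%C)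
   <= N * Cmod (g (t + h)%R - g t - l * h)).
{ eapply Rle_trans; [apply Rabs_triang|]. rewrite !Rabs_mult.
  pose proof (fst_le_Cmod (g (t + h)%R - g t - l * h)).
  pose proof (snd_le_Cmod (g (t + h)%R - g t - l * h)).
  pose proof (Rabs_pos a); pose proof (Rabs_pos b). unfold N.
  pose proof (Cmod_ge_0 (g (t + h) - g t - l * h)). nra. }
apply Rmult_le_compat_l with (r := e / (2 * M)) in H3; [|left; apply Rdiv_lt_0_compat; lra].
fold M in H3.
replace (e / (2 * M) * (M * Rabs h)) with (e / 2 * Rabs h) in H3 by (field; lra).
apply Rmult_le_compat_l with (r := N) in H4; [|lra].
replace (N * (e / (2 * N) * Rabs h)) with (e / 2 * Rabs h) in H4 by (field; lra).
lra.
Qed.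

(** Along each line through [p] the derivative in one variable is unique. *)
Lemma grad_unique f p a b a' b' : grad f p a b -> grad f p a' b' -> a = a' /\ b = b'.
Proof.
intros H K.
assert (G : forall l : C, a * fst l + b * snd l = a' * fst l + b' * snd l).
{ intros l.
  assert (Hc : vder (fun s => p + l * RtoC s)%C 0 l).
  { eapply vder_eq. apply vder_plus; [apply vder_const|].
    apply vder_mult; [apply vder_const|apply vder_id]. cring. }
  assert (E : p = (p + l * RtoC 0)%C) by ring.
  pose proof (grad_curve f (fun s => p + l * RtoC s)%C 0 a b l) as A. simpl in A.
  pose proof (grad_curve f (fun s => p + l * RtoC s)%C 0 a' b' l) as B. simpl in B.
  rewrite <- E in A, B. specialize (A H Hc). specialize (B K Hc).
  rewrite <- (is_derive_unique _ _ _ A). apply is_derive_unique, B. }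
split.
- specialize (G (1, 0)). simpl in G. lra.
- specialize (G (0, 1)). simpl in G. lra.
Qed.

Lemma grad_const c p : grad (fun _ => c) p 0 0.
Proof.
intros e He. exists 1; split; [lra|]. intros q _.
replace (c - c - (0 * (fst q - fst p) + 0 * (snd q - snd p))) with 0 by ring.
rewrite Rabs_R0. pose proof (Cmod_ge_0 (q - p)). nra.
Qed.

Lemma grad_fst p : grad fst p 1 0.
Proof.
intros e He. exists 1; split; [lra|]. intros q _.
replace (fst q - fst p - (1 * (fst q - fst p) + 0 * (snd q - snd p))) with 0 by ring.
rewrite Rabs_R0. pose proof (Cmod_ge_0 (q - p)). nra.
Qed.

Lemma grad_snd p : grad snd p 0 1.
Proof.
intros e He. exists 1; split; [lra|]. intros q _.
replace (snd q - snd p - (0 * (fst q - fst p) + 1 * (snd q - snd p))) with 0 by ring.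
rewrite Rabs_R0. pose proof (Cmod_ge_0 (q - p)). nra.
Qed.

Lemma grad_plus f g p a b a' b' : grad f p a b -> grad g p a' b' ->
  grad (fun q => f q + g q) p (a + a') (b + b').
Proof.
intros H K e He.
destruct (H (e/2)) as [d1 [Hd1 H1]]; [lra|]. destruct (K (e/2)) as [d2 [Hd2 H2]]; [lra|].
exists (Rmin d1 d2); split; [now apply Rmin_pos|]. intros q Hq.
specialize (H1 q (Rlt_le_trans _ _ _ Hq (Rmin_l _ _))).
specialize (H2 q (Rlt_le_trans _ _ _ Hq (Rmin_r _ _))).
match goal with |- Rabs ?x <= _ => replace x with
 ((f q - f p - (a * (fst q - fst p) + b * (snd q - snd p))) +
  (g q - g p - (a' * (fst q - fst p) + b' * (snd q - snd p)))) by ring end.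
eapply Rle_trans; [apply Rabs_triang|]. lra.
Qed.

Lemma grad_eq f p a b a' b' : grad f p a b -> a = a' -> b = b' -> grad f p a' b'.
Proof. now intros H <- <-. Qed.

Lemma grad_ext_loc f g p a b r : 0 < r -> (forall q, Cmod (q - p) < r -> f q = g q) ->
  grad f p a b -> grad g p a b.
Proof.
intros Hr E H e He. destruct (H e He) as [d [Hd K]].
exists (Rmin r d); split; [now apply Rmin_pos|]. intros q Hq.
rewrite <- !E. apply K. eapply Rlt_le_trans; [apply Hq|apply Rmin_r].
replace (p - p)%C with (RtoC 0) by ring. now rewrite Cmod_0.
eapply Rlt_le_trans; [apply Hq|apply Rmin_l].
Qed.

Lemma grad_ext f g p a b : (forall q, f q = g q) -> grad f p a b -> grad g p a b.
Proof. intros E. apply grad_ext_loc with 1; auto. lra. Qed.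

Lemma grad_comp (h : R -> R) f p a b l : grad f p a b -> is_derive h (f p) l ->
  grad (fun q => h (f q)) p (l * a) (l * b).
Proof.
intros H K e He. rewrite is_derive_eps in K.
set (N := Rabs a + Rabs b + 1). assert (HN : 0 < N) by (pose proof (Rabs_pos a); pose proof (Rabs_pos b); unfold N;
  lra).
set (M := Rabs l + 1). assert (HM : 0 < M) by (pose proof (Rabs_pos l); unfold M; lra).
destruct (K (e / (2 * N))) as [d1 [Hd1 H1]]. { apply Rdiv_lt_0_compat; lra. }
destruct (grad_lip _ _ _ _ H) as [d2 [Hd2 H2]].
destruct (grad_cont _ _ _ _ H d1 Hd1) as [d3 [Hd3 H3]].
destruct (H (e / (2 * M))) as [d4 [Hd4 H4]]. { apply Rdiv_lt_0_compat; lra. }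
exists (Rmin d2 (Rmin d3 d4)). split. { repeat apply Rmin_pos; auto. }
intros q Hq.
assert (Q2 : Cmod (q - p) < d2) by (eapply Rlt_le_trans; [apply Hq|apply Rmin_l]).
assert (Q5 : Cmod (q - p) < Rmin d3 d4) by (eapply Rlt_le_trans; [apply Hq|apply Rmin_r]).
assert (Q3 : Cmod (q - p) < d3) by (eapply Rlt_le_trans; [apply Q5|apply Rmin_l]).
assert (Q4 : Cmod (q - p) < d4) by (eapply Rlt_le_trans; [apply Q5|apply Rmin_r]).
specialize (H3 q Q3). specialize (H1 _ H3). specialize (H2 q Q2). specialize (H4 q Q4).
replace (f p + (f q - f p)) with (f q) in H1 by ring.
match goal with |- Rabs ?x <= _ => replace x with
 ((h (f q) - h (f p) - l * (f q - f p)) +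
  l * (f q - f p - (a * (fst q - fst p) + b * (snd q - snd p)))) by ring end.
eapply Rle_trans; [apply Rabs_triang|]. rewrite Rabs_mult.
apply Rmult_le_compat_l with (r := e / (2 * N)) in H2; [|left; apply Rdiv_lt_0_compat; lra].
fold N in H2.
replace (e / (2 * N) * (N * Cmod (q - p))) with (e / 2 * Cmod (q - p)) in H2 by (field; lra).
assert (Rabs l * Rabs (f q - f p - (a * (fst q - fst p) + b * (snd q - snd p))) <= e / 2 * Cmod (q - p)).
{ eapply Rle_trans. apply Rmult_le_compat_l; [apply Rabs_pos|apply H4].
  apply Rle_trans with (M * (e / (2 * M) * Cmod (q - p))).
  - apply Rmult_le_compat_r. apply Rmult_le_pos; [left; apply Rdiv_lt_0_compat; lra|apply Cmod_ge_0].
    unfold M; lra.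
  - right; field; lra. }
lra.
Qed.

Lemma grad_scal c f p a b : grad f p a b -> grad (fun q => c * f q) p (c * a) (c * b).
Proof.
intros H. apply (grad_comp (fun x => c * x)); auto.
eapply is_derive_eq. apply (is_derive_scal (fun x => x)). apply is_derive_id.
unfold one; simpl; unfold scal; simpl; unfold mult; simpl; ring.
Qed.

Lemma grad_opp f p a b : grad f p a b -> grad (fun q => - f q) p (- a) (- b).
Proof.
intros H. apply grad_ext with (f := fun q => -1 * f q). intros; ring.
eapply grad_eq. apply grad_scal, H. ring. ring.
Qed.

Lemma grad_minus f g p a b a' b' : grad f p a b -> grad g p a' b' ->
  grad (fun q => f q - g q) p (a - a') (b - b').
Proof. intros; apply grad_plus; auto. now apply grad_opp. Qed.

Lemma grad_mult f g p a b a' b' : grad f p a b -> grad g p a' b' ->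
  grad (fun q => f q * g q) p (a * g p + f p * a') (b * g p + f p * b').
Proof.
intros H K.
(* Polarization reduces the product to squares, hence to [grad_comp]. *)
apply grad_ext with (f := fun q => / 4 * ((f q + g q) * (f q + g q)) - / 4 * ((f q - g q) * (f q - g q))).
{ intros; field. }
assert (S : forall x, is_derive (fun y => y * y) x (2 * x)).
{ intros x. eapply is_derive_eq. apply is_derive_mult_R; apply is_derive_id.
  unfold one; simpl; ring. }
eapply grad_eq.
- apply grad_minus; apply grad_scal.
  + apply (grad_comp (fun y => y * y) (fun q => f q + g q)). apply grad_plus; eauto. apply S.
  + apply (grad_comp (fun y => y * y) (fun q => f q - g q)). apply grad_minus; eauto. apply S.
- field.
- field.
Qed.

Lemma grad_compC f (phi : C -> C) p a b x1 x2 y1 y2 :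
  grad f (phi p) a b -> grad (fun q => fst (phi q)) p x1 x2 -> grad (fun q => snd (phi q)) p y1 y2 ->
  grad (fun q => f (phi q)) p (a * x1 + b * y1) (a * x2 + b * y2).
Proof.
intros H X Y e He.
(* The linear part of [f] at [phi p], composed with [phi]: its gradient follows from the rules for
   sums, so only the remainder of [f] has to be estimated through the Lipschitz bound of [phi]. *)
set (L := fun q : C => a * fst (phi q) + b * snd (phi q)).
assert (HL : grad L p (a * x1 + b * y1) (a * x2 + b * y2)).
{ apply grad_plus; now apply grad_scal. }
destruct (grad_lip _ _ _ _ X) as [d1 [Hd1 H1]].
destruct (grad_lip _ _ _ _ Y) as [d2 [Hd2 H2]].
set (N := (Rabs x1 + Rabs x2 + 1) + (Rabs y1 + Rabs y2 + 1)) in *.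
assert (HN : 0 < N).
{ unfold N. pose proof (Rabs_pos x1); pose proof (Rabs_pos x2); pose proof (Rabs_pos y1); pose proof (Rabs_pos y2);
    lra. }
destruct (H (e / (2 * N))) as [d3 [Hd3 H3]]. { apply Rdiv_lt_0_compat; lra. }
destruct (HL (e / 2)) as [d4 [Hd4 H4]]; [lra|].
exists (Rmin (Rmin d1 d2) (Rmin (d3 / N) d4)).
split. { repeat apply Rmin_pos; auto. now apply Rdiv_lt_0_compat. }
intros q Hq.
assert (Q1 : Cmod (q - p) < Rmin d1 d2) by (eapply Rlt_le_trans; [apply Hq|apply Rmin_l]).
assert (Q2 : Cmod (q - p) < Rmin (d3 / N) d4) by (eapply Rlt_le_trans; [apply Hq|apply Rmin_r]).
specialize (H1 q (Rlt_le_trans _ _ _ Q1 (Rmin_l _ _))).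
specialize (H2 q (Rlt_le_trans _ _ _ Q1 (Rmin_r _ _))).
specialize (H4 q (Rlt_le_trans _ _ _ Q2 (Rmin_r _ _))).
assert (Q3 := Rlt_le_trans _ _ _ Q2 (Rmin_l _ _)).
assert (Hphi : Cmod (phi q - phi p) <= N * Cmod (q - p)).
{ eapply Rle_trans; [apply Cmod_le_sum|]. rewrite fst_minus, snd_minus. unfold N. lra. }
assert (Hlt : Cmod (phi q - phi p) < d3).
{ eapply Rle_lt_trans; [apply Hphi|]. apply Rmult_lt_compat_l with (r := N) in Q3; auto.
  replace (N * (d3 / N)) with d3 in Q3 by (field; lra). auto. }
specialize (H3 _ Hlt). unfold L in H4.
match goal with |- Rabs ?x <= _ => replace x with
 ((f (phi q) - f (phi p) - (a * (fst (phi q) - fst (phi p)) + b * (snd (phi q) - snd (phi p)))) +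
  (a * fst (phi q) + b * snd (phi q) - (a * fst (phi p) + b * snd (phi p)) -
        ((a * x1 + b * y1) * (fst q - fst p) + (a * x2 + b * y2) * (snd q - snd p)))) by ring end.
eapply Rle_trans; [apply Rabs_triang|].
apply Rmult_le_compat_l with (r := e / (2 * N)) in Hphi; [|left; apply Rdiv_lt_0_compat; lra].
replace (e / (2 * N) * (N * Cmod (q - p))) with (e / 2 * Cmod (q - p)) in Hphi by (field; lra).
lra.
Qed.

Lemma fcont_ext_loc f g p r : 0 < r -> (forall q, Cmod (q - p) < r -> f q = g q) ->
  fcont f p -> fcont g p.
Proof.
intros Hr E H e He. destruct (H e He) as [d [Hd K]].
exists (Rmin r d); split; [now apply Rmin_pos|]. intros q Hq.
rewrite <- !E. apply K. eapply Rlt_le_trans; [apply Hq|apply Rmin_r].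
replace (p - p)%C with (RtoC 0) by ring. now rewrite Cmod_0.
eapply Rlt_le_trans; [apply Hq|apply Rmin_l].
Qed.

Lemma fcont_plus f g p : fcont f p -> fcont g p -> fcont (fun q => f q + g q) p.
Proof.
intros H K e He. destruct (H (e/2)) as [d1 [Hd1 H1]]; [lra|].
destruct (K (e/2)) as [d2 [Hd2 H2]]; [lra|].
exists (Rmin d1 d2); split; [now apply Rmin_pos|]. intros q Hq.
specialize (H1 q (Rlt_le_trans _ _ _ Hq (Rmin_l _ _))).
specialize (H2 q (Rlt_le_trans _ _ _ Hq (Rmin_r _ _))).
replace (f q + g q - (f p + g p)) with ((f q - f p) + (g q - g p)) by ring.
eapply Rle_lt_trans; [apply Rabs_triang|]. lra.
Qed.

Lemma fcont_comp (h : R -> R) f p : fcont f p -> continuity_pt h (f p) -> fcont (fun q => h (f q)) p.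
Proof.
intros H K e He. destruct (K e He) as [a [Ha K']].
destruct (H a Ha) as [d [Hd H']]. exists d; split; auto. intros q Hq.
specialize (H' q Hq). destruct (Req_dec (f q) (f p)) as [E|E].
- rewrite E, Rminus_diag, Rabs_R0. auto.
- apply (K' (f q)). split; auto. split; unfold no_cond; auto.
Qed.

Lemma fcont_scal c f p : fcont f p -> fcont (fun q => c * f q) p.
Proof.
intros H. apply (fcont_comp (fun x => c * x)); auto.
apply derivable_continuous_pt. apply derivable_pt_scal, derivable_pt_id.
Qed.

Lemma fcont_mult f g p : fcont f p -> fcont g p -> fcont (fun q => f q * g q) p.
Proof.
intros H K.
assert (S : forall x, continuity_pt (fun y => y * y) x).
{ intros x. apply derivable_continuous_pt. apply derivable_pt_mult; apply derivable_pt_id. }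
(* Polarization again, as in [grad_mult]. *)
assert (A : fcont (fun q => / 4 * ((f q + g q) * (f q + g q)) + (- / 4) * ((f q + (-1) * g q) * (f q + (-1) * g q))) p).
{ apply fcont_plus; apply fcont_scal; apply (fcont_comp (fun y => y * y)); auto;
  apply fcont_plus; auto; now apply fcont_scal. }
revert A. apply fcont_ext_loc with 1; [lra|]. intros; field.
Qed.

Lemma fcont_const c p : fcont (fun _ => c) p.
Proof. eapply grad_cont, grad_const. Qed.

Lemma fcont_compC f (phi : C -> C) p :
  fcont f (phi p) -> fcont (fun q => fst (phi q)) p -> fcont (fun q => snd (phi q)) p ->
  fcont (fun q => f (phi q)) p.
Proof.
intros H X Y e He. destruct (H e He) as [d [Hd K]].
destruct (X (d/2)) as [d1 [Hd1 H1]]; [lra|]. destruct (Y (d/2)) as [d2 [Hd2 H2]]; [lra|].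
exists (Rmin d1 d2); split; [now apply Rmin_pos|]. intros q Hq. apply K.
specialize (H1 q (Rlt_le_trans _ _ _ Hq (Rmin_l _ _))).
specialize (H2 q (Rlt_le_trans _ _ _ Hq (Rmin_r _ _))).
eapply Rle_lt_trans; [apply Cmod_le_sum|]. rewrite fst_minus, snd_minus. lra.
Qed.

(** * Continuous curves and their integrals *)

Definition vcont (X : R -> C) (t : R) : Prop :=
  forall e, 0 < e -> exists d, 0 < d /\ forall h, Rabs (h - t) < d -> Cmod (X h - X t) < e.

Lemma vcont_fst X t : vcont X t -> continuous (fun s => fst (X s)) t.
Proof.
intros H. apply continuity_pt_filterlim. intros e He. destruct (H e He) as [d [Hd K]].
exists d; split; auto. intros y [_ Hy]. simpl in *. unfold R_dist in *.
eapply Rle_lt_trans; [|apply (K y Hy)]. apply (fst_le_Cmod (X y - X t)).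
Qed.

Lemma vcont_snd X t : vcont X t -> continuous (fun s => snd (X s)) t.
Proof.
intros H. apply continuity_pt_filterlim. intros e He. destruct (H e He) as [d [Hd K]].
exists d; split; auto. intros y [_ Hy]. simpl in *. unfold R_dist in *.
eapply Rle_lt_trans; [|apply (K y Hy)]. apply (snd_le_Cmod (X y - X t)).
Qed.

Lemma ex_RInt_cont (f : R -> R) a b :
  (forall z, Rmin a b <= z <= Rmax a b -> continuous f z) -> ex_RInt f a b.
Proof. apply (@ex_RInt_continuous R_CompleteNormedModule). Qed.

Definition CInt (X : R -> C) (a b : R) : C :=
  (RInt (fun s => fst (X s)) a b, RInt (fun s => snd (X s)) a b).

Lemma vder_CInt X a t : (forall s, vcont X s) -> vder (fun b => CInt X a b) t (X t).
Proof.
intros H. split; simpl.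
- apply (is_derive_RInt (fun s => fst (X s)) (fun b => RInt (fun s => fst (X s)) a b) a t).
  + exists (mkposreal 1 Rlt_0_1). intros y _. apply (@RInt_correct R_CompleteNormedModule), ex_RInt_cont.
    intros; now apply vcont_fst.
  + now apply vcont_fst.
- apply (is_derive_RInt (fun s => snd (X s)) (fun b => RInt (fun s => snd (X s)) a b) a t).
  + exists (mkposreal 1 Rlt_0_1). intros y _. apply (@RInt_correct R_CompleteNormedModule), ex_RInt_cont.
    intros; now apply vcont_snd.
  + now apply vcont_snd.
Qed.

Lemma abs_RInt_bound (f : R -> R) a b B : (forall s, continuous f s) ->
  (forall s, Rmin a b <= s <= Rmax a b -> Rabs (f s) <= B) ->
  Rabs (RInt f a b) <= Rabs (b - a) * B.
Proof.
intros Hc HB. destruct (Rle_dec a b) as [Hab|Hab].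
- rewrite (Rabs_pos_eq (b - a)) by lra. apply abs_RInt_le_const; auto.
  apply ex_RInt_cont; auto.
  intros t Ht; apply HB. now rewrite Rmin_left, Rmax_right.
- rewrite <- opp_RInt_swap by (apply ex_RInt_cont; auto).
  unfold opp; simpl. rewrite Rabs_Ropp, Rabs_minus_sym, (Rabs_pos_eq (a - b)) by lra.
  apply abs_RInt_le_const; [lra| |].
  apply ex_RInt_cont; auto.
  intros t Ht; apply HB. rewrite Rmin_right, Rmax_left; lra.
Qed.

(** The factor 2 comes from bounding the two components separately. *)
Lemma CInt_bound X a b B : (forall s, vcont X s) ->
  (forall s, Rmin a b <= s <= Rmax a b -> Cmod (X s) <= B) ->
  Cmod (CInt X a b) <= 2 * Rabs (b - a) * B.
Proof.
intros Hc HB. eapply Rle_trans; [apply Cmod_le_sum|]. simpl.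
assert (Rabs (RInt (fun s => fst (X s)) a b) <= Rabs (b - a) * B).
{ apply abs_RInt_bound. intros; now apply vcont_fst.
  intros; eapply Rle_trans; [apply fst_le_Cmod|auto]. }
assert (Rabs (RInt (fun s => snd (X s)) a b) <= Rabs (b - a) * B).
{ apply abs_RInt_bound. intros; now apply vcont_snd.
  intros; eapply Rle_trans; [apply snd_le_Cmod|auto]. }
lra.
Qed.

Lemma CInt_minus X Y a b : (forall s, vcont X s) -> (forall s, vcont Y s) ->
  (CInt X a b - CInt Y a b)%C = CInt (fun s => X s - Y s)%C a b.
Proof.
intros H K. apply injective_projections; simpl; symmetry.
- apply (RInt_minus (fun s => fst (X s)) (fun s => fst (Y s)));
  apply ex_RInt_cont; intros; now apply vcont_fst.
- apply (RInt_minus (fun s => snd (X s)) (fun s => snd (Y s)));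
  apply ex_RInt_cont; intros; now apply vcont_snd.
Qed.

Lemma CInt_Chasles X a b c : (forall s, vcont X s) ->
  (CInt X a b + CInt X b c)%C = CInt X a c.
Proof.
intros H. apply injective_projections; simpl.
- apply (RInt_Chasles (fun s => fst (X s))); apply ex_RInt_cont; intros; now apply vcont_fst.
- apply (RInt_Chasles (fun s => snd (X s))); apply ex_RInt_cont; intros; now apply vcont_snd.
Qed.

Lemma CInt_point X a : CInt X a a = 0%C.
Proof.
apply injective_projections; simpl.
- apply (RInt_point a (fun s => fst (X s))).
- apply (RInt_point a (fun s => snd (X s))).
Qed.

Lemma vcont_minus X Y t : vcont X t -> vcont Y t -> vcont (fun s => X s - Y s)%C t.
Proof.
intros H K e He. destruct (H (e/2)) as [d1 [Hd1 H1]]; [lra|].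
destruct (K (e/2)) as [d2 [Hd2 H2]]; [lra|].
exists (Rmin d1 d2); split; [now apply Rmin_pos|]. intros h Hh. split_min.
specialize (H1 h ltac:(assumption)). specialize (H2 h ltac:(assumption)).
replace (X h - Y h - (X t - Y t))%C with ((X h - X t) - (Y h - Y t))%C by ring.
eapply Rle_lt_trans; [apply Cmod_minus_le|]. lra.
Qed.

Lemma vcont_vder X t l : vder X t l -> vcont X t.
Proof. intros H; exact (vder_cont _ _ _ H). Qed.

(** * Picard iteration for systems of two complex equations *)

Section Picard.
Variables (f : R -> C -> C -> C) (K M : R).
Definition field_lip := forall t x y x' y',
  Cmod (f t x y - f t x' y') <= K * (Cmod (x - x') + Cmod (y - y')).
Definition field_bd := forall t x y, Cmod (f t x y) <= M.
Definition field_cont := forall x y t, vcont (fun s => f s x y) t.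
End Picard.

Lemma vcont_field f K (X Y : R -> C) t : 0 < K -> field_lip f K -> field_cont f ->
  vcont X t -> vcont Y t -> vcont (fun s => f s (X s) (Y s)) t.
Proof.
intros HK HL HC HX HY e He.
destruct (HC (X t) (Y t) t (e/2)) as [d1 [Hd1 H1]]; [lra|].
destruct (HX (e/(8*K))) as [d2 [Hd2 H2]]; [apply Rdiv_lt_0_compat; lra|].
destruct (HY (e/(8*K))) as [d3 [Hd3 H3]]; [apply Rdiv_lt_0_compat; lra|].
exists (Rmin d1 (Rmin d2 d3)); split; [repeat apply Rmin_pos; auto|].
intros h Hh. split_min. specialize (H1 h ltac:(assumption)). specialize (H2 h ltac:(assumption)).
specialize (H3 h ltac:(assumption)).
eapply Rle_lt_trans; [apply (Cmod_triangle_sub _ (f h (X t) (Y t)))|].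
specialize (HL h (X h) (Y h) (X t) (Y t)).
assert (Q : K * (Cmod (X h - X t) + Cmod (Y h - Y t)) <= K * (e / (8*K) + e/(8*K))).
{ apply Rmult_le_compat_l; lra. }
replace (K * (e / (8*K) + e/(8*K))) with (e/4) in Q by (field; lra). lra.
Qed.

Fixpoint picard_iter (f g : R -> C -> C -> C) (t0 : R) (x0 y0 : C) (n : nat) : (R -> C) * (R -> C) :=
  match n with
  | O => (fun _ => x0, fun _ => y0)
  | S n => let (X, Y) := picard_iter f g t0 x0 y0 n in
    (fun t => x0 + CInt (fun s => f s (X s) (Y s)) t0 t,
     fun t => y0 + CInt (fun s => g s (X s) (Y s)) t0 t)%C
  end.

(** The limit is delivered as a [sig], so that taking it for every time defines a function in
    [picard]. *)
Lemma cauchy_lim (X : nat -> C) A : (forall n, Cmod (X (S n) - X n) <= A * (1/2)^n) ->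
  {l : C | forall n, Cmod (l - X n) <= 4 * A * (1/2)^n}.
Proof.
intros H.
assert (HA : 0 <= A). { specialize (H O). pose proof (Cmod_ge_0 (X 1%nat - X 0%nat)). simpl in H; lra. }
assert (Hp : forall n, 0 < (1/2)^n) by (intros; apply pow_lt; lra).
(* The exact partial sum of the geometric series is kept, because the bound without its second term
   is not inductive in [k]. *)
assert (D : forall n k, Cmod (X (n + k)%nat - X n) <= 2 * A * (1/2)^n - 2 * A * (1/2)^(n+k)).
{ intros n k. induction k.
  - rewrite Nat.add_0_r. replace (X n - X n)%C with (RtoC 0) by ring. rewrite Cmod_0. lra.
  - rewrite Nat.add_succ_r. eapply Rle_trans; [apply (Cmod_triangle_sub _ (X (n+k)%nat))|].
    specialize (H (n+k)%nat). simpl. lra. }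
assert (D' : forall n k, Cmod (X (n + k)%nat - X n) <= 2 * A * (1/2)^n).
{ intros n k. specialize (D n k). specialize (Hp (n+k)%nat). nra. }
assert (T : forall e, 0 < e -> exists N, forall n, (N <= n)%nat -> 4 * A * (1/2)^n < e).
{ intros e He.
  destruct (pow_lt_1_zero (1/2)) with (y := e / (4 * A + 1)) as [N HN].
  - rewrite Rabs_pos_eq; lra.
  - apply Rdiv_lt_0_compat; lra.
  - exists N. intros n Hn. specialize (HN n Hn). rewrite Rabs_pos_eq in HN by (left; auto).
    apply Rmult_lt_compat_l with (r := 4 * A + 1) in HN; [|lra].
    replace ((4 * A + 1) * (e / (4 * A + 1))) with e in HN by (field; lra).
    specialize (Hp n). lra. }
assert (C1 : forall p : C -> R, (forall z, Rabs (p z) <= Cmod z) -> (forall z w, p (z - w)%C = p z - p w) ->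
   {l | Un_cv (fun n => p (X n)) l}).
{ intros p P1 P2. apply Rcomplete.R_complete. intros e He. destruct (T e He) as [N HN]. exists N.
  intros n m Hn Hm. unfold Rdist. rewrite <- P2.
  eapply Rle_lt_trans; [apply P1|].
  replace n with (N + (n - N))%nat by lia. replace m with (N + (m - N))%nat by lia.
  eapply Rle_lt_trans; [apply (Cmod_triangle_sub _ (X N))|]. rewrite (Cmod_minus_sym (X N)).
  pose proof (D' N (n - N)%nat). pose proof (D' N (m - N)%nat).
  specialize (HN N (le_n _)). lra. }
destruct (C1 fst fst_le_Cmod fst_minus) as [a Ha].
destruct (C1 snd snd_le_Cmod snd_minus) as [b Hb].
exists (a, b). intros n.
apply le_epsilon. intros e He.
destruct (Ha (e/2)) as [N1 H1]; [lra|]. destruct (Hb (e/2)) as [N2 H2]; [lra|].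
set (m := (n + (N1 + N2))%nat).
specialize (H1 m). specialize (H2 m). unfold Rdist in *.
eapply Rle_trans; [apply (Cmod_triangle_sub _ (X m))|].
assert (Cmod ((a, b) - X m) <= e).
{ eapply Rle_trans; [apply Cmod_le_sum|]. rewrite fst_minus, snd_minus; simpl.
  rewrite Rabs_minus_sym, (Rabs_minus_sym b).
  assert (Rabs (fst (X m) - a) < e/2) by (apply H1; unfold m; lia).
  assert (Rabs (snd (X m) - b) < e/2) by (apply H2; unfold m; lia). lra. }
specialize (D' n (N1 + N2)%nat). fold m in D'. specialize (Hp n). nra.
Qed.

Lemma CInt_ext_bound x0 X Y a b B : (forall s, vcont X s) -> (forall s, vcont Y s) ->
  (forall s, Rmin a b <= s <= Rmax a b -> Cmod (X s - Y s) <= B) ->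
  Cmod ((x0 + CInt X a b) - (x0 + CInt Y a b)) <= 2 * Rabs (b - a) * B.
Proof.
intros HX HY HB.
replace ((x0 + CInt X a b) - (x0 + CInt Y a b))%C with (CInt X a b - CInt Y a b)%C by ring.
rewrite CInt_minus by auto. apply CInt_bound; auto. intros; now apply vcont_minus.
Qed.

Lemma between_abs a b s h : Rmin a b <= s <= Rmax a b -> Rabs (b - a) <= h -> Rabs (s - a) <= h.
Proof.
unfold Rmin, Rmax, Rabs. repeat destruct Rle_dec; repeat destruct Rcase_abs; lra.
Qed.

Lemma pow2_lt_small A e : 0 <= A -> 0 < e -> exists n, A * (1/2)^n < e.
Proof.
intros HA He. destruct (pow_lt_1_zero (1/2)) with (y := e / (A + 1)) as [N HN].
- rewrite Rabs_pos_eq; lra.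
- apply Rdiv_lt_0_compat; lra.
- exists N. specialize (HN N (le_n _)). assert (0 < (1/2)^N) by (apply pow_lt; lra).
  rewrite Rabs_pos_eq in HN by lra.
  apply Rmult_lt_compat_l with (r := A + 1) in HN; [|lra].
  replace ((A + 1) * (e / (A + 1))) with e in HN by (field; lra). lra.
Qed.

(** With [h = 1 / (16 K)] one iteration multiplies differences by at most [4 h K = 1 / 4], counting
    both unknowns and the factor 2 of [CInt_bound]. The length of the time interval depends on [K]
    alone and not on the initial data; this uniformity is what later carries a solution past a
    limiting time. *)
Lemma picard (f g : R -> C -> C -> C) K M t0 x0 y0 : 0 < K ->
  field_lip f K -> field_lip g K -> field_bd f M -> field_bd g M ->
  field_cont f -> field_cont g ->
  exists X Y : R -> C, X t0 = x0 /\ Y t0 = y0 /\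
   forall t, Rabs (t - t0) < / (16 * K) ->
     vder X t (f t (X t) (Y t)) /\ vder Y t (g t (X t) (Y t)).
Proof.
intros HK Lf Lg Bf Bg Cf Cg.
set (h := / (16 * K)). assert (Hh : 0 < h) by (apply Rinv_0_lt_compat; lra).
assert (HKh : 16 * K * h = 1) by (unfold h; field; lra).
set (Xn := fun n => fst (picard_iter f g t0 x0 y0 n)). set (Yn := fun n => snd (picard_iter f g t0 x0 y0 n)).
assert (EX : forall n t, Xn (S n) t = (x0 + CInt (fun s => f s (Xn n s) (Yn n s)) t0 t)%C).
{ intros n t. unfold Xn, Yn. simpl. destruct (picard_iter f g t0 x0 y0 n); reflexivity. }
assert (EY : forall n t, Yn (S n) t = (y0 + CInt (fun s => g s (Xn n s) (Yn n s)) t0 t)%C).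
{ intros n t. unfold Xn, Yn. simpl. destruct (picard_iter f g t0 x0 y0 n); reflexivity. }
assert (KC : forall x (Z : R -> C), (forall s, vcont Z s) ->
   forall t, vder (fun t => x + CInt Z t0 t)%C t (Z t)).
{ intros x Z HZ t. eapply vder_eq. apply vder_plus; [apply vder_const|apply (vder_CInt Z); exact HZ]. cring. }
assert (EX0 : forall t, Xn O t = x0) by reflexivity.
assert (EY0 : forall t, Yn O t = y0) by reflexivity.
clearbody Xn Yn.
assert (CC : forall n, (forall t, vcont (Xn n) t) /\ (forall t, vcont (Yn n) t)).
{ induction n as [|n [IH1 IH2]].
  - split; intros t; apply (vcont_vder _ _ 0).
    + apply (vder_ext (fun _ => x0)); [intros; now rewrite EX0|apply vder_const].
    + apply (vder_ext (fun _ => y0)); [intros; now rewrite EY0|apply vder_const].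
  - split; intros t.
    + apply (vcont_vder _ _ (f t (Xn n t) (Yn n t))).
      apply (vder_ext (fun t => (x0 + CInt (fun s => f s (Xn n s) (Yn n s)) t0 t)%C)); [intros; now rewrite EX|].
      apply (KC x0 (fun s => f s (Xn n s) (Yn n s))).
      intros ?; (apply (vcont_field f K) || apply (vcont_field g K)); auto.
    + apply (vcont_vder _ _ (g t (Xn n t) (Yn n t))).
      apply (vder_ext (fun t => (y0 + CInt (fun s => g s (Xn n s) (Yn n s)) t0 t)%C)); [intros; now rewrite EY|].
      apply (KC y0 (fun s => g s (Xn n s) (Yn n s))).
      intros ?; (apply (vcont_field f K) || apply (vcont_field g K)); auto. }
assert (CXn : forall n t, vcont (Xn n) t) by (intros; apply CC).
assert (CYn : forall n t, vcont (Yn n) t) by (intros; apply CC).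
assert (CF : forall n t, vcont (fun s => f s (Xn n s) (Yn n s)) t) by (intros ? ?;
  (apply (vcont_field f K) || apply (vcont_field g K)); auto).
assert (CG : forall n t, vcont (fun s => g s (Xn n s) (Yn n s)) t) by (intros ? ?;
  (apply (vcont_field f K) || apply (vcont_field g K)); auto).
assert (HM : 0 <= M). { eapply Rle_trans; [apply Cmod_ge_0|apply (Bf 0 x0 y0)]. }
set (A := 2 * h * M). assert (HA : 0 <= A) by (unfold A; nra).
assert (Hp : forall n, 0 < (1/2)^n) by (intros; apply pow_lt; lra).
assert (DD : forall n t, Rabs (t - t0) <= h ->
   Cmod (Xn (S n) t - Xn n t) <= A * (1/2)^n /\ Cmod (Yn (S n) t - Yn n t) <= A * (1/2)^n).
{ induction n; intros t Ht.
  - rewrite EX, EY, EX0, EY0. simpl.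
    replace (x0 + CInt (fun s => f s (Xn O s) (Yn O s)) t0 t - x0)%C with (CInt (fun s => f s (Xn O s) (Yn O s)) t0 t)
      by ring.
    replace (y0 + CInt (fun s => g s (Xn O s) (Yn O s)) t0 t - y0)%C with (CInt (fun s => g s (Xn O s) (Yn O s)) t0 t)
      by ring.
    split; (eapply Rle_trans; [apply (CInt_bound _ _ _ M); auto|unfold A; pose proof (Rabs_pos (t - t0)); nra]).
  - rewrite (EX (S n)), (EX n), (EY (S n)), (EY n).
    assert (Q : forall s, Rmin t0 t <= s <= Rmax t0 t ->
       Cmod (Xn (S n) s - Xn n s) <= A * (1/2)^n /\ Cmod (Yn (S n) s - Yn n s) <= A * (1/2)^n).
    { intros s Hs. apply IHn. eapply between_abs; eauto. }
    specialize (Hp n).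
    split; (eapply Rle_trans; [apply (CInt_ext_bound _ _ _ _ _ (K * (2 * (A * (1/2)^n))))|]); auto;
    try (intros s Hs; destruct (Q s Hs);
       eapply Rle_trans; [apply Lf || apply Lg|]; apply Rmult_le_compat_l; lra);
    (simpl; pose proof (Rabs_pos (t - t0));
    apply Rle_trans with (2 * h * (K * (2 * (A * (1/2)^n))));
    [apply Rmult_le_compat_r; [|lra]; repeat apply Rmult_le_pos; lra|];
    assert (0 <= A * (1/2)^n) by (apply Rmult_le_pos; lra); nra). }
assert (LX : forall t, {l | Rabs (t - t0) <= h -> forall n, Cmod (l - Xn n t) <= 4 * A * (1/2)^n}).
{ intros t. destruct (Rle_dec (Rabs (t - t0)) h) as [Ht|Ht].
  - destruct (cauchy_lim (fun n => Xn n t) A) as [l Hl]. intros; now apply DD. exists l; auto.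
  - exists 0%C. intros; contradiction. }
assert (LY : forall t, {l | Rabs (t - t0) <= h -> forall n, Cmod (l - Yn n t) <= 4 * A * (1/2)^n}).
{ intros t. destruct (Rle_dec (Rabs (t - t0)) h) as [Ht|Ht].
  - destruct (cauchy_lim (fun n => Yn n t) A) as [l Hl]. intros; now apply DD. exists l; auto.
  - exists 0%C. intros; contradiction. }
(* The iterates are controlled only for [|t - t0| <= h]. Clamping the time makes their limit
   continuous on the whole line, as [vder_CInt] demands. *)
set (cl := fun t => Rmax (t0 - h) (Rmin (t0 + h) t)).
assert (cl_in : forall t, Rabs (cl t - t0) <= h).
{ intros t; unfold cl, Rmax, Rmin, Rabs; repeat destruct Rle_dec; repeat destruct Rcase_abs; lra. }
assert (cl_id : forall t, Rabs (t - t0) <= h -> cl t = t).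
{ intros t; unfold cl, Rmax, Rmin, Rabs; repeat destruct Rle_dec; repeat destruct Rcase_abs; lra. }
assert (cl_lip : forall t s, Rabs (cl t - cl s) <= Rabs (t - s)).
{ intros t s; unfold cl, Rmax, Rmin, Rabs; repeat destruct Rle_dec; repeat destruct Rcase_abs; lra. }
set (X := fun t => proj1_sig (LX (cl t))). set (Y := fun t => proj1_sig (LY (cl t))).
assert (AX : forall n t, Cmod (X t - Xn n (cl t)) <= 4 * A * (1/2)^n).
{ intros n t. unfold X. destruct (LX (cl t)); simpl; auto. }
assert (AY : forall n t, Cmod (Y t - Yn n (cl t)) <= 4 * A * (1/2)^n).
{ intros n t. unfold Y. destruct (LY (cl t)); simpl; auto. }
assert (lipX : forall n t s, Cmod (Xn n t - Xn n s) <= 2 * Rabs (t - s) * M).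
{ intros [|n] t s.
  - rewrite !EX0. replace (x0 - x0)%C with (RtoC 0) by ring. rewrite Cmod_0.
    pose proof (Rabs_pos (t - s)); nra.
  - rewrite !EX, <- (CInt_Chasles _ t0 s t) by auto.
    match goal with |- Cmod ?x <= _ => replace x with (CInt (fun s0 => f s0 (Xn n s0) (Yn n s0)) s t) by ring end.
    apply CInt_bound; auto. }
assert (lipY : forall n t s, Cmod (Yn n t - Yn n s) <= 2 * Rabs (t - s) * M).
{ intros [|n] t s.
  - rewrite !EY0. replace (y0 - y0)%C with (RtoC 0) by ring. rewrite Cmod_0.
    pose proof (Rabs_pos (t - s)); nra.
  - rewrite !EY, <- (CInt_Chasles _ t0 s t) by auto.
    match goal with |- Cmod ?x <= _ => replace x with (CInt (fun s0 => g s0 (Xn n s0) (Yn n s0)) s t) by ring end.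
    apply CInt_bound; auto. }
assert (KL : forall (Z : R -> C) (Zn : nat -> R -> C), (forall n t, Cmod (Z t - Zn n (cl t)) <= 4 * A * (1/2)^n) ->
  (forall n t s, Cmod (Zn n t - Zn n s) <= 2 * Rabs (t - s) * M) -> forall t, vcont Z t).
{ intros Z Zn H1 H2 t e He.
  destruct (pow2_lt_small (4 * A) (e/4)) as [n Hn]; [lra|lra|].
  exists (e / (4 * (M + 1))). split. { apply Rdiv_lt_0_compat; lra. }
  intros s Hs.
  replace (Z s - Z t)%C with ((Z s - Zn n (cl s)) + (Zn n (cl s) - Zn n (cl t)) - (Z t - Zn n (cl t)))%C by ring.
  eapply Rle_lt_trans; [apply Cmod_minus_le|].
  eapply Rle_lt_trans; [apply Rplus_le_compat_r, Cmod_triangle|].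
  pose proof (H1 n s). pose proof (H1 n t). pose proof (H2 n (cl s) (cl t)).
  pose proof (cl_lip s t).
  assert (2 * Rabs (cl s - cl t) * M <= 2 * (e / (4 * (M + 1))) * (M + 1)).
  { apply Rmult_le_compat; try lra. pose proof (Rabs_pos (cl s - cl t)); lra. }
  replace (2 * (e / (4 * (M + 1))) * (M + 1)) with (e / 2) in H5 by (field; lra). lra. }
assert (CX : forall t, vcont X t) by (apply (KL X Xn); auto).
assert (CY : forall t, vcont Y t) by (apply (KL Y Yn); auto).
assert (CFX : forall t, vcont (fun s => f s (X s) (Y s)) t) by (intros ?;
  (apply (vcont_field f K) || apply (vcont_field g K)); auto).
assert (CGX : forall t, vcont (fun s => g s (X s) (Y s)) t) by (intros ?;
  (apply (vcont_field f K) || apply (vcont_field g K)); auto).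
(* [X] is merely a continuous limit; its image [Z] under the integral operator is differentiable by
   construction and coincides with [X] on the interval. *)
set (Z := fun t => (x0 + CInt (fun s => f s (X s) (Y s)) t0 t)%C).
set (W := fun t => (y0 + CInt (fun s => g s (X s) (Y s)) t0 t)%C).
assert (Zero : forall z : C, (forall n, Cmod z <= 12 * A * (1/2)^n) -> z = 0%C).
{ intros z Hz. apply Cmod_eq_0. apply Rle_antisym; [|apply Cmod_ge_0].
  apply le_epsilon. intros e He. destruct (pow2_lt_small (12 * A) e) as [n Hn]; [lra|lra|].
  specialize (Hz n). lra. }
assert (EQ : forall t, Rabs (t - t0) <= h -> X t = Z t /\ Y t = W t).
{ intros t Ht.
  assert (B : forall n s, Rmin t0 t <= s <= Rmax t0 t -> Cmod (X s - Xn n s) <= 4 * A * (1/2)^n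
     /\ Cmod (Y s - Yn n s) <= 4 * A * (1/2)^n).
  { intros n s Hs. pose proof (between_abs _ _ _ _ Hs Ht).
    specialize (AX n s). specialize (AY n s). rewrite (cl_id s) in AX, AY by auto. auto. }
  split.
  - assert (X t - Z t = 0)%C as E; [|replace (X t) with (X t - Z t + Z t)%C by ring; rewrite E; ring].
    apply Zero. intros n.
    eapply Rle_trans; [apply (Cmod_triangle_sub _ (Xn (S n) t))|].
    specialize (AX (S n) t). rewrite cl_id in AX by auto. simpl in AX.
    rewrite EX. rewrite EX in AX.
    assert (Cmod ((x0 + CInt (fun s => f s (Xn n s) (Yn n s)) t0 t) - Z t) <= 2 * Rabs (t - t0) * (K * (8 * A *
      (1/2)^n))).
    { apply CInt_ext_bound; auto. intros s Hs. destruct (B n s Hs).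
      eapply Rle_trans; [apply Lf|]. rewrite (Cmod_minus_sym (Xn n s)), (Cmod_minus_sym (Yn n s)).
      apply Rmult_le_compat_l; lra. }
    specialize (Hp n).
    assert (0 <= A * (1/2)^n) by (apply Rmult_le_pos; lra).
    assert (2 * Rabs (t - t0) * (K * (8 * A * (1/2)^n)) <= 2 * h * (K * (8 * A * (1/2)^n))).
    { apply Rmult_le_compat_r; nra. }
    replace (2 * h * (K * (8 * A * (1/2)^n))) with (16 * K * h * (A * (1/2)^n)) in H1 by ring.
    rewrite HKh in H1. lra.
  - assert (Y t - W t = 0)%C as E; [|replace (Y t) with (Y t - W t + W t)%C by ring; rewrite E; ring].
    apply Zero. intros n.
    eapply Rle_trans; [apply (Cmod_triangle_sub _ (Yn (S n) t))|].
    specialize (AY (S n) t). rewrite cl_id in AY by auto. simpl in AY.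
    rewrite EY. rewrite EY in AY.
    assert (Cmod ((y0 + CInt (fun s => g s (Xn n s) (Yn n s)) t0 t) - W t) <= 2 * Rabs (t - t0) * (K * (8 * A *
      (1/2)^n))).
    { apply CInt_ext_bound; auto. intros s Hs. destruct (B n s Hs).
      eapply Rle_trans; [apply Lg|]. rewrite (Cmod_minus_sym (Xn n s)), (Cmod_minus_sym (Yn n s)).
      apply Rmult_le_compat_l; lra. }
    specialize (Hp n).
    assert (0 <= A * (1/2)^n) by (apply Rmult_le_pos; lra).
    assert (2 * Rabs (t - t0) * (K * (8 * A * (1/2)^n)) <= 2 * h * (K * (8 * A * (1/2)^n))).
    { apply Rmult_le_compat_r; nra. }
    replace (2 * h * (K * (8 * A * (1/2)^n))) with (16 * K * h * (A * (1/2)^n)) in H1 by ring.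
    rewrite HKh in H1. lra. }
exists Z, W. split; [|split].
- unfold Z. rewrite CInt_point. ring.
- unfold W. rewrite CInt_point. ring.
- intros t Ht. destruct (EQ t) as [<- <-]; [fold h in Ht; lra|].
  split; unfold Z, W.
  + apply (KC x0 (fun s => f s (X s) (Y s))); auto.
  + apply (KC y0 (fun s => g s (X s) (Y s))); auto.
Qed.

(** * Differential inequalities, Gronwall's lemma and compactness in time *)

Lemma is_derive_cont (f : R -> R) t l : is_derive f t l ->
  forall e, 0 < e -> exists d, 0 < d /\ forall s, Rabs (s - t) < d -> Rabs (f s - f t) < e.
Proof.
intros H e He.
destruct (vder_cont _ _ _ (vder_RtoC _ _ _ H) e He) as [d [Hd K]].
exists d; split; auto. intros s Hs. specialize (K s Hs).
rewrite <- RtoC_minus, Cmod_R in K. auto.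
Qed.

Lemma is_derive_MVT (f f' : R -> R) a b : a < b ->
  (forall t, a <= t <= b -> is_derive f t (f' t)) ->
  exists c, a < c < b /\ f b - f a = f' c * (b - a).
Proof.
intros Hab H.
destruct (MVT_cor2 f f' a b Hab) as [c [E Hc]].
- intros c Hc. apply is_derive_Reals, H; auto.
- exists c; auto.
Qed.

(** A bootstrap: the sign of [phi'] is known only just after a time at which [phi <= 0], since the
    estimates hold only near a reference point or curve. The last time before [t1] with [phi <= 0]
    again has this property by continuity, and the mean value theorem pushes it further. *)
Lemma nonpos_persist (phi phi' : R -> R) T :
  (forall t, 0 <= t <= T -> is_derive phi t (phi' t)) -> phi 0 <= 0 ->
  (forall t, 0 <= t <= T -> phi t <= 0 -> exists d, 0 < d /\
      forall s, t < s < t + d -> s <= T -> phi' s <= 0) ->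
  forall t, 0 <= t <= T -> phi t <= 0.
Proof.
intros HD H0 HP t1 Ht1.
destruct (Rle_dec (phi t1) 0) as [|Hn]; auto. exfalso.
destruct (completeness (fun s => 0 <= s <= t1 /\ phi s <= 0)) as [m [Hub Hl]].
{ exists t1. intros s [Hs _]; lra. }
{ exists 0. split; lra. }
assert (Hm : 0 <= m <= t1).
{ split. apply Hub; split; lra. apply Hl. intros s [Hs _]; lra. }
assert (Pm : phi m <= 0).
{ destruct (Rle_dec (phi m) 0) as [|Hn']; auto. exfalso.
  destruct (is_derive_cont phi m (phi' m) (HD m ltac:(lra)) (phi m)) as [d [Hd K]]; [lra|].
  assert (m <= m - d); [|lra]. apply Hl. intros s [Hs Ps].
  destruct (Rle_dec s (m - d)); auto. exfalso.
  assert (s <= m) by (apply Hub; split; auto).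
  assert (Q : Rabs (phi s - phi m) < phi m) by (apply K; apply Rabs_def1; lra).
  apply Rabs_def2 in Q. lra. }
destruct (HP m) as [d [Hd K]]; [lra|auto|].
assert (m < t1). { destruct (Req_dec m t1) as [E|]; [rewrite E in Pm; lra|lra]. }
set (s := Rmin (m + d / 2) t1).
assert (Hs : m < s <= t1 /\ s < m + d).
{ unfold s, Rmin; destruct Rle_dec; lra. }
destruct (is_derive_MVT phi phi' m s) as [c [Hc E]]; [lra| |].
{ intros t Ht; apply HD; lra. }
assert (phi' c <= 0) by (apply K; lra).
assert (phi s <= 0) by nra.
assert (s <= m) by (apply Hub; split; lra). lra.
Qed.

Lemma is_derive_Cmod2 X t l : vder X t l ->
  is_derive (fun s => Cmod (X s) ^ 2) t (2 * (fst (X t) * fst l + snd (X t) * snd l)).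
Proof.
intros [H1 H2]. eapply is_derive_ext_R. intros s; symmetry; apply Cmod_sqr.
eapply is_derive_eq. apply (is_derive_plus (fun s => fst (X s) * fst (X s)) (fun s => snd (X s) * snd (X s)));
apply is_derive_mult_R; eauto. unfold plus; simpl; ring.
Qed.

Lemma dot_le (a b : C) : fst a * fst b + snd a * snd b <= Cmod a * Cmod b.
Proof.
destruct (Rle_dec (fst a * fst b + snd a * snd b) 0) as [H|H].
- pose proof (Cmod_ge_0 a). pose proof (Cmod_ge_0 b). nra.
- apply Rsqr_incr_0_var. 2: apply Rmult_le_pos; apply Cmod_ge_0.
  unfold Rsqr.
  replace (Cmod a * Cmod b * (Cmod a * Cmod b)) with (Cmod a ^ 2 * Cmod b ^ 2) by ring.
  rewrite !Cmod_sqr. assert (0 <= (fst a * snd b - snd a * fst b)^2) by apply pow2_ge_0. nra.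
Qed.

Lemma is_derive_id_R t : is_derive (fun x : R => x) t 1.
Proof. apply is_derive_Reals, derivable_pt_lim_id. Qed.
Lemma is_derive_scal_R c f t l : is_derive f t l -> is_derive (fun x => c * f x) t (c * l).
Proof. intros H. apply is_derive_Reals. apply derivable_pt_lim_scal. now apply is_derive_Reals. Qed.
Lemma is_derive_plus_R f g t l m : is_derive f t l -> is_derive g t m -> is_derive (fun x => f x + g x) t (l + m).
Proof. apply (is_derive_plus f g). Qed.
Lemma is_derive_minus_R f g t l m : is_derive f t l -> is_derive g t m -> is_derive (fun x => f x - g x) t (l - m).
Proof. apply (is_derive_minus f g). Qed.
Lemma is_derive_opp_R f t l : is_derive f t l -> is_derive (fun x => - f x) t (- l).
Proof. apply (is_derive_opp f). Qed.
Lemma is_derive_const_R (c : R) t : is_derive (fun _ => c) t 0.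
Proof. apply is_derive_Reals, derivable_pt_lim_const. Qed.
Lemma is_derive_comp_R (h f : R -> R) t l m : is_derive f t l -> is_derive h (f t) m ->
  is_derive (fun x => h (f x)) t (m * l).
Proof.
intros H K. apply is_derive_Reals. apply (derivable_pt_lim_comp f h); now apply is_derive_Reals.
Qed.
Lemma is_derive_exp_R f t l : is_derive f t l -> is_derive (fun x => exp (f x)) t (exp (f t) * l).
Proof. intros H. apply (is_derive_comp_R exp f); auto. apply is_derive_exp. Qed.

Definition gronwall_const (M T : R) := 2 * T * exp ((4 * M + 1) * T).

(** The energy [E = |X|^2 + |Y|^2] is differentiable even where [X] or [Y] vanishes and satisfies
    [E' <= (4 M + 1) E + 2 eta^2], whence [gronwall_const]. The bounds on [X'] and [Y'] are assumed
    only while [E < rho]; the smallness of [eta] against [rho] closes the bootstrap. *)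
Lemma gronwall (X Y X' Y' : R -> C) T M eta rho : 0 <= M -> 0 <= T -> X 0 = 0%C -> Y 0 = 0%C ->
  (forall t, 0 <= t <= T -> vder X t (X' t) /\ vder Y t (Y' t)) ->
  eta ^ 2 * gronwall_const M T < rho ->
  (forall t, 0 <= t <= T -> Cmod (X t) ^ 2 + Cmod (Y t) ^ 2 < rho ->
     Cmod (X' t) <= M * (Cmod (X t) + Cmod (Y t)) + eta /\
     Cmod (Y' t) <= M * (Cmod (X t) + Cmod (Y t)) + eta) ->
  forall t, 0 <= t <= T -> Cmod (X t) ^ 2 + Cmod (Y t) ^ 2 <= eta ^ 2 * gronwall_const M T.
Proof.
intros HM HT X0 Y0 HD Hrho HP.
set (a := 4 * M + 1). set (b := 2 * eta ^ 2).
assert (Hb : 0 <= b) by (unfold b; pose proof (pow2_ge_0 eta); lra).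
set (E := fun t => Cmod (X t) ^ 2 + Cmod (Y t) ^ 2).
set (E' := fun t => 2 * (fst (X t) * fst (X' t) + snd (X t) * snd (X' t)) +
                    2 * (fst (Y t) * fst (Y' t) + snd (Y t) * snd (Y' t))).
assert (DE : forall t, 0 <= t <= T -> is_derive E t (E' t)).
{ intros t Ht. destruct (HD t Ht). apply is_derive_plus_R; now apply is_derive_Cmod2. }
set (phi := fun t => E t * exp (- a * t) - b * t).
set (phi' := fun t => (E' t - a * E t) * exp (- a * t) - b).
assert (Dphi : forall t, 0 <= t <= T -> is_derive phi t (phi' t)).
{ intros t Ht. eapply is_derive_eq. apply is_derive_minus_R.
  - apply is_derive_mult_R. apply DE, Ht. apply is_derive_exp_R, is_derive_scal_R, is_derive_id_R.
  - apply is_derive_scal_R, is_derive_id_R.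
  - unfold phi'. req. ring. }
assert (EB : forall t, 0 <= t <= T -> phi t <= 0 -> E t <= eta ^ 2 * gronwall_const M T).
{ intros t Ht H. unfold phi in H.
  assert (E t <= b * t * exp (a * t)).
  { apply Rmult_le_reg_r with (exp (- a * t)); [apply exp_pos|].
    rewrite Rmult_assoc, <- exp_plus. replace (a * t + - a * t) with 0 by ring. rewrite exp_0. lra. }
  eapply Rle_trans; [apply H0|]. unfold gronwall_const, b. fold a.
  assert (exp (a * t) <= exp (a * T)).
  { destruct (Req_dec t T) as [->|]; [lra|]. left; apply exp_increasing. unfold a in *. nra. }
  assert (t * exp (a * t) <= T * exp (a * T)).
  { apply Rmult_le_compat; try lra. left; apply exp_pos. }
  pose proof (pow2_ge_0 eta). nra. }
intros t Ht. apply EB; auto. revert t Ht.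
apply (nonpos_persist phi phi' T); auto.
- unfold phi, E. rewrite X0, Y0, Cmod_0. simpl. lra.
- intros t Ht Pt. pose proof (EB t Ht Pt) as Hlt.
  destruct (is_derive_cont _ _ _ (DE t Ht) (rho - E t)) as [d [Hd K]]; [lra|].
  exists d; split; auto. intros s Hs HsT.
  assert (Hs0 : 0 <= s <= T) by lra.
  assert (Es : E s < rho).
  { specialize (K s). assert (Q : Rabs (E s - E t) < rho - E t) by (apply K, Rabs_def1; lra).
    apply Rabs_def2 in Q. lra. }
  destruct (HP s Hs0 Es) as [P1 P2].
  unfold phi'.
  assert (E' s - a * E s <= b).
  { unfold E', E, a, b. pose proof (dot_le (X s) (X' s)). pose proof (dot_le (Y s) (Y' s)).
    pose proof (Cmod_ge_0 (X s)). pose proof (Cmod_ge_0 (Y s)).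
    set (x := Cmod (X s)) in *. set (y := Cmod (Y s)) in *.
    assert (x * Cmod (X' s) <= x * (M * (x + y) + eta)) by (apply Rmult_le_compat_l; auto).
    assert (y * Cmod (Y' s) <= y * (M * (x + y) + eta)) by (apply Rmult_le_compat_l; auto).
    pose proof (pow2_ge_0 (x - y)). pose proof (pow2_ge_0 (x - eta)). pose proof (pow2_ge_0 (y - eta)).
    assert (0 <= M * (x - y) ^ 2) by (apply Rmult_le_pos; auto).
    nra. }
  assert (exp (- a * s) <= 1).
  { rewrite <- exp_0. destruct (Req_dec (- a * s) 0) as [->|]; [lra|]. left; apply exp_increasing.
    unfold a in *; nra. }
  pose proof (exp_pos (- a * s)). nra.
Qed.

Lemma gronwall_bound (X Y X' Y' : R -> C) T M eta rho : 0 <= M -> 0 <= T -> 0 <= eta -> X 0 = 0%C -> Y 0 = 0%C ->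
  (forall t, 0 <= t <= T -> vder X t (X' t) /\ vder Y t (Y' t)) ->
  eta ^ 2 * gronwall_const M T < rho ->
  (forall t, 0 <= t <= T -> Cmod (X t) ^ 2 + Cmod (Y t) ^ 2 < rho ->
     Cmod (X' t) <= M * (Cmod (X t) + Cmod (Y t)) + eta /\
     Cmod (Y' t) <= M * (Cmod (X t) + Cmod (Y t)) + eta) ->
  forall t, 0 <= t <= T -> Cmod (X t) <= eta * (gronwall_const M T + 1) /\ Cmod (Y t) <= eta * (gronwall_const M T + 1).
Proof.
intros HM HT He X0 Y0 HD Hr HP t Ht.
pose proof (gronwall X Y X' Y' T M eta rho HM HT X0 Y0 HD Hr HP t Ht) as G.
assert (Hg : 0 <= gronwall_const M T). { unfold gronwall_const. pose proof (exp_pos ((4 * M + 1) * T)). nra. }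
pose proof (Cmod_ge_0 (X t)). pose proof (Cmod_ge_0 (Y t)).
assert (G2 : eta ^ 2 * gronwall_const M T <= (eta * (gronwall_const M T + 1)) ^ 2).
{ pose proof (pow2_ge_0 eta). rewrite Rpow_mult_distr. nra. }
assert (0 <= eta * (gronwall_const M T + 1)) by nra.
split; apply Rsqr_incr_0_var; auto; unfold Rsqr; nra.
Qed.

(** Compactness of [[0, T]], for a property that improves as the radius shrinks. The finite cover
    comes under a double negation, hence [NNPP]. *)
Lemma uniform_on_compact (P : R -> R -> Prop) T :
  (forall s r r', P s r -> 0 < r' <= r -> P s r') ->
  (forall s, 0 <= s <= T -> exists r, 0 < r /\ forall s', 0 <= s' <= T -> Rabs (s' - s) < r -> P s' r) ->
  exists r, 0 < r /\ forall s, 0 <= s <= T -> P s r.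
Proof.
intros Hm HL.
assert (CH : forall s, {r : posreal | 0 <= s <= T -> forall s', 0 <= s' <= T -> Rabs (s' - s) < r -> P s' r}).
{ intros s. apply constructive_indefinite_description.
  destruct (classic (0 <= s <= T)) as [H|H].
  - destruct (HL s H) as [r [Hr K]]. exists (mkposreal r Hr). auto.
  - exists (mkposreal 1 Rlt_0_1). intros; contradiction. }
destruct (compactness_value_1d 0 T (fun s => proj1_sig (CH s))) as [d Hd].
exists d; split; [apply cond_pos|]. intros s Hs.
apply NNPP. intros Hn. apply (Hd s Hs). intros [t [Ht [Hst Hdt]]]. apply Hn.
destruct (CH t) as [r Hr]; simpl in *.
apply Hm with r. apply Hr; auto. split; [apply cond_pos|auto].
Qed.

(** * Planar metrics and their second-order data *)

(** [ju] stands for the logarithm of a density. The derivatives are carried along as total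
    functions, with a single mixed one, so that the symmetry of second derivatives is built into the
    fields of [planar_metric]. *)
Record jet := { ju : C -> R; jx : C -> R; jy : C -> R; jxx : C -> R; jxy : C -> R; jyy : C -> R }.

Definition plane_open (W : C -> Prop) := forall p, W p -> exists r, 0 < r /\ forall q, Cmod (q - p) < r -> W q.

Record planar_metric (W : C -> Prop) (J : jet) : Prop := {
  pm_open : plane_open W;
  pm_u : forall p, W p -> grad (ju J) p (jx J p) (jy J p);
  pm_ux : forall p, W p -> grad (jx J) p (jxx J p) (jxy J p);
  pm_uy : forall p, W p -> grad (jy J) p (jxy J p) (jyy J p);
  pm_cxx : forall p, W p -> fcont (jxx J) p;
  pm_cxy : forall p, W p -> fcont (jxy J) p;
  pm_cyy : forall p, W p -> fcont (jyy J) p;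
  pm_L : forall p, W p -> jxx J p + jyy J p = exp (2 * ju J p) }.

(** Metric completeness of [exp u |dz|], in the only form in which it is used: a curve of bounded speed on a bounded
    time interval accumulates at a point of [W] when the time runs out. *)
Definition curve_complete (W : C -> Prop) (u : C -> R) : Prop :=
  forall (g dg : R -> C) T K, 0 < T ->
   (forall t, 0 <= t < T -> W (g t) /\ vder g t (dg t) /\ vcont dg t /\ exp (u (g t)) * Cmod (dg t) <= K) ->
   exists P, W P /\ forall e eta, 0 < e -> 0 < eta ->
     exists t, 0 <= t /\ T - eta < t < T /\ Cmod (g t - P) < e.

Lemma vder_line (B h : C) t : vder (fun s => B + h * RtoC s)%C t h.
Proof.
eapply vder_eq. apply vder_plus; [apply vder_const|]. apply vder_mult; [apply vder_const|apply vder_id].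
cring.
Qed.

Lemma ball_convex (P A B : C) r s : Cmod (A - P) < r -> Cmod (B - P) < r -> 0 <= s <= 1 ->
  Cmod (B + (A - B) * RtoC s - P) < r.
Proof.
intros HA HB Hs.
replace (B + (A - B) * RtoC s - P)%C with ((A - P) * RtoC s + (B - P) * RtoC (1 - s))%C
 by (rewrite RtoC_minus; ring).
eapply Rle_lt_trans; [apply Cmod_triangle|]. rewrite !Cmod_mult, !Cmod_R, !Rabs_pos_eq by lra.
destruct (Req_dec s 0); [subst; lra|].
assert (Cmod (A - P) * s < r * s) by (apply Rmult_lt_compat_r; lra).
assert (Cmod (B - P) * (1 - s) <= r * (1 - s)) by (apply Rmult_le_compat_r; lra). lra.
Qed.

(** Strict differentiability of a C1 function, by the mean value theorem on a segment. Both points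
    move freely near [P], which is what allows uniform estimates along a compact curve. *)
Lemma strict_diff f fx fy P e : 0 < e ->
  (exists r, 0 < r /\ forall q, Cmod (q - P) < r -> grad f q (fx q) (fy q)) ->
  fcont fx P -> fcont fy P ->
  exists r, 0 < r /\ forall A B, Cmod (A - P) < r -> Cmod (B - P) < r ->
   Rabs (f A - f B - (fx B * (fst A - fst B) + fy B * (snd A - snd B))) <= e * Cmod (A - B).
Proof.
intros He [r0 [Hr0 HD]] Cx Cy.
destruct (Cx (e/4)) as [r1 [Hr1 H1]]; [lra|]. destruct (Cy (e/4)) as [r2 [Hr2 H2]]; [lra|].
exists (Rmin r0 (Rmin r1 r2)). split; [repeat apply Rmin_pos; auto|].
intros A B HA HB.
set (g := fun s => (B + (A - B) * RtoC s)%C).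
assert (Hg : forall s, 0 <= s <= 1 -> Cmod (g s - P) < Rmin r0 (Rmin r1 r2)) by (intros; apply ball_convex; auto).
destruct (is_derive_MVT (fun s => f (g s)) (fun s => fx (g s) * fst (A - B)%C + fy (g s) * snd (A - B)%C) 0 1)
 as [c [Hc E]]; [lra| |].
{ intros s Hs. apply grad_curve; [|apply vder_line]. apply HD. specialize (Hg s Hs). split_min; auto. }
replace (g 1) with A in E by (unfold g; ring). replace (g 0) with B in E by (unfold g; ring).
rewrite E.
assert (Hgc : Cmod (g c - P) < Rmin r0 (Rmin r1 r2)) by (apply Hg; lra).
assert (Rabs (fx (g c) - fx B) <= e / 2 /\ Rabs (fy (g c) - fy B) <= e / 2) as [X Y].
{ split_min.
  pose proof (H1 B ltac:(assumption)) as A1. pose proof (H1 (g c) ltac:(assumption)) as A2.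
  pose proof (H2 B ltac:(assumption)) as A3. pose proof (H2 (g c) ltac:(assumption)) as A4.
  apply Rabs_def2 in A1, A2, A3, A4. split; apply Rabs_le; lra. }
match goal with |- Rabs ?x <= _ => replace x with
  ((fx (g c) - fx B) * fst (A - B)%C + (fy (g c) - fy B) * snd (A - B)%C)
  by (rewrite fst_minus, snd_minus; ring) end.
eapply Rle_trans; [apply Rabs_triang|]. rewrite !Rabs_mult.
pose proof (fst_le_Cmod (A - B)). pose proof (snd_le_Cmod (A - B)).
pose proof (Rabs_pos (fst (A - B)%C)). pose proof (Rabs_pos (snd (A - B)%C)).
assert (Rabs (fx (g c) - fx B) * Rabs (fst (A - B)%C) <= e/2 * Cmod (A - B)) by (apply Rmult_le_compat; auto;
  apply Rabs_pos).
assert (Rabs (fy (g c) - fy B) * Rabs (snd (A - B)%C) <= e/2 * Cmod (A - B)) by (apply Rmult_le_compat; auto;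
  apply Rabs_pos).
lra.
Qed.

(** * Complete metrics of curvature -1 on plane sets *)

Section LocalBounds.
Variables (W : C -> Prop) (J : jet).
Hypothesis HJ : planar_metric W J.

(** [dlog] is [2 d_z u]; its derivatives are [dlog_z = 2 d_z d_z u] and [dlog_zbar = 2 d_zbar d_z u = Laplacian u / 2],
    the latter rewritten by the curvature equation. *)
Definition dlog (w : C) : C := (jx J w, - jy J w).
Definition dlog_z (w : C) : C := ((jxx J w - jyy J w) / 2, - jxy J w).
Definition dlog_zbar (w : C) : R := exp (2 * ju J w) / 2.

Lemma dlog_strict P e : W P -> 0 < e -> exists r, 0 < r /\
  forall A B, Cmod (A - P) < r -> Cmod (B - P) < r -> W A /\
   Cmod (dlog A - dlog B - (dlog_z B * (A - B) + RtoC (dlog_zbar B) * Cconj (A - B))) <= e * Cmod (A - B).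
Proof.
intros HP He. destruct (pm_open _ _ HJ P HP) as [r0 [Hr0 H0]].
destruct (strict_diff (jx J) (jxx J) (jxy J) P (e/2)) as [r1 [Hr1 H1]]; [lra| | | |].
{ exists r0; split; auto. intros; apply (pm_ux _ _ HJ); auto. }
{ now apply (pm_cxx _ _ HJ). } { now apply (pm_cxy _ _ HJ). }
destruct (strict_diff (jy J) (jxy J) (jyy J) P (e/2)) as [r2 [Hr2 H2]]; [lra| | | |].
{ exists r0; split; auto. intros; apply (pm_uy _ _ HJ); auto. }
{ now apply (pm_cxy _ _ HJ). } { now apply (pm_cyy _ _ HJ). }
exists (Rmin r0 (Rmin r1 r2)); split; [repeat apply Rmin_pos; auto|].
intros A B HA HB. split_min. split; [auto|].
specialize (H1 A B ltac:(assumption) ltac:(assumption)).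
specialize (H2 A B ltac:(assumption) ltac:(assumption)).
eapply Rle_trans; [apply Cmod_le_sum|].
assert (HW : W B) by auto.
pose proof (pm_L _ _ HJ B HW) as HL.
match goal with |- Rabs ?x + Rabs ?y <= _ =>
 replace x with (jx J A - jx J B - (jxx J B * (fst A - fst B) + jxy J B * (snd A - snd B)));
 [replace y with (- (jy J A - jy J B - (jxy J B * (fst A - fst B) + jyy J B * (snd A - snd B))))|] end.
- rewrite Rabs_Ropp. lra.
- simpl. unfold dlog_zbar. rewrite <- HL. field.
- simpl. unfold dlog_zbar. rewrite <- HL. field.
Qed.

Lemma dlog_bounded P : W P -> exists r M, 0 < r /\ 0 <= M /\ forall A, Cmod (A - P) < r ->
  W A /\ Cmod (dlog A) <= M /\ Cmod (dlog_z A) <= M /\ Rabs (dlog_zbar A) <= M.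
Proof.
intros HP. destruct (pm_open _ _ HJ P HP) as [r0 [Hr0 H0]].
assert (L : forall f, fcont f P -> exists r, 0 < r /\ forall A, Cmod (A - P) < r -> Rabs (f A) <= Rabs (f P) + 1).
{ intros f Hf. destruct (Hf 1) as [r [Hr K]]; [lra|]. exists r; split; auto. intros A HA.
  specialize (K A HA). replace (f A) with (f P + (f A - f P)) by ring.
  eapply Rle_trans; [apply Rabs_triang|]. lra. }
assert (LP : forall p, W p -> fcont (jx J) p /\ fcont (jy J) p).
{ intros p Hp; split; eapply grad_cont. now apply (pm_ux _ _ HJ). now apply (pm_uy _ _ HJ). }
destruct (L (jx J)) as [r1 [Hr1 H1]]; [now apply LP|].
destruct (L (jy J)) as [r2 [Hr2 H2]]; [now apply LP|].
destruct (L (jxx J)) as [r3 [Hr3 H3]]; [now apply (pm_cxx _ _ HJ)|].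
destruct (L (jxy J)) as [r4 [Hr4 H4]]; [now apply (pm_cxy _ _ HJ)|].
destruct (L (jyy J)) as [r5 [Hr5 H5]]; [now apply (pm_cyy _ _ HJ)|].
set (M := (Rabs (jx J P) + 1) + (Rabs (jy J P) + 1) + (Rabs (jxx J P) + 1) + (Rabs (jxy J P) + 1) + (Rabs (jyy J P) +
  1)).
exists (Rmin r0 (Rmin r1 (Rmin r2 (Rmin r3 (Rmin r4 r5))))), M.
pose proof (Rabs_pos (jx J P)); pose proof (Rabs_pos (jy J P)); pose proof (Rabs_pos (jxx J P));
pose proof (Rabs_pos (jxy J P)); pose proof (Rabs_pos (jyy J P)).
split; [repeat apply Rmin_pos; auto|]. split; [unfold M; lra|].
intros A HA. split_min.
assert (HW : W A) by auto.
specialize (H1 A ltac:(assumption)). specialize (H2 A ltac:(assumption)).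
specialize (H3 A ltac:(assumption)). specialize (H4 A ltac:(assumption)). specialize (H5 A ltac:(assumption)).
split; auto. split; [|split].
- eapply Rle_trans; [apply Cmod_le_sum|]. simpl. rewrite Rabs_Ropp. unfold M. lra.
- eapply Rle_trans; [apply Cmod_le_sum|]. simpl. rewrite Rabs_Ropp.
  unfold Rdiv. rewrite Rabs_mult, (Rabs_pos_eq (/2)) by lra.
  pose proof (Rabs_triang (jxx J A) (- jyy J A)) as Q. rewrite Rabs_Ropp in Q.
  unfold Rminus, M. lra.
- unfold dlog_zbar. rewrite <- (pm_L _ _ HJ A HW).
  unfold Rdiv. rewrite Rabs_mult, (Rabs_pos_eq (/2)) by lra.
  pose proof (Rabs_triang (jxx J A) (jyy J A)). unfold M. lra.
Qed.
End LocalBounds.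

(** The two components take their mean values at different times, whence the factor 2. *)
Lemma vder_MVT (F F' : R -> C) M a b :
  (forall s, Rmin a b <= s <= Rmax a b -> vder F s (F' s) /\ Cmod (F' s) <= M) ->
  Cmod (F b - F a) <= 2 * M * Rabs (b - a).
Proof.
assert (Q : forall a b, a < b -> (forall s, a <= s <= b -> vder F s (F' s) /\ Cmod (F' s) <= M) ->
  Cmod (F b - F a) <= 2 * M * Rabs (b - a)).
{ intros x y Hxy H. rewrite Rabs_pos_eq by lra. eapply Rle_trans; [apply Cmod_le_sum|].
  rewrite fst_minus, snd_minus.
  destruct (is_derive_MVT (fun s => fst (F s)) (fun s => fst (F' s)) x y) as [c [Hc ->]]; auto.
  { intros t Ht. apply H; auto. }
  destruct (is_derive_MVT (fun s => snd (F s)) (fun s => snd (F' s)) x y) as [d [Hd ->]]; auto.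
  { intros t Ht. apply H; auto. }
  rewrite !Rabs_mult, (Rabs_pos_eq (y - x)) by lra.
  pose proof (fst_le_Cmod (F' c)). pose proof (snd_le_Cmod (F' d)).
  destruct (H c) as [_ H2]; [lra|]. destruct (H d) as [_ H3]; [lra|].
  assert (Rabs (fst (F' c)) * (y - x) <= M * (y - x)) by (apply Rmult_le_compat_r; lra).
  assert (Rabs (snd (F' d)) * (y - x) <= M * (y - x)) by (apply Rmult_le_compat_r; lra). lra. }
intros H. destruct (Rtotal_order a b) as [h|[->|h]].
- apply Q; auto. intros s Hs; apply H. rewrite Rmin_left, Rmax_right; lra.
- replace (F b - F b)%C with (RtoC 0) by ring. rewrite Cmod_0, Rminus_diag, Rabs_R0. lra.
- rewrite Cmod_minus_sym, Rabs_minus_sym. apply Q; auto.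
  intros s Hs; apply H. rewrite Rmin_right, Rmax_left; lra.
Qed.

(** Truncation to a box makes the ray equation globally Lipschitz, as [picard] requires. *)
Definition clamp (b x : R) := Rmax (- b) (Rmin b x).
Definition cbox (b : R) (w : C) : C := (clamp b (fst w), clamp b (snd w)).

Lemma clamp_lip b x y : Rabs (clamp b x - clamp b y) <= Rabs (x - y).
Proof. unfold clamp, Rmax, Rmin, Rabs; repeat destruct Rle_dec; repeat destruct Rcase_abs; lra. Qed.
Lemma clamp_bd b x : 0 <= b -> Rabs (clamp b x) <= b.
Proof. unfold clamp, Rmax, Rmin, Rabs; repeat destruct Rle_dec; repeat destruct Rcase_abs; lra. Qed.
Lemma clamp_id b x : Rabs x <= b -> clamp b x = x.
Proof. unfold clamp, Rmax, Rmin, Rabs; repeat destruct Rle_dec; repeat destruct Rcase_abs; lra. Qed.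

Lemma cbox_lip b w w' : Cmod (cbox b w - cbox b w') <= 2 * Cmod (w - w').
Proof.
eapply Rle_trans; [apply Cmod_le_sum|]. rewrite fst_minus, snd_minus. simpl.
pose proof (clamp_lip b (fst w) (fst w')). pose proof (clamp_lip b (snd w) (snd w')).
pose proof (fst_le_Cmod (w - w')). pose proof (snd_le_Cmod (w - w')).
rewrite fst_minus in *. rewrite snd_minus in *. lra.
Qed.
Lemma cbox_bd b w : 0 <= b -> Cmod (cbox b w) <= 2 * b.
Proof.
intros Hb. eapply Rle_trans; [apply Cmod_le_sum|]. simpl.
pose proof (clamp_bd b (fst w) Hb). pose proof (clamp_bd b (snd w) Hb). lra.
Qed.
Lemma cbox_id b w : Cmod w <= b -> cbox b w = w.
Proof.
intros H. unfold cbox. pose proof (fst_le_Cmod w). pose proof (snd_le_Cmod w).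
rewrite !clamp_id by lra. now destruct w.
Qed.

(** [2 d_z] of the logarithm of the density [2 / (1 - |z|^2)] of the unit disc *)
Definition dlog_disc (c : C) : C := (RtoC (2 / (1 - Cmod c ^ 2)) * Cconj c)%C.

(** * The developing map *)

Section DevelopingRays.
Variables (W : C -> Prop) (J : jet).
Hypothesis HJ : planar_metric W J.
Notation u := (ju J).
Notation pf := (dlog J).
Notation aa := (dlog_z J).
Notation bb := (dlog_zbar J).

(** The second derivative [F''] of a local isometry of the disc into [W] with [F' = G], at [z]. *)
Definition holo_coef (z F G : C) : C := (dlog_disc z * G - pf F * (G * G))%C.

Lemma dlog_lipschitz P : W P -> exists r L, 0 < r /\ 0 <= L /\ forall A B, Cmod (A - P) < r -> Cmod (B - P) < r ->
  W A /\ Cmod (pf A) <= L /\ Cmod (pf A - pf B) <= L * Cmod (A - B).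
Proof.
intros HP. destruct (dlog_strict W J HJ P 1 HP Rlt_0_1) as [r1 [Hr1 H1]].
destruct (dlog_bounded W J HJ P HP) as [r2 [M [Hr2 [HM H2]]]].
exists (Rmin r1 r2), (2 * M + 1). split; [now apply Rmin_pos|]. split; [lra|].
intros A B HA HB. split_min.
destruct (H1 A B ltac:(assumption) ltac:(assumption)) as [WA K].
destruct (H2 A ltac:(assumption)) as [_ [PA _]]. destruct (H2 B ltac:(assumption)) as [_ [_ [PB PB']]].
split; auto. split; [lra|].
eapply Rle_trans; [apply Cmod_le_add with (b := (aa B * (A - B) + RtoC (bb B) * Cconj (A - B))%C)|].
assert (Cmod (aa B * (A - B) + RtoC (bb B) * Cconj (A - B)) <= 2 * M * Cmod (A - B)).
{ eapply Rle_trans; [apply Cmod_triangle|]. rewrite !Cmod_mult, Cmod_R, Cmod_conj.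
  pose proof (Cmod_ge_0 (A - B)). nra. }
lra.
Qed.

(** The derivative in [s] of the logarithm of [2 / (1 - s^2 m)]: along a ray the disc enters the
    equation only through this real number. *)
Definition ray_coef (m s : R) := 2 * s * m / (1 - s ^ 2 * m).

Lemma dlog_disc_ray z s : (z * dlog_disc (RtoC s * z))%C = RtoC (ray_coef (Cmod z ^ 2) s).
Proof.
unfold dlog_disc, ray_coef.
replace (z * (RtoC (2 / (1 - Cmod (RtoC s * z) ^ 2)) * Cconj (RtoC s * z)))%C
 with (RtoC (2 / (1 - Cmod (RtoC s * z) ^ 2) * s) * (z * Cconj z))%C.
- rewrite <- Cmod2_conj, <- RtoC_mult. f_equal. rewrite Cmod_mult, Cmod_R, Rpow_mult_distr, pow2_abs. unfold Rdiv; ring.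
- rewrite RtoC_mult. apply injective_projections; simpl; ring.
Qed.

(** The radius [r] and the life span [tau] are fixed before the starting time and values. A solution
    that comes close to [P] with [|G| <= B] can therefore be continued by a definite amount of
    time. *)
Lemma ray_local_exists P B z T0 : W P -> 0 < B -> 0 <= T0 -> T0 ^ 2 * Cmod z ^ 2 < 1 ->
  exists r tau, 0 < r /\ 0 < tau /\ forall t0 F0 G0, 0 <= t0 <= T0 -> Cmod (F0 - P) < r -> Cmod G0 <= B ->
  exists F G, F t0 = F0 /\ G t0 = G0 /\ forall t, Rabs (t - t0) < tau -> 0 <= t <= T0 ->
    W (F t) /\ vder F t (z * G t)%C /\ vder G t (z * holo_coef (RtoC t * z) (F t) (G t))%C.
Proof.
intros HP HB HT0 HTz.
destruct (dlog_lipschitz P HP) as [r0 [L [Hr0 [HL HPL]]]].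
set (r1 := r0 / 4). assert (Hr1 : 0 < r1) by (unfold r1; lra).
(* Room for [G] to grow by 1 before the truncation acts. *)
set (B' := B + 1).
set (m := Cmod z ^ 2) in *. assert (Hm : 0 <= m) by apply pow2_ge_0.
(* Clamped to [[0, T0]], the time keeps the denominator of [ray_coef] away from 0. *)
set (cs := fun t => Rmax 0 (Rmin T0 t)).
assert (cs_in : forall t, 0 <= cs t <= T0).
{ intros t; unfold cs, Rmax, Rmin; repeat destruct Rle_dec; lra. }
assert (cs_id : forall t, 0 <= t <= T0 -> cs t = t).
{ intros t; unfold cs, Rmax, Rmin; repeat destruct Rle_dec; lra. }
assert (cs_lip : forall t s, Rabs (cs t - cs s) <= Rabs (t - s)).
{ intros t s; unfold cs, Rmax, Rmin, Rabs; repeat destruct Rle_dec; repeat destruct Rcase_abs; lra. }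
assert (Hden : forall t, 1 - T0 ^ 2 * m <= 1 - cs t ^ 2 * m).
{ intros t. destruct (cs_in t). assert (cs t ^ 2 <= T0 ^ 2) by nra. nra. }
set (k0 := 2 * T0 * m / (1 - T0 ^ 2 * m)).
assert (Hk0 : 0 <= k0). { unfold k0. apply Rmult_le_pos. nra. left; apply Rinv_0_lt_compat; lra. }
assert (Hk : forall t, Rabs (ray_coef m (cs t)) <= k0).
{ intros t. destruct (cs_in t). specialize (Hden t). unfold ray_coef, k0. rewrite Rabs_pos_eq.
  - apply Rmult_le_compat; try nra. left; apply Rinv_0_lt_compat; lra. apply Rinv_le_contravar; lra.
  - apply Rmult_le_pos; [nra|]. left; apply Rinv_0_lt_compat; lra. }
set (cP := fun x => (P + cbox r1 (x - P))%C).
assert (cP_in : forall x, Cmod (cP x - P) < r0).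
{ intros x. unfold cP. replace (P + cbox r1 (x - P) - P)%C with (cbox r1 (x - P)) by ring.
  eapply Rle_lt_trans; [apply cbox_bd; lra|]. unfold r1; lra. }
assert (cP_lip : forall x y, Cmod (cP x - cP y) <= 2 * Cmod (x - y)).
{ intros x y. unfold cP. replace (P + cbox r1 (x - P) - (P + cbox r1 (y - P)))%C with (cbox r1 (x - P) - cbox r1 (y -
    P))%C by ring.
  eapply Rle_trans; [apply cbox_lip|]. replace (x - P - (y - P))%C with (x - y)%C by ring. lra. }
set (f := fun (t : R) (x y : C) => (z * cbox B' y)%C).
set (g := fun (t : R) (x y : C) => (RtoC (ray_coef m (cs t)) * cbox B' y - z * pf (cP x) * (cbox B' y * cbox B' y))%C).
assert (HB' : 0 < B') by (unfold B'; lra).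
set (Z := Cmod z). assert (HZ : 0 <= Z) by apply Cmod_ge_0.
set (K := 2 * Z + 2 * k0 + Z * L * (8 * B') + Z * (2 * L) * (4 * B' * B') + 1).
assert (HZL : 0 <= Z * L) by (apply Rmult_le_pos; lra).
assert (HZLB : 0 <= Z * L * B') by (apply Rmult_le_pos; lra).
assert (HZLBB : 0 <= Z * L * B' * B') by (apply Rmult_le_pos; lra).
assert (HK : 0 < K) by (unfold K; nra).
assert (Lf : field_lip f K).
{ intros t x y x' y'. unfold f.
  replace (z * cbox B' y - z * cbox B' y')%C with (z * (cbox B' y - cbox B' y'))%C by ring.
  rewrite Cmod_mult. fold Z. pose proof (cbox_lip B' y y'). pose proof (Cmod_ge_0 (x - x')).
  pose proof (Cmod_ge_0 (y - y')).
  assert (Z * Cmod (cbox B' y - cbox B' y') <= Z * (2 * Cmod (y - y'))) by (apply Rmult_le_compat_l; auto).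
  assert (2 * Z <= K) by (unfold K; nra). nra. }
assert (Lg : field_lip g K).
{ intros t x y x' y'. unfold g.
  set (Y := cbox B' y). set (Y' := cbox B' y'). set (p := pf (cP x)). set (p' := pf (cP x')).
  set (k := RtoC (ray_coef m (cs t))).
  replace (k * Y - z * p * (Y * Y) - (k * Y' - z * p' * (Y' * Y')))%C with
    (k * (Y - Y') - (z * p * ((Y + Y') * (Y - Y')) + z * (p - p') * (Y' * Y')))%C by ring.
  eapply Rle_trans; [apply Cmod_minus_le|].
  eapply Rle_trans; [apply Rplus_le_compat_l, Cmod_triangle|].
  rewrite !Cmod_mult. fold Z. unfold k. rewrite Cmod_R.
  pose proof (cbox_lip B' y y') as H1. fold Y Y' in H1.
  assert (H2 : Cmod Y <= 2 * B') by (apply cbox_bd; lra).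
  assert (H3 : Cmod Y' <= 2 * B') by (apply cbox_bd; lra).
  destruct (HPL (cP x) (cP x') (cP_in x) (cP_in x')) as [_ [H4 H5]]. fold p p' in H4, H5.
  pose proof (cP_lip x x') as H6. pose proof (Cmod_triangle Y Y') as H7.
  pose proof (Cmod_ge_0 (x - x')) as G1. pose proof (Cmod_ge_0 (y - y')) as G2.
  pose proof (Cmod_ge_0 (Y - Y')). pose proof (Cmod_ge_0 (Y + Y')). pose proof (Cmod_ge_0 p).
  pose proof (Cmod_ge_0 (p - p')).
  pose proof (Cmod_ge_0 Y').
  set (dx := Cmod (x - x')) in *. set (dy := Cmod (y - y')) in *.
  assert (A1 : Rabs (ray_coef m (cs t)) * Cmod (Y - Y') <= k0 * (2 * dy)) by (apply Rmult_le_compat; auto;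
    apply Rabs_pos).
  assert (A2 : Z * Cmod p * (Cmod (Y + Y') * Cmod (Y - Y')) <= Z * L * (4 * B' * (2 * dy))).
  { apply Rmult_le_compat; [apply Rmult_le_pos; auto|apply Rmult_le_pos; auto|apply Rmult_le_compat_l; auto|].
    apply Rmult_le_compat; auto; lra. }
  assert (A3 : Z * Cmod (p - p') * (Cmod Y' * Cmod Y') <= Z * (L * (2 * dx)) * (2 * B' * (2 * B'))).
  { apply Rmult_le_compat; [apply Rmult_le_pos; auto|apply Rmult_le_pos; auto|apply Rmult_le_compat_l; auto|].
    - eapply Rle_trans; [apply H5|]. apply Rmult_le_compat_l; auto.
    - apply Rmult_le_compat; auto. }
  unfold K. nra. }
set (M := Z * (2 * B') + (k0 * (2 * B') + Z * L * (2 * B' * (2 * B'))) + 1).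
assert (Bf : field_bd f M).
{ intros t x y. unfold f. rewrite Cmod_mult. fold Z.
  assert (Cmod (cbox B' y) <= 2 * B') by (apply cbox_bd; lra).
  assert (Z * Cmod (cbox B' y) <= Z * (2 * B')) by (apply Rmult_le_compat_l; auto). unfold M. nra. }
assert (Bg : field_bd g M).
{ intros t x y. unfold g. eapply Rle_trans; [apply Cmod_minus_le|]. rewrite !Cmod_mult, Cmod_R. fold Z.
  assert (Cmod (cbox B' y) <= 2 * B') by (apply cbox_bd; lra). pose proof (Cmod_ge_0 (cbox B' y)).
  destruct (HPL (cP x) (cP x) (cP_in x) (cP_in x)) as [_ [H4 _]]. pose proof (Cmod_ge_0 (pf (cP x))).
  assert (Rabs (ray_coef m (cs t)) * Cmod (cbox B' y) <= k0 * (2 * B')) by (apply Rmult_le_compat; auto;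
    apply Rabs_pos).
  assert (Z * Cmod (pf (cP x)) * (Cmod (cbox B' y) * Cmod (cbox B' y)) <= Z * L * (2 * B' * (2 * B'))).
  { apply Rmult_le_compat; [apply Rmult_le_pos; auto|apply Rmult_le_pos; auto|apply Rmult_le_compat_l; auto|].
    apply Rmult_le_compat; auto. }
  unfold M. nra. }
assert (Cf : field_cont f).
{ intros x y t. apply (vcont_vder _ _ 0). unfold f. exact (vder_const (z * cbox B' y)%C t). }
assert (Cg : field_cont g).
{ intros x y t e He. unfold g.
  assert (Hc : exists l, is_derive (ray_coef m) (cs t) l).
  { exists (Derive (ray_coef m) (cs t)). apply Derive_correct. unfold ray_coef. auto_derive.
    specialize (Hden t). simpl in *. lra. }
  destruct Hc as [l Hl].
  destruct (is_derive_cont _ _ _ Hl (e / (2 * B' + 1))) as [d [Hd H]]. { apply Rdiv_lt_0_compat; lra. }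
  exists d; split; auto. intros h Hh.
  match goal with |- Cmod ?w < _ => replace w with (RtoC (ray_coef m (cs h) - ray_coef m (cs t)) * cbox B' y)%C
    by (rewrite RtoC_minus; ring) end.
  rewrite Cmod_mult, Cmod_R.
  assert (Cmod (cbox B' y) <= 2 * B') by (apply cbox_bd; lra).
  specialize (H (cs h)). assert (Q : Rabs (ray_coef m (cs h) - ray_coef m (cs t)) < e / (2 * B' + 1)).
  { apply H. eapply Rle_lt_trans; [apply cs_lip|auto]. }
  apply Rle_lt_trans with (e / (2 * B' + 1) * (2 * B')).
  - apply Rmult_le_compat; try lra; [apply Rabs_pos|apply Cmod_ge_0].
  - apply Rlt_le_trans with (e / (2 * B' + 1) * (2 * B' + 1)).
    + apply Rmult_lt_compat_l; [apply Rdiv_lt_0_compat; lra|lra].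
    + right; field; lra. }
assert (HM : 1 <= M) by (unfold M; nra).
(* The first bound is the interval of [picard]; during the other two, [F] moves by at most [r1 / 2]
   and [G] by at most 1, so that both truncations stay inactive. *)
set (tau := Rmin (/ (16 * K)) (Rmin (r1 / (4 * M)) (1 / (2 * M)))).
exists (r1 / 2), tau. split; [lra|].
split. { unfold tau. repeat apply Rmin_pos. apply Rinv_0_lt_compat; lra. apply Rdiv_lt_0_compat; lra.
apply Rdiv_lt_0_compat; lra. }
intros t0 F0 G0 Ht0 HF0 HG0.
destruct (picard f g K M t0 F0 G0 HK Lf Lg Bf Bg Cf Cg) as [F [G [EF [EG HFG]]]].
exists F, G. split; auto. split; auto.
intros t Htau Ht.
assert (Hs : forall s, Rmin t0 t <= s <= Rmax t0 t -> Rabs (s - t0) < / (16 * K)).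
{ intros s Hs. eapply Rle_lt_trans with (Rabs (t - t0)).
  eapply between_abs; [eassumption|lra]. unfold tau in Htau. split_min; auto. }
assert (Htau' : Rabs (t - t0) < r1 / (4 * M) /\ Rabs (t - t0) < 1 / (2 * M)).
{ unfold tau in Htau. split_min; auto. }
destruct Htau' as [T1 T2].
assert (DF : Cmod (F t - F t0) <= 2 * M * Rabs (t - t0)).
{ apply (vder_MVT F (fun s => f s (F s) (G s))). intros s Hs'. split; [apply HFG, Hs; auto|apply Bf]. }
assert (DG : Cmod (G t - G t0) <= 2 * M * Rabs (t - t0)).
{ apply (vder_MVT G (fun s => g s (F s) (G s))). intros s Hs'. split; [apply HFG, Hs; auto|apply Bg]. }
rewrite EF in DF. rewrite EG in DG.
apply Rmult_lt_compat_l with (r := 2 * M) in T1; [|lra].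
replace (2 * M * (r1 / (4 * M))) with (r1 / 2) in T1 by (field; lra).
apply Rmult_lt_compat_l with (r := 2 * M) in T2; [|lra].
replace (2 * M * (1 / (2 * M))) with 1 in T2 by (field; lra).
assert (NF : Cmod (F t - P) < r1).
{ eapply Rle_lt_trans; [apply (Cmod_triangle_sub _ F0)|]. lra. }
assert (NG : Cmod (G t) <= B').
{ eapply Rle_trans; [apply (Cmod_le_add _ G0)|]. unfold B'. lra. }
assert (IF : cP (F t) = F t). { unfold cP. rewrite cbox_id by lra. ring. }
assert (IG : cbox B' (G t) = G t) by (now apply cbox_id).
assert (WF : W (F t)). { eapply HPL. unfold r1 in NF. apply Rlt_trans with (1 := NF). lra. unfold r1 in NF.
apply Rlt_trans with (1 := NF). lra. }
split; auto.
destruct (HFG t) as [DF' DG'].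
{ unfold tau in Htau. split_min; auto. }
unfold f in DF'. unfold g in DG'. rewrite IG in DF', DG'. rewrite IF, cs_id in DG' by auto.
split; auto. eapply vder_eq; [apply DG'|].
unfold holo_coef. pose proof (dlog_disc_ray z t) as E. fold m in E. rewrite <- E. cring.
Qed.
End DevelopingRays.

(** * Estimates for the logarithmic derivative of the disc density *)

Lemma RtoC_inj_neq (x : R) : x <> 0 -> RtoC x <> RtoC 0.
Proof. intros H E. apply H. now apply RtoC_inj. Qed.

Lemma Cmod2_C (c : C) : RtoC (Cmod c ^ 2) = (c * Cconj c)%C.
Proof. now rewrite Cmod2_conj. Qed.

Lemma Cconj_plus (a b : C) : Cconj (a + b) = (Cconj a + Cconj b)%C.
Proof. apply injective_projections; simpl; ring. Qed.
Lemma Cconj_minus (a b : C) : Cconj (a - b) = (Cconj a - Cconj b)%C.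
Proof. apply injective_projections; simpl; ring. Qed.
Lemma Cconj_mult (a b : C) : Cconj (a * b) = (Cconj a * Cconj b)%C.
Proof. apply injective_projections; simpl; ring. Qed.
Lemma Cconj_R (a : R) : Cconj (RtoC a) = RtoC a.
Proof. apply injective_projections; simpl; ring. Qed.

(** An exact increment: with [D'] replaced by [D], the first two terms are the differential, and the
    third is quadratic in [h]. *)
Lemma dlog_disc_diff (c h : C) : let D := 1 - Cmod c ^ 2 in let D' := 1 - Cmod (c + h) ^ 2 in
  D <> 0 -> D' <> 0 ->
  (dlog_disc (c + h) - dlog_disc c)%C = (RtoC (2 / (D * D')) * (Cconj h + Cconj c * Cconj c * h + Cconj c * h * Cconj
    h))%C.
Proof.
intros D D' HD HD'. unfold dlog_disc. fold D D'.
rewrite !RtoC_div, RtoC_mult by auto.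
assert (HDc : RtoC D <> 0%C) by (apply RtoC_inj_neq; auto).
assert (HDc' : RtoC D' <> 0%C) by (apply RtoC_inj_neq; auto).
assert (E : (Cconj h + Cconj c * Cconj c * h + Cconj c * h * Cconj h)%C =
   (RtoC D * (Cconj c + Cconj h) - RtoC D' * Cconj c)%C).
{ unfold D, D'. rewrite !RtoC_minus, !Cmod2_C, Cconj_plus. ring. }
rewrite E, Cconj_plus. field. auto.
Qed.

Lemma Cmod_sq_diff (c h : C) : Cmod c <= 1 -> Cmod h <= 1 ->
  Rabs (Cmod (c + h) ^ 2 - Cmod c ^ 2) <= 3 * Cmod h.
Proof.
intros Hc Hh. rewrite <- Cmod_R, RtoC_minus, !Cmod2_C, Cconj_plus.
replace ((c + h) * (Cconj c + Cconj h) - c * Cconj c)%C with (c * Cconj h + h * Cconj c + h * Cconj h)%C by ring.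
eapply Rle_trans; [apply Cmod_triangle|]. eapply Rle_trans; [apply Rplus_le_compat_r, Cmod_triangle|].
rewrite !Cmod_mult, !Cmod_conj. pose proof (Cmod_ge_0 h). pose proof (Cmod_ge_0 c). nra.
Qed.

(** [|c + h|^2] differs from [|c|^2] by at most [3 |h|], so [|h| <= d / 6] leaves half of the gap
    [d]. In the last bound, 28 is 24 for replacing [D'] by [D] in the differential plus 4 for the
    quadratic term. *)
Lemma dlog_disc_lip (c h : C) d : 0 < d -> d <= 1 - Cmod c ^ 2 -> Cmod h <= d / 6 ->
  d / 2 <= 1 - Cmod (c + h) ^ 2 /\
  Cmod (dlog_disc (c + h) - dlog_disc c) <= 12 / d ^ 2 * Cmod h /\
  Cmod (dlog_disc (c + h)) <= 4 / d /\ Cmod (dlog_disc c) <= 4 / d /\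
  Cmod (dlog_disc (c + h) - dlog_disc c - RtoC (2 / (1 - Cmod c ^ 2) ^ 2) * (Cconj h + Cconj c * Cconj c * h)) <= 28 /
    d ^ 3 * Cmod h ^ 2.
Proof.
intros Hd HD Hh.
assert (Hc : Cmod c <= 1). { pose proof (Cmod_ge_0 c). nra. }
assert (Hd1 : d <= 1) by (pose proof (pow2_ge_0 (Cmod c)); lra).
pose proof (Cmod_ge_0 h) as H0.
pose proof (Cmod_sq_diff c h Hc ltac:(lra)) as HS. apply Rabs_le_between in HS.
set (D := 1 - Cmod c ^ 2) in *. set (D' := 1 - Cmod (c + h) ^ 2) in *.
assert (HD' : d / 2 <= D') by (unfold D, D' in *; lra).
assert (PD : 0 < D) by lra. assert (PD' : 0 < D') by lra.
pose proof (dlog_disc_diff c h) as KD. cbv zeta in KD. fold D D' in KD. specialize (KD ltac:(lra) ltac:(lra)).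
assert (B1 : Cmod (Cconj h + Cconj c * Cconj c * h + Cconj c * h * Cconj h) <= 3 * Cmod h).
{ eapply Rle_trans; [apply Cmod_triangle|]. eapply Rle_trans; [apply Rplus_le_compat_r, Cmod_triangle|].
  rewrite !Cmod_mult, !Cmod_conj. pose proof (Cmod_ge_0 c).
  assert (Cmod c * Cmod c * Cmod h <= 1 * 1 * Cmod h) by (apply Rmult_le_compat_r; auto; nra).
  assert (Cmod c * Cmod h * Cmod h <= 1 * Cmod h * 1) by (apply Rmult_le_compat; nra). lra. }
assert (I1 : / (D * D') <= 2 / d ^ 2).
{ replace (2 / d ^ 2) with (/ (d * (d / 2))) by (field; lra). apply Rinv_le_contravar; nra. }
assert (I0 : 0 < / (D * D')) by (apply Rinv_0_lt_compat; nra).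
assert (KB : forall w E, Cmod w <= 1 -> d / 2 <= E -> Cmod (RtoC (2 / E) * Cconj w)%C <= 4 / d).
{ intros w E Hw HE. rewrite Cmod_mult, Cmod_R, Cmod_conj.
  assert (0 < / E) by (apply Rinv_0_lt_compat; lra).
  assert (/ E <= 2 / d). { replace (2 / d) with (/ (d / 2)) by (field; lra). apply Rinv_le_contravar; lra. }
  rewrite Rabs_pos_eq by (unfold Rdiv; nra). unfold Rdiv in *.
  pose proof (Cmod_ge_0 w).
  replace (4 * / d) with (2 * (2 * / d) * 1) by ring. apply Rmult_le_compat; nra. }
split; auto. split; [|split; [|split]].
- rewrite KD, Cmod_mult, Cmod_R. unfold Rdiv. rewrite Rabs_pos_eq by nra.
  replace (12 * / d ^ 2 * Cmod h) with (2 * (2 / d ^ 2) * (3 * Cmod h)) by (field; lra).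
  apply Rmult_le_compat; try apply Cmod_ge_0; nra.
- apply KB; auto. fold D'. pose proof (Cmod_ge_0 (c + h)). unfold D' in *. nra.
- apply KB; auto. fold D. lra.
- replace (dlog_disc (c + h) - dlog_disc c - RtoC (2 / D ^ 2) * (Cconj h + Cconj c * Cconj c * h))%C with
   (RtoC (2 * (D - D') / (D ^ 2 * D')) * (Cconj h + Cconj c * Cconj c * h) +
    RtoC (2 / (D * D')) * (Cconj c * h * Cconj h))%C.
  2: { rewrite KD.
       replace (2 * (D - D') / (D ^ 2 * D')) with (2 / (D * D') - 2 / D ^ 2) by (field; lra).
       rewrite RtoC_minus. ring. }
  eapply Rle_trans; [apply Cmod_triangle|]. rewrite !Cmod_mult, !Cmod_R, !Cmod_conj.
  assert (HDD : Rabs (D - D') <= 3 * Cmod h) by (unfold D, D' in *; apply Rabs_le; lra).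
  assert (B2 : Cmod (Cconj h + Cconj c * Cconj c * h) <= 2 * Cmod h).
  { eapply Rle_trans; [apply Cmod_triangle|]. rewrite !Cmod_mult, !Cmod_conj. pose proof (Cmod_ge_0 c).
    assert (Cmod c * Cmod c * Cmod h <= 1 * 1 * Cmod h) by (apply Rmult_le_compat_r; auto; nra). lra. }
  assert (I2 : / (D ^ 2 * D') <= 2 / d ^ 3).
  { replace (2 / d ^ 3) with (/ (d ^ 2 * (d / 2))) by (field; lra).
    assert (0 < d ^ 2) by (apply pow_lt; auto).
    assert (d ^ 2 <= D ^ 2) by (apply pow_incr; lra).
    apply Rinv_le_contravar; [nra|]. apply Rmult_le_compat; nra. }
  assert (I3 : 0 < / (D ^ 2 * D')). { apply Rinv_0_lt_compat. apply Rmult_lt_0_compat; auto. apply pow_lt; auto. }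
  assert (A1 : Rabs (2 * (D - D') / (D ^ 2 * D')) <= 2 * (3 * Cmod h) * (2 / d ^ 3)).
  { unfold Rdiv at 1. rewrite !Rabs_mult. rewrite (Rabs_pos_eq 2), (Rabs_pos_eq (/ _)) by lra.
    apply Rmult_le_compat; try lra. apply Rmult_le_pos; [lra|apply Rabs_pos]. }
  assert (A2 : Rabs (2 / (D * D')) <= 2 * (2 / d ^ 2)).
  { unfold Rdiv at 1. rewrite Rabs_pos_eq by nra. nra. }
  assert (A3 : 2 / d ^ 2 <= 2 / d ^ 3).
  { unfold Rdiv. apply Rmult_le_compat_l; [lra|]. apply Rinv_le_contravar. apply pow_lt; auto.
    simpl. assert (0 < d * d) by nra. nra. }
  assert (0 < / d ^ 3) by (apply Rinv_0_lt_compat, pow_lt; auto).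
  assert (T1 : Rabs (2 * (D - D') / (D ^ 2 * D')) * Cmod (Cconj h + Cconj c * Cconj c * h) <= 2 * (3 * Cmod h) * (2 /
    d ^ 3) * (2 * Cmod h)).
  { apply Rmult_le_compat; auto. apply Rabs_pos. apply Cmod_ge_0. }
  assert (T2 : Rabs (2 / (D * D')) * (Cmod c * Cmod h * Cmod h) <= 2 * (2 / d ^ 3) * (1 * Cmod h * Cmod h)).
  { pose proof (Cmod_ge_0 c). apply Rmult_le_compat; [apply Rabs_pos|apply Rmult_le_pos; nra|lra|].
    apply Rmult_le_compat_r; auto. apply Rmult_le_compat_r; auto. }
  eapply Rle_trans; [apply Rplus_le_compat; [apply T1|apply T2]|].
  right. field. lra.
Qed.

Lemma vder_glue (F1 F2 : R -> C) t l : vder F1 t l -> vder F2 t l -> F1 t = F2 t ->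
  vder (fun s => if Rle_dec s t then F1 s else F2 s) t l.
Proof.
intros H1 H2 E. rewrite vder_eps in *. intros e He.
destruct (H1 e He) as [d1 [Hd1 K1]]. destruct (H2 e He) as [d2 [Hd2 K2]].
exists (Rmin d1 d2); split; [now apply Rmin_pos|]. intros h Hh. split_min.
destruct (Rle_dec t t); [|lra]. destruct (Rle_dec (t + h) t).
- apply K1; auto.
- rewrite E. apply K2; auto.
Qed.

(** * Uniqueness, stability and energy of solutions along rays *)

Section DevelopingRays.
Variables (W : C -> Prop) (J : jet) (p0 g0 : C).
Hypothesis HJ : planar_metric W J.
Notation u := (ju J).
Notation pf := (dlog J).
Notation aa := (dlog_z J).
Notation bb := (dlog_zbar J).
Notation KK := (holo_coef J).

(** [F s] and [G s] are meant as the developing map and its derivative at the point [s z]; hence the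
    factor [z] in both equations. *)
Definition ray_sol (z : C) (T : R) (F G : R -> C) : Prop :=
  F 0 = p0 /\ G 0 = g0 /\ forall s, 0 <= s <= T ->
    W (F s) /\ vder F s (z * G s)%C /\ vder G s (z * KK (RtoC s * z) (F s) (G s))%C.

Lemma ray_sol_le z T T' F G : T' <= T -> ray_sol z T F G -> ray_sol z T' F G.
Proof. intros H [A [B K]]. split; [exact A|]. split; [exact B|]. intros s Hs; apply K; lra. Qed.

(** One radius and one bound valid along the whole compact curve, so that a neighbouring solution
    can be compared with it at all times. *)
Lemma compact_tube T (F G : R -> C) : (forall s, 0 <= s <= T -> W (F s) /\ vcont F s /\ vcont G s) ->
  exists r M, 0 < r <= 1 /\ 1 <= M /\ forall s, 0 <= s <= T ->
    Cmod (G s) <= M /\ Cmod (aa (F s)) <= M /\ Rabs (bb (F s)) <= M /\ Cmod (pf (F s)) <= M /\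
    forall A, Cmod (A - F s) < r -> W A /\ Cmod (pf A) <= M /\ Cmod (pf A - pf (F s)) <= M * Cmod (A - F s).
Proof.
intros H.
(* The bound is written as the inverse of the radius: a single parameter, weakening monotonically as
   it decreases, fits [uniform_on_compact]. *)
destruct (uniform_on_compact (fun s r => Cmod (G s) <= / r /\ Cmod (aa (F s)) <= / r /\ Rabs (bb (F s)) <= / r /\
    forall A, Cmod (A - F s) < r -> W A /\ Cmod (pf A) <= / r /\ Cmod (pf A - pf (F s)) <= / r * Cmod (A - F s)) T)
 as [r [Hr K]].
- intros s r r' [A1 [A2 [A3 A4]]] Hr.
  assert (/ r <= / r') by (apply Rinv_le_contravar; lra).
  split; [lra|]. split; [lra|]. split; [lra|]. intros A HA. destruct (A4 A ltac:(lra)) as [B1 [B2 B3]].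
  split; auto. split; [lra|]. eapply Rle_trans; [apply B3|]. apply Rmult_le_compat_r; auto. apply Cmod_ge_0.
- intros s Hs. destruct (H s Hs) as [Ws [CF CG]].
  destruct (dlog_lipschitz W J HJ (F s) Ws) as [r1 [L [Hr1 [HL PL]]]].
  destruct (dlog_bounded W J HJ (F s) Ws) as [r2 [M [Hr2 [HM PM]]]].
  destruct (CF (Rmin (r1/2) r2)) as [d1 [Hd1 K1]]. { apply Rmin_pos; lra. }
  destruct (CG 1) as [d2 [Hd2 K2]]; [lra|].
  set (N := L + M + Cmod (G s) + 1 + 1). pose proof (Cmod_ge_0 (G s)).
  set (r := Rmin (r1 / 2) (Rmin (/ N) (Rmin d1 d2))).
  assert (HN : 1 <= N) by (unfold N; lra).
  assert (Hr : 0 < r). { unfold r. repeat apply Rmin_pos; auto; try lra. apply Rinv_0_lt_compat; lra. }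
  assert (Hr' : r <= r1 / 2 /\ r <= / N /\ r <= d1 /\ r <= d2).
  { unfold r, Rmin; repeat destruct Rle_dec; lra. }
  destruct Hr' as [Q1 [Q2 [Q3 Q4]]].
  assert (HNr : N <= / r). { rewrite <- (Rinv_inv N). apply Rinv_le_contravar; auto. }
  exists r. split; auto. intros s' Hs' Hss.
  specialize (K1 s' ltac:(lra)). specialize (K2 s' ltac:(lra)). split_min.
  destruct (PM (F s') ltac:(assumption)) as [_ [_ [P1 P2]]].
  split; [|split; [|split]].
  + eapply Rle_trans; [apply (Cmod_le_add _ (G s))|]. unfold N in HNr. lra.
  + unfold N in HNr; lra.
  + unfold N in HNr; lra.
  + intros A HA. destruct (PL A (F s')) as [R1 [R2 R3]].
    { eapply Rle_lt_trans; [apply (Cmod_triangle_sub _ (F s'))|]. lra. } { lra. }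
    split; auto. split; [unfold N in HNr; lra|]. eapply Rle_trans; [apply R3|].
    apply Rmult_le_compat_r; [apply Cmod_ge_0|]. unfold N in HNr; lra.
- exists (Rmin r 1), (/ r + 1).
  assert (0 < / r) by (now apply Rinv_0_lt_compat).
  split. { split; [apply Rmin_pos; lra|apply Rmin_r]. }
  split; [lra|]. intros s Hs. destruct (K s Hs) as [A1 [A2 [A3 A4]]].
  split; [lra|]. split; [lra|]. split; [lra|].
  assert (Z0 : Cmod (F s - F s) < r). { replace (F s - F s)%C with (RtoC 0) by ring. rewrite Cmod_0; auto. }
  split. { destruct (A4 (F s) Z0); lra. }
  intros A HA. split_min. destruct (A4 A ltac:(assumption)) as [B1 [B2 B3]].
  split; auto. split; [lra|]. pose proof (Cmod_ge_0 (A - F s)). nra.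
Qed.

(** The increment [zeta = 0] gives uniqueness. *)
Lemma ray_sol_lip z T F G : 0 <= T <= 2 -> Cmod z < 1 -> T ^ 2 * Cmod z ^ 2 < 1 -> ray_sol z T F G ->
  exists Cst d, 0 < d /\ 0 <= Cst /\ forall zeta, Cmod zeta < d -> forall F' G', ray_sol (z + zeta) T F' G' ->
   forall s, 0 <= s <= T -> Cmod (F' s - F s) <= Cst * Cmod zeta /\ Cmod (G' s - G s) <= Cst * Cmod zeta.
Proof.
intros HT Hz HTz [F0 [G0 HS]].
destruct (compact_tube T F G) as [r [M [Hr [HM HTu]]]].
{ intros s Hs. destruct (HS s Hs) as [A [B K]]. split; auto. split; eapply vcont_vder; eauto. }
set (d := 1 - T ^ 2 * Cmod z ^ 2).
pose proof (Cmod_ge_0 z) as Z0.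
assert (Hd : 0 < d) by (unfold d; lra).
assert (HD : forall s, 0 <= s <= T -> d <= 1 - Cmod (RtoC s * z) ^ 2).
{ intros s Hs. rewrite Cmod_mult, Cmod_R, Rabs_pos_eq, Rpow_mult_distr by lra. unfold d.
  assert (s ^ 2 <= T ^ 2) by (apply pow_incr; lra). pose proof (pow2_ge_0 (Cmod z)). nra. }
set (k := / d). assert (Hk : 0 < k) by (apply Rinv_0_lt_compat; auto).
(* In the equations for the two differences, [Mg] collects the coefficients of the differences
   themselves and [Ce] those of [|zeta|], the forcing. *)
set (Mg := 2 + 8 * k + 2 * M * (2 * M + 1) + 2 * M ^ 3).
set (Ce := M + 48 * M * k ^ 2 + 4 * M * k + M ^ 3).
assert (HM3 : 1 <= M ^ 3) by (apply pow_R1_Rle; auto).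
assert (Hk2 : 0 < k ^ 2) by (apply pow_lt; auto).
assert (Hce : 0 < Ce). { unfold Ce. assert (0 < M * k ^ 2) by nra. assert (0 < M * k) by nra. lra. }
assert (HMg : 0 <= Mg). { unfold Mg. assert (0 <= M * (2 * M + 1)) by nra. lra. }
set (gc := gronwall_const Mg T).
assert (Hgc : 0 <= gc). { unfold gc, gronwall_const. pose proof (exp_pos ((4 * Mg + 1) * T)). nra. }
(* The last bound keeps the differences below the radius of the tube, where alone the estimates
   hold: [gronwall_bound] is applied with the threshold [r ^ 2]. *)
exists (Ce * (gc + 1)), (Rmin (d / 12) (Rmin 1 (r / (Ce * (gc + 1))))).
split. { repeat apply Rmin_pos; try lra. apply Rdiv_lt_0_compat; nra. }
split; [nra|].
intros zeta Hzeta F' G' [F0' [G0' HS']] s Hs. split_min.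
replace (Ce * (gc + 1) * Cmod zeta) with (Ce * Cmod zeta * (gc + 1)) by ring.
pose proof (Cmod_ge_0 zeta) as Ze0.
apply (gronwall_bound (fun s => F' s - F s)%C (fun s => G' s - G s)%C
  (fun s => (z + zeta) * G' s - z * G s)%C
  (fun s => (z + zeta) * KK (RtoC s * (z + zeta)) (F' s) (G' s) - z * KK (RtoC s * z) (F s) (G s))%C
  T Mg (Ce * Cmod zeta) (r ^ 2)); auto; try lra; try nra.
- rewrite F0, F0'. ring.
- rewrite G0, G0'. ring.
- intros t Ht. destruct (HS t Ht) as [_ [A B]]. destruct (HS' t Ht) as [_ [A' B']].
  split; now apply vder_minus.
- fold gc. apply Rle_lt_trans with ((Ce * Cmod zeta * (gc + 1)) ^ 2).
  + rewrite (Rpow_mult_distr (Ce * Cmod zeta)). apply Rmult_le_compat_l; [apply pow2_ge_0|]. nra.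
  + apply Rmult_lt_compat_l with (r := Ce * (gc + 1)) in H1; [|nra].
    replace (Ce * (gc + 1) * (r / (Ce * (gc + 1)))) with r in H1 by (field; nra).
    assert (0 <= Ce * Cmod zeta * (gc + 1)) by (apply Rmult_le_pos; nra).
    assert (Ce * Cmod zeta * (gc + 1) < r) by lra. nra.
- intros t Ht Hlt.
  set (f := (F' t - F t)%C) in *. set (g := (G' t - G t)%C) in *.
  pose proof (Cmod_ge_0 f) as f0. pose proof (Cmod_ge_0 g) as gg0.
  assert (fr : Cmod f < r) by nra. assert (gr : Cmod g < r) by nra.
  destruct (HTu t Ht) as [T1 [_ [_ [T5 T4]]]]. destruct (T4 (F' t) fr) as [_ [T2 T3]]. fold f in T3.
  set (c := (RtoC t * z)%C). set (h := (RtoC t * zeta)%C).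
  assert (Hh : Cmod h <= 2 * Cmod zeta). { unfold h. rewrite Cmod_mult, Cmod_R, Rabs_pos_eq by lra. nra. }
  destruct (dlog_disc_lip c h d Hd (HD t Ht) ltac:(lra)) as [_ [L1 [L2 [L3 _]]]].
  replace (RtoC t * (z + zeta))%C with (c + h)%C by (unfold c, h; ring).
  assert (E1 : ((z + zeta) * G' t - z * G t)%C = ((z + zeta) * g + zeta * G t)%C) by (unfold g; ring).
  assert (E2 : ((z + zeta) * KK (c + h) (F' t) (G' t) - z * KK c (F t) (G t))%C =
    ((z + zeta) * (dlog_disc (c + h) * g + (dlog_disc (c + h) - dlog_disc c) * G t - (pf (F' t) * ((G t + G t + g) *
      g) + (pf (F' t) - pf (F t)) * (G t * G t)))
      + zeta * KK c (F t) (G t))%C).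
  { unfold holo_coef, g. ring. }
  assert (Zz : Cmod (z + zeta) <= 2). { eapply Rle_trans; [apply Cmod_triangle|]; lra. }
  replace (12 / d ^ 2) with (12 * k ^ 2) in L1 by (unfold k; field; lra).
  replace (4 / d) with (4 * k) in L2, L3 by (unfold k; field; lra).
  split.
  + rewrite E1. eapply Rle_trans; [apply Cmod_triangle|]. rewrite !Cmod_mult.
    assert (Cmod (z + zeta) * Cmod g <= 2 * Cmod g) by (apply Rmult_le_compat_r; auto).
    assert (Cmod zeta * Cmod (G t) <= Cmod zeta * M) by (apply Rmult_le_compat_l; auto).
    assert (2 <= Mg). { unfold Mg. assert (0 <= M * (2 * M + 1)) by nra. lra. }
    assert (M <= Ce). { unfold Ce. assert (0 < M * k ^ 2) by nra. assert (0 < M * k) by nra. lra. }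
    nra.
  + rewrite E2. eapply Rle_trans; [apply Cmod_triangle|]. rewrite !Cmod_mult.
    assert (A1 : Cmod (dlog_disc (c + h) * g) <= 4 * k * Cmod g). { rewrite Cmod_mult. apply Rmult_le_compat_r; auto. }
    assert (A2 : Cmod ((dlog_disc (c + h) - dlog_disc c) * G t) <= 24 * k ^ 2 * Cmod zeta * M).
    { rewrite Cmod_mult. apply Rmult_le_compat; auto; try apply Cmod_ge_0.
      eapply Rle_trans; [apply L1|]. nra. }
    assert (A3 : Cmod (pf (F' t) * ((G t + G t + g) * g)) <= M * ((2 * M + 1) * Cmod g)).
    { rewrite !Cmod_mult. apply Rmult_le_compat; auto; try apply Cmod_ge_0.
      apply Rmult_le_pos; auto; apply Cmod_ge_0. apply Rmult_le_compat_r; auto.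
      eapply Rle_trans; [apply Cmod_triangle|]. pose proof (Cmod_triangle (G t) (G t)). lra. }
    assert (A4 : Cmod ((pf (F' t) - pf (F t)) * (G t * G t)) <= M * Cmod f * (M * M)).
    { rewrite !Cmod_mult. apply Rmult_le_compat; auto; try apply Cmod_ge_0.
      apply Rmult_le_pos; apply Cmod_ge_0. apply Rmult_le_compat; auto; apply Cmod_ge_0. }
    assert (A5 : Cmod (KK c (F t) (G t)) <= 4 * k * M + M * (M * M)).
    { unfold holo_coef. eapply Rle_trans; [apply Cmod_minus_le|]. rewrite !Cmod_mult.
      assert (Cmod (dlog_disc c) * Cmod (G t) <= 4 * k * M) by (apply Rmult_le_compat; auto; apply Cmod_ge_0).
      assert (Cmod (pf (F t)) * (Cmod (G t) * Cmod (G t)) <= M * (M * M)).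
      { apply Rmult_le_compat; auto; try apply Cmod_ge_0. apply Rmult_le_pos; apply Cmod_ge_0.
        apply Rmult_le_compat; auto; apply Cmod_ge_0. }
      lra. }
    match goal with |- Cmod (z + zeta) * Cmod ?w + _ <= _ => assert (A6 : Cmod w <=
      4 * k * Cmod g + 24 * k ^ 2 * Cmod zeta * M + (M * ((2 * M + 1) * Cmod g) + M * Cmod f * (M * M))) end.
    { eapply Rle_trans; [apply Cmod_minus_le|]. apply Rplus_le_compat.
      - eapply Rle_trans; [apply Cmod_triangle|]. lra.
      - eapply Rle_trans; [apply Cmod_triangle|]. lra. }
    assert (A7 : Cmod zeta * Cmod (KK c (F t) (G t)) <= Cmod zeta * (4 * k * M + M * (M * M))) by (apply
      Rmult_le_compat_l; auto).
    eapply Rle_trans; [apply Rplus_le_compat; [apply Rmult_le_compat;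
      [apply Cmod_ge_0|apply Cmod_ge_0|apply Zz|apply A6]|apply A7]|].
    unfold Mg, Ce.
    assert (0 <= 8 * k * Cmod f) by nra.
    assert (0 <= M ^ 3 * Cmod g) by nra.
    assert (0 <= M * (2 * M + 1) * Cmod f) by (apply Rmult_le_pos; nra).
    simpl in *. nra.
Qed.

Lemma ray_sol_uniq z T F G F' G' : 0 <= T <= 2 -> Cmod z < 1 -> T ^ 2 * Cmod z ^ 2 < 1 ->
  ray_sol z T F G -> ray_sol z T F' G' -> forall s, 0 <= s <= T -> F' s = F s /\ G' s = G s.
Proof.
intros HT Hz HTz H H' s Hs.
destruct (ray_sol_lip z T F G HT Hz HTz H) as [Cst [d [Hd [_ K]]]].
assert (H'' : ray_sol (z + 0) T F' G'). { replace (z + 0)%C with z by ring. auto. }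
destruct (K 0%C) with (F' := F') (G' := G') (s := s) as [A B]; auto. { rewrite Cmod_0; auto. }
rewrite Cmod_0, Rmult_0_r in A, B.
assert (Z : forall a b : C, Cmod (a - b) <= 0 -> a = b).
{ intros a b Hab. assert (a - b = 0)%C. { apply Cmod_eq_0. apply Rle_antisym; auto. apply Cmod_ge_0. }
  replace a with (a - b + b)%C by ring. rewrite H0. ring. }
split; now apply Z.
Qed.

(** The equation for [G] makes the ratio of the pulled-back density to that of the disc constant
    along the ray. Its square [Q] is differentiated, which avoids the modulus of [G]. *)
Lemma ray_sol_energy z T F G : Cmod z < 1 -> T ^ 2 * Cmod z ^ 2 < 1 -> ray_sol z T F G ->
  exp (u p0) * Cmod g0 = 2 ->
  forall s, 0 <= s <= T -> exp (u (F s)) * Cmod (G s) = 2 / (1 - s ^ 2 * Cmod z ^ 2).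
Proof.
intros Hz HTz [F0 [G0 HS]] Hg s Hs.
set (m := Cmod z ^ 2) in *. assert (Hm : 0 <= m) by apply pow2_ge_0.
assert (HD : forall t, 0 <= t <= T -> 0 < 1 - t ^ 2 * m).
{ intros t Ht. assert (t ^ 2 <= T ^ 2) by (apply pow_incr; lra). nra. }
set (Q := fun t => exp (2 * u (F t)) * Cmod (G t) ^ 2 * (1 - t ^ 2 * m) ^ 2).
assert (DQ : forall t, 0 <= t <= T -> is_derive Q t 0).
{ intros t Ht. destruct (HS t Ht) as [Wt [A B]].
  pose proof (grad_curve _ _ _ _ _ _ (pm_u _ _ HJ _ Wt) A) as Du.
  eapply is_derive_eq. apply is_derive_mult_R. apply is_derive_mult_R.
  apply is_derive_exp_R, is_derive_scal_R, Du. apply is_derive_Cmod2, B.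
  assert (DP : is_derive (fun t => (1 - t ^ 2 * m) ^ 2) t (2 * (1 - t ^ 2 * m) * (- (2 * t * m)))).
  { auto_derive; auto. ring. }
  apply DP.
  cbv beta. rewrite Cmod_sqr.
  assert (EK : (z * KK (RtoC t * z) (F t) (G t))%C = (RtoC (ray_coef m t) * G t - z * G t * pf (F t) * G t)%C).
  { unfold holo_coef. pose proof (dlog_disc_ray z t) as E. fold m in E. rewrite <- E. cring. }
  rewrite EK. unfold ray_coef. pose proof (HD t Ht). unfold dlog. simpl. req. field. lra. }
assert (EQ : Q s = Q 0).
{ destruct (Req_dec s 0) as [->|]; auto.
  destruct (is_derive_MVT Q (fun _ => 0) 0 s) as [c [_ E]]; [lra| |lra]. intros; apply DQ; lra. }
unfold Q in EQ. rewrite F0, G0 in EQ. pose proof (HD s Hs).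
assert (E4 : (exp (u (F s)) * Cmod (G s) * (1 - s ^ 2 * m)) ^ 2 = 2 ^ 2).
{ rewrite <- Hg. replace (2 * u (F s)) with (u (F s) + u (F s)) in EQ by ring.
  replace (2 * u p0) with (u p0 + u p0) in EQ by ring. rewrite !exp_plus in EQ.
  match type of EQ with ?a = ?b => transitivity a; [ring|rewrite EQ; ring] end. }
assert (E5 : exp (u (F s)) * Cmod (G s) * (1 - s ^ 2 * m) = 2).
{ assert (0 <= exp (u (F s)) * Cmod (G s) * (1 - s ^ 2 * m)).
  { apply Rmult_le_pos; [apply Rmult_le_pos|]; try lra. left; apply exp_pos. apply Cmod_ge_0. }
  nra. }
rewrite <- E5. field. lra.
Qed.
End DevelopingRays.

(** * Global existence along rays and holomorphic dependence on the end point *)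

Section DevelopingRays.
Variables (W : C -> Prop) (J : jet) (p0 : C).
Hypothesis HJ : planar_metric W J.
Hypothesis Hp0 : W p0.
Notation u := (ju J).
Notation pf := (dlog J).
Notation aa := (dlog_z J).
Notation bb := (dlog_zbar J).
Notation KK := (holo_coef J).
(** The value of [F' 0] for which [F] is isometric at 0. *)
Definition g0 : C := RtoC (2 * exp (- u p0)).
Notation ray_sol := (ray_sol W J p0 g0).

Lemma g0_energy : exp (u p0) * Cmod g0 = 2.
Proof.
unfold g0. rewrite Cmod_R, Rabs_pos_eq by (pose proof (exp_pos (- u p0)); lra).
replace (exp (u p0) * (2 * exp (- u p0))) with (2 * (exp (u p0) * exp (- u p0))) by ring.
rewrite <- exp_plus, Rplus_opp_r, exp_0. ring.
Qed.

(** Let [ms] be the supremum of the life spans. If [ms <= 1], the energy identity bounds the speed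
    of [F] up to [ms], so [F] accumulates at some [P] in [W]; the local solution near [P], whose
    life span is uniform, then starts early enough to outlive [ms]. *)
Lemma ray_exists : curve_complete W u -> forall z, Cmod z < 1 -> exists F G, ray_sol z 1 F G.
Proof.
intros HC z Hz.
set (m := Cmod z ^ 2). assert (Hm : 0 <= m < 1). { unfold m. pose proof (Cmod_ge_0 z). nra. }
(* Any [T0 > 1] with [T0^2 m < 1] would do: solutions are continued a little beyond time 1. *)
set (T0 := 2 / (1 + m)).
assert (HT0 : 1 < T0 <= 2).
{ unfold T0. split; apply Rmult_lt_reg_r with (1 + m) || apply Rmult_le_reg_r with (1 + m); try lra;
  unfold Rdiv; rewrite Rmult_assoc, Rinv_l by lra; lra. }
assert (HT0m : T0 ^ 2 * m < 1).
{ unfold T0. apply Rmult_lt_reg_r with ((1 + m) ^ 2). apply pow_lt; lra.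
  replace ((2 / (1 + m)) ^ 2 * m * (1 + m) ^ 2) with (4 * m) by (field; lra). nra. }
destruct (completeness (fun T => 0 <= T <= T0 /\ exists F G, ray_sol z T F G)) as [ms [Hub Hl]].
{ exists T0. intros T [HT _]; lra. }
{ exists 0. split; [lra|].
  destruct (ray_local_exists W J HJ p0 (Cmod g0 + 1) z T0) as [r [tau [Hr [Htau K]]]]; auto; try lra.
  { pose proof (Cmod_ge_0 g0); lra. }
  destruct (K 0 p0 g0) as [F [G [A [B D]]]]; try lra.
  { replace (p0 - p0)%C with (RtoC 0) by ring. now rewrite Cmod_0. }
  exists F, G. split; auto. split; auto. intros s Hs. replace s with 0 by lra.
  apply D. rewrite Rminus_diag, Rabs_R0. auto. lra. }
assert (Hms : 0 < ms <= T0).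
{ split; [|apply Hl; intros T [HT _]; lra].
  destruct (ray_local_exists W J HJ p0 (Cmod g0 + 1) z T0) as [r [tau [Hr [Htau K]]]]; auto; try lra.
  { pose proof (Cmod_ge_0 g0); lra. }
  destruct (K 0 p0 g0) as [F [G [A [B D]]]]; try lra.
  { replace (p0 - p0)%C with (RtoC 0) by ring. now rewrite Cmod_0. }
  apply Rlt_le_trans with (Rmin (tau / 2) T0). { apply Rmin_pos; lra. }
  assert (0 < Rmin (tau / 2) T0 <= T0) by (split; [apply Rmin_pos; lra|apply Rmin_r]).
  apply Hub. split; [lra|].
  exists F, G. split; auto. split; auto. intros s Hs.
  assert (Rmin (tau / 2) T0 <= tau / 2) by apply Rmin_l.
  apply D; [|lra]. rewrite Rabs_pos_eq; lra. }
assert (HA : forall T, 0 <= T < ms -> exists F G, ray_sol z T F G).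
{ intros T HT. apply NNPP. intros Hn.
  assert (ms <= T); [|lra]. apply Hl. intros T' [HT' [F [G HS]]].
  destruct (Rle_dec T' T); auto. exfalso. apply Hn. exists F, G. eapply ray_sol_le; [|apply HS]. lra. }
destruct (Rlt_dec 1 ms) as [H1|H1].
{ apply HA; lra. }
exfalso.
(* Each solution is taken up to [(t + ms) / 2], beyond [t] itself, so that by uniqueness the glued
   curve agrees with it around [t] and inherits its derivative. *)
assert (CH : forall t, {FG : (R -> C) * (R -> C) | 0 <= t < ms -> ray_sol z ((t + ms) / 2) (fst FG) (snd FG)}).
{ intros t. apply constructive_indefinite_description.
  destruct (classic (0 <= t < ms)) as [Ht|Ht].
  - destruct (HA ((t + ms) / 2)) as [F [G HS]]; [lra|]. exists (F, G). auto.
  - exists (fun _ => p0, fun _ => p0). intros; contradiction. }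
(* For negative arguments the solution chosen at 0 is used, which makes the derivative at 0
   two-sided. *)
set (Fs := fun t => fst (proj1_sig (CH (Rmax 0 t))) t).
set (Gs := fun t => snd (proj1_sig (CH (Rmax 0 t))) t).
set (SF := fun t => fst (proj1_sig (CH t))). set (SG := fun t => snd (proj1_sig (CH t))).
assert (HSS : forall t, 0 <= t < ms -> ray_sol z ((t + ms) / 2) (SF t) (SG t)).
{ intros t Ht. unfold SF, SG. destruct (CH t); simpl; auto. }
assert (HTm : forall T, 0 <= T <= T0 -> T ^ 2 * m < 1).
{ intros T HT. assert (T ^ 2 <= T0 ^ 2) by (apply pow_incr; lra). nra. }
assert (AG : forall t s, 0 <= t < ms -> 0 <= s < ms -> s <= (t + ms) / 2 -> Fs s = SF t s /\ Gs s = SG t s).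
{ intros t s Ht Hs Hst. unfold Fs, Gs. rewrite Rmax_right by lra. fold (SF s) (SG s).
  apply (ray_sol_uniq W J p0 g0 HJ z s (SF t) (SG t) (SF s) (SG s)); auto; try lra.
  - apply HTm; lra.
  - eapply ray_sol_le; [|apply HSS; auto]. lra.
  - eapply ray_sol_le; [|apply HSS; auto]. lra. }
assert (AGn : forall s, s <= 0 -> Fs s = SF 0 s /\ Gs s = SG 0 s).
{ intros s Hs. unfold Fs, Gs. rewrite Rmax_left by lra. auto. }
assert (AGL : forall t, 0 <= t < ms -> forall s,
  Rabs (s - t) < (ms - t) / 2 -> (t = 0 \/ 0 <= s) -> Fs s = SF t s /\ Gs s = SG t s).
{ intros t Ht s Hs [->|H0].
  - apply Rabs_def2 in Hs. destruct (Rle_dec s 0). now apply AGn. apply AG; lra.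
  - apply Rabs_def2 in Hs. apply AG; lra. }
assert (DS : forall t, 0 <= t < ms -> W (Fs t) /\ vder Fs t (z * Gs t)%C /\ vder Gs t (z * KK (RtoC t * z) (Fs t) (Gs
  t))%C).
{ intros t Ht. destruct (HSS t Ht) as [_ [_ HS]]. destruct (HS t) as [A [B D]]; [lra|].
  destruct (AG t t Ht Ht ltac:(lra)) as [E1 E2]. rewrite E1, E2. split; auto.
  destruct (Req_dec t 0) as [E0|E0].
  - split; (eapply vder_ext_loc; [| |eassumption]);
     try (intros s Hs; symmetry; apply (AGL t Ht s Hs); auto); lra.
  - assert (0 < Rmin t ((ms - t) / 2)) by (apply Rmin_pos; lra).
    split; (eapply vder_ext_loc; [eassumption| |eassumption]);
    (intros s Hs; split_min; symmetry; apply (AGL t Ht s); auto; right; apply Rabs_def2 in H0; lra). }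
assert (F0 : Fs 0 = p0 /\ Gs 0 = g0).
{ destruct (AGn 0) as [-> ->]; [lra|]. destruct (HSS 0) as [A [B _]]; [lra|]. auto. }
assert (EN : forall t, 0 <= t < ms -> exp (u (Fs t)) * Cmod (Gs t) <= 2 / (1 - T0 ^ 2 * m)).
{ intros t Ht. rewrite (ray_sol_energy W J p0 g0 HJ z t Fs Gs) with (s := t); auto; try lra.
  - fold m. assert (t ^ 2 <= T0 ^ 2) by (apply pow_incr; lra).
    unfold Rdiv. apply Rmult_le_compat_l; [lra|]. apply Rinv_le_contravar; [lra|nra].
  - apply HTm; lra.
  - destruct F0. split; auto. split; auto. intros s Hs. apply DS; lra.
  - apply g0_energy. }
set (c := 2 / (1 - T0 ^ 2 * m)) in *.
assert (Hc : 0 < c) by (unfold c; apply Rdiv_lt_0_compat; lra).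
destruct (HC Fs (fun t => z * Gs t)%C ms c) as [P [WP HP]]; [lra| |].
{ intros t Ht. destruct (DS t Ht) as [A [B D]]. split; auto. split; auto. split.
  - apply (vcont_vder _ _ (0 * Gs t + z * (z * KK (RtoC t * z) (Fs t) (Gs t)))%C). apply vder_mult; auto.
    apply vder_const.
  - rewrite Cmod_mult. specialize (EN t Ht). pose proof (exp_pos (u (Fs t))). pose proof (Cmod_ge_0 (Gs t)).
    pose proof (Cmod_ge_0 z). assert (0 <= exp (u (Fs t)) * Cmod (Gs t)) by nra. nra. }
destruct (grad_cont _ _ _ _ (pm_u _ _ HJ P WP) 1) as [ru [Hru KU]]; [lra|].
(* Near [P] one has [u >= u P - 1], so the energy bound [c] turns into this bound for [|G|]. *)
set (B := c * exp (1 - u P)).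
assert (HB : 0 < B) by (unfold B; pose proof (exp_pos (1 - u P)); nra).
destruct (ray_local_exists W J HJ P B z T0 WP HB ltac:(lra) HT0m) as [r [tau [Hr [Htau K]]]].
destruct (HP (Rmin r ru) tau) as [t [Ht0 [Htm HtP]]]; auto. { now apply Rmin_pos. }
split_min.
assert (Ht : 0 <= t < ms) by lra.
assert (HG : Cmod (Gs t) <= B).
{ specialize (EN t Ht). specialize (KU (Fs t) ltac:(assumption)). apply Rabs_def2 in KU.
  unfold B. apply Rmult_le_reg_l with (exp (u P - 1)); [apply exp_pos|].
  replace (exp (u P - 1) * (c * exp (1 - u P))) with (c * (exp (u P - 1) * exp (1 - u P))) by ring.
  rewrite <- exp_plus. replace (u P - 1 + (1 - u P)) with 0 by ring. rewrite exp_0.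
  assert (exp (u P - 1) < exp (u (Fs t))) by (apply exp_increasing; lra).
  pose proof (Cmod_ge_0 (Gs t)). nra. }
destruct (K t (Fs t) (Gs t)) as [F1 [G1 [E1 [E2 D1]]]]; auto. { lra. }
set (T2 := Rmin (t + (ms - t + tau) / 2) T0).
assert (HT2 : ms < T2 /\ T2 <= T0 /\ T2 < t + tau).
{ unfold T2, Rmin; destruct Rle_dec; lra. }
assert (ms >= T2); [|lra].
apply Rle_ge, Hub. split; [lra|].
exists (fun s => if Rle_dec s t then Fs s else F1 s), (fun s => if Rle_dec s t then Gs s else G1 s).
split; [destruct Rle_dec; [apply F0|lra]|]. split; [destruct Rle_dec; [apply F0|lra]|].
intros s Hs. destruct (DS t Ht) as [A1 [A2 A3]].
destruct (Rtotal_order s t) as [h|[->|h]].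
- destruct (Rle_dec s t); [|lra]. destruct (DS s ltac:(lra)) as [X1 [X2 X3]]. split; auto.
  split; (eapply vder_ext_loc with (r := t - s); [lra| |eassumption]);
  intros y Hy; apply Rabs_def2 in Hy; destruct (Rle_dec y t); auto; lra.
- destruct (Rle_dec t t); [|lra].
  destruct (D1 t) as [Y1 [Y2 Y3]]. { rewrite Rminus_diag, Rabs_R0; lra. } { lra. }
  rewrite E1, E2 in *. split; auto.
  split; apply vder_glue; auto.
- destruct (Rle_dec s t); [lra|].
  destruct (D1 s) as [Y1 [Y2 Y3]]. { apply Rabs_def1; lra. } { lra. }
  split; auto.
  split; (eapply vder_ext_loc with (r := s - t); [lra| |eassumption]);
  intros y Hy; apply Rabs_def2 in Hy; destruct (Rle_dec y t); auto; lra.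
Qed.

Lemma unif_strict T (F : R -> C) e : 0 < e -> (forall s, 0 <= s <= T -> W (F s) /\ vcont F s) ->
  exists r, 0 < r /\ forall s, 0 <= s <= T -> forall A, Cmod (A - F s) < r ->
   Cmod (pf A - pf (F s) - (aa (F s) * (A - F s) + RtoC (bb (F s)) * Cconj (A - F s))) <= e * Cmod (A - F s).
Proof.
intros He H.
apply (uniform_on_compact (fun s r => forall A, Cmod (A - F s) < r ->
   Cmod (pf A - pf (F s) - (aa (F s) * (A - F s) + RtoC (bb (F s)) * Cconj (A - F s))) <= e * Cmod (A - F s))).
- intros s r r' K Hr A HA. apply K. lra.
- intros s Hs. destruct (H s Hs) as [Ws Cs].
  destruct (dlog_strict W J HJ (F s) e Ws He) as [r [Hr K]].
  destruct (Cs (r/2)) as [d [Hd Kd]]; [lra|].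
  exists (Rmin (r/2) d). split; [apply Rmin_pos; lra|].
  intros s' Hs' Hss A HA. split_min. specialize (Kd s' ltac:(assumption)).
  apply K; [|lra]. eapply Rle_lt_trans; [apply (Cmod_triangle_sub _ (F s'))|]. lra.
Qed.

(** On a ray [dlog_disc] is a real function of the time multiplied by the constant [Cconj z]. *)
Lemma vder_dlog_disc z s : 1 - s ^ 2 * Cmod z ^ 2 <> 0 ->
  vder (fun t => dlog_disc (RtoC t * z)) s
   (RtoC (2 / (1 - Cmod (RtoC s * z) ^ 2) ^ 2) * (Cconj z + Cconj (RtoC s * z) * Cconj (RtoC s * z) * z))%C.
Proof.
intros Hn. set (m := Cmod z ^ 2) in *.
assert (E : forall t, Cmod (RtoC t * z) ^ 2 = t ^ 2 * m).
{ intros t. rewrite Cmod_mult, Cmod_R, Rpow_mult_distr, pow2_abs. reflexivity. }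
apply vder_ext with (f := fun t => (RtoC (2 * t / (1 - t ^ 2 * m)) * Cconj z)%C).
{ intros t. unfold dlog_disc. rewrite E, Cconj_mult, Cconj_R. unfold Rdiv. rewrite !RtoC_mult. ring. }
eapply vder_eq. apply vder_mult; [apply vder_RtoC|apply vder_const].
{ instantiate (1 := 2 * (1 + s ^ 2 * m) / (1 - s ^ 2 * m) ^ 2). auto_derive; auto. field. auto. }
cbv beta. rewrite E, Cconj_mult, Cconj_R.
replace (2 * (1 + s ^ 2 * m) / (1 - s ^ 2 * m) ^ 2) with (2 / (1 - s ^ 2 * m) ^ 2 * (1 + s ^ 2 * m)) by (field; auto).
rewrite RtoC_mult, RtoC_plus, RtoC_mult. unfold m at 2. rewrite Cmod2_C.
rewrite RtoC_pow. simpl. ring.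
Qed.

(** The remainders of the expected complex-linear expansions vanish at time 0 and satisfy a linear
    system whose forcing is [o(zeta)]: the terms of first order in [zeta] and in its conjugate
    cancel. Gronwall's lemma then makes the remainders [o(zeta)] at time 1, which is complex
    differentiability of the end values. *)
Lemma ray_sol_cauchy_riemann z F G : Cmod z < 1 -> ray_sol z 1 F G ->
  forall e, 0 < e -> exists d, 0 < d /\ forall zeta, Cmod zeta < d -> forall F' G', ray_sol (z + zeta) 1 F' G' ->
   Cmod (F' 1 - F 1 - zeta * G 1) <= e * Cmod zeta /\
   Cmod (G' 1 - G 1 - zeta * KK z (F 1) (G 1)) <= e * Cmod zeta.
Proof.
intros Hz HSol e He.
assert (HTz : 1 ^ 2 * Cmod z ^ 2 < 1). { pose proof (Cmod_ge_0 z). nra. }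
destruct (ray_sol_lip W J p0 g0 HJ z 1 F G ltac:(lra) Hz HTz HSol) as [Cs [dl [Hdl [HCs LIP]]]].
pose proof (ray_sol_energy W J p0 g0 HJ z 1 F G Hz HTz HSol g0_energy) as EN.
destruct HSol as [F0 [G0 HS]].
assert (CFG : forall s, 0 <= s <= 1 -> W (F s) /\ vcont F s /\ vcont G s).
{ intros s Hs. destruct (HS s Hs) as [A [B K]]. split; auto. split; eapply vcont_vder; eauto. }
destruct (compact_tube W J HJ 1 F G CFG) as [r [M [Hr [HM HTu]]]].
set (d := 1 - Cmod z ^ 2). pose proof (Cmod_ge_0 z) as Z0.
assert (Hd : 0 < d <= 1) by (unfold d; nra).
assert (HD : forall s, 0 <= s <= 1 -> d <= 1 - Cmod (RtoC s * z) ^ 2).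
{ intros s Hs. rewrite Cmod_mult, Cmod_R, Rabs_pos_eq, Rpow_mult_distr by lra. unfold d.
  assert (s ^ 2 <= 1 ^ 2) by (apply pow_incr; lra). pose proof (pow2_ge_0 (Cmod z)). nra. }
set (k := / d). assert (Hk : 0 < k) by (apply Rinv_0_lt_compat; lra).
set (Mg := 4 * k + 2 * M * M + 2 * M ^ 3 + 1).
assert (HM3 : 1 <= M ^ 3) by (apply pow_R1_Rle; auto).
assert (HMg : 0 <= Mg) by (unfold Mg; nra).
set (gc := gronwall_const Mg 1).
assert (Hgc : 0 <= gc). { unfold gc, gronwall_const. pose proof (exp_pos ((4 * Mg + 1) * 1)). lra. }
(* Gronwall's lemma returns the forcing multiplied by [gc + 1]. *)
set (e1 := e / (gc + 1)). assert (He1 : 0 < e1) by (unfold e1; apply Rdiv_lt_0_compat; lra).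
(* The strict differentiability error of [dlog] reaches the system with the factor [Cs * M^2]; this
   choice makes it at most [e1 / 2] per unit of [|zeta|]. *)
set (e2 := e1 / (2 * (Cs + 1) * M ^ 2)).
assert (HM2 : 1 <= M ^ 2) by (apply pow_R1_Rle; auto).
assert (He2 : 0 < e2). { unfold e2. apply Rdiv_lt_0_compat; nra. }
destruct (unif_strict 1 F e2 He2) as [r2 [Hr2 US]]. { intros s Hs; split; apply CFG; auto. }
assert (Hk2 : 0 < k ^ 2) by (apply pow_lt; auto). assert (Hk3 : 0 < k ^ 3) by (apply pow_lt; auto).
(* The sum of the coefficients of all quadratic terms of [Err]; the final [Cs] takes care of
   [zeta * (G' - G)] in [DF']. *)
set (C2 := 28 * k ^ 3 * M + 12 * k ^ 2 * Cs + M * Cs ^ 2 + M * Cs * ((2 * M + Cs) * Cs) +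
   (4 * k * Cs + 12 * k ^ 2 * M + (M * ((2 * M + Cs) * Cs) + M * Cs * (M * M))) + Cs).
assert (HC2 : 0 <= C2).
{ unfold C2. assert (0 <= M * Cs) by nra. assert (0 <= k * Cs) by nra. assert (0 <= k ^ 2 * Cs) by nra.
  assert (0 <= Cs ^ 2) by nra. assert (0 <= M * Cs ^ 2) by nra. assert (0 <= (2 * M + Cs) * Cs) by nra.
  assert (0 <= M * Cs * ((2 * M + Cs) * Cs)) by nra. assert (0 <= M * ((2 * M + Cs) * Cs)) by nra.
  assert (0 <= M * Cs * (M * M)) by nra. nra. }
(* In order: validity of the Lipschitz bound, room for [dlog_disc_lip], [|zeta| < 1], staying in the
   compact tube, staying in the region of strict differentiability, and quadratic terms below
   [e1 / 2] times [|zeta|]. *)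
set (dd := Rmin (Rmin dl (d / 6)) (Rmin (Rmin 1 (r / (Cs + 1))) (Rmin (r2 / (Cs + 1)) (e1 / (2 * (C2 + 1)))))).
exists dd. split.
{ unfold dd. repeat apply Rmin_pos; try lra; apply Rdiv_lt_0_compat; lra. }
intros zeta Hzeta F' G' HSol'.
assert (Hz6 : Cmod zeta < dl /\ Cmod zeta < d / 6 /\ Cmod zeta < 1 /\ Cmod zeta < r / (Cs + 1) /\
  Cmod zeta < r2 / (Cs + 1) /\ Cmod zeta < e1 / (2 * (C2 + 1))).
{ unfold dd in Hzeta. split_min. repeat split; assumption. }
destruct Hz6 as [Y1 [Y2 [Y3 [Y4 [Y5 Y6]]]]].
specialize (LIP zeta ltac:(assumption) F' G' HSol').
destruct HSol' as [F0' [G0' HS']].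
pose proof (Cmod_ge_0 zeta) as Ze0. set (x := Cmod zeta) in *.
assert (Hx : (Cs + 1) * x < r /\ (Cs + 1) * x < r2 /\ 2 * (C2 + 1) * x < e1).
{ split; [|split].
  - apply Rmult_lt_compat_l with (r := Cs + 1) in Y4; [|lra].
    replace ((Cs + 1) * (r / (Cs + 1))) with r in Y4 by (field; lra). auto.
  - apply Rmult_lt_compat_l with (r := Cs + 1) in Y5; [|lra].
    replace ((Cs + 1) * (r2 / (Cs + 1))) with r2 in Y5 by (field; lra). auto.
  - apply Rmult_lt_compat_l with (r := 2 * (C2 + 1)) in Y6; [|lra].
    replace (2 * (C2 + 1) * (e1 / (2 * (C2 + 1)))) with e1 in Y6 by (field; lra). auto. }
destruct Hx as [X1 [X2 X3]].
(* At time [s] the two rays are [s zeta] apart, so this is the error of the first-order expansion at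
   that time. *)
set (DF := fun s => (F' s - F s - RtoC s * zeta * G s)%C).
set (DG := fun s => (G' s - G s - RtoC s * zeta * KK (RtoC s * z) (F s) (G s))%C).
set (DF' := fun s => (z * DG s + zeta * (G' s - G s))%C).
set (q := fun s => RtoC (2 / (1 - Cmod (RtoC s * z) ^ 2) ^ 2)).
(* Everything that is left after linearization: quadratic terms, and one term governed by the strict
   differentiability of [dlog]. *)
set (Err := fun s => let c := (RtoC s * z)%C in let h := (RtoC s * zeta)%C in
   let f := (F' s - F s)%C in let g := (G' s - G s)%C in
  (z * ((dlog_disc (c + h) - dlog_disc c - q s * (Cconj h + Cconj c * Cconj c * h)) * G s + (dlog_disc (c + h) -
    dlog_disc c) * g - pf (F s) * (g * g)
     - (pf (F' s) - pf (F s) - (aa (F s) * f + RtoC (bb (F s)) * Cconj f)) * (G s * G s)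
     - (pf (F' s) - pf (F s)) * ((G s + G s + g) * g))
   + zeta * (dlog_disc (c + h) * g + (dlog_disc (c + h) - dlog_disc c) * G s - (pf (F' s) * ((G s + G s + g) * g) +
       (pf (F' s) - pf (F s)) * (G s * G s))))%C).
set (DG' := fun s => (z * (dlog_disc (RtoC s * z) - 2 * pf (F s) * G s) * DG s
    - z * (G s * G s) * (aa (F s) * DF s + RtoC (bb (F s)) * Cconj (DF s)) + Err s)%C).
assert (HDer : forall s, 0 <= s <= 1 -> vder DF s (DF' s) /\ vder DG s (DG' s)).
{ intros s Hs. destruct (HS s Hs) as [Ws [A B]]. destruct (HS' s Hs) as [Ws' [A' B']].
  assert (Cid : vder (fun s => RtoC s * zeta)%C s zeta).
  { eapply vder_eq. apply vder_mult; [apply vder_id|apply vder_const]. cring. }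
  split.
  - unfold DF. eapply vder_eq. apply vder_minus. apply vder_minus; eassumption.
    apply vder_mult; eassumption. unfold DF', DG. cring.
  - assert (Dn : 1 - Cmod (RtoC s * z) ^ 2 <> 0) by (specialize (HD s Hs); lra).
    assert (Dk : vder (fun t => dlog_disc (RtoC t * z)) s
       (q s * (Cconj z + Cconj (RtoC s * z) * Cconj (RtoC s * z) * z))%C).
    { apply vder_dlog_disc. rewrite Cmod_mult, Cmod_R, Rpow_mult_distr, pow2_abs in Dn. auto. }
    assert (Dp : vder (fun t => pf (F t)) s (aa (F s) * (z * G s) + RtoC (bb (F s)) * Cconj (z * G s))%C).
    { unfold dlog, dlog_z, dlog_zbar. rewrite <- (pm_L _ _ HJ _ Ws).
      pose proof (grad_curve _ _ _ _ _ _ (pm_ux _ _ HJ _ Ws) A) as Q1.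
      pose proof (grad_curve _ _ _ _ _ _ (pm_uy _ _ HJ _ Ws) A) as Q2.
      split; cbn [fst snd].
      - eapply is_derive_eq. apply Q1. simpl. req. field.
      - eapply is_derive_eq. apply (is_derive_opp_R _ _ _ Q2). simpl. req. field. }
    assert (DK : vder (fun t => KK (RtoC t * z) (F t) (G t)) s
      (q s * (Cconj z + Cconj (RtoC s * z) * Cconj (RtoC s * z) * z) * G s + dlog_disc (RtoC s * z) * (z * KK (RtoC s
        * z) (F s) (G s))
       - ((aa (F s) * (z * G s) + RtoC (bb (F s)) * Cconj (z * G s)) * (G s * G s)
          + pf (F s) * ((z * KK (RtoC s * z) (F s) (G s)) * G s + G s * (z * KK (RtoC s * z) (F s) (G s)))))%C).
    { unfold holo_coef at 1. apply vder_minus. apply vder_mult; auto. apply vder_mult; auto. apply vder_mult; auto. }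
    unfold DG. eapply vder_eq. apply vder_minus. apply vder_minus; eassumption.
    apply vder_mult; eassumption.
    (* Here the curvature equation enters: [d_zbar] of the two terms of [KK] cancel. *)
    assert (FL : q s = (RtoC (bb (F s)) * (G s * Cconj (G s)))%C).
    { rewrite <- Cmod2_C, <- RtoC_mult. unfold q, dlog_zbar. f_equal.
      specialize (EN s Hs).
      replace (2 * u (F s)) with (u (F s) + u (F s)) by ring. rewrite exp_plus.
      replace (exp (u (F s)) * exp (u (F s)) / 2 * Cmod (G s) ^ 2) with ((exp (u (F s)) * Cmod (G s)) ^ 2 / 2) by field.
      rewrite EN.
      assert (Es : Cmod (RtoC s * z) ^ 2 = s ^ 2 * Cmod z ^ 2) by (rewrite Cmod_mult, Cmod_R, Rpow_mult_distr,
        pow2_abs; reflexivity).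
      rewrite Es in Dn |- *. set (y := s ^ 2 * Cmod z ^ 2) in *. field. auto. }
    replace (RtoC s * (z + zeta))%C with (RtoC s * z + RtoC s * zeta)%C by ring.
    unfold DG', Err, DG, DF. cbv zeta beta.
    unfold holo_coef. rewrite FL, !Cconj_minus, !Cconj_mult, !Cconj_R. cring. }
assert (BE : forall s, 0 <= s <= 1 -> Cmod (DF' s) <= Mg * (Cmod (DF s) + Cmod (DG s)) + e1 * x /\
                                 Cmod (DG' s) <= Mg * (Cmod (DF s) + Cmod (DG s)) + e1 * x).
{ intros s Hs. destruct (LIP s Hs) as [LF LG].
  destruct (HTu s Hs) as [T1 [T2 [T3 [T4 T5]]]].
  pose proof (US s Hs (F' s) ltac:(lra)) as T6.
  destruct (T5 (F' s) ltac:(lra)) as [_ [T7 T8]].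
  set (f := (F' s - F s)%C) in *. set (g := (G' s - G s)%C) in *.
  pose proof (Cmod_ge_0 f) as f0. pose proof (Cmod_ge_0 g) as gg0.
  set (c := (RtoC s * z)%C). set (h := (RtoC s * zeta)%C).
  assert (Hh : Cmod h <= x). { unfold h. rewrite Cmod_mult, Cmod_R, Rabs_pos_eq by lra. fold x. nra. }
  pose proof (Cmod_ge_0 h) as h0.
  destruct (dlog_disc_lip c h d ltac:(lra) (HD s Hs) ltac:(lra)) as [_ [L1 [L2 [L3 L4]]]].
  replace (12 / d ^ 2) with (12 * k ^ 2) in L1 by (unfold k; field; lra).
  replace (4 / d) with (4 * k) in L2, L3 by (unfold k; field; lra).
  replace (28 / d ^ 3) with (28 * k ^ 3) in L4 by (unfold k; field; lra).
  assert (L1' : Cmod (dlog_disc (c + h) - dlog_disc c) <= 12 * k ^ 2 * x) by nra.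
  assert (L4' : Cmod (dlog_disc (c + h) - dlog_disc c - q s * (Cconj h + Cconj c * Cconj c * h)) <= 28 * k ^ 3 * x ^ 2).
  { eapply Rle_trans; [apply L4|]. apply Rmult_le_compat_l; [lra|]. apply pow_incr; lra. }
  set (a := Cmod (DF s)). set (b := Cmod (DG s)).
  assert (a0 : 0 <= a) by apply Cmod_ge_0. assert (b0 : 0 <= b) by apply Cmod_ge_0.
  assert (HC2x : C2 * x ^ 2 <= e1 / 2 * x) by nra.
  assert (HCs2 : Cs <= C2).
  { unfold C2. assert (0 <= M * Cs) by nra. assert (0 <= k * Cs) by nra. assert (0 <= k ^ 2 * Cs) by nra.
  assert (0 <= Cs ^ 2) by nra. assert (0 <= M * Cs ^ 2) by nra. assert (0 <= (2 * M + Cs) * Cs) by nra.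
  assert (0 <= M * Cs * ((2 * M + Cs) * Cs)) by nra. assert (0 <= M * ((2 * M + Cs) * Cs)) by nra.
  assert (0 <= M * Cs * (M * M)) by nra. nra. }
  split.
  - unfold DF'. fold g. eapply Rle_trans; [apply Cmod_triangle|]. rewrite !Cmod_mult. fold b x.
    assert (1 <= Mg) by (unfold Mg; nra).
    assert (x * Cmod g <= Cs * x ^ 2) by nra. assert (Cs * x ^ 2 <= C2 * x ^ 2) by (apply Rmult_le_compat_r; auto; nra).
    assert (Cmod z * b <= 1 * b) by (apply Rmult_le_compat_r; lra).
    assert (1 * (a + b) <= Mg * (a + b)) by (apply Rmult_le_compat_r; lra).
    assert (0 <= e1 * x) by (apply Rmult_le_pos; lra). lra.
  - assert (A1 : Cmod (z * (dlog_disc c - 2 * pf (F s) * G s) * DG s) <= (4 * k + 2 * M * M) * b).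
    { rewrite !Cmod_mult. fold b. apply Rmult_le_compat_r; auto.
      assert (Cmod (dlog_disc c - 2 * pf (F s) * G s) <= 4 * k + 2 * M * M).
      { eapply Rle_trans; [apply Cmod_minus_le|]. rewrite !Cmod_mult, Cmod_R, Rabs_pos_eq by lra.
        pose proof (Cmod_ge_0 (pf (F s))). pose proof (Cmod_ge_0 (G s)).
        assert (Cmod (pf (F s)) * Cmod (G s) <= M * M) by (apply Rmult_le_compat; auto). lra. }
      pose proof (Cmod_ge_0 (dlog_disc c - 2 * pf (F s) * G s)).
      apply Rle_trans with (1 * Cmod (dlog_disc c - 2 * pf (F s) * G s)); [apply Rmult_le_compat_r; lra|lra]. }
    assert (A2 : Cmod (z * (G s * G s) * (aa (F s) * DF s + RtoC (bb (F s)) * Cconj (DF s))) <= 2 * M ^ 3 * a).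
    { rewrite !Cmod_mult.
      assert (Cmod (aa (F s) * DF s + RtoC (bb (F s)) * Cconj (DF s)) <= 2 * M * a).
      { eapply Rle_trans; [apply Cmod_triangle|]. rewrite !Cmod_mult, Cmod_R, Cmod_conj. fold a.
        assert (Cmod (aa (F s)) * a <= M * a) by (apply Rmult_le_compat_r; auto).
        assert (Rabs (bb (F s)) * a <= M * a) by (apply Rmult_le_compat_r; auto). lra. }
      pose proof (Cmod_ge_0 (G s)).
      assert (Cmod (G s) * Cmod (G s) <= M * M) by (apply Rmult_le_compat; auto).
      assert (0 <= Cmod (G s) * Cmod (G s)) by (apply Rmult_le_pos; auto).
      assert (Cmod z * (Cmod (G s) * Cmod (G s)) <= 1 * (M * M)) by (apply Rmult_le_compat; lra).
      replace (2 * M ^ 3 * a) with (1 * (M * M) * (2 * M * a)) by ring.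
      apply Rmult_le_compat; auto; [apply Rmult_le_pos; auto|apply Cmod_ge_0]. }
    pose proof (Cmod_ge_0 (G s)) as G00.
    assert (GG : Cmod (G s) * Cmod (G s) <= M * M) by (apply Rmult_le_compat; auto).
    assert (GG0 : 0 <= Cmod (G s) * Cmod (G s)) by (apply Rmult_le_pos; auto).
    assert (Sg : Cmod ((G s + G s + g) * g) <= (2 * M + Cs) * Cs * x).
    { rewrite Cmod_mult. assert (Cmod (G s + G s + g) <= 2 * M + Cs).
      { eapply Rle_trans; [apply Cmod_triangle|]. pose proof (Cmod_triangle (G s) (G s)).
        assert (Cs * x <= Cs * 1) by (apply Rmult_le_compat_l; lra). lra. }
      rewrite Rmult_assoc. apply Rmult_le_compat; auto; apply Cmod_ge_0. }
    pose proof (Cmod_ge_0 ((G s + G s + g) * g)) as Sg0.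
    assert (Pf : Cmod (pf (F' s) - pf (F s)) <= M * Cs * x).
    { eapply Rle_trans; [apply T8|]. rewrite Rmult_assoc. apply Rmult_le_compat_l; lra. }
    pose proof (Cmod_ge_0 (pf (F' s) - pf (F s))) as Pf0.
    assert (B1 : Cmod ((dlog_disc (c + h) - dlog_disc c - q s * (Cconj h + Cconj c * Cconj c * h)) * G s) <= 28 * k ^
      3 * x ^ 2 * M).
    { rewrite Cmod_mult. apply Rmult_le_compat; auto; apply Cmod_ge_0. }
    assert (B2 : Cmod ((dlog_disc (c + h) - dlog_disc c) * g) <= 12 * k ^ 2 * x * (Cs * x)).
    { rewrite Cmod_mult. apply Rmult_le_compat; auto; apply Cmod_ge_0. }
    assert (B3 : Cmod (pf (F s) * (g * g)) <= M * ((Cs * x) * (Cs * x))).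
    { rewrite !Cmod_mult. apply Rmult_le_compat; auto; try apply Cmod_ge_0. apply Rmult_le_pos; auto.
      apply Rmult_le_compat; auto. }
    assert (B4 : Cmod ((pf (F' s) - pf (F s) - (aa (F s) * f + RtoC (bb (F s)) * Cconj f)) * (G s * G s)) <= e2 * (Cs
      * x) * (M * M)).
    { rewrite !Cmod_mult. apply Rmult_le_compat; auto; try apply Cmod_ge_0.
      eapply Rle_trans; [apply T6|]. apply Rmult_le_compat_l; lra. }
    assert (B5 : Cmod ((pf (F' s) - pf (F s)) * ((G s + G s + g) * g)) <= M * Cs * x * ((2 * M + Cs) * Cs * x)).
    { rewrite (Cmod_mult (pf (F' s) - pf (F s))). apply Rmult_le_compat; auto. }
    assert (B6 : Cmod (dlog_disc (c + h) * g) <= 4 * k * (Cs * x)).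
    { rewrite Cmod_mult. apply Rmult_le_compat; auto; apply Cmod_ge_0. }
    assert (B7 : Cmod ((dlog_disc (c + h) - dlog_disc c) * G s) <= 12 * k ^ 2 * x * M).
    { rewrite Cmod_mult. apply Rmult_le_compat; auto; apply Cmod_ge_0. }
    assert (B8 : Cmod (pf (F' s) * ((G s + G s + g) * g)) <= M * ((2 * M + Cs) * Cs * x)).
    { rewrite Cmod_mult. apply Rmult_le_compat; auto; apply Cmod_ge_0. }
    assert (B9 : Cmod ((pf (F' s) - pf (F s)) * (G s * G s)) <= M * Cs * x * (M * M)).
    { rewrite !Cmod_mult. apply Rmult_le_compat; auto. }
    assert (BErr : Cmod (Err s) <= C2 * x ^ 2 + e1 / 2 * x).
    { unfold Err. cbv zeta. fold f g c h.
      eapply Rle_trans; [apply Cmod_triangle|]. rewrite (Cmod_mult z), (Cmod_mult zeta). fold x.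
      match goal with |- _ * Cmod ?v + _ * Cmod ?w <= _ =>
        assert (V : Cmod v <= 28 * k ^ 3 * x ^ 2 * M + 12 * k ^ 2 * x * (Cs * x) + M * ((Cs * x) * (Cs * x)) +
           e2 * (Cs * x) * (M * M) + M * Cs * x * ((2 * M + Cs) * Cs * x));
        [|assert (Ww : Cmod w <= 4 * k * (Cs * x) + 12 * k ^ 2 * x * M + (M * ((2 * M + Cs) * Cs * x) + M * Cs * x *
          (M * M)));
          [|assert (0 <= Cmod v) by apply Cmod_ge_0; set (log_barrier := Cmod v) in *; set (ww := Cmod w) in *]] end.
      - eapply Rle_trans; [apply Cmod_minus_le|]. apply Rplus_le_compat; [|exact B5].
        eapply Rle_trans; [apply Cmod_minus_le|]. apply Rplus_le_compat; [|exact B4].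
        eapply Rle_trans; [apply Cmod_minus_le|]. apply Rplus_le_compat; [|exact B3].
        eapply Rle_trans; [apply Cmod_triangle|]. apply Rplus_le_compat; [exact B1|exact B2].
      - eapply Rle_trans; [apply Cmod_minus_le|]. apply Rplus_le_compat.
        eapply Rle_trans; [apply Cmod_triangle|]. apply Rplus_le_compat; [exact B6|exact B7].
        eapply Rle_trans; [apply Cmod_triangle|]. apply Rplus_le_compat; [exact B8|exact B9].
      - assert (E2 : e2 * (Cs * x) * (M * M) <= e1 / 2 * x).
        { apply Rle_trans with (e2 * ((Cs + 1) * x) * (M * M)).
          - apply Rmult_le_compat_r; [apply Rmult_le_pos; lra|]. apply Rmult_le_compat_l; lra.
          - right. unfold e2. field. split; lra. }
        assert (Cmod z * log_barrier <= 1 * log_barrier) by (apply Rmult_le_compat_r; lra).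
        assert (x * ww <= x * (4 * k * (Cs * x) + 12 * k ^ 2 * x * M + (M * ((2 * M + Cs) * Cs * x) + M * Cs * x * (M
          * M)))).
        { apply Rmult_le_compat_l; auto. }
        assert (0 <= Cs * x ^ 2) by (apply Rmult_le_pos; [auto|apply pow2_ge_0]).
        unfold C2. lra. }
    unfold DG'. fold c. eapply Rle_trans; [apply Cmod_triangle|].
    eapply Rle_trans; [apply Rplus_le_compat_r, Cmod_minus_le|].
    assert ((4 * k + 2 * M * M) * b <= Mg * b). { apply Rmult_le_compat_r; auto. unfold Mg; lra. }
    assert (2 * M ^ 3 * a <= Mg * a). { apply Rmult_le_compat_r; auto. unfold Mg.
    assert (0 <= M * M) by (apply Rmult_le_pos; lra). lra. }
    lra. }
(* [BE] holds on all of [[0, 1]] regardless of the size of [DF] and [DG], so any threshold above the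
   final bound will do. *)
destruct (gronwall_bound DF DG DF' DG' 1 Mg (e1 * x) ((e1 * x) ^ 2 * gc + 1)) with (t := 1) as [R1 R2]; auto; try lra.
- nra.
- unfold DF. rewrite F0, F0'. ring.
- unfold DG. rewrite G0, G0'. ring.
- fold gc. lra.
- fold gc in R1, R2.
  replace (e1 * x * (gc + 1)) with (e * x) in R1, R2 by (unfold e1; field; lra).
  unfold DF, DG in R1, R2.
  replace (RtoC 1 * zeta * G 1)%C with (zeta * G 1)%C in R1 by ring.
  replace (RtoC 1 * z)%C with z in R2 by ring.
  replace (RtoC 1 * zeta * KK z (F 1) (G 1))%C with (zeta * KK z (F 1) (G 1))%C in R2 by ring.
  split; [exact R1|exact R2].
Qed.
End DevelopingRays.

(** * Holomorphic maps, the developing map and local lifts through it *)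

Definition holo (F : C -> C) (z g : C) : Prop :=
  forall e, 0 < e -> exists d, 0 < d /\ forall zeta, Cmod zeta < d ->
    Cmod (F (z + zeta) - F z - zeta * g)%C <= e * Cmod zeta.

Lemma holo_grad F z g : holo F z g ->
  grad (fun q => fst (F q)) z (fst g) (- snd g) /\ grad (fun q => snd (F q)) z (snd g) (fst g).
Proof.
intros H; split; intros e He; destruct (H e He) as [d [Hd K]]; exists d; split; auto; intros q Hq;
specialize (K (q - z)%C Hq); replace (z + (q - z))%C with q in K by ring;
(eapply Rle_trans; [|apply K]).
- eapply Rle_trans; [|apply fst_le_Cmod]. right; f_equal. simpl. ring.
- eapply Rle_trans; [|apply snd_le_Cmod]. right; f_equal. simpl. ring.
Qed.

Lemma holo_curve F g (c : R -> C) s l : holo F (c s) g -> vder c s l -> vder (fun t => F (c t)) s (g * l)%C.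
Proof.
intros H K. destruct (holo_grad _ _ _ H) as [A B].
split; eapply is_derive_eq.
- apply (grad_curve (fun q => fst (F q)) c s _ _ l A K).
- simpl; req; ring.
- apply (grad_curve (fun q => snd (F q)) c s _ _ l B K).
- simpl; req; ring.
Qed.


(** [F z] and [G z] are the end values of the solution along the ray from 0 to [z]. Neighbouring
    rays are compared only at their end points, by [ray_sol_cauchy_riemann], so no local inverse has
    to be continued around a loop. *)
Lemma developing (W : C -> Prop) (J : jet) (p0 : C) : planar_metric W J -> curve_complete W (ju J) -> W p0 ->
  exists F G : C -> C, F 0%C = p0 /\ forall z, Cmod z < 1 ->
    W (F z) /\ exp (ju J (F z)) * Cmod (G z) = 2 / (1 - Cmod z ^ 2) /\
    holo F z (G z) /\ holo G z (holo_coef J z (F z) (G z)).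
Proof.
intros HJ HC Hp.
assert (CH : forall z, {FG : (R -> C) * (R -> C) | Cmod z < 1 -> ray_sol W J p0 (g0 J p0) z 1 (fst FG) (snd FG)}).
{ intros z. apply constructive_indefinite_description.
  destruct (Rlt_dec (Cmod z) 1) as [Hz|Hz].
  - destruct (ray_exists W J p0 HJ Hp HC z Hz) as [F [G H]]. exists (F, G); auto.
  - exists (fun _ => p0, fun _ => p0). intros; contradiction. }
set (SF := fun z => fst (proj1_sig (CH z))). set (SG := fun z => snd (proj1_sig (CH z))).
assert (HS : forall z, Cmod z < 1 -> ray_sol W J p0 (g0 J p0) z 1 (SF z) (SG z)).
{ intros z Hz. unfold SF, SG. destruct (CH z); auto. }
exists (fun z => SF z 1), (fun z => SG z 1). split.
- destruct (ray_sol_uniq W J p0 (g0 J p0) HJ 0%C 1 (SF 0%C) (SG 0%C) (fun _ => p0) (fun _ => g0 J p0)) with (s := 1)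
    as [A B];
  rewrite ?Cmod_0; try lra.
  + apply HS. rewrite Cmod_0; lra.
  + split; auto. split; auto. intros s Hs. split; auto.
    split; (eapply vder_eq; [apply vder_const|]); ring.
  + symmetry. exact A.
- intros z Hz. pose proof (HS z Hz) as HSz. split; [apply HSz; lra|]. split.
  + rewrite (ray_sol_energy W J p0 (g0 J p0) HJ z 1 (SF z) (SG z)); auto; try lra.
    f_equal; ring. pose proof (Cmod_ge_0 z); nra. apply g0_energy.
  + assert (K : forall e, 0 < e -> exists d, 0 < d /\ forall zeta, Cmod zeta < d ->
      Cmod (SF (z + zeta)%C 1 - SF z 1 - zeta * SG z 1)%C <= e * Cmod zeta /\
      Cmod (SG (z + zeta)%C 1 - SG z 1 - zeta * holo_coef J z (SF z 1) (SG z 1))%C <= e * Cmod zeta).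
    { intros e He. destruct (ray_sol_cauchy_riemann W J p0 HJ z (SF z) (SG z) Hz HSz e He) as [d [Hd K]].
      exists (Rmin d (1 - Cmod z)). split; [apply Rmin_pos; lra|].
      intros zeta Hzeta. assert (Hq : Cmod zeta < d /\ Cmod zeta < 1 - Cmod z) by (split_min; auto).
      destruct Hq as [Q1 Q2].
      apply K; auto. apply HS. eapply Rle_lt_trans; [apply Cmod_triangle|]. lra. }
    split; intros e He; destruct (K e He) as [d [Hd Kd]]; exists d; split; auto; intros zeta Hz'; apply Kd; auto.
Qed.

Lemma holo_cont F z g : holo F z g -> forall e, 0 < e -> exists d, 0 < d /\ forall q,
  Cmod (q - z) < d -> Cmod (F q - F z) < e.
Proof.
intros H e He. destruct (holo_grad _ _ _ H) as [A B].
destruct (grad_cont _ _ _ _ A (e/2)) as [d1 [Hd1 K1]]; [lra|].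
destruct (grad_cont _ _ _ _ B (e/2)) as [d2 [Hd2 K2]]; [lra|].
exists (Rmin d1 d2). split; [now apply Rmin_pos|]. intros q Hq.
assert (Q : Cmod (q - z) < d1 /\ Cmod (q - z) < d2) by (split_min; auto). destruct Q as [Q1 Q2].
eapply Rle_lt_trans; [apply Cmod_le_sum|]. rewrite fst_minus, snd_minus.
specialize (K1 q Q1). specialize (K2 q Q2). lra.
Qed.

Lemma Cmod_neq0 (z : C) : 0 < Cmod z -> z <> 0%C.
Proof. intros H E. rewrite E, Cmod_0 in H. lra. Qed.

(** Solving [Z' = e / G Z] replaces the inverse function theorem for [F]. *)
Lemma segment_lift (F G K : C -> C) z0 (e : C) : Cmod z0 < 1 -> Cmod e = 1 ->
  (forall z, Cmod z < 1 -> 0 < Cmod (G z) /\ holo F z (G z) /\ holo G z (K z)) ->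
  (exists r M, 0 < r /\ forall z, Cmod (z - z0) < r -> Cmod (K z) <= M) ->
  exists Z d, 0 < d /\ Z 0 = z0 /\ forall s, Rabs s < d ->
    Cmod (Z s) < 1 /\ vder Z s (e / G (Z s))%C /\ F (Z s) = (F z0 + e * RtoC s)%C.
Proof.
intros Hz0 He HF [rk [M [Hrk HKb]]].
destruct (HF z0 Hz0) as [Gz0 [_ CG0]].
destruct (holo_cont _ _ _ CG0 (Cmod (G z0) / 2)) as [rg [Hrg HG]]; [lra|].
set (m := Cmod (G z0) / 2). assert (Hm : 0 < m) by (unfold m; lra).
set (r := Rmin rk (Rmin rg (1 - Cmod z0))).
assert (Hr : 0 < r) by (unfold r; repeat apply Rmin_pos; lra).
assert (Rk : forall w, Cmod (w - z0) < r -> Cmod w < 1 /\ Cmod (K w) <= M /\ m <= Cmod (G w)).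
{ intros w Hw. assert (Q : Cmod (w - z0) < rk /\ Cmod (w - z0) < rg /\ Cmod (w - z0) < 1 - Cmod z0).
  { unfold r in Hw. split_min; auto. }
  destruct Q as [Q1 [Q2 Q3]]. split; [|split].
  - eapply Rle_lt_trans; [apply (Cmod_le_add _ z0)|]. lra.
  - now apply HKb.
  - specialize (HG w Q2). pose proof (Cmod_le_add (G z0) (G w)). rewrite Cmod_minus_sym in H. unfold m. lra. }
assert (HM : 0 <= M). { destruct (Rk z0) as [_ [A _]]. replace (z0 - z0)%C with (RtoC 0) by ring. now rewrite Cmod_0.
  pose proof (Cmod_ge_0 (K z0)); lra. }
assert (GL : forall A B, Cmod (A - z0) < r -> Cmod (B - z0) < r -> Cmod (G A - G B) <= 2 * M * Cmod (A - B)).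
{ intros A B HA HB.
  pose proof (vder_MVT (fun s => G (B + (A - B) * RtoC s)%C) (fun s => K (B + (A - B) * RtoC s) * (A - B))%C (M * Cmod
    (A - B)) 0 1) as Q.
  cbv beta in Q. replace (B + (A - B) * RtoC 1)%C with A in Q by ring.
  replace (B + (A - B) * RtoC 0)%C with B in Q by ring.
  rewrite Rminus_0_r, Rabs_R1, Rmult_1_r in Q. rewrite Rmult_assoc. apply Q.
  intros s Hs. rewrite Rmin_left, Rmax_right in Hs by lra.
  destruct (Rk _ (ball_convex z0 A B r s HA HB Hs)) as [R1 [R2 R3]]. split.
  - apply holo_curve; [apply HF; auto|apply vder_line].
  - rewrite Cmod_mult. apply Rmult_le_compat_r; auto. apply Cmod_ge_0. }
set (r1 := r / 4). assert (Hr1 : 0 < r1) by (unfold r1; lra).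
set (cP := fun x => (z0 + cbox r1 (x - z0))%C).
assert (cP_in : forall x, Cmod (cP x - z0) < r).
{ intros x. unfold cP. replace (z0 + cbox r1 (x - z0) - z0)%C with (cbox r1 (x - z0)) by ring.
  eapply Rle_lt_trans; [apply cbox_bd; lra|]. unfold r1; lra. }
assert (cP_lip : forall x y, Cmod (cP x - cP y) <= 2 * Cmod (x - y)).
{ intros x y. unfold cP. replace (z0 + cbox r1 (x - z0) - (z0 + cbox r1 (y - z0)))%C with (cbox r1 (x - z0) - cbox r1
    (y - z0))%C by ring.
  eapply Rle_trans; [apply cbox_lip|]. replace (x - z0 - (y - z0))%C with (x - y)%C by ring. lra. }
set (f := fun (t : R) (x y : C) => (e / G (cP x))%C).
(* [picard] solves for pairs; a constant second unknown completes this single equation. *)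
set (g := fun (t : R) (x y : C) => RtoC 0).
assert (Gn : forall x, m <= Cmod (G (cP x)) /\ G (cP x) <> 0%C).
{ intros x. destruct (Rk (cP x) (cP_in x)) as [_ [_ Q]]. split; auto. apply Cmod_neq0. lra. }
set (L := 4 * M / m ^ 2 + 1).
assert (Hm2 : 0 < m ^ 2) by (apply pow_lt; auto).
assert (HL : 0 < L). { unfold L. assert (0 <= 4 * M / m ^ 2). { apply Rmult_le_pos; [lra|].
left; apply Rinv_0_lt_compat; auto. } lra. }
assert (Lf : field_lip f L).
{ intros t x y x' y'. unfold f. destruct (Gn x) as [N1 N2]. destruct (Gn x') as [N3 N4].
  replace (e / G (cP x) - e / G (cP x'))%C with (e * (G (cP x') - G (cP x)) / (G (cP x) * G (cP x')))%C by (field;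
    auto).
  rewrite Cmod_div, !Cmod_mult, He.
  2: { now apply Cmult_neq_0. }
  pose proof (GL (cP x') (cP x) (cP_in x') (cP_in x)) as Q1. pose proof (cP_lip x' x) as Q2.
  rewrite (Cmod_minus_sym x' x) in Q2. pose proof (Cmod_ge_0 (x - x')) as Q3. pose proof (Cmod_ge_0 (y - y')) as Q4.
  assert (I1 : / (Cmod (G (cP x)) * Cmod (G (cP x'))) <= / m ^ 2).
  { apply Rinv_le_contravar; auto. replace (m ^ 2) with (m * m) by ring. apply Rmult_le_compat; lra. }
  assert (I0 : 0 <= / (Cmod (G (cP x)) * Cmod (G (cP x')))).
  { left; apply Rinv_0_lt_compat, Rmult_lt_0_compat; lra. }
  unfold Rdiv. rewrite Rmult_1_l.
  apply Rle_trans with (4 * M * Cmod (x - x') * / m ^ 2).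
  - apply Rmult_le_compat; auto. apply Cmod_ge_0. eapply Rle_trans; [apply Q1|].
    replace (4 * M * Cmod (x - x')) with (2 * M * (2 * Cmod (x - x'))) by ring.
    apply Rmult_le_compat_l; lra.
  - unfold L. replace (4 * M * Cmod (x - x') * / m ^ 2) with (4 * M / m ^ 2 * Cmod (x - x')) by (unfold Rdiv; ring).
    assert (0 <= 4 * M / m ^ 2). { apply Rmult_le_pos; [lra|]. left; apply Rinv_0_lt_compat; auto. }
    apply Rle_trans with (4 * M / m ^ 2 * (Cmod (x - x') + Cmod (y - y'))); [apply Rmult_le_compat_l; lra|].
    apply Rmult_le_compat_r; lra. }
assert (Lg : field_lip g L).
{ intros t x y x' y'. unfold g. replace (0 - 0)%C with (RtoC 0) by ring. rewrite Cmod_0.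
  pose proof (Cmod_ge_0 (x - x')). pose proof (Cmod_ge_0 (y - y')). apply Rmult_le_pos; lra. }
assert (Bf : field_bd f (1 / m)).
{ intros t x y. unfold f. destruct (Gn x) as [N1 N2]. rewrite Cmod_div, He by auto.
  unfold Rdiv. rewrite !Rmult_1_l. apply Rinv_le_contravar; auto. }
assert (Hm1 : 0 < 1 / m) by (apply Rdiv_lt_0_compat; lra).
assert (Bg : field_bd g (1 / m)).
{ intros t x y. unfold g. rewrite Cmod_0. lra. }
assert (Cf : field_cont f).
{ intros x y t. apply (vcont_vder _ _ 0). unfold f. exact (vder_const (e / G (cP x))%C t). }
assert (Cg : field_cont g).
{ intros x y t. apply (vcont_vder _ _ 0). unfold g. exact (vder_const 0%C t). }
destruct (picard f g L (1 / m) 0 z0 0%C HL Lf Lg Bf Bg Cf Cg) as [Z [Y [EZ [_ HZ]]]].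
set (d := Rmin (/ (16 * L)) (r1 * m / 4)).
assert (Hd : 0 < d). { unfold d. apply Rmin_pos. apply Rinv_0_lt_compat; lra.
assert (0 < r1 * m) by (apply Rmult_lt_0_compat; auto). lra. }
assert (HdZ : forall s, Rabs s < d -> Cmod (Z s - z0) < r1).
{ intros s Hs. assert (Q : Rabs s < / (16 * L) /\ Rabs s < r1 * m / 4) by (unfold d in Hs; split_min; auto).
  destruct Q as [Q1 Q2].
  pose proof (vder_MVT Z (fun s => f s (Z s) (Y s)) (1 / m) 0 s) as Q. rewrite EZ, Rminus_0_r in Q.
  eapply Rle_lt_trans; [apply Q|].
  - intros t Ht. split; [|apply Bf]. apply HZ. eapply Rle_lt_trans; [|apply Q1].
    eapply between_abs; [eassumption|]. rewrite Rminus_0_r. lra.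
  - apply Rmult_lt_compat_l with (r := 2 * (1 / m)) in Q2; [|lra].
    replace (2 * (1 / m) * (r1 * m / 4)) with (r1 / 2) in Q2 by (field; lra). lra. }
assert (DZ : forall s, Rabs s < d -> Cmod (Z s) < 1 /\ vder Z s (e / G (Z s))%C).
{ intros s Hs. pose proof (HdZ s Hs) as Q. split.
  - apply Rk. unfold r1 in Q. lra.
  - assert (E : cP (Z s) = Z s). { unfold cP. rewrite cbox_id by lra. ring. }
    rewrite <- E. apply HZ. rewrite Rminus_0_r. unfold d in Hs. split_min; auto. }
exists Z, d. split; auto. split; auto. intros s Hs. destruct (DZ s Hs) as [A B]. split; auto. split; auto.
(* The derivative is [G * (e / G) - e = 0], and [vder_MVT] with bound 0 makes the difference
   constant. *)
pose proof (vder_MVT (fun t => F (Z t) - e * RtoC t)%C (fun _ => 0%C) 0 0 s) as Q. cbv beta in Q.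
rewrite EZ in Q.
assert (E : Cmod (F (Z s) - e * RtoC s - (F z0 - e * RtoC 0)) <= 0).
{ eapply Rle_trans; [apply Q|]. 2: { right; ring. }
  intros t Ht. split; [|rewrite Cmod_0; lra].
  assert (Ht' : Rabs t < d).
  { pose proof (between_abs 0 s t (Rabs s) Ht) as Q'. rewrite !Rminus_0_r in Q'. specialize (Q' (Rle_refl _)). lra. }
  destruct (DZ t Ht') as [A' B']. destruct (HF _ A') as [G1 [F1 _]].
  eapply vder_eq. apply vder_minus. apply holo_curve; eassumption. apply vder_mult; [apply vder_const|apply vder_id].
  cbv beta. field. now apply Cmod_neq0. }
assert (E0 : (F (Z s) - e * RtoC s - (F z0 - e * RtoC 0))%C = 0%C).
{ apply Cmod_eq_0. apply Rle_antisym; auto. apply Cmod_ge_0. }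
replace (F (Z s)) with ((F (Z s) - e * RtoC s - (F z0 - e * RtoC 0)) + F z0 + e * RtoC s)%C by ring.
rewrite E0. ring.
Qed.

(** A local bound for the derivative of [G], which makes the right-hand side [e / G] in
    [segment_lift] Lipschitz. *)
Lemma holo_coef_bounded W J (F G : C -> C) z0 : planar_metric W J -> Cmod z0 < 1 ->
  (forall z, Cmod z < 1 -> W (F z) /\ holo F z (G z) /\ holo G z (holo_coef J z (F z) (G z))) ->
  exists r M, 0 < r /\ forall z, Cmod (z - z0) < r -> Cmod (holo_coef J z (F z) (G z)) <= M.
Proof.
intros HJ Hz0 HF. destruct (HF z0 Hz0) as [W0 [CF CG]].
destruct (dlog_lipschitz W J HJ (F z0) W0) as [r1 [L [Hr1 [HL PL]]]].
destruct (holo_cont _ _ _ CF r1 Hr1) as [d1 [Hd1 K1]].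
destruct (holo_cont _ _ _ CG 1 Rlt_0_1) as [d2 [Hd2 K2]].
pose proof (Cmod_ge_0 z0) as Z0.
set (d := 1 - Cmod z0 ^ 2). assert (Hd : 0 < d) by (unfold d; nra).
set (B := Cmod (G z0) + 1). pose proof (Cmod_ge_0 (G z0)) as GG.
exists (Rmin d1 (Rmin d2 (d / 6))), (4 / d * B + L * (B * B)).
split; [repeat apply Rmin_pos; lra|]. intros z Hz.
assert (Q : Cmod (z - z0) < d1 /\ Cmod (z - z0) < d2 /\ Cmod (z - z0) < d / 6) by (split_min; auto).
destruct Q as [Q1 [Q2 Q3]].
destruct (dlog_disc_lip z0 (z - z0) d Hd (Rle_refl _) ltac:(lra)) as [_ [_ [Kz _]]].
replace (z0 + (z - z0))%C with z in Kz by ring.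
specialize (K1 z Q1). specialize (K2 z Q2).
destruct (PL (F z) (F z) K1 K1) as [_ [P1 _]].
assert (GB : Cmod (G z) <= B). { eapply Rle_trans; [apply (Cmod_le_add _ (G z0))|]. unfold B. lra. }
unfold holo_coef. eapply Rle_trans; [apply Cmod_minus_le|]. rewrite !Cmod_mult.
pose proof (Cmod_ge_0 (G z)). pose proof (Cmod_ge_0 (dlog_disc z)). pose proof (Cmod_ge_0 (dlog J (F z))).
apply Rplus_le_compat; apply Rmult_le_compat; auto. apply Rmult_le_pos; auto. apply Rmult_le_compat; auto.
Qed.

(** * Sequential compactness and existence of maxima *)

(** The indices satisfy [n <= phi n] in place of monotonicity: this is enough to preserve limits, is
    stable under composition, and can be read off a cluster point one index at a time. *)
Lemma subseq_R (x : nat -> R) B : (forall n, Rabs (x n) <= B) ->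
  exists (phi : nat -> nat) l, (forall n, (n <= phi n)%nat) /\ Un_cv (fun n => x (phi n)) l.
Proof.
intros H.
destruct (Bolzano_Weierstrass x (fun c => - B <= c <= B)) as [l Hl].
- apply compact_P3.
- intros n. apply Rabs_le_between, H.
- assert (CH : forall n, {p : nat | (n <= p)%nat /\ Rabs (x p - l) < / (INR n + 1)}).
  { intros n. apply constructive_indefinite_description.
    assert (Hp : 0 < / (INR n + 1)) by (apply Rinv_0_lt_compat; pose proof (pos_INR n); lra).
    destruct (Hl (disc l (mkposreal _ Hp)) n) as [p [Hp1 Hp2]].
    - exists (mkposreal _ Hp). intros y Hy; exact Hy.
    - exists p. split; auto. }
  exists (fun n => proj1_sig (CH n)), l. split.
  + intros n. destruct (CH n); simpl; tauto.
  + intros e He. destruct (archimed_cor1 e He) as [N [HN HN0]].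
    exists N. intros n Hn. destruct (CH n) as [p [P1 P2]]; simpl. unfold Rdist.
    eapply Rlt_trans; [apply P2|]. eapply Rle_lt_trans; [|apply HN].
    apply Rinv_le_contravar. apply lt_0_INR; lia. apply le_INR in Hn. lra.
Qed.

Definition seq_cv (x : nat -> C) (l : C) : Prop :=
  forall e, 0 < e -> exists N, forall n, (N <= n)%nat -> Cmod (x n - l) < e.

Lemma Un_cv_sub x l (phi : nat -> nat) : (forall n, (n <= phi n)%nat) -> Un_cv x l -> Un_cv (fun n => x (phi n)) l.
Proof.
intros H K e He. destruct (K e He) as [N HN]. exists N. intros n Hn. apply HN. specialize (H n). lia.
Qed.

Lemma seq_cv_of_comp (x : nat -> C) a b : Un_cv (fun n => fst (x n)) a -> Un_cv (fun n => snd (x n)) b -> seq_cv x (a,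
  b).
Proof.
intros H K e He. destruct (H (e/2)) as [N1 H1]; [lra|]. destruct (K (e/2)) as [N2 H2]; [lra|].
exists (N1 + N2)%nat. intros n Hn. eapply Rle_lt_trans; [apply Cmod_le_sum|].
rewrite fst_minus, snd_minus. cbn [fst snd]. unfold Rdist in *.
specialize (H1 n ltac:(lia)). specialize (H2 n ltac:(lia)). lra.
Qed.

Lemma subseq_C (x : nat -> C) B : (forall n, Cmod (x n) <= B) ->
  exists (phi : nat -> nat) l, (forall n, (n <= phi n)%nat) /\ seq_cv (fun n => x (phi n)) l.
Proof.
intros H.
destruct (subseq_R (fun n => fst (x n)) B) as [phi [a [P1 P2]]].
{ intros; eapply Rle_trans; [apply fst_le_Cmod|auto]. }
destruct (subseq_R (fun n => snd (x (phi n))) B) as [psi [b [Q1 Q2]]].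
{ intros; eapply Rle_trans; [apply snd_le_Cmod|auto]. }
exists (fun n => phi (psi n)), (a, b). split.
- intros n. specialize (P1 (psi n)). specialize (Q1 n). lia.
- apply seq_cv_of_comp; auto. apply (Un_cv_sub (fun n => fst (x (phi n)))); auto.
Qed.

Lemma seq_cv_sub x l (phi : nat -> nat) : (forall n, (n <= phi n)%nat) -> seq_cv x l -> seq_cv (fun n => x (phi n)) l.
Proof.
intros H K e He. destruct (K e He) as [N HN]. exists N. intros n Hn. apply HN. specialize (H n). lia.
Qed.

(** Closedness of [S] and continuity of [Phi] are asked for together and along sequences in [S]
    only, because outside [S] the function used later is not known to be continuous. Unboundedness
    is excluded by the same extraction of a convergent subsequence. *)
Lemma compact_max (S : C -> C -> Prop) (Phi : C -> C -> R) B :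
  (forall a b, S a b -> Cmod a <= B /\ Cmod b <= B) -> (exists a b, S a b) ->
  (forall x y a b, (forall n, S (x n) (y n)) -> seq_cv x a -> seq_cv y b ->
     S a b /\ Un_cv (fun n => Phi (x n) (y n)) (Phi a b)) ->
  exists a b, S a b /\ forall a' b', S a' b' -> Phi a' b' <= Phi a b.
Proof.
intros HB [a0 [b0 H0]] HC.
assert (EX : forall x y, (forall n, S (x n) (y n)) -> exists phi a b, (forall n, (n <= phi n)%nat) /\
   S a b /\ Un_cv (fun n => Phi (x (phi n)) (y (phi n))) (Phi a b)).
{ intros x y H. destruct (subseq_C x B) as [phi [a [P1 P2]]]. { intros n; destruct (HB _ _ (H n)); auto. }
  destruct (subseq_C (fun n => y (phi n)) B) as [psi [b [Q1 Q2]]]. { intros n; destruct (HB _ _ (H (phi n))); auto. }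
  exists (fun n => phi (psi n)), a, b. split. { intros n. specialize (P1 (psi n)). specialize (Q1 n). lia. }
  apply HC; auto. apply (seq_cv_sub (fun n => x (phi n))); auto. }
destruct (classic (exists m, forall a b, S a b -> Phi a b <= m)) as [[m Hm]|Hn].
- destruct (completeness (fun v => exists a b, S a b /\ v = Phi a b)) as [M [Hub Hl]].
  { exists m. intros v [a [b [Hab ->]]]. auto. } { exists (Phi a0 b0), a0, b0. auto. }
  assert (CH : forall n, {ab : C * C | S (fst ab) (snd ab) /\ M - / (INR n + 1) < Phi (fst ab) (snd ab)}).
  { intros n. apply constructive_indefinite_description. apply NNPP. intros Hn.
    assert (Hp : 0 < / (INR n + 1)) by (apply Rinv_0_lt_compat; pose proof (pos_INR n); lra).
    assert (M <= M - / (INR n + 1)); [|lra]. apply Hl. intros v [a [b [Hab ->]]].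
    destruct (Rle_dec (Phi a b) (M - / (INR n + 1))); auto. exfalso. apply Hn. exists (a, b). simpl. split; auto. lra. }
  destruct (EX (fun n => fst (proj1_sig (CH n))) (fun n => snd (proj1_sig (CH n)))) as [phi [a [b [P1 [P2 P3]]]]].
  { intros n. destruct (CH n); simpl; tauto. }
  exists a, b. split; auto. intros a' b' Hab. apply Rle_trans with M. { apply Hub. exists a', b'; auto. }
  apply le_epsilon. intros e He.
  destruct (P3 (e/2)) as [N1 K1]; [lra|]. destruct (archimed_cor1 (e/2)) as [N2 [K2 K2']]; [lra|].
  set (n := (N1 + N2)%nat). specialize (K1 n ltac:(unfold n; lia)). unfold Rdist in K1. apply Rabs_def2 in K1.
  destruct (CH (phi n)) as [[u v] [Q1 Q2]]; simpl in *.
  assert (/ (INR (phi n) + 1) <= / INR N2).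
  { apply Rinv_le_contravar. apply lt_0_INR; auto.
    assert (INR N2 <= INR (phi n)). { apply le_INR. specialize (P1 n). unfold n in *. lia. } lra. }
  lra.
- exfalso.
  assert (CH : forall n, {ab : C * C | S (fst ab) (snd ab) /\ INR n < Phi (fst ab) (snd ab)}).
  { intros n. apply constructive_indefinite_description. apply NNPP. intros Hn'. apply Hn.
    exists (INR n). intros a b Hab. destruct (Rle_dec (Phi a b) (INR n)); auto. exfalso. apply Hn'. exists (a, b).
    simpl; split; auto. lra. }
  destruct (EX (fun n => fst (proj1_sig (CH n))) (fun n => snd (proj1_sig (CH n)))) as [phi [a [b [P1 [P2 P3]]]]].
  { intros n. destruct (CH n); simpl; tauto. }
  destruct (P3 1) as [N K]; [lra|].
  destruct (INR_unbounded (Phi a b + 1)) as [N' HN'].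
  set (n := (N + N')%nat). specialize (K n ltac:(unfold n; lia)). unfold Rdist in K. apply Rabs_def2 in K.
  destruct (CH (phi n)) as [[u v] [Q1 Q2]]; simpl in *.
  assert (INR N' <= INR (phi n)). { apply le_INR. specialize (P1 n). unfold n in *; lia. } lra.
Qed.

(** * Second derivatives along segments and their lifts *)

(** At the maximum [w' 0 = 0]; a positive [w2] would make [w'] positive just to the right of 0, and
    [w] would increase there. *)
Lemma second_derivative_test (w w' : R -> R) (w2 d : R) : 0 < d -> (forall s, Rabs s < d -> is_derive w s (w' s)) ->
  is_derive w' 0 w2 -> (forall s, Rabs s < d -> w s <= w 0) -> w2 <= 0.
Proof.
intros Hd Hw Hw2 Hmax.
assert (W0 : w' 0 = 0).
{ assert (D : derivable_pt_lim w 0 (w' 0)). { apply is_derive_Reals, Hw. rewrite Rabs_R0; auto. }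
  pose (pr := exist (fun l => derivable_pt_abs w 0 l) (w' 0) D : derivable_pt w 0).
  pose proof (deriv_maximum w (-d) d 0 pr ltac:(lra) ltac:(lra)) as Q.
  assert (E : derive_pt w 0 pr = w' 0) by reflexivity. rewrite <- E. apply Q.
  intros x H1 H2. apply Hmax. apply Rabs_def1; lra. }
destruct (Rle_dec w2 0) as [|Hn]; auto. exfalso.
rewrite is_derive_eps in Hw2. destruct (Hw2 (w2 / 2)) as [d1 [Hd1 K]]; [lra|].
set (s := Rmin d d1 / 2). assert (Hm : 0 < Rmin d d1) by (apply Rmin_pos; auto).
assert (Hs : 0 < s /\ s < d /\ s < d1). { unfold s. pose proof (Rmin_l d d1). pose proof (Rmin_r d d1). lra. }
destruct (is_derive_MVT w w' 0 s) as [c [Hc E]]; [lra| |].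
{ intros t Ht. apply Hw. apply Rabs_def1; lra. }
specialize (K c ltac:(apply Rabs_def1; lra)). rewrite Rplus_0_l, W0, Rminus_0_r, (Rabs_pos_eq c) in K by lra.
apply Rabs_le_between in K.
assert (0 < w' c) by nra. specialize (Hmax s ltac:(apply Rabs_def1; lra)). nra.
Qed.

(** [ln] of the ratio of the Poincaré densities of the discs of radius [a] and [1], up to [ln a] *)
Definition log_barrier (a r : R) := ln (1 - r) - ln (a ^ 2 - r).

Lemma log_barrier_second (a : R) (Z xi : R -> C) d eta : 0 < d -> 0 < a < 1 ->
  (forall s, Rabs s < d -> Cmod (Z s) < a /\ vder Z s (xi s)) -> vder xi 0 eta ->
  exists v', (forall s, Rabs s < d -> is_derive (fun t => log_barrier a (Cmod (Z t) ^ 2)) s (v' s)) /\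
   let r := Cmod (Z 0) ^ 2 in
   is_derive v' 0 ((/ (a ^ 2 - r) ^ 2 - / (1 - r) ^ 2) * (2 * (fst (Z 0) * fst (xi 0) + snd (Z 0) * snd (xi 0))) ^ 2
      + (/ (a ^ 2 - r) - / (1 - r)) * (2 * (Cmod (xi 0) ^ 2 + fst (Z 0) * fst eta + snd (Z 0) * snd eta))).
Proof.
intros Hd HR HZ Hxi.
assert (HB : forall s, Rabs s < d -> 0 < 1 - Cmod (Z s) ^ 2 /\ 0 < a ^ 2 - Cmod (Z s) ^ 2).
{ intros s Hs. destruct (HZ s Hs) as [A _]. pose proof (Cmod_ge_0 (Z s)). nra. }
set (r' := fun s => 2 * (fst (Z s) * fst (xi s) + snd (Z s) * snd (xi s))).
assert (Dr : forall s, Rabs s < d -> is_derive (fun t => Cmod (Z t) ^ 2) s (r' s)).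
{ intros s Hs. apply is_derive_Cmod2. now apply HZ. }
exists (fun s => (/ (a ^ 2 - Cmod (Z s) ^ 2) - / (1 - Cmod (Z s) ^ 2)) * r' s).
split.
- intros s Hs. destruct (HB s Hs). eapply is_derive_eq.
  apply (is_derive_comp_R (log_barrier a) (fun t => Cmod (Z t) ^ 2) s (r' s) (/ (a ^ 2 - Cmod (Z s) ^ 2) - / (1 - Cmod
    (Z s) ^ 2))).
  now apply Dr. 2: reflexivity.
  unfold log_barrier. auto_derive; simpl in *; [repeat split; lra|field; lra].
- intros r. assert (H0 : Rabs 0 < d) by (rewrite Rabs_R0; auto).
  destruct (HB 0 H0) as [B1 B2]. fold r in B1, B2. destruct (HZ 0 H0) as [_ [Z1 Z2]]. destruct Hxi as [X1 X2].
  eapply is_derive_eq. apply is_derive_mult_R.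
  + apply (is_derive_comp_R (fun x => / (a ^ 2 - x) - / (1 - x)) (fun t => Cmod (Z t) ^ 2) 0 (r' 0) (/ (a ^ 2 - r) ^ 2
      - / (1 - r) ^ 2)).
    now apply Dr. fold r. auto_derive; simpl in *; [repeat split; lra|field; lra].
  + unfold r'. apply is_derive_scal_R. apply is_derive_plus_R; apply is_derive_mult_R; eassumption.
  + cbv beta. fold r. rewrite (Cmod_sqr (xi 0)). unfold r'. req. ring.
Qed.

Lemma pm_sub W W' J : planar_metric W J -> plane_open W' -> (forall p, W' p -> W p) -> planar_metric W' J.
Proof. intros [A B D E F G H I] O K. constructor; auto. Qed.

Lemma plane_open_inter W1 W2 : plane_open W1 -> plane_open W2 -> plane_open (fun p => W1 p /\ W2 p).
Proof.
intros H1 H2 p [P1 P2]. destruct (H1 p P1) as [r1 [R1 K1]]. destruct (H2 p P2) as [r2 [R2 K2]].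
exists (Rmin r1 r2). split; [now apply Rmin_pos|]. intros q Hq. split_min. split; auto.
Qed.

Lemma seq_cv_fcont f x l : fcont f l -> seq_cv x l -> Un_cv (fun n => f (x n)) (f l).
Proof.
intros H K e He. destruct (H e He) as [d [Hd H']]. destruct (K d Hd) as [N HN].
exists N. intros n Hn. unfold Rdist. apply H', HN. lia.
Qed.

Lemma is_derive_continuity_pt f x l : is_derive f x l -> continuity_pt f x.
Proof.
intros H. apply derivable_continuous_pt. exists l. now apply is_derive_Reals.
Qed.

Lemma fcont_Cmod2 p : fcont (fun z => Cmod z ^ 2) p.
Proof.
apply fcont_ext_loc with (f := fun z : C => fst z * fst z + snd z * snd z) (r := 1); [lra| |].
- intros; symmetry; apply Cmod_sqr.
- apply fcont_plus; apply fcont_mult; eapply grad_cont; (apply grad_fst || apply grad_snd).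
Qed.

Lemma holo_seq_cv F x z g : holo F z g -> seq_cv x z -> seq_cv (fun n => F (x n)) (F z).
Proof.
intros H K e He. destruct (holo_cont _ _ _ H e He) as [d [Hd H']]. destruct (K d Hd) as [N HN].
exists N. intros n Hn. apply H', HN, Hn.
Qed.

Lemma seq_cv_unique x a b : seq_cv x a -> seq_cv x b -> a = b.
Proof.
intros H K. assert (Z : (a - b = 0)%C).
{ apply Cmod_eq_0. apply Rle_antisym; [|apply Cmod_ge_0]. apply le_epsilon. intros e He.
  destruct (H (e/2)) as [N1 H1]; [lra|]. destruct (K (e/2)) as [N2 H2]; [lra|].
  specialize (H1 (N1 + N2)%nat ltac:(lia)). specialize (H2 (N1 + N2)%nat ltac:(lia)).
  pose proof (Cmod_triangle_sub a (x (N1 + N2)%nat) b). rewrite (Cmod_minus_sym a (x _)) in H0. lra. }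
replace a with ((a - b) + b)%C by ring. rewrite Z. ring.
Qed.

Lemma Cmod_closed x z a : seq_cv x z -> (forall n, Cmod (x n) <= a) -> Cmod z <= a.
Proof.
intros H K. apply le_epsilon. intros e He. destruct (H e He) as [N HN]. specialize (HN N (le_n _)).
specialize (K N). pose proof (Cmod_le_add z (x N)). rewrite Cmod_minus_sym in H0. lra.
Qed.

(** What [developing] provides apart from the base point: a holomorphic local isometry with its
    first two derivatives. Surjectivity is not part of it. *)
Definition disc_covering (W : C -> Prop) (J : jet) (F G : C -> C) := forall z, Cmod z < 1 ->
    W (F z) /\ exp (ju J (F z)) * Cmod (G z) = 2 / (1 - Cmod z ^ 2) /\
    holo F z (G z) /\ holo G z (holo_coef J z (F z) (G z)).

Lemma disc_covering_neq0 W J F G z : disc_covering W J F G -> Cmod z < 1 -> 0 < Cmod (G z).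
Proof.
intros H Hz. destruct (H z Hz) as [_ [E _]]. pose proof (Cmod_ge_0 z).
assert (0 < 2 / (1 - Cmod z ^ 2)) by (apply Rdiv_lt_0_compat; nra).
pose proof (exp_pos (ju J (F z))). pose proof (Cmod_ge_0 (G z)).
destruct (Req_dec (Cmod (G z)) 0) as [E0|]; [rewrite E0 in E|]; lra.
Qed.

(** Value at 0 of the second derivative of [log_barrier a (Cmod (Z s) ^ 2)] when [Z 0 = m], [Z' 0 = xi],
  [Z'' 0 = eta]. *)
Definition barrier_second (a : R) (m xi eta : C) : R :=
  let r := Cmod m ^ 2 in
  (/ (a ^ 2 - r) ^ 2 - / (1 - r) ^ 2) * (2 * (fst m * fst xi + snd m * snd xi)) ^ 2
      + (/ (a ^ 2 - r) - / (1 - r)) * (2 * (Cmod xi ^ 2 + fst m * fst eta + snd m * snd eta)).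

(** The Laplacian of the barrier in disguise. The directions 1 and [Ci] have lifted velocities [A]
    and [Ci * A] and opposite accelerations, which cancel; the result is [|A|^2] times the
    difference of the squared densities [2 a / (a^2 - r)] and [2 / (1 - r)] of the two discs. *)
Lemma barrier_second_sum a m A B : 0 < a ^ 2 - Cmod m ^ 2 -> 0 < 1 - Cmod m ^ 2 ->
  barrier_second a m A B + barrier_second a m (Ci * A) (- B) =
  Cmod A ^ 2 * (4 * a ^ 2 / (a ^ 2 - Cmod m ^ 2) ^ 2 - 4 / (1 - Cmod m ^ 2) ^ 2).
Proof.
intros H1 H2. unfold barrier_second. rewrite Cmod_mult, Cmod_Ci, Rmult_1_l.
pose proof (Cmod_sqr m) as Em. pose proof (Cmod_sqr A) as EA. set (r := Cmod m ^ 2) in *. set (t := Cmod A ^ 2) in *.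
replace (fst (Ci * A)%C) with (- snd A) by (simpl; ring). replace (snd (Ci * A)%C) with (fst A) by (simpl; ring).
replace (fst (- B)%C) with (- fst B) by reflexivity. replace (snd (- B)%C) with (- snd B) by reflexivity.
assert (E : (fst m * fst A + snd m * snd A) ^ 2 + (fst m * - snd A + snd m * fst A) ^ 2 = r * t).
{ rewrite Em, EA. ring. }
transitivity ((/ (a ^ 2 - r) ^ 2 - / (1 - r) ^ 2) * (4 * ((fst m * fst A + snd m * snd A) ^ 2 + (fst m * - snd A + snd
  m * fst A) ^ 2))
 + (/ (a ^ 2 - r) - / (1 - r)) * (4 * t)); [ring|].
rewrite E. field. lra.
Qed.

(** The lift has velocity [e / G]; differentiating once more, with the derivative of [G] known,
    gives the acceleration [- e^2 G' / G^3] that enters [barrier_second]. *)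
Lemma segment_lift_full W J F G z0 (e : C) a : planar_metric W J -> disc_covering W J F G -> 0 < a < 1 ->
  Cmod z0 < a -> Cmod e = 1 ->
  exists Z d v', 0 < d /\ Z 0 = z0 /\ (forall s, Rabs s < d -> Cmod (Z s) < a /\ F (Z s) = (F z0 + e * RtoC s)%C) /\
    (forall s, Rabs s < d -> is_derive (fun t => log_barrier a (Cmod (Z t) ^ 2)) s (v' s)) /\
    is_derive v' 0 (barrier_second a z0 (e / G z0) (- (e * e) * holo_coef J z0 (F z0) (G z0) / (G z0 * G z0 * G z0))).
Proof.
intros HJ HL Ha Hz0 He.
assert (HL' : forall z, Cmod z < 1 -> W (F z) /\ holo F z (G z) /\ holo G z (holo_coef J z (F z) (G z))).
{ intros z Hz. destruct (HL z Hz) as [A [_ B]]. auto. }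
destruct (segment_lift F G (fun z => holo_coef J z (F z) (G z)) z0 e) as [Z [d [Hd [Z0 HZ]]]]; auto; try lra.
{ intros z Hz. split; [eapply disc_covering_neq0; eauto|]. apply HL; auto. }
{ apply (holo_coef_bounded W J F G z0); auto. lra. }
assert (D0 : vder Z 0 (e / G (Z 0))%C) by (apply HZ; rewrite Rabs_R0; auto).
destruct (vder_cont _ _ _ D0 (a - Cmod z0)) as [d1 [Hd1 K1]]; [lra|]. rewrite Z0 in K1.
assert (Hz01 : Cmod z0 < 1) by lra.
destruct (log_barrier_second a Z (fun s => e / G (Z s))%C (Rmin d d1) (- (e * e) * holo_coef J z0 (F z0) (G z0) / (G
  z0 * G z0 * G z0))%C) as [v' [V1 V2]].
{ now apply Rmin_pos. } { auto. }
{ intros s Hs. assert (Q : Rabs s < d /\ Rabs s < d1) by (split_min; auto). destruct Q as [Q1 Q2].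
  specialize (K1 s). rewrite Rminus_0_r in K1. specialize (K1 Q2). split; [|now apply HZ].
  eapply Rle_lt_trans; [apply (Cmod_le_add _ z0)|]. lra. }
{ pose proof (disc_covering_neq0 W J F G z0 HL Hz01) as GP. assert (GN : G z0 <> 0%C) by (now apply Cmod_neq0).
  assert (DG : vder (fun s => G (Z s)) 0 (holo_coef J z0 (F z0) (G z0) * (e / G z0))%C).
  { rewrite Z0 in D0. apply holo_curve; auto. rewrite Z0. apply HL; auto. }
  eapply vder_eq.
  - apply (vder_mult (fun _ => e) (fun s => / G (Z s))%C 0 0%C (- (holo_coef J z0 (F z0) (G z0) * (e / G z0)) / (G (Z
      0) * G (Z 0)))%C).
    apply vder_const. apply vder_inv; [rewrite Z0; auto|exact DG].
  - cbv beta. rewrite Z0. field. auto. }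
exists Z, (Rmin d d1), v'. split; [now apply Rmin_pos|]. split; auto. split; [|split; auto].
- intros s Hs. assert (Q : Rabs s < d /\ Rabs s < d1) by (split_min; auto). destruct Q as [Q1 Q2].
  split; [|now apply HZ]. specialize (K1 s). rewrite Rminus_0_r in K1. specialize (K1 Q2).
  eapply Rle_lt_trans; [apply (Cmod_le_add _ z0)|]. lra.
- cbv zeta in V2. rewrite Z0 in V2. exact V2.
Qed.

Lemma exp_log_barrier a r : 0 < 1 - r -> 0 < a ^ 2 - r -> exp (- log_barrier a r) = (a ^ 2 - r) / (1 - r).
Proof.
intros H1 H2. unfold log_barrier. replace (- (ln (1 - r) - ln (a ^ 2 - r))) with (ln (a ^ 2 - r) + - ln (1 - r)) by
  ring.
rewrite exp_plus, exp_Ropp, !exp_ln by auto. reflexivity.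
Qed.

Definition jcomb (A B D E : jet) : jet :=
  let f (p : jet -> C -> R) := fun q => p A q + p B q - p D q - p E q in
  {| ju := f ju; jx := f jx; jy := f jy; jxx := f jxx; jxy := f jxy; jyy := f jyy |}.

(** The differentiability fields of [planar_metric] alone: linear combinations such as [jcomb]
    preserve them but destroy the curvature equation. *)
Record jet_at (W : C -> Prop) (J : jet) : Prop := {
  jet_u : forall p, W p -> grad (ju J) p (jx J p) (jy J p);
  jet_ux : forall p, W p -> grad (jx J) p (jxx J p) (jxy J p);
  jet_uy : forall p, W p -> grad (jy J) p (jxy J p) (jyy J p) }.

Lemma jet_comb W A B D E : planar_metric W A -> planar_metric W B -> planar_metric W D -> planar_metric W E ->
  jet_at W (jcomb A B D E).
Proof.
intros HA HB HD HE. constructor; intros p Hp; unfold jcomb; cbn [ju jx jy jxx jxy jyy];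
repeat apply grad_minus; try apply grad_plus;
first [apply (pm_u _ _ HA)|apply (pm_ux _ _ HA)|apply (pm_uy _ _ HA)|apply (pm_u _ _ HB)|apply (pm_ux _ _ HB)|apply
  (pm_uy _ _ HB)
 |apply (pm_u _ _ HD)|apply (pm_ux _ _ HD)|apply (pm_uy _ _ HD)|apply (pm_u _ _ HE)|apply (pm_ux _ _ HE)|apply (pm_uy
   _ _ HE)]; auto.
Qed.

Lemma jet_line W J q (e : C) : plane_open W -> jet_at W J -> W q ->
  exists d w', 0 < d /\ (forall s, Rabs s < d -> is_derive (fun t => ju J (q + e * RtoC t)%C) s (w' s)) /\
    is_derive w' 0 ((jxx J q * fst e + jxy J q * snd e) * fst e + (jxy J q * fst e + jyy J q * snd e) * snd e).
Proof.
intros HO HJ Hq. destruct (HO q Hq) as [r [Hr K]].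
pose proof (Cmod_ge_0 e).
exists (r / (Cmod e + 1)), (fun s => jx J (q + e * RtoC s)%C * fst e + jy J (q + e * RtoC s)%C * snd e).
assert (Q0 : (q + e * RtoC 0)%C = q) by ring.
split; [apply Rdiv_lt_0_compat; lra|]. split.
- intros s Hs. apply (grad_curve (ju J) (fun t => q + e * RtoC t)%C); [|apply vder_line].
  apply (jet_u _ _ HJ). apply K. replace (q + e * RtoC s - q)%C with (e * RtoC s)%C by ring.
  rewrite Cmod_mult, Cmod_R. apply Rmult_lt_compat_l with (r := Cmod e + 1) in Hs; [|lra].
  replace ((Cmod e + 1) * (r / (Cmod e + 1))) with r in Hs by (field; lra).
  pose proof (Rabs_pos s). nra.
- pose proof (grad_curve (jx J) (fun t => q + e * RtoC t)%C 0 (jxx J q) (jxy J q) e) as X.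
  pose proof (grad_curve (jy J) (fun t => q + e * RtoC t)%C 0 (jxy J q) (jyy J q) e) as Y.
  cbv beta in X, Y. rewrite Q0 in X, Y.
  specialize (X (jet_ux _ _ HJ q Hq) (vder_line q e 0)). specialize (Y (jet_uy _ _ HJ q Hq) (vder_line q e 0)).
  eapply is_derive_eq. apply is_derive_plus_R.
  + apply is_derive_mult_R; [exact X|apply is_derive_const_R].
  + apply is_derive_mult_R; [exact Y|apply is_derive_const_R].
  + cbv beta. req. ring.
Qed.

(** [x^2 y^2 <= (a^2 + b^2 - y^2) y^2 <= a^2 b^2], the last inequality being
    [(a^2 - y^2) (b^2 - y^2) >= 0]. *)
Lemma sq_prod_le x y a b : 0 < x -> 0 < y -> y <= a -> y <= b -> x ^ 2 + y ^ 2 <= a ^ 2 + b ^ 2 -> x * y <= a * b.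
Proof.
intros Hx Hy Ha Hb H.
assert (H1 : y ^ 2 <= a ^ 2) by (apply pow_incr; lra). assert (H2 : y ^ 2 <= b ^ 2) by (apply pow_incr; lra).
assert (H3 : x ^ 2 * y ^ 2 <= a ^ 2 * b ^ 2).
{ assert (0 <= (a ^ 2 - y ^ 2) * (b ^ 2 - y ^ 2)) by (apply Rmult_le_pos; lra).
  assert (0 < y ^ 2) by (apply pow_lt; auto).
  assert (x ^ 2 * y ^ 2 <= (a ^ 2 + b ^ 2 - y ^ 2) * y ^ 2) by (apply Rmult_le_compat_r; lra). lra. }
rewrite <- !Rpow_mult_distr in H3.
apply Rsqr_incr_0_var; [unfold Rsqr; simpl in H3; lra|apply Rmult_le_pos; lra].
Qed.

(** * The maximum principle *)

Section ProductComparison.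
Variables (W1 W2 : C -> Prop) (J1 J2 JI JU : jet).
Let WI := fun p => W1 p /\ W2 p.
Hypotheses (H1 : planar_metric W1 J1) (H2 : planar_metric W2 J2) (HI : planar_metric WI JI) (HU : planar_metric WI JU).
Hypotheses (C1 : curve_complete W1 (ju J1)) (C2 : curve_complete W2 (ju J2)).
(** [JU] is assumed to be a metric on the intersection only, with this domination in place of any
    link to the union. The section thereby also yields [ahlfors], from which the domination for the
    union metric is obtained. *)
Hypothesis HUle : forall p, WI p -> ju JU p <= ju J1 p /\ ju JU p <= ju J2 p.

Let JJ := jcomb JI JU J1 J2.

Lemma WI_open : plane_open WI.
Proof. apply plane_open_inter; [apply (pm_open _ _ H1)|apply (pm_open _ _ H2)]. Qed.

Lemma JJ_jet : jet_at WI JJ.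
Proof. apply jet_comb; auto; eapply pm_sub; eauto using WI_open; intros p [A B]; auto. Qed.

(** The corrected quotient [Phi] equals [a^4 exp (ju JJ p)] at the pair of centres and is at most
    [a^2] at its maximum. *)
Lemma product_le_scaled p a : WI p -> 0 < a < 1 -> exp (ju JJ p) <= / a ^ 2.
Proof.
intros Hp Ha.
destruct (developing W1 J1 p H1 C1) as [F1 [G1 [F10 L1]]]; [apply Hp|].
destruct (developing W2 J2 p H2 C2) as [F2 [G2 [F20 L2]]]; [apply Hp|].
fold (disc_covering W1 J1 F1 G1) in L1. fold (disc_covering W2 J2 F2 G2) in L2.
(* Up to the factor [a], the density of the unit disc divided by that of the disc of radius [a]. It
   vanishes on [|z| = a], so a positive maximum lies in the interior. *)
set (H := fun z => (a ^ 2 - Cmod z ^ 2) / (1 - Cmod z ^ 2)).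
set (Phi := fun x y => exp (ju JJ (F1 x)) * H x * H y).
(* A closed condition on a bounded set, whose common image point lies automatically in both [W1] and
   [W2]. *)
set (S := fun x y => Cmod x <= a /\ Cmod y <= a /\ F1 x = F2 y).
assert (Hbd : forall z, Cmod z <= a -> 0 < 1 - Cmod z ^ 2 /\ 0 <= a ^ 2 - Cmod z ^ 2).
{ intros z Hz. pose proof (Cmod_ge_0 z). nra. }
assert (SW : forall x y, S x y -> WI (F1 x)).
{ intros x y [A [B E]]. split. apply L1; lra. rewrite E. apply L2; lra. }
assert (S00 : S 0%C 0%C). { unfold S. rewrite Cmod_0, F10, F20. repeat split; lra. }
destruct (compact_max S Phi a) as [m1 [m2 [Sm Mm]]].
{ intros x y [A [B _]]; auto. } { exists 0%C, 0%C; auto. }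
{ intros x y za zb HS Cx Cy.
  assert (Za : Cmod za <= a) by (eapply Cmod_closed; [eassumption|intros n; apply HS]).
  assert (Zb : Cmod zb <= a) by (eapply Cmod_closed; [eassumption|intros n; apply HS]).
  destruct (L1 za) as [Wa [_ [Da _]]]; [lra|]. destruct (L2 zb) as [Wb [_ [Db _]]]; [lra|].
  assert (CF1 : seq_cv (fun n => F1 (x n)) (F1 za)) by (eapply holo_seq_cv; eauto).
  assert (CF2 : seq_cv (fun n => F2 (y n)) (F2 zb)) by (eapply holo_seq_cv; eauto).
  assert (E : F1 za = F2 zb).
  { apply (seq_cv_unique (fun n => F1 (x n))); auto. intros e He. destruct (CF2 e He) as [N HN]. exists N.
    intros n Hn. destruct (HS n) as [_ [_ ->]]. auto. }
  assert (HSz : S za zb) by (repeat split; auto).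
  split; auto.
  assert (CH : forall (t : nat -> C) z, Cmod z <= a -> seq_cv t z -> Un_cv (fun n => H (t n)) (H z)).
  { intros t z Hz Ht. apply (seq_cv_fcont H); auto. unfold H.
    apply (fcont_comp (fun r => (a ^ 2 - r) / (1 - r)) (fun z => Cmod z ^ 2)); [apply fcont_Cmod2|].
    apply (is_derive_continuity_pt _ _ (Derive (fun r => (a ^ 2 - r) / (1 - r)) (Cmod z ^ 2))). apply Derive_correct.
    auto_derive. destruct (Hbd z Hz). simpl in *. lra. }
  unfold Phi. apply CV_mult; [apply CV_mult|]; auto.
  apply (seq_cv_fcont (fun q => exp (ju JJ q)) (fun n => F1 (x n))); auto.
  apply (fcont_comp exp).
  - eapply grad_cont. apply (jet_u _ _ JJ_jet). eapply SW; eauto.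
  - apply derivable_continuous_pt, derivable_pt_exp. }
pose proof (SW _ _ Sm) as Wq.
destruct Sm as [Sm1 [Sm2 SmE]].
assert (HP0 : Phi 0%C 0%C = exp (ju JJ p) * a ^ 4).
{ unfold Phi, H. rewrite F10, Cmod_0. field. }
assert (PM : 0 < Phi m1 m2).
{ apply Rlt_le_trans with (Phi 0%C 0%C); [|apply Mm; auto]. rewrite HP0.
  apply Rmult_lt_0_compat; [apply exp_pos|apply pow_lt; lra]. }
assert (HH : forall z, Cmod z <= a -> 0 <= H z).
{ intros z Hz. destruct (Hbd z Hz). unfold H. apply Rmult_le_pos; auto. left. now apply Rinv_0_lt_compat. }
assert (Hin : forall z, Cmod z <= a -> H z <> 0 -> Cmod z < a).
{ intros z Hz Hn. destruct (Req_dec (Cmod z) a) as [E|]; [|lra]. exfalso. apply Hn. unfold H. rewrite E. unfold Rdiv.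
  ring. }
assert (M1 : Cmod m1 < a).
{ apply Hin; auto. intros E. unfold Phi in PM. rewrite E in PM. lra. }
assert (M2 : Cmod m2 < a).
{ apply Hin; auto. intros E. unfold Phi in PM. rewrite E in PM. lra. }
set (q := F1 m1) in *.
set (K1 := holo_coef J1 m1 (F1 m1) (G1 m1)). set (K2 := holo_coef J2 m2 (F2 m2) (G2 m2)).
(* The segment through [q] in direction [e] is lifted to both discs. The two lifts have the same
   image at each time, so the pair stays in [S] and [ln Phi] has a maximum along it. *)
assert (TEST : forall e : C, Cmod e = 1 ->
  (jxx JJ q * fst e + jxy JJ q * snd e) * fst e + (jxy JJ q * fst e + jyy JJ q * snd e) * snd e
  - barrier_second a m1 (e / G1 m1) (- (e * e) * K1 / (G1 m1 * G1 m1 * G1 m1))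
  - barrier_second a m2 (e / G2 m2) (- (e * e) * K2 / (G2 m2 * G2 m2 * G2 m2)) <= 0).
{ intros e He.
  destruct (segment_lift_full W1 J1 F1 G1 m1 e a H1 L1 Ha M1 He) as [Z1 [d1 [v1 [Hd1 [Z10 [A1 [B1 D1']]]]]]].
  destruct (segment_lift_full W2 J2 F2 G2 m2 e a H2 L2 Ha M2 He) as [Z2 [d2 [v2 [Hd2 [Z20 [A2 [B2 D2']]]]]]].
  destruct (jet_line WI JJ q e WI_open JJ_jet Wq) as [d3 [w3 [Hd3 [B3 D3]]]].
  set (d := Rmin d1 (Rmin d2 d3)).
  assert (Hd : forall s, Rabs s < d -> Rabs s < d1 /\ Rabs s < d2 /\ Rabs s < d3).
  { intros s Hs. unfold d in Hs. split_min. auto. }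
  apply (second_derivative_test (fun s => ju JJ (q + e * RtoC s)%C - log_barrier a (Cmod (Z1 s) ^ 2) - log_barrier a
    (Cmod (Z2 s) ^ 2))
    (fun s => w3 s - v1 s - v2 s) _ d).
  - unfold d. repeat apply Rmin_pos; auto.
  - intros s Hs. destruct (Hd s Hs) as [Q1 [Q2 Q3]]. apply is_derive_minus_R; [apply is_derive_minus_R|]; auto.
  - apply is_derive_minus_R; [apply is_derive_minus_R|]; auto.
  - assert (EP : forall s, Rabs s < d -> exp (ju JJ (q + e * RtoC s)%C - log_barrier a (Cmod (Z1 s) ^ 2) - log_barrier
      a (Cmod (Z2 s) ^ 2)) = Phi (Z1 s) (Z2 s)).
    { intros s Hs. destruct (Hd s Hs) as [Q1 [Q2 Q3]]. destruct (A1 s Q1) as [R1 R2]. destruct (A2 s Q2) as [R3 R4].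
      pose proof (Cmod_ge_0 (Z1 s)). pose proof (Cmod_ge_0 (Z2 s)).
      unfold Rminus at 1 2. rewrite !exp_plus, !exp_log_barrier by nra. unfold Phi, H. rewrite R2. reflexivity. }
    intros s Hs.
    assert (L : exp (ju JJ (q + e * RtoC s)%C - log_barrier a (Cmod (Z1 s) ^ 2) - log_barrier a (Cmod (Z2 s) ^ 2)) <=
       exp (ju JJ (q + e * RtoC 0)%C - log_barrier a (Cmod (Z1 0) ^ 2) - log_barrier a (Cmod (Z2 0) ^ 2))).
    { rewrite !EP; auto.
      2: { rewrite Rabs_R0. unfold d. repeat apply Rmin_pos; auto. }
      rewrite Z10, Z20. apply Mm. destruct (Hd s Hs) as [Q1 [Q2 Q3]]. destruct (A1 s Q1) as [R1 R2].
      destruct (A2 s Q2) as [R3 R4].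
      split; [lra|]. split; [lra|]. rewrite R2, R4. fold q. now rewrite SmE. }
    apply Rnot_lt_le. intros Hlt. apply exp_increasing in Hlt. lra. }
destruct (L1 m1) as [_ [E1 _]]; [lra|]. destruct (L2 m2) as [_ [E2 _]]; [lra|].
pose proof (disc_covering_neq0 _ _ _ _ m1 L1 ltac:(lra)) as GP1.
pose proof (disc_covering_neq0 _ _ _ _ m2 L2 ltac:(lra)) as GP2.
assert (GN1 : G1 m1 <> 0%C) by now apply Cmod_neq0. assert (GN2 : G2 m2 <> 0%C) by now apply Cmod_neq0.
rewrite <- SmE in E2. fold q in E1, E2.
(* Adding the inequalities for the directions 1 and [Ci] produces Laplacians. *)
pose proof (TEST 1%C Cmod_1) as T1. pose proof (TEST Ci Cmod_Ci) as T2.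
assert (X1 : forall (K G : C), G <> 0%C -> (- (1 * 1) * K / (G * G * G) = - K / (G * G * G))%C) by (intros; field;
  auto).
assert (X2 : forall (K G : C), G <> 0%C -> (- (Ci * Ci) * K / (G * G * G) = - (- K / (G * G * G)))%C).
{ intros K G HG. replace (Ci * Ci)%C with (- (1))%C by (apply injective_projections; simpl; ring). field; auto. }
assert (X3 : forall (G : C), G <> 0%C -> (Ci / G = Ci * (1 / G))%C) by (intros; field; auto).
rewrite !X1 in T1 by auto. rewrite !X2, !X3 in T2 by auto.
assert (B1 : 0 < 1 - Cmod m1 ^ 2 /\ 0 < a ^ 2 - Cmod m1 ^ 2) by (pose proof (Cmod_ge_0 m1); nra).
assert (B2 : 0 < 1 - Cmod m2 ^ 2 /\ 0 < a ^ 2 - Cmod m2 ^ 2) by (pose proof (Cmod_ge_0 m2); nra).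
pose proof (barrier_second_sum a m1 (1 / G1 m1) (- K1 / (G1 m1 * G1 m1 * G1 m1)) ltac:(tauto) ltac:(tauto)) as V1.
pose proof (barrier_second_sum a m2 (1 / G2 m2) (- K2 / (G2 m2 * G2 m2 * G2 m2)) ltac:(tauto) ltac:(tauto)) as V2.
simpl fst in T1, T2. simpl snd in T1, T2.
assert (T : jxx JJ q + jyy JJ q -
   Cmod (1 / G1 m1) ^ 2 * (4 * a ^ 2 / (a ^ 2 - Cmod m1 ^ 2) ^ 2 - 4 / (1 - Cmod m1 ^ 2) ^ 2) -
   Cmod (1 / G2 m2) ^ 2 * (4 * a ^ 2 / (a ^ 2 - Cmod m2 ^ 2) ^ 2 - 4 / (1 - Cmod m2 ^ 2) ^ 2) <= 0).
{ rewrite <- V1, <- V2. lra. }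
clear T1 T2 V1 V2 TEST.
rewrite !Cmod_div, !Cmod_1 in T by auto.
set (lI := exp (ju JI q)). set (lU := exp (ju JU q)). set (l1 := exp (ju J1 q)) in *. set (l2 := exp (ju J2 q)) in *.
assert (P1 : 0 < l1) by apply exp_pos. assert (P2 : 0 < l2) by apply exp_pos.
assert (PI' : 0 < lI) by apply exp_pos. assert (PU : 0 < lU) by apply exp_pos.
set (r1 := Cmod m1 ^ 2) in *. set (r2 := Cmod m2 ^ 2) in *. set (g1 := Cmod (G1 m1)) in *.
set (g2 := Cmod (G2 m2)) in *.
assert (G1E : g1 = 2 / ((1 - r1) * l1)).
{ apply Rmult_eq_reg_l with l1; [|lra]. rewrite E1. field. lra. }
assert (G2E : g2 = 2 / ((1 - r2) * l2)).
{ apply Rmult_eq_reg_l with l2; [|lra]. rewrite E2. field. lra. }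
(* The densities at [q] of the metrics pushed down from the discs of radius [a] by [F1] and [F2]. *)
set (a1 := l1 * (a * (1 - r1) / (a ^ 2 - r1))). set (a2 := l2 * (a * (1 - r2) / (a ^ 2 - r2))).
assert (LAP : jxx JJ q + jyy JJ q = lI ^ 2 + lU ^ 2 - l1 ^ 2 - l2 ^ 2).
{ unfold JJ, jcomb; cbn [jxx jyy].
  assert (SQ : forall x, exp (2 * x) = exp x ^ 2). { intros x. replace (2 * x) with (x + x) by ring. rewrite exp_plus.
  ring. }
  pose proof (pm_L _ _ HI q Wq). pose proof (pm_L _ _ HU q Wq). pose proof (pm_L _ _ H1 q (proj1 Wq)).
  pose proof (pm_L _ _ H2 q (proj2 Wq)).
  rewrite SQ in *. unfold lI, lU, l1, l2. lra. }
rewrite LAP in T.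
(* The corrections replace [l1^2 + l2^2] in the Laplacian by [a1^2 + a2^2], because [|1 / G|] is the
   density of [W] divided by that of the unit disc. *)
assert (KEY : lI ^ 2 + lU ^ 2 <= a1 ^ 2 + a2 ^ 2).
{ assert (Y1 : (1 / g1) ^ 2 * (4 * a ^ 2 / (a ^ 2 - r1) ^ 2 - 4 / (1 - r1) ^ 2) = a1 ^ 2 - l1 ^ 2).
  { rewrite G1E. unfold a1. field. repeat split; lra. }
  assert (Y2 : (1 / g2) ^ 2 * (4 * a ^ 2 / (a ^ 2 - r2) ^ 2 - 4 / (1 - r2) ^ 2) = a2 ^ 2 - l2 ^ 2).
  { rewrite G2E. unfold a2. field. repeat split; lra. }
  rewrite Y1, Y2 in T. lra. }
(* The smaller disc has the larger density, so the pushed-down densities still dominate [lU]. *)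
assert (GE : forall r l, 0 <= r -> 0 < 1 - r -> 0 < a ^ 2 - r -> 0 < l -> l <= l * (a * (1 - r) / (a ^ 2 - r))).
{ intros r l Hr0 Hr1 Hr2 Hl. rewrite <- (Rmult_1_r l) at 1. apply Rmult_le_compat_l; [lra|].
  apply Rmult_le_reg_r with (a ^ 2 - r); auto. unfold Rdiv. rewrite Rmult_assoc, Rinv_l by lra.
  assert (0 <= (1 - a) * (a + r)) by (apply Rmult_le_pos; lra). lra. }
assert (A1 : l1 <= a1) by (apply GE; try tauto; apply pow2_ge_0).
assert (A2 : l2 <= a2) by (apply GE; try tauto; apply pow2_ge_0).
destruct (HUle q Wq) as [U1 U2].
assert (LE : forall x y, x <= y -> exp x <= exp y).
{ intros x y [h| ->]; [left; now apply exp_increasing|lra]. }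
apply LE in U1, U2. fold lU l1 in U1. fold lU l2 in U2.
pose proof (sq_prod_le lI lU a1 a2 PI' PU ltac:(lra) ltac:(lra) KEY) as FIN.
assert (PhiE : Phi m1 m2 = a ^ 2 * (lI * lU) / (a1 * a2)).
{ unfold Phi, H. fold q r1 r2. unfold JJ, jcomb; cbn [ju].
  unfold Rminus at 1 2. rewrite !exp_plus, !exp_Ropp. fold lI lU l1 l2. unfold a1, a2. field. repeat split; lra. }
assert (Phi m1 m2 <= a ^ 2).
{ rewrite PhiE. assert (0 < a1 * a2) by (apply Rmult_lt_0_compat; lra).
  apply Rmult_le_reg_r with (a1 * a2); auto. unfold Rdiv. rewrite Rmult_assoc, Rinv_l, Rmult_1_r by lra.
  apply Rmult_le_compat_l; auto. apply pow2_ge_0. }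
pose proof (Mm 0%C 0%C S00) as Q. rewrite HP0 in Q.
assert (0 < a ^ 2) by (apply pow_lt; lra).
apply Rmult_le_reg_r with (a ^ 2 * a ^ 2); [nra|].
replace (/ a ^ 2 * (a ^ 2 * a ^ 2)) with (a ^ 2) by (field; lra).
replace (a ^ 2 * a ^ 2) with (a ^ 4) by ring. lra.
Qed.

Theorem product_le p : W1 p -> W2 p -> ju JI p + ju JU p <= ju J1 p + ju J2 p.
Proof.
intros Hp1 Hp2. apply Rnot_lt_le. intros Hlt.
set (t := ju JI p + ju JU p - ju J1 p - ju J2 p). assert (Ht : 0 < t) by (unfold t; lra).
(* With this radius [1 / a^2 = exp (t / 2)], which is smaller than [exp t]. *)
pose proof (product_le_scaled p (exp (- (t / 4))) (conj Hp1 Hp2)) as Q.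
assert (E : / exp (- (t / 4)) ^ 2 = exp (t / 2)).
{ simpl. rewrite Rmult_1_r, <- exp_plus, <- exp_Ropp. f_equal. field. }
rewrite E in Q.
assert (exp (- (t / 4)) < 1). { rewrite <- exp_0. apply exp_increasing. lra. }
pose proof (exp_pos (- (t / 4))). specialize (Q ltac:(lra)).
assert (exp (t / 2) < exp t) by (apply exp_increasing; lra).
change (ju JJ p) with t in Q. lra.
Qed.
End ProductComparison.

(** * Ahlfors' lemma, the strong maximum principle and boundary escape *)

(** [product_le] with both sets equal to [W] and with [J] in the place of [J1], [J2] and [JU]: it
    reads [u' + u <= u + u]. *)
Lemma ahlfors W J J' : planar_metric W J -> curve_complete W (ju J) -> planar_metric W J' -> forall p,
  W p -> ju J' p <= ju J p.
Proof.
intros HJ HC HJ' p Hp.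
assert (S : forall K, planar_metric W K -> planar_metric (fun p => W p /\ W p) K).
{ intros K HK. eapply pm_sub; [exact HK| |tauto]. apply plane_open_inter; apply (pm_open _ _ HJ). }
pose proof (product_le W W J J J' J HJ HJ (S _ HJ') (S _ HJ) HC HC) as Q.
specialize (Q ltac:(intros; lra) p Hp Hp). lra.
Qed.

Lemma pm_jet_at W J : planar_metric W J -> jet_at W J.
Proof. intros [A B D E F G H I]. constructor; auto. Qed.

Lemma exp_sq x : exp (2 * x) = exp x ^ 2.
Proof. replace (2 * x) with (x + x) by ring. rewrite exp_plus. ring. Qed.

Lemma exp_le x y : x <= y -> exp x <= exp y.
Proof. intros [h| ->]; [left; now apply exp_increasing|lra]. Qed.

Lemma seq_cv_ball_closed x z y a : seq_cv x z -> (forall n, Cmod (x n - y) <= a) -> Cmod (z - y) <= a.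
Proof.
intros H K. apply (Cmod_closed (fun n => x n - y)%C); auto. intros e He.
destruct (H e He) as [N HN]. exists N. intros n Hn.
replace (x n - y - (z - y))%C with (x n - z)%C by ring. auto.
Qed.

Lemma seq_cv_ball_closed' x z y a : seq_cv x z -> (forall n, a <= Cmod (x n - y)) -> a <= Cmod (z - y).
Proof.
intros H K. apply le_epsilon. intros e He. destruct (H e He) as [N HN]. specialize (HN N (le_n _)).
specialize (K N). pose proof (Cmod_triangle_sub (x N) z y). lra.
Qed.

(** [compact_max] concerns pairs, so the second entry is pinned to 0. Inner radius 0 gives a closed
    disc. *)
Lemma annulus_max f y r1 r2 : 0 <= r1 <= r2 -> (forall x, Cmod (x - y) <= r2 -> fcont f x) ->
  exists x, r1 <= Cmod (x - y) <= r2 /\ forall x', r1 <= Cmod (x' - y) <= r2 -> f x' <= f x.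
Proof.
intros Hr Hf.
destruct (compact_max (fun a b => r1 <= Cmod (a - y) <= r2 /\ b = 0%C) (fun a _ => f a) (Cmod y + r2)) as [a [b [[A _]
  B]]].
- intros a b [[_ H] ->]. rewrite Cmod_0. split; [|pose proof (Cmod_ge_0 y); lra].
  eapply Rle_trans; [apply (Cmod_le_add _ y)|]. lra.
- exists (y + RtoC r2)%C, 0%C. split; auto. replace (y + RtoC r2 - y)%C with (RtoC r2) by ring.
  rewrite Cmod_R, Rabs_pos_eq; lra.
- intros x b xa xb HS Cx Cb.
  assert (E : xb = 0%C). { apply (seq_cv_unique b); auto. intros e He. exists O. intros n _. destruct (HS n) as [_ ->].
    replace (0 - 0)%C with (RtoC 0) by ring. now rewrite Cmod_0. }
  assert (Q : r1 <= Cmod (xa - y) <= r2).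
  { split; [eapply seq_cv_ball_closed'|eapply seq_cv_ball_closed]; eauto; intros n; apply HS. }
  split; [split; auto|]. apply seq_cv_fcont; auto. apply Hf; lra.
- exists a. split; auto. intros x' Hx'. apply (B x' 0%C). auto.
Qed.

Lemma line_norm2 (w e : C) s : Cmod (w + e * RtoC s) ^ 2 = Cmod w ^ 2 + 2 * s * (fst w * fst e + snd w * snd e) + s ^
  2 * Cmod e ^ 2.
Proof. rewrite !Cmod_sqr. simpl. ring. Qed.

(** Comparison on an annulus around [y] with Hopf's barrier [exp (- al |x - y|^2)]. *)
Lemma hopf W J J' y rho : planar_metric W J -> planar_metric W J' -> (forall p, W p -> ju J' p <= ju J p) ->
  (forall x, Cmod (x - y) <= rho -> W x) -> ju J' y < ju J y ->
  forall x, Cmod (x - y) < rho -> ju J' x < ju J x.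
Proof.
intros HJ HJ' Hle HW Hy xs Hxs.
pose proof (Cmod_ge_0 (xs - y)) as d0.
destruct (Rle_lt_or_eq_dec _ _ (Hle xs (HW xs ltac:(lra)))) as [|Exs]; auto. exfalso.
set (v := fun x => ju J x - ju J' x).
assert (Vc : forall x, W x -> fcont v x).
{ intros x Hx. eapply grad_cont. apply grad_minus. apply (pm_u _ _ HJ x Hx). apply (pm_u _ _ HJ' x Hx). }
assert (V0 : forall x, W x -> 0 <= v x) by (intros x Hx; specialize (Hle x Hx); unfold v; lra).
set (d := Cmod (xs - y)) in *.
assert (Wy : W y). { apply HW. replace (y - y)%C with (RtoC 0) by ring. rewrite Cmod_0. lra. }
assert (Hd : 0 < d).
{ destruct (Req_dec d 0) as [E|]; [|lra]. apply Cmod_eq_0 in E.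
  assert (xs = y) by (replace xs with (xs - y + y)%C by ring; rewrite E; ring). subst. lra. }
assert (Vy : 0 < v y) by (unfold v; lra). set (m := v y / 2). assert (Hm : 0 < m) by (unfold m; lra).
destruct (Vc y Wy m Hm) as [r0 [Hr0 K0]].
set (r1 := Rmin r0 d / 2). assert (Hmn : 0 < Rmin r0 d) by (apply Rmin_pos; auto).
assert (Hr1 : 0 < r1 /\ r1 < r0 /\ r1 < d). { unfold r1. pose proof (Rmin_l r0 d). pose proof (Rmin_r r0 d). lra. }
destruct (annulus_max (fun x => exp (2 * ju J x)) y 0 rho) as [xm [Hxm Mx]].
{ lra. }
{ intros x Hx. apply (fcont_comp (fun t => exp (2 * t)) (ju J)).
  - eapply grad_cont, (pm_u _ _ HJ), HW, Hx.
  - apply (is_derive_continuity_pt _ _ (exp (2 * ju J x) * 2)).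
    eapply is_derive_eq. apply is_derive_exp_R, is_derive_scal_R, is_derive_id_R. req. ring. }
(* [exp (2 u) - exp (2 u') <= 2 exp (2 u) (u - u')] by convexity, so the Laplacian of [v] is at most
   [Cc * v] on the closed disc, where [xm] maximizes [exp (2 u)]. *)
set (Cc := 2 * exp (2 * ju J xm)). assert (HCc : 0 < Cc) by (unfold Cc; pose proof (exp_pos (2 * ju J xm)); lra).
assert (LAP : forall x, Cmod (x - y) <= rho -> (jxx J x + jyy J x) - (jxx J' x + jyy J' x) <= Cc * v x).
{ intros x Hx. pose proof (HW x Hx) as Wx. rewrite (pm_L _ _ HJ x Wx), (pm_L _ _ HJ' x Wx).
  specialize (Mx x ltac:(pose proof (Cmod_ge_0 (x - y)); lra)).
  pose proof (V0 x Wx) as Vx. unfold Cc.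
  replace (ju J' x) with (ju J x - v x) by (unfold v; ring).
  replace (2 * (ju J x - v x)) with (2 * ju J x + - (2 * v x)) by ring. rewrite exp_plus.
  assert (1 + - (2 * v x) <= exp (- (2 * v x))) by apply exp_ineq1_le.
  pose proof (exp_pos (2 * ju J x)).
  apply Rle_trans with (exp (2 * ju J x) * (2 * v x)); [nra|]. nra. }
(* The Laplacian of [exp (- al r^2)] is [4 al^2 r^2 - 4 al] times that function; for this [al] the
   factor exceeds [Cc] as soon as [r >= r1]. *)
set (al := 1 + (Cc + 5) / (4 * r1 ^ 2)).
assert (Hr12 : 0 < r1 ^ 2) by (apply pow_lt; lra).
assert (Hal : 1 <= al). { unfold al. assert (0 < (Cc + 5) / (4 * r1 ^ 2)) by (apply Rdiv_lt_0_compat; lra). lra. }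
assert (Hal2 : Cc < 4 * al ^ 2 * r1 ^ 2 - 4 * al).
{ assert (4 * al * r1 ^ 2 = 4 * r1 ^ 2 + Cc + 5) by (unfold al; field; lra).
  replace (4 * al ^ 2 * r1 ^ 2 - 4 * al) with (al * (4 * al * r1 ^ 2 - 4)) by ring. rewrite H. nra. }
(* On the inner circle [v > m], and there the barrier term must stay below [v]. *)
set (ep := m / 2). assert (Hep : 0 < ep) by (unfold ep; lra).
set (E := fun x => exp (- al * Cmod (x - y) ^ 2)).
(* Negative on both bounding circles and zero at [xs], where [v] vanishes: its maximum over the
   annulus is nonnegative and interior. There [v <= ep * E], against which the Laplacian of the
   barrier is too large. *)
set (g := fun x => ep * (E x - exp (- al * d ^ 2)) - v x).
assert (CE : forall x, fcont E x).
{ intros x. unfold E. apply (fcont_compC (fun w => exp (- al * Cmod w ^ 2)) (fun x => x - y)%C).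
  - apply (fcont_comp (fun t => exp (- al * t)) (fun w => Cmod w ^ 2)); [apply fcont_Cmod2|].
    apply (is_derive_continuity_pt _ _ (exp (- al * Cmod (x - y) ^ 2) * - al)).
    eapply is_derive_eq. apply is_derive_exp_R, is_derive_scal_R, is_derive_id_R. req. ring.
  - eapply grad_cont. apply (grad_minus fst (fun _ => fst y)). apply grad_fst. apply grad_const.
  - eapply grad_cont. apply (grad_minus snd (fun _ => snd y)). apply grad_snd. apply grad_const. }
destruct (annulus_max g y r1 rho) as [x1 [Hx1 M1]]; [lra| |].
{ intros x Hx. unfold g.
  apply fcont_ext_loc with (f := fun x => ep * E x + ((-1) * v x + - (ep * exp (- al * d ^ 2)))) (r := 1); [lra| |].
  intros; ring. apply fcont_plus; [now apply fcont_scal|]. apply fcont_plus; [|apply fcont_const].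
  apply fcont_scal, Vc, HW, Hx. }
assert (Gxs : g xs = 0). { unfold g, E, v. fold d. rewrite Exs. ring. }
assert (G1 : 0 <= g x1). { rewrite <- Gxs. apply M1. unfold d in *. lra. }
assert (Wx1 : W x1) by (apply HW; lra).
assert (E1 : forall x, E x <= 1).
{ intros x. unfold E. rewrite <- exp_0. apply exp_le. pose proof (pow2_ge_0 (Cmod (x - y))). nra. }
assert (Hin : r1 < Cmod (x1 - y) < rho).
{ split.
  - destruct (Req_dec (Cmod (x1 - y)) r1) as [Eq|]; [|lra]. exfalso.
    specialize (K0 x1 ltac:(lra)). apply Rabs_def2 in K0. unfold g in G1. specialize (E1 x1).
    pose proof (exp_pos (- al * d ^ 2)).
    assert (ep * (E x1 - exp (- al * d ^ 2)) <= ep * 1) by (apply Rmult_le_compat_l; lra).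
    assert (m = v y / 2) by reflexivity. assert (ep = m / 2) by reflexivity. lra.
  - apply Rnot_le_lt. intros Hge. assert (Eq : Cmod (x1 - y) = rho) by lra.
    unfold g in G1. specialize (V0 x1 Wx1).
    assert (E x1 < exp (- al * d ^ 2)).
    { unfold E. apply exp_increasing. rewrite Eq.
      assert (d ^ 2 < rho ^ 2) by (unfold d in *; simpl; apply Rmult_le_0_lt_compat; lra).
      assert (al * d ^ 2 < al * rho ^ 2) by (apply Rmult_lt_compat_l; lra). lra. }
    assert (0 < ep * (exp (- al * d ^ 2) - E x1)) by (apply Rmult_lt_0_compat; lra). lra. }
assert (TEST : forall e : C, Cmod e = 1 ->
   ep * (((2 * al * (fst (x1 - y)%C * fst e + snd (x1 - y)%C * snd e)) ^ 2 - 2 * al) * E x1)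
   - (((jxx J x1 * fst e + jxy J x1 * snd e) * fst e + (jxy J x1 * fst e + jyy J x1 * snd e) * snd e) -
      ((jxx J' x1 * fst e + jxy J' x1 * snd e) * fst e + (jxy J' x1 * fst e + jyy J' x1 * snd e) * snd e)) <= 0).
{ intros e He.
  destruct (jet_line W J x1 e (pm_open _ _ HJ) (pm_jet_at _ _ HJ) Wx1) as [d1 [w1 [Hd1 [A1 B1]]]].
  destruct (jet_line W J' x1 e (pm_open _ _ HJ) (pm_jet_at _ _ HJ') Wx1) as [d2 [w2 [Hd2 [A2 B2]]]].
  set (k := fst (x1 - y)%C * fst e + snd (x1 - y)%C * snd e).
  set (tt := fun s => Cmod (x1 - y) ^ 2 + 2 * s * k + s ^ 2).
  assert (ET : forall s, E (x1 + e * RtoC s)%C = exp (- al * tt s)).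
  { intros s. unfold E, tt. f_equal. replace (x1 + e * RtoC s - y)%C with ((x1 - y) + e * RtoC s)%C by ring.
    rewrite line_norm2, He. unfold k. ring. }
  assert (Dt : forall s, is_derive tt s (2 * k + 2 * s)). { intros s. unfold tt. auto_derive; auto. ring. }
  set (d3 := Rmin (Cmod (x1 - y) - r1) (rho - Cmod (x1 - y))). assert (Hd3 : 0 < d3) by (apply Rmin_pos; lra).
  apply (second_derivative_test (fun s => ep * (exp (- al * tt s) - exp (- al * d ^ 2)) - (ju J (x1 + e * RtoC s)%C -
    ju J' (x1 + e * RtoC s)%C))
     (fun s => ep * (- al * (2 * k + 2 * s) * exp (- al * tt s)) - (w1 s - w2 s)) _ (Rmin d1 (Rmin d2 d3))).
  - apply Rmin_pos; auto. apply Rmin_pos; auto.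
  - intros s Hs. assert (Q : Rabs s < d1 /\ Rabs s < d2) by (split_min; auto). destruct Q as [Q1 Q2].
    apply is_derive_minus_R; [|apply is_derive_minus_R; auto].
    apply is_derive_scal_R. eapply is_derive_eq.
    apply is_derive_minus_R; [apply is_derive_exp_R, is_derive_scal_R, Dt|apply is_derive_const_R]. req. ring.
  - apply is_derive_minus_R; [|apply is_derive_minus_R; auto].
    apply is_derive_ext_R with (f := fun s => ep * ((- al * (2 * k + 2 * s)) * exp (- al * tt s))); [reflexivity|].
    apply is_derive_scal_R. eapply is_derive_eq.
    apply is_derive_mult_R; [|apply is_derive_exp_R, is_derive_scal_R, Dt].
    { instantiate (1 := - al * 2). auto_derive; auto. ring. }
    replace (E x1) with (exp (- al * tt 0)). 2: { rewrite <- ET. f_equal. ring. }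
    req. ring.
  - intros s Hs. assert (Q : Rabs s < d3) by (split_min; auto).
    assert (Q' : Rabs s < Cmod (x1 - y) - r1 /\ Rabs s < rho - Cmod (x1 - y)) by (unfold d3 in Q; split_min; auto).
    destruct Q' as [Q1 Q2].
    assert (EG : forall s, ep * (exp (- al * tt s) - exp (- al * d ^ 2)) - (ju J (x1 + e * RtoC s)%C - ju J' (x1 + e *
      RtoC s)%C) = g (x1 + e * RtoC s)%C).
    { intros t. unfold g, v. now rewrite ET. }
    rewrite !EG. replace (x1 + e * RtoC 0)%C with x1 by ring. apply M1.
    assert (Es : Cmod (e * RtoC s) = Rabs s) by (rewrite Cmod_mult, He, Cmod_R; ring).
    pose proof (Cmod_triangle (x1 - y) (e * RtoC s)) as T1.
    pose proof (Cmod_minus_le (x1 - y + e * RtoC s) (e * RtoC s)) as T2.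
    replace (x1 - y + e * RtoC s - e * RtoC s)%C with (x1 - y)%C in T2 by ring.
    replace (x1 + e * RtoC s - y)%C with (x1 - y + e * RtoC s)%C by ring. lra. }
pose proof (TEST 1%C Cmod_1) as T1. pose proof (TEST Ci Cmod_Ci) as T2. clear TEST.
specialize (LAP x1 ltac:(lra)).
pose proof (Cmod_sqr (x1 - y)) as S.
set (a := fst (x1 - y)%C) in *. set (b := snd (x1 - y)%C) in *.
simpl in T1, T2.
assert (T : ep * ((4 * al ^ 2 * Cmod (x1 - y) ^ 2 - 4 * al) * E x1) <= Cc * v x1).
{ rewrite S. lra. }
assert (Ex : 0 < E x1) by apply exp_pos.
assert (Vx : v x1 <= ep * E x1).
{ unfold g in G1. pose proof (exp_pos (- al * d ^ 2)). nra. }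
assert (r1 ^ 2 <= Cmod (x1 - y) ^ 2) by (apply pow_incr; lra).
assert (0 < ep * E x1) by (apply Rmult_lt_0_compat; auto).
assert (0 < al ^ 2) by (apply pow_lt; lra).
assert (Cc < 4 * al ^ 2 * Cmod (x1 - y) ^ 2 - 4 * al) by nra.
assert (Cc * v x1 <= Cc * (ep * E x1)) by (apply Rmult_le_compat_l; lra).
assert (Cc * (ep * E x1) < (4 * al ^ 2 * Cmod (x1 - y) ^ 2 - 4 * al) * (ep * E x1)) by (apply Rmult_lt_compat_r; auto).
lra.
Qed.

Definition plane_connected (W : C -> Prop) : Prop := forall A B, plane_open A -> plane_open B ->
  (forall p, W p <-> A p \/ B p) -> (forall p, ~ (A p /\ B p)) -> (forall p, ~ A p) \/ (forall p, ~ B p).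

Lemma strong_max W J J' p : planar_metric W J -> planar_metric W J' -> plane_connected W -> (forall p,
  W p -> ju J' p <= ju J p) ->
  W p -> ju J' p = ju J p -> forall q, W q -> ju J' q = ju J q.
Proof.
intros HJ HJ' HC Hle Hp Ep.
destruct (HC (fun q => W q /\ ju J' q = ju J q) (fun q => W q /\ ju J' q < ju J q)) as [A|B].
- intros x [Wx Ex]. destruct (pm_open _ _ HJ x Wx) as [r [Hr K]]. exists (r / 3). split; [lra|].
  intros y Hy. assert (Wy : W y) by (apply K; lra). split; auto.
  destruct (Rle_lt_or_eq_dec _ _ (Hle y Wy)) as [Hlt|]; auto. exfalso.
  (* Since [y] is within [r / 3] of [x], the disc of radius [r / 2] about [y] contains [x] and stays
     in [W]. *)
  pose proof (hopf W J J' y (r / 2) HJ HJ' Hle) as Q.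
  assert (ju J' x < ju J x); [|lra]. apply Q; auto.
  + intros z Hz. apply K. eapply Rle_lt_trans; [apply (Cmod_triangle_sub _ y)|]. lra.
  + rewrite Cmod_minus_sym. lra.
- intros x [Wx Lx]. destruct (pm_open _ _ HJ x Wx) as [r [Hr K]].
  assert (Hc : fcont (fun z => ju J z - ju J' z) x).
  { eapply grad_cont. apply grad_minus. apply (pm_u _ _ HJ x Wx). apply (pm_u _ _ HJ' x Wx). }
  destruct (Hc (ju J x - ju J' x)) as [d [Hd Kd]]; [lra|].
  exists (Rmin r d). split; [now apply Rmin_pos|]. intros q Hq.
  assert (Q : Cmod (q - x) < r /\ Cmod (q - x) < d) by (split_min; auto). destruct Q as [Q1 Q2].
  split; auto. specialize (Kd q Q2). apply Rabs_def2 in Kd. lra.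
- intros q. split.
  + intros Wq. destruct (Rle_lt_or_eq_dec _ _ (Hle q Wq)); auto.
  + tauto.
- intros q [[_ E] [_ L]]. lra.
- exfalso. apply (A p). auto.
- intros q Wq. destruct (Rle_lt_or_eq_dec _ _ (Hle q Wq)); auto. exfalso. apply (B q). auto.
Qed.

(** The segment from [y] to [Q] would leave [W] at a point of [WU], where [ju JU] is finite: a path of finite length. *)
Lemma no_escape W WU J JU Q : planar_metric W J -> curve_complete W (ju J) -> planar_metric WU JU -> (forall p,
  W p -> ju J p = ju JU p) ->
  WU Q -> ~ W Q -> exists r, 0 < r /\ forall y, Cmod (y - Q) < r -> ~ W y.
Proof.
intros HJ HC HU HE WQ NQ.
destruct (grad_cont _ _ _ _ (pm_u _ _ HU Q WQ) 1 Rlt_0_1) as [r [Hr K]].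
exists r. split; auto. intros y Hy Wy.
set (c := fun t => (y + (Q - y) * RtoC t)%C).
assert (Hball : forall t, 0 <= t <= 1 -> Cmod (c t - Q) < r).
{ intros t Ht. apply ball_convex; auto. replace (Q - Q)%C with (RtoC 0) by ring. now rewrite Cmod_0. }
assert (Cc : forall t, vder c t (Q - y)%C) by (intros; apply vder_line).
assert (C0 : c 0 = y) by (unfold c; ring). assert (C1 : c 1 = Q) by (unfold c; ring).
(* [T] is the exit time from [W]. The point [c T] is outside [W], whereas completeness produces a
   point of accumulation in [W], which can only be [c T]. *)
destruct (completeness (fun t => 0 <= t <= 1 /\ forall s, 0 <= s <= t -> W (c s))) as [T [Hub Hl]].
{ exists 1. intros t [Ht _]; lra. }
{ exists 0. split; [lra|]. intros s Hs. replace s with 0 by lra. now rewrite C0. }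
assert (OP : forall t, W (c t) -> exists d, 0 < d /\ forall s, Rabs (s - t) < d -> W (c s)).
{ intros t Wt. destruct (pm_open _ _ HJ _ Wt) as [e [He Ke]].
  destruct (vder_cont _ _ _ (Cc t) e He) as [d [Hd Kd]]. exists d; split; auto. }
assert (HT : 0 <= T <= 1). { split. apply Hub. split; [lra|]. intros s Hs. replace s with 0 by lra. now rewrite C0.
  apply Hl. intros t [Ht _]; lra. }
assert (HW : forall s, 0 <= s < T -> W (c s)).
{ intros s Hs. apply NNPP. intros Hn. assert (T <= s); [|lra]. apply Hl. intros t [Ht Kt].
  apply Rnot_lt_le. intros Hst. apply Hn, Kt. lra. }
assert (NT : ~ W (c T)).
{ intros WT. destruct (OP T WT) as [d [Hd Kd]].
  assert (WW : forall s, 0 <= s < T + d -> W (c s)).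
  { intros s Hs. destruct (Rlt_dec s T). apply HW; lra. apply Kd. apply Rabs_def1; lra. }
  destruct (Req_dec T 1) as [E|]; [apply NQ; rewrite <- C1, <- E; auto|].
  set (t := Rmin (T + d / 2) 1). assert (Ht : T < t <= 1 /\ t < T + d) by (unfold t, Rmin; destruct Rle_dec; lra).
  assert (t <= T); [|lra]. apply Hub. split; [lra|]. intros s Hs. apply WW; lra. }
assert (HT0 : 0 < T).
{ destruct (Req_dec T 0) as [E|]; [|lra]. exfalso. apply NT. now rewrite E, C0. }
destruct (HC c (fun _ => (Q - y)%C) T (exp (ju JU Q + 1) * Cmod (Q - y)) HT0) as [P [WP KP]].
{ intros t Ht. split; [apply HW; auto|]. split; auto. split.
  - apply (vcont_vder _ _ 0), vder_const.
  - apply Rmult_le_compat_r; [apply Cmod_ge_0|]. rewrite HE by (apply HW; auto). apply exp_le.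
    specialize (K (c t) (Hball t ltac:(lra))). apply Rabs_def2 in K. lra. }
apply NT. assert (c T = P) as ->; auto.
assert (Z : (c T - P = 0)%C).
{ apply Cmod_eq_0. apply Rle_antisym; [|apply Cmod_ge_0]. apply le_epsilon. intros e He.
  destruct (vder_cont _ _ _ (Cc T) (e/2)) as [d [Hd Kd]]; [lra|].
  destruct (KP (e/2) d) as [t [T1 [T2 T3]]]; auto; [lra|].
  specialize (Kd t ltac:(apply Rabs_def1; lra)).
  pose proof (Cmod_triangle_sub (c T) (c t) P). rewrite (Cmod_minus_sym (c T) (c t)) in H. lra. }
replace (c T) with ((c T - P) + P)%C by ring. rewrite Z. ring.
Qed.

(** * The theorem for plane sets *)

Section Planar.
Variables (W1 W2 : C -> Prop) (J1 J2 JI JU : jet).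
Let WI := fun p => W1 p /\ W2 p.
Let WU := fun p => W1 p \/ W2 p.
Hypotheses (H1 : planar_metric W1 J1) (H2 : planar_metric W2 J2) (HI : planar_metric WI JI) (HU : planar_metric WU JU).
Hypotheses (C1 : curve_complete W1 (ju J1)) (C2 : curve_complete W2 (ju J2)) (CI : curve_complete WI (ju JI)).

Lemma union_metric_le p : WI p -> ju JU p <= ju J1 p /\ ju JU p <= ju J2 p.
Proof.
intros [P1 P2]. split.
- apply (ahlfors W1 J1 JU); auto. eapply pm_sub; [exact HU|apply (pm_open _ _ H1)|]. intros; now left.
- apply (ahlfors W2 J2 JU); auto. eapply pm_sub; [exact HU|apply (pm_open _ _ H2)|]. intros; now right.
Qed.

Lemma HUI : planar_metric WI JU.
Proof. eapply pm_sub; [exact HU|apply plane_open_inter; [apply (pm_open _ _ H1)|apply (pm_open _ _ H2)]|].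
intros p [A B]; now left. Qed.

Lemma planar_product_le p : WI p -> ju JI p + ju JU p <= ju J1 p + ju J2 p.
Proof. intros [P1 P2]. apply (product_le W1 W2); auto. apply HUI. apply union_metric_le. Qed.

(** Equality at [p] makes [p] a maximum of a nonpositive function. With densities [x y = a b] and
    [x^2 + y^2 <= a^2 + b^2], the identity [(a^2 - y^2) (b^2 - y^2) = y^2 (x^2 + y^2 - a^2 - b^2)]
    shows that the left side is not positive. *)
Lemma union_metric_eq_at p : WI p -> ju JI p + ju JU p = ju J1 p + ju J2 p -> ju JU p = ju J1 p \/ ju JU p = ju J2 p.
Proof.
intros Hp E.
set (JJ := jcomb JI JU J1 J2).
pose proof (pm_sub W1 WI J1 H1 (pm_open _ _ HI) (fun p Q => proj1 Q)) as HI1.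
pose proof (pm_sub W2 WI J2 H2 (pm_open _ _ HI) (fun p Q => proj2 Q)) as HI2.
pose proof (jet_comb WI JI JU J1 J2 HI HUI HI1 HI2) as HJJ. fold JJ in HJJ.
assert (TEST : forall e : C, Cmod e = 1 ->
  (jxx JJ p * fst e + jxy JJ p * snd e) * fst e + (jxy JJ p * fst e + jyy JJ p * snd e) * snd e <= 0).
{ intros e He. destruct (jet_line WI JJ p e (pm_open _ _ HI) HJJ Hp) as [d [w' [Hd [A B]]]].
  destruct (pm_open _ _ HI p Hp) as [r [Hr K]].
  apply (second_derivative_test (fun s => ju JJ (p + e * RtoC s)%C) w' _ (Rmin d r)); auto.
  - now apply Rmin_pos.
  - intros s Hs. apply A. split_min; auto.
  - intros s Hs. assert (Hs' : Rabs s < r) by (split_min; auto).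
    replace (p + e * RtoC 0)%C with p by ring.
    assert (ju JJ p = 0) by (unfold JJ, jcomb; cbn [ju]; lra). rewrite H.
    pose proof (planar_product_le (p + e * RtoC s)%C) as Q.
    unfold JJ, jcomb; cbn [ju]. cut (ju JI (p + e * RtoC s) + ju JU (p + e * RtoC s) <= ju J1 (p + e * RtoC s) + ju J2
      (p + e * RtoC s)); [lra|].
    apply Q, K. replace (p + e * RtoC s - p)%C with (e * RtoC s)%C by ring. rewrite Cmod_mult, He, Cmod_R. lra. }
pose proof (TEST 1%C Cmod_1) as T1. pose proof (TEST Ci Cmod_Ci) as T2. simpl fst in T1, T2. simpl snd in T1, T2.
assert (T : jxx JJ p + jyy JJ p <= 0) by lra.
unfold JJ, jcomb in T; cbn [jxx jyy] in T.
pose proof (pm_L _ _ HI p Hp). pose proof (pm_L _ _ HUI p Hp). pose proof (pm_L _ _ HI1 p Hp).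
pose proof (pm_L _ _ HI2 p Hp).
rewrite exp_sq in *.
destruct (union_metric_le p Hp) as [U1 U2].
assert (EE : exp (ju JI p) * exp (ju JU p) = exp (ju J1 p) * exp (ju J2 p)) by (rewrite <- !exp_plus; now f_equal).
pose proof (exp_le _ _ U1) as V1. pose proof (exp_le _ _ U2) as V2.
pose proof (exp_pos (ju JU p)) as PU.
destruct (Req_dec (ju JU p) (ju J1 p)) as [|N1]; auto. destruct (Req_dec (ju JU p) (ju J2 p)) as [|N2]; auto. exfalso.
assert (L1 : exp (ju JU p) < exp (ju J1 p)) by (apply exp_increasing; lra).
assert (L2 : exp (ju JU p) < exp (ju J2 p)) by (apply exp_increasing; lra).
set (a := exp (ju J1 p)) in *. set (b := exp (ju J2 p)) in *. set (y := exp (ju JU p)) in *.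
set (x := exp (ju JI p)) in *.
assert (Q : x ^ 2 + y ^ 2 <= a ^ 2 + b ^ 2) by lra.
assert (EE2 : x ^ 2 * y ^ 2 = a ^ 2 * b ^ 2) by (rewrite <- !Rpow_mult_distr, EE; ring).
assert (0 < a ^ 2 - y ^ 2) by nra. assert (0 < b ^ 2 - y ^ 2) by nra.
assert (0 < (a ^ 2 - y ^ 2) * (b ^ 2 - y ^ 2)) by (apply Rmult_lt_0_compat; auto).
assert (0 < y ^ 2) by nra.
assert ((x ^ 2 + y ^ 2) * y ^ 2 <= (a ^ 2 + b ^ 2) * y ^ 2) by (apply Rmult_le_compat_r; lra). nra.
Qed.
End Planar.

Lemma equality_subset W1 W2 J1 J2 JI JU p :
  planar_metric W1 J1 -> planar_metric W2 J2 -> planar_metric (fun p => W1 p /\ W2 p) JI ->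
    planar_metric (fun p => W1 p \/ W2 p) JU ->
  curve_complete W1 (ju J1) -> curve_complete W2 (ju J2) -> curve_complete (fun p => W1 p /\ W2 p) (ju JI) ->
  plane_connected W1 -> plane_connected W2 -> W1 p -> W2 p -> ju JU p = ju J1 p ->
  (forall q, W2 q -> W1 q) /\ (forall q, W1 q -> W2 q -> ju JI q + ju JU q = ju J1 q + ju J2 q).
Proof.
intros H1 H2 HI HU C1 C2 CI N1 N2 P1 P2 Ep.
assert (HU1 : planar_metric W1 JU). { eapply pm_sub; [exact HU|apply (pm_open _ _ H1)|]. intros; now left. }
assert (E1 : forall q, W1 q -> ju JU q = ju J1 q).
{ apply (strong_max W1 J1 JU p); auto. apply ahlfors; auto. }
assert (S : forall q, W2 q -> W1 q).
{ destruct (N2 (fun q => W1 q /\ W2 q) (fun q => W2 q /\ ~ W1 q)) as [A|B].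
  - apply (pm_open _ _ HI).
  - intros q [A B]. destruct (no_escape W1 _ J1 JU q H1 C1 HU) as [r [Hr K]]; auto.
    { intros; symmetry; auto. }
    destruct (pm_open _ _ H2 q A) as [r' [Hr' K']]. exists (Rmin r r'). split; [now apply Rmin_pos|].
    intros y Hy. split_min. split; auto.
  - intros q. split; [|tauto]. intros Wq. destruct (classic (W1 q)); auto.
  - tauto.
  - exfalso. apply (A p). auto.
  - intros q Wq. apply NNPP. intros Hn. apply (B q). auto. }
split; auto.
intros q Q1 Q2. rewrite (E1 q Q1).
(* The intersection is now [W2] itself, so [JI] and [J2] are two complete metrics on it, and
   [ahlfors] applies in both directions. *)
assert (ju JI q = ju J2 q); [|lra].
apply Rle_antisym.
- apply (ahlfors W2 J2 JI); auto. eapply pm_sub; [exact HI|apply (pm_open _ _ H2)|]. intros y Hy; split; auto.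
- apply (ahlfors _ JI J2 HI CI); auto. eapply pm_sub; [exact H2|apply (pm_open _ _ HI)|]. tauto.
Qed.

(** * From densities with partial derivatives to planar metrics *)

Lemma pdist_Cmod (z w : Pt) : pdist z w = Cmod ((z : C) - (w : C)).
Proof. unfold pdist, Cmod. f_equal. simpl. ring. Qed.

Lemma norm2_Cmod (z : Pt) : norm2 z = Cmod (z : C) ^ 2.
Proof. rewrite Cmod_sqr. reflexivity. Qed.

Lemma norm2_eq0 (z : Pt) : norm2 z = 0 <-> (z : C) = 0%C.
Proof.
rewrite norm2_Cmod. split.
- intros H. apply Cmod_eq_0. apply Rsqr_0_uniq. unfold Rsqr. rewrite <- H. ring.
- intros ->. rewrite Cmod_0. ring.
Qed.

Lemma cinv_Cinv (z : Pt) : cinv z = (/ (z : C))%C.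
Proof. unfold cinv, norm2, Cinv. f_equal; simpl; f_equal; ring. Qed.

Lemma mvt_between (f f' : R -> R) a b : (forall t, Rmin a b <= t <= Rmax a b -> is_derive f t (f' t)) ->
  exists c, Rmin a b <= c <= Rmax a b /\ f b - f a = f' c * (b - a).
Proof.
intros H. destruct (Rtotal_order a b) as [h|[->|h]].
- rewrite Rmin_left, Rmax_right in * by lra. destruct (is_derive_MVT f f' a b h H) as [c [Hc E]].
  exists c; split; auto; lra.
- exists b. rewrite Rmin_left, Rmax_right by lra. split; [lra|ring].
- rewrite Rmin_right, Rmax_left in * by lra. destruct (is_derive_MVT f f' b a h H) as [c [Hc E]].
  exists c; split; [lra|].
  lra.
Qed.

(** Two applications of the mean value theorem, along the vertical and the horizontal side of the
    path from [p] to [q] with corner [(fst p, snd q)]. *)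
Lemma grad_of_partials (f fx fy : C -> R) (W : C -> Prop) p r : 0 < r ->
  (forall q, Cmod (q - p) < r -> W q) -> partial_x f fx W -> partial_y f fy W -> fcont fx p -> fcont fy p ->
  grad f p (fx p) (fy p).
Proof.
intros Hr HW Px Py Cx Cy e He.
destruct (Cx (e/2)) as [d1 [Hd1 K1]]; [lra|]. destruct (Cy (e/2)) as [d2 [Hd2 K2]]; [lra|].
set (d := Rmin r (Rmin d1 d2)). assert (Hd : 0 < d) by (unfold d; repeat apply Rmin_pos; auto).
exists (d / 2). split; [lra|]. intros q Hq.
set (px := fst p) in *. set (py := snd p) in *. set (qx := fst q) in *. set (qy := snd q) in *.
pose proof (fst_le_Cmod (q - p)) as F1. pose proof (snd_le_Cmod (q - p)) as F2. rewrite fst_minus in F1.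
rewrite snd_minus in F2.
fold px qx in F1. fold py qy in F2.
assert (IN : forall x y, Rabs (x - px) <= Rabs (qx - px) -> Rabs (y - py) <= Rabs (qy - py) -> Cmod ((x, y) - p) < d).
{ intros x y Hx Hy. eapply Rle_lt_trans; [apply Cmod_le_sum|]. rewrite fst_minus, snd_minus. cbn [fst snd].
  fold px py. lra. }
assert (IN' : forall x y, Cmod ((x, y) - p) < d -> W (x, y) /\ Rabs (fx (x, y) - fx p) < e/2 /\ Rabs (fy (x,
  y) - fy p) < e / 2).
{ intros x y H. unfold d in H. split_min. auto. }
destruct (mvt_between (fun t => f (t, qy)) (fun t => fx (t, qy)) px qx) as [c [Hc E1]].
{ intros t Ht. apply is_derive_Reals. apply (Px (t, qy)). apply IN', IN; [|lra].
  eapply between_abs; [exact Ht|lra]. }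
destruct (mvt_between (fun t => f (px, t)) (fun t => fy (px, t)) py qy) as [c' [Hc' E2]].
{ intros t Ht. apply is_derive_Reals. apply (Py (px, t)). apply IN', IN.
  rewrite Rminus_diag, Rabs_R0; apply Rabs_pos. eapply between_abs; [exact Ht|lra]. }
assert (A1 : Rabs (fx (c, qy) - fx p) < e / 2). { apply IN', IN; [|lra]. eapply between_abs; [exact Hc|lra]. }
assert (A2 : Rabs (fy (px, c') - fy p) < e / 2).
{ apply IN', IN. rewrite Rminus_diag, Rabs_R0; apply Rabs_pos. eapply between_abs; [exact Hc'|lra]. }
assert (Eq : q = (qx, qy)) by (unfold qx, qy; now destruct q).
assert (Ep : p = (px, py)) by (unfold px, py; now destruct p).
replace (f q - f p - (fx p * (qx - px) + fy p * (qy - py))) with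
  ((fx (c, qy) - fx p) * (qx - px) + (fy (px, c') - fy p) * (qy - py)).
2: { rewrite Eq at 1. rewrite Ep at 3. lra. }
eapply Rle_trans; [apply Rabs_triang|]. rewrite !Rabs_mult.
assert (Rabs (fx (c, qy) - fx p) * Rabs (qx - px) <= e / 2 * Cmod (q - p)) by (apply Rmult_le_compat;
  try apply Rabs_pos; lra).
assert (Rabs (fy (px, c') - fy p) * Rabs (qy - py) <= e / 2 * Cmod (q - p)) by (apply Rmult_le_compat;
  try apply Rabs_pos; lra).
lra.
Qed.

(** The second difference over a square of side [h] is evaluated once through [fx] and once through
    [fy]; differentiability of both at [p] suffices. *)
Lemma mixed_partials_eq (f fx fy : C -> R) p a b c d r : 0 < r -> (forall q,
  Cmod (q - p) < r -> grad f q (fx q) (fy q)) ->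
  grad fx p a b -> grad fy p c d -> b = c.
Proof.
intros Hr HD Hx Hy.
destruct (Req_dec b c) as [|Hn]; auto. exfalso.
(* Each of the four expansions below is off by at most [e * h], so comparing the two evaluations
   yields [|b - c| <= 4 e], half of [|b - c|]. *)
set (e := Rabs (b - c) / 8). assert (He : 0 < e). { unfold e. assert (0 < Rabs (b - c)) by (apply Rabs_pos_lt; lra).
lra. }
destruct (Hx (e/2)) as [d1 [Hd1 K1]]; [lra|]. destruct (Hy (e/2)) as [d2 [Hd2 K2]]; [lra|].
set (h := Rmin r (Rmin d1 d2) / 4). assert (Hm : 0 < Rmin r (Rmin d1 d2)) by (repeat apply Rmin_pos; auto).
assert (Hh : 0 < h) by (unfold h; lra).
set (x := fst p) in *. set (y := snd p) in *.
assert (Ep : p = (x, y)) by (unfold x, y; now destruct p).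
assert (IN : forall s t, 0 <= s <= h -> 0 <= t <= h -> Cmod ((x + s, y + t) - p) <= 2 * h).
{ intros s t Hs Ht. eapply Rle_trans; [apply Cmod_le_sum|]. rewrite fst_minus, snd_minus. cbn [fst snd]. fold x y.
  replace (x + s - x) with s by ring. replace (y + t - y) with t by ring. rewrite !Rabs_pos_eq; lra. }
assert (H4 : 2 * h < r /\ 2 * h < d1 /\ 2 * h < d2).
{ unfold h. pose proof (Rmin_l r (Rmin d1 d2)). pose proof (Rmin_r r (Rmin d1 d2)). pose proof (Rmin_l d1 d2).
  pose proof (Rmin_r d1 d2). lra. }
assert (DX : forall s t, 0 <= s <= h -> 0 <= t <= h -> is_derive (fun s => f (x + s, y + t)) s (fx (x + s, y + t))).
{ intros s t Hs Ht. eapply is_derive_eq.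
  apply (grad_curve f (fun s => (x + s, y + t) : C) s (fx (x + s, y + t)) (fy (x + s, y + t)) (1, 0)).
  - apply HD. eapply Rle_lt_trans; [apply IN; auto|lra].
  - split; cbn [fst snd]. auto_derive; auto. auto_derive; auto.
  - simpl. req. ring. }
assert (DY : forall s t, 0 <= s <= h -> 0 <= t <= h -> is_derive (fun t => f (x + s, y + t)) t (fy (x + s, y + t))).
{ intros s t Hs Ht. eapply is_derive_eq.
  apply (grad_curve f (fun t => (x + s, y + t) : C) t (fx (x + s, y + t)) (fy (x + s, y + t)) (0, 1)).
  - apply HD. eapply Rle_lt_trans; [apply IN; auto|lra].
  - split; cbn [fst snd]. auto_derive; auto. auto_derive; auto.
  - simpl. req. ring. }
destruct (is_derive_MVT (fun s => f (x + s, y + h) - f (x + s, y + 0)) (fun s => fx (x + s, y + h) - fx (x + s,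
  y + 0)) 0 h Hh) as [s [Hs Es]].
{ intros s Hs. apply is_derive_minus_R; apply DX; lra. }
destruct (is_derive_MVT (fun t => f (x + h, y + t) - f (x + 0, y + t)) (fun t => fy (x + h, y + t) - fy (x + 0,
  y + t)) 0 h Hh) as [t [Ht Et]].
{ intros t Ht. apply is_derive_minus_R; apply DY; lra. }
assert (X : forall s t, 0 <= s <= h -> 0 <= t <= h -> Rabs (fx (x + s, y + t) - fx p - (a * s + b * t)) <= e * h).
{ intros s' t' Hs' Ht'. pose proof (IN s' t' Hs' Ht') as Q. specialize (K1 (x + s', y + t') ltac:(lra)).
  cbn [fst snd] in K1.
  fold x y in K1. replace (x + s' - x) with s' in K1 by ring. replace (y + t' - y) with t' in K1 by ring.
  eapply Rle_trans; [apply K1|]. nra. }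
assert (Y : forall s t, 0 <= s <= h -> 0 <= t <= h -> Rabs (fy (x + s, y + t) - fy p - (c * s + d * t)) <= e * h).
{ intros s' t' Hs' Ht'. pose proof (IN s' t' Hs' Ht') as Q. specialize (K2 (x + s', y + t') ltac:(lra)).
  cbn [fst snd] in K2.
  fold x y in K2. replace (x + s' - x) with s' in K2 by ring. replace (y + t' - y) with t' in K2 by ring.
  eapply Rle_trans; [apply K2|]. nra. }
pose proof (X s h ltac:(lra) ltac:(lra)) as X1. pose proof (X s 0 ltac:(lra) ltac:(lra)) as X2.
pose proof (Y h t ltac:(lra) ltac:(lra)) as Y1. pose proof (Y 0 t ltac:(lra) ltac:(lra)) as Y2.
apply Rabs_le_between in X1, X2, Y1, Y2.
set (A := fx (x + s, y + h) - fx (x + s, y + 0)) in *. set (B := fy (x + h, y + t) - fy (x + 0, y + t)) in *.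
assert (AB : A = B). { apply Rmult_eq_reg_r with h; [|lra]. lra. }
assert (Rabs ((b - c) * h) <= 4 * e * h). { apply Rabs_le. unfold A, B in AB. lra. }
rewrite Rabs_mult, (Rabs_pos_eq h) in H by lra.
assert (Rabs (b - c) <= 4 * e) by (apply Rmult_le_reg_r with h; auto).
unfold e in *. lra.
Qed.

Lemma cont_on_fcont f W p : cont_on f W -> W p -> fcont f p.
Proof.
intros H Hp e He. destruct (H p Hp e He) as [d [Hd K]]. exists d; split; auto.
intros q Hq. apply K. rewrite pdist_Cmod, Cmod_minus_sym. auto.
Qed.

Lemma partial_x_grad g (p : C) a b : grad g p a b -> derivable_pt_lim (fun t => g (t, snd p)) (fst p) a.
Proof.
intros H. apply is_derive_Reals. eapply is_derive_eq.
- apply (grad_curve g (fun t => (t, snd p) : C) (fst p) a b (1, 0)).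
  + now destruct p.
  + split; cbn [fst snd]; auto_derive; auto.
- simpl; req; ring.
Qed.

Lemma partial_y_grad g (p : C) a b : grad g p a b -> derivable_pt_lim (fun t => g (fst p, t)) (snd p) b.
Proof.
intros H. apply is_derive_Reals. eapply is_derive_eq.
- apply (grad_curve g (fun t => (fst p, t) : C) (snd p) a b (0, 1)).
  + now destruct p.
  + split; cbn [fst snd]; auto_derive; auto.
- simpl; req; ring.
Qed.

Lemma derivable_pt_lim_ext_loc f g x l r : 0 < r -> (forall t, Rabs (t - x) < r -> f t = g t) ->
  derivable_pt_lim f x l -> derivable_pt_lim g x l.
Proof.
intros Hr E H. apply is_derive_Reals. apply is_derive_Reals in H.
eapply is_derive_ext_loc; [|exact H]. exists (mkposreal r Hr). intros y Hy. apply E. exact Hy.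
Qed.

(** The jet of [ln f] is computed from the derivatives of [f]. The curvature condition brings its
    own derivatives of [ln f], which uniqueness of limits identifies with these. *)
Lemma C2_jet (f : C -> R) W : plane_open W -> (forall p, W p -> 0 < f p) -> C2_on f W -> curvature_minus_one f W ->
  exists J, planar_metric W J /\ forall p, ju J p = ln (f p).
Proof.
intros HO Hpos [fx [fy [fxx [fxy [fyx [fyy [Px [Py [Pxx [Pxy [Pyx [Pyy [C0 [Cx [Cy [Cxx [Cxy [Cyx
  Cyy]]]]]]]]]]]]]]]]]] [ux [uy [uxx [uyy [Ux [Uy [Uxx [Uyy HL]]]]]]]].
assert (D : forall g gx gy, partial_x g gx W -> partial_y g gy W -> cont_on gx W -> cont_on gy W -> forall p,
  W p -> grad g p (gx p) (gy p)).
{ intros g gx gy A B CA CB p Hp. destruct (HO p Hp) as [r [Hr K]].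
  apply (grad_of_partials g gx gy W p r); auto; eapply cont_on_fcont; eauto. }
pose proof (D f fx fy Px Py Cx Cy) as Df. pose proof (D fx fxx fxy Pxx Pxy Cxx Cxy) as Dx.
pose proof (D fy fyx fyy Pyx Pyy Cyx Cyy) as Dy.
assert (SY : forall p, W p -> fxy p = fyx p).
{ intros p Hp. destruct (HO p Hp) as [r [Hr K]]. apply (mixed_partials_eq f fx fy p (fxx p) _ _ (fyy p) r); auto. }
set (J := {| ju := fun p => ln (f p); jx := fun p => fx p * / f p; jy := fun p => fy p * / f p;
  jxx := fun p => fxx p * / f p + (- 1) * (fx p * (fx p * / (f p * f p)));
  jxy := fun p => fxy p * / f p + (- 1) * (fx p * (fy p * / (f p * f p)));
  jyy := fun p => fyy p * / f p + (- 1) * (fy p * (fy p * / (f p * f p))) |}).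
assert (Di : forall p, W p -> grad (fun q => / f q) p (- / (f p * f p) * fx p) (- / (f p * f p) * fy p)).
{ intros p Hp. specialize (Hpos p Hp). apply (grad_comp Rinv f); auto. auto_derive; [lra|field; lra]. }
assert (J1 : forall p, W p -> grad (ju J) p (jx J p) (jy J p)).
{ intros p Hp. specialize (Hpos p Hp). eapply grad_eq.
  apply (grad_comp ln f p (fx p) (fy p) (/ f p)); [now apply Df|auto_derive; [lra|field; lra]].
  simpl; ring. simpl; ring. }
assert (J2 : forall p, W p -> grad (jx J) p (jxx J p) (jxy J p)).
{ intros p Hp. pose proof (Hpos p Hp). eapply grad_eq. apply grad_mult; [now apply Dx|now apply Di].
  simpl; field; lra. simpl; field; lra. }
assert (J3 : forall p, W p -> grad (jy J) p (jxy J p) (jyy J p)).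
{ intros p Hp. pose proof (Hpos p Hp). eapply grad_eq. apply grad_mult; [now apply Dy|now apply Di].
  simpl; rewrite (SY p Hp); field; lra. simpl; field; lra. }
assert (Cf : forall p, W p -> fcont f p) by (intros; eapply cont_on_fcont; eauto).
assert (Ci1 : forall p, W p -> fcont (fun q => / f q) p) by (intros p Hp; eapply grad_cont; apply (Di p Hp)).
assert (Ci2 : forall p, W p -> fcont (fun q => / (f q * f q)) p).
{ intros p Hp. pose proof (Hpos p Hp). apply (fcont_comp (fun t => / (t * t)) f); [now apply Cf|].
  apply (is_derive_continuity_pt _ _ (Derive (fun t => / (t * t)) (f p))). apply Derive_correct. auto_derive. nra. }
exists J. split; [|reflexivity].
constructor; auto.
- intros p Hp. simpl. apply fcont_plus; [apply fcont_mult; auto; eapply cont_on_fcont; eauto|].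
  apply fcont_scal. repeat apply fcont_mult; auto; eapply cont_on_fcont; eauto.
- intros p Hp. simpl. apply fcont_plus; [apply fcont_mult; auto; eapply cont_on_fcont; eauto|].
  apply fcont_scal. repeat apply fcont_mult; auto; eapply cont_on_fcont; eauto.
- intros p Hp. simpl. apply fcont_plus; [apply fcont_mult; auto; eapply cont_on_fcont; eauto|].
  apply fcont_scal. repeat apply fcont_mult; auto; eapply cont_on_fcont; eauto.
- intros p Hp.
  assert (EX : forall q, W q -> ux q = jx J q).
  { intros q Hq. eapply uniqueness_limite; [apply (Ux q Hq)|]. apply (partial_x_grad (ju J) q _ _ (J1 q Hq)). }
  assert (EY : forall q, W q -> uy q = jy J q).
  { intros q Hq. eapply uniqueness_limite; [apply (Uy q Hq)|]. apply (partial_y_grad (ju J) q _ _ (J1 q Hq)). }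
  destruct (HO p Hp) as [r [Hr K]].
  assert (EXX : uxx p = jxx J p).
  { eapply uniqueness_limite; [apply (Uxx p Hp)|].
    apply (derivable_pt_lim_ext_loc (fun t => jx J (t, snd p)) _ _ _ r Hr);
      [|apply (partial_x_grad (jx J) p _ _ (J2 p Hp))].
    intros t Ht. symmetry. apply EX, K. eapply Rle_lt_trans; [apply Cmod_le_sum|]. rewrite fst_minus, snd_minus.
    cbn [fst snd].
    rewrite Rminus_diag, Rabs_R0. lra. }
  assert (EYY : uyy p = jyy J p).
  { eapply uniqueness_limite; [apply (Uyy p Hp)|].
    apply (derivable_pt_lim_ext_loc (fun t => jy J (fst p, t)) _ _ _ r Hr);
      [|apply (partial_y_grad (jy J) p _ _ (J3 p Hp))].
    intros t Ht. symmetry. apply EY, K. eapply Rle_lt_trans; [apply Cmod_le_sum|]. rewrite fst_minus, snd_minus.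
    cbn [fst snd].
    rewrite Rminus_diag, Rabs_R0. lra. }
  rewrite <- EXX, <- EYY, HL by auto. simpl. rewrite exp_sq, exp_ln by auto. ring.
Qed.

(** The derivatives are determined by [u], so jets chosen around different points agree on overlaps,
    and the jet that takes at [p] the one chosen for [p] is locally a single one of them. *)
Lemma jet_patch (W : C -> Prop) (u : C -> R) : plane_open W ->
  (forall p, W p -> exists r J, 0 < r /\ planar_metric (fun q => Cmod (q - p) < r) J /\ forall q,
    Cmod (q - p) < r -> ju J q = u q) ->
  exists J, planar_metric W J /\ forall q, ju J q = u q.
Proof.
intros HO HL.
assert (CH : forall p, {rJ : R * jet | W p ->
  0 < fst rJ /\ planar_metric (fun q => Cmod (q - p) < fst rJ) (snd rJ) /\ forall q,
    Cmod (q - p) < fst rJ -> ju (snd rJ) q = u q}).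
{ intros p. apply constructive_indefinite_description. destruct (classic (W p)) as [Hp|Hp].
  - destruct (HL p Hp) as [r [J H]]. exists (r, J). auto.
  - exists (0, {| ju := u; jx := u; jy := u; jxx := u; jxy := u; jyy := u |}). intros; contradiction. }
set (rr := fun p => fst (proj1_sig (CH p))). set (Jp := fun p => snd (proj1_sig (CH p))).
assert (HJ : forall p, W p -> 0 < rr p /\ planar_metric (fun q => Cmod (q - p) < rr p) (Jp p) /\ forall q,
  Cmod (q - p) < rr p -> ju (Jp p) q = u q).
{ intros p. unfold rr, Jp. destruct (CH p); auto. }
assert (Z : forall p : C, Cmod (p - p) = 0). { intros p. replace (p - p)%C with (RtoC 0) by ring. apply Cmod_0. }
assert (AG1 : forall p q x, W p -> W q -> Cmod (x - p) < rr p -> Cmod (x - q) < rr q ->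
   jx (Jp p) x = jx (Jp q) x /\ jy (Jp p) x = jy (Jp q) x).
{ intros p q x Hp Hq X1 X2. destruct (HJ p Hp) as [A1 [A2 A3]]. destruct (HJ q Hq) as [B1 [B2 B3]].
  apply (grad_unique u x).
  - apply (grad_ext_loc (ju (Jp p)) u x _ _ (rr p - Cmod (x - p))); [lra| |apply (pm_u _ _ A2); auto].
    intros y Hy. apply A3. eapply Rle_lt_trans; [apply (Cmod_triangle_sub _ x)|]. lra.
  - apply (grad_ext_loc (ju (Jp q)) u x _ _ (rr q - Cmod (x - q))); [lra| |apply (pm_u _ _ B2); auto].
    intros y Hy. apply B3. eapply Rle_lt_trans; [apply (Cmod_triangle_sub _ x)|]. lra. }
assert (AG2 : forall p q x, W p -> W q -> Cmod (x - p) < rr p -> Cmod (x - q) < rr q ->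
   jxx (Jp p) x = jxx (Jp q) x /\ jxy (Jp p) x = jxy (Jp q) x /\ jyy (Jp p) x = jyy (Jp q) x).
{ intros p q x Hp Hq X1 X2. destruct (HJ p Hp) as [A1 [A2 A3]]. destruct (HJ q Hq) as [B1 [B2 B3]].
  set (d := Rmin (rr p - Cmod (x - p)) (rr q - Cmod (x - q))). assert (Hd : 0 < d) by (unfold d; apply Rmin_pos; lra).
  assert (IN : forall y, Cmod (y - x) < d -> Cmod (y - p) < rr p /\ Cmod (y - q) < rr q).
  { intros y Hy. assert (Q : Cmod (y - x) < rr p - Cmod (x - p) /\ Cmod (y - x) < rr q - Cmod (x - q)) by (unfold d in
      Hy; split_min; auto).
    destruct Q. split; (eapply Rle_lt_trans; [apply (Cmod_triangle_sub _ x)|]; lra). }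
  assert (E1 : jxx (Jp p) x = jxx (Jp q) x /\ jxy (Jp p) x = jxy (Jp q) x).
  { apply (grad_unique (jx (Jp q)) x); [|apply (pm_ux _ _ B2); auto].
    apply (grad_ext_loc (jx (Jp p)) _ x _ _ d Hd); [|apply (pm_ux _ _ A2); auto].
    intros y Hy. destruct (IN y Hy). apply (AG1 p q y); auto. }
  assert (E2 : jxy (Jp p) x = jxy (Jp q) x /\ jyy (Jp p) x = jyy (Jp q) x).
  { apply (grad_unique (jy (Jp q)) x); [|apply (pm_uy _ _ B2); auto].
    apply (grad_ext_loc (jy (Jp p)) _ x _ _ d Hd); [|apply (pm_uy _ _ A2); auto].
    intros y Hy. destruct (IN y Hy). apply (AG1 p q y); auto. }
  tauto. }
exists {| ju := u; jx := fun p => jx (Jp p) p; jy := fun p => jy (Jp p) p; jxx := fun p => jxx (Jp p) p;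
   jxy := fun p => jxy (Jp p) p; jyy := fun p => jyy (Jp p) p |}.
split; [|reflexivity].
assert (NB : forall p, W p -> exists d, 0 < d /\ forall y,
  Cmod (y - p) < d -> Cmod (y - p) < rr p /\ W y /\ Cmod (y - y) < rr y).
{ intros p Hp. destruct (HJ p Hp) as [A1 _]. destruct (HO p Hp) as [r [Hr K]]. exists (Rmin r (rr p)).
  split; [now apply Rmin_pos|]. intros y Hy.
  assert (Q : Cmod (y - p) < r /\ Cmod (y - p) < rr p) by (split_min; auto). destruct Q. split; auto. split; auto.
  rewrite Z. apply HJ; auto. }
assert (TR : forall (f : jet -> C -> R) p, W p -> (forall q x,
  W q -> Cmod (x - p) < rr p -> Cmod (x - q) < rr q -> f (Jp p) x = f (Jp q) x) ->
   exists d, 0 < d /\ forall y, Cmod (y - p) < d -> f (Jp p) y = f (Jp y) y).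
{ intros f p Hp H. destruct (NB p Hp) as [d [Hd K]]. exists d; split; auto. intros y Hy.
  destruct (K y Hy) as [Q1 [Q2 Q3]]. auto. }
constructor; auto; cbn [ju jx jy jxx jxy jyy]; intros p Hp; destruct (HJ p Hp) as [A1 [A2 A3]];
 assert (Z0 : Cmod (p - p) < rr p) by (rewrite Z; auto).
- apply (grad_ext_loc (ju (Jp p)) u p _ _ (rr p)); auto. apply (pm_u _ _ A2); auto.
- destruct (TR jx p Hp) as [d [Hd K]]. { intros; apply AG1; auto. }
  apply (grad_ext_loc (jx (Jp p)) _ p _ _ d Hd); auto. apply (pm_ux _ _ A2); auto.
- destruct (TR jy p Hp) as [d [Hd K]]. { intros; apply AG1; auto. }
  apply (grad_ext_loc (jy (Jp p)) _ p _ _ d Hd); auto. apply (pm_uy _ _ A2); auto.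
- destruct (TR jxx p Hp) as [d [Hd K]]. { intros; apply AG2; auto. }
  apply (fcont_ext_loc (jxx (Jp p)) _ p d Hd); auto. apply (pm_cxx _ _ A2); auto.
- destruct (TR jxy p Hp) as [d [Hd K]]. { intros; apply AG2; auto. }
  apply (fcont_ext_loc (jxy (Jp p)) _ p d Hd); auto. apply (pm_cxy _ _ A2); auto.
- destruct (TR jyy p Hp) as [d [Hd K]]. { intros; apply AG2; auto. }
  apply (fcont_ext_loc (jyy (Jp p)) _ p d Hd); auto. apply (pm_cyy _ _ A2); auto.
- rewrite <- A3 by auto. apply (pm_L _ _ A2); auto.
Qed.

(** * Moebius maps and the pull-back of planar metrics *)

(** [A] and [B] are the partial derivatives of [f] in the real and the imaginary direction. *)
Definition cgrad (f : C -> C) (p A B : C) : Prop :=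
  grad (fun q => fst (f q)) p (fst A) (fst B) /\ grad (fun q => snd (f q)) p (snd A) (snd B).

Lemma holo_cgrad F z g : holo F z g -> cgrad F z g (Ci * g)%C.
Proof.
intros H. destruct (holo_grad _ _ _ H) as [A B]. split; (eapply grad_eq; [eassumption| |]); simpl; ring.
Qed.

Lemma cgrad_mult f g p A B A' B' : cgrad f p A B -> cgrad g p A' B' ->
  cgrad (fun q => f q * g q)%C p (A * g p + f p * A')%C (B * g p + f p * B')%C.
Proof.
intros [F1 F2] [G1 G2]. split; simpl.
- eapply grad_eq. apply grad_minus; apply grad_mult; eassumption. simpl; ring. simpl; ring.
- eapply grad_eq. apply grad_plus; apply grad_mult; eassumption. simpl; ring. simpl; ring.
Qed.

Lemma cgrad_minus f g p A B A' B' : cgrad f p A B -> cgrad g p A' B' ->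
  cgrad (fun q => f q - g q)%C p (A - A')%C (B - B')%C.
Proof.
intros [F1 F2] [G1 G2]. split; simpl; apply grad_minus; assumption.
Qed.

Lemma cgrad_const c p : cgrad (fun _ => c) p 0%C 0%C.
Proof. split; apply grad_const. Qed.

Section Mob.
Variables al be ga de : C.
(** Modulus 1, since exchanging the rows of the matrix, as is done for the chart at infinity,
    changes the sign of the determinant. *)
Hypothesis Hdet : Cmod (al * de - be * ga) = 1.
Definition mob_den (w : C) : C := (ga * w + de)%C.
Definition mob (w : C) : C := ((al * w + be) / (ga * w + de))%C.
Let dt := (al * de - be * ga)%C.

Lemma mob_holo w : mob_den w <> 0%C -> holo mob w (dt / (mob_den w * mob_den w))%C.
Proof.
intros Hn e He. set (n := mob_den w) in *. assert (Hn0 : 0 < Cmod n) by (apply Cmod_gt_0; auto).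
set (G := Cmod ga + 1). assert (HG : 0 < G) by (unfold G; pose proof (Cmod_ge_0 ga); lra).
exists (Rmin (Cmod n / (2 * G)) (e * Cmod n ^ 3 / (2 * G))).
assert (H3 : 0 < Cmod n ^ 3) by (apply pow_lt; auto).
split. { apply Rmin_pos; apply Rdiv_lt_0_compat; nra. }
intros z Hz. assert (Q : Cmod z < Cmod n / (2 * G) /\ Cmod z < e * Cmod n ^ 3 / (2 * G)) by (split_min; auto).
destruct Q as [Q1 Q2]. pose proof (Cmod_ge_0 z) as z0.
apply Rmult_lt_compat_l with (r := 2 * G) in Q1; [|lra].
replace (2 * G * (Cmod n / (2 * G))) with (Cmod n) in Q1 by (field; lra).
apply Rmult_lt_compat_l with (r := 2 * G) in Q2; [|lra].
replace (2 * G * (e * Cmod n ^ 3 / (2 * G))) with (e * Cmod n ^ 3) in Q2 by (field; lra).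
assert (Hgz : Cmod (ga * z) <= G * Cmod z). { rewrite Cmod_mult. apply Rmult_le_compat_r; auto. unfold G; lra. }
set (n' := (n + ga * z)%C).
assert (Hn' : Cmod n / 2 <= Cmod n').
{ unfold n'. pose proof (Cmod_minus_le (n + ga * z) (ga * z)) as T.
  replace (n + ga * z - ga * z)%C with n in T by ring. lra. }
assert (Nn' : n' <> 0%C) by (apply Cmod_neq0; lra).
assert (E : (mob (w + z) - mob w - z * (dt / (n * n)))%C = (- dt * ga * (z * z) / (n * n * n'))%C).
{ unfold mob. replace (ga * (w + z) + de)%C with n' by (unfold n', n, mob_den; ring). fold (mob_den w). fold n.
  assert (En : de = (n - ga * w)%C) by (unfold n, mob_den; ring).
  unfold dt. unfold n' in *. rewrite En. field. split; auto. }
rewrite E, Cmod_div, !Cmod_mult, Cmod_opp. 2: { repeat apply Cmult_neq_0; auto. }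
fold dt in Hdet. rewrite Hdet, Rmult_1_l. rewrite Cmod_mult in Hgz.
assert (I : / (Cmod n * Cmod n * Cmod n') <= 2 / Cmod n ^ 3).
{ replace (2 / Cmod n ^ 3) with (/ (Cmod n * Cmod n * (Cmod n / 2))) by (field; lra).
  apply Rinv_le_contravar. repeat apply Rmult_lt_0_compat; lra. apply Rmult_le_compat_l; nra. }
unfold Rdiv at 1. apply Rle_trans with (G * Cmod z * Cmod z * (2 / Cmod n ^ 3)).
- apply Rmult_le_compat; auto. pose proof (Cmod_ge_0 ga). apply Rmult_le_pos; nra.
  left; apply Rinv_0_lt_compat. repeat apply Rmult_lt_0_compat; lra. nra.
- replace (G * Cmod z * Cmod z * (2 / Cmod n ^ 3)) with (2 * G * Cmod z * / Cmod n ^ 3 * Cmod z) by (field; lra).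
  apply Rmult_le_compat_r; auto. apply Rmult_le_reg_r with (Cmod n ^ 3); auto.
  rewrite Rmult_assoc, Rinv_l by lra. lra.
Qed.

Lemma mob_den_holo w : holo mob_den w ga.
Proof.
intros e He. exists 1; split; [lra|]. intros z _. unfold mob_den.
replace (ga * (w + z) + de - (ga * w + de) - z * ga)%C with (RtoC 0) by ring. rewrite Cmod_0.
pose proof (Cmod_ge_0 z); nra.
Qed.

Lemma mob_den_open w : mob_den w <> 0%C -> exists r, 0 < r /\ forall q, Cmod (q - w) < r -> mob_den q <> 0%C.
Proof.
intros H. apply Cmod_gt_0 in H. destruct (holo_cont _ _ _ (mob_den_holo w) (Cmod (mob_den w)) H) as [r [Hr K]].
exists r; split; auto. intros q Hq E. specialize (K q Hq). rewrite E in K.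
replace (0 - mob_den w)%C with (- mob_den w)%C in K by ring. rewrite Cmod_opp in K. lra.
Qed.
End Mob.

Lemma grad_fcont_comp (f : C -> R) (phi : C -> C) p A B : cgrad phi p A B -> fcont f (phi p) ->
  fcont (fun q => f (phi q)) p.
Proof. intros [H1 H2] H. apply fcont_compC; auto; eapply grad_cont; eassumption. Qed.

(** Conformal pull-back: the derivative of the Moebius map has modulus [1 / |mob_den|^2], and the
    logarithm of this modulus is added to [u]. The jet is written with complex derivatives, where
    the holomorphic factors are easy to differentiate. *)
Lemma mob_jet al be ga de (W : C -> Prop) J : Cmod (al * de - be * ga) = 1 -> planar_metric W J ->
  exists J', planar_metric (fun w => mob_den ga de w <> 0%C /\ W (mob al be ga de w)) J' /\
    forall w, ju J' w = ju J (mob al be ga de w) - ln (Cmod (mob_den ga de w) ^ 2).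
Proof.
intros Hdet HJ. set (T := mob al be ga de). set (n := mob_den ga de). set (dt := (al * de - be * ga)%C).
set (h := fun w => (/ n w)%C).
assert (Hh : forall w, n w <> 0%C -> holo h w (- ga * (h w * h w))%C).
{ intros w Hn. intros e He.
  destruct (classic (ga = 0%C)) as [G0|G0].
  - assert (Ec : forall q, h q = (/ de)%C). { intros q. unfold h, n, mob_den. f_equal. rewrite G0. ring. }
    exists 1; split; [lra|]. intros z _. rewrite !Ec, G0.
    replace (/ de - / de - z * (- 0 * (/ de * / de)))%C with (RtoC 0) by ring. rewrite Cmod_0.
    pose proof (Cmod_ge_0 z); nra.
  - (* [1 / mob_den] is a multiple of the Moebius map with matrix [(0, - 1 / ga; ga, de)]. *)
    assert (Hd : Cmod (0 * de - (- / ga) * ga) = 1).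
    { replace (0 * de - - / ga * ga)%C with (RtoC 1) by (field; auto). apply Cmod_1. }
    destruct (mob_holo 0 (- / ga)%C ga de Hd w Hn (e / (Cmod ga + 1))) as [d [Hd' K]].
    { apply Rdiv_lt_0_compat; auto. pose proof (Cmod_ge_0 ga); lra. }
    exists d; split; auto. intros z Hz. specialize (K z Hz).
    assert (Eh : forall q, h q = (- ga * mob 0 (- / ga) ga de q)%C).
    { intros q. unfold h, mob, n, mob_den. unfold Cdiv. rewrite Cmult_0_l, Cplus_0_l.
      transitivity ((ga * / ga) * / (ga * q + de))%C; [|ring]. rewrite Cinv_r by auto. ring. }
    rewrite (Eh (w + z)%C), (Eh w).
    replace (- ga * mob 0 (- / ga) ga de (w + z) - - ga * mob 0 (- / ga) ga de w - z * (- ga * (- ga * mob 0 (- / ga)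
      ga de w * (- ga * mob 0 (- / ga) ga de w))))%C
     with (- ga * (mob 0 (- / ga) ga de (w + z) - mob 0 (- / ga) ga de w - z * (ga * ga * mob 0 (- / ga) ga de w * mob
       0 (- / ga) ga de w)))%C by ring.
    rewrite Cmod_mult, Cmod_opp.
    replace (ga * ga * mob 0 (- / ga) ga de w * mob 0 (- / ga) ga de w)%C with ((0 * de - - / ga * ga) / (mob_den ga
      de w * mob_den ga de w))%C.
    2: { unfold mob. fold (mob_den ga de w). unfold n in Hn. field. auto. }
    pose proof (Cmod_ge_0 ga). apply Rle_trans with ((Cmod ga + 1) * (e / (Cmod ga + 1) * Cmod z)).
    + apply Rmult_le_compat; auto; try lra. apply Cmod_ge_0.
    + right; field; lra. }
set (T' := fun w => (dt * (h w * h w))%C).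
assert (HT : forall w, n w <> 0%C -> cgrad T w (T' w) (Ci * T' w)%C).
{ intros w Hn. assert (E : T' w = (dt / (n w * n w))%C) by (unfold T', h; field; auto). rewrite E. apply holo_cgrad.
  apply mob_holo; auto. }
set (X := fun w => (- ga * (h w * h w))%C).
assert (Hh1 : forall w, n w <> 0%C -> cgrad h w (X w) (Ci * X w)%C) by (intros; now apply holo_cgrad, Hh).
set (Y := fun w => (dt * (X w * h w + h w * X w))%C).
assert (HT' : forall w, n w <> 0%C -> cgrad T' w (Y w) (Ci * Y w)%C).
{ intros w Hn. unfold T'. pose proof (cgrad_mult (fun _ => dt) (fun w => h w * h w)%C w 0%C 0%C _ _ (cgrad_const dt w)
    (cgrad_mult h h w _ _ _ _ (Hh1 w Hn) (Hh1 w Hn))) as [Q1 Q2].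
  split; (eapply grad_eq; [eassumption| |]); unfold Y; f_equal; ring. }
set (P := fun w => dlog J (T w)).
set (PA := fun w => (jxx J (T w), - jxy J (T w)) : C). set (PB := fun w => (jxy J (T w), - jyy J (T w)) : C).
set (A1 := fun w => (PA w * RtoC (fst (T' w)) + PB w * RtoC (snd (T' w)))%C).
set (B1 := fun w => (PA w * RtoC (- snd (T' w)) + PB w * RtoC (fst (T' w)))%C).
set (V := fun w => n w <> 0%C /\ W (T w)).
assert (HP : forall w, V w -> cgrad P w (A1 w) (B1 w)).
{ intros w [Hn Hw]. destruct (HT w Hn) as [T1 T2].
  pose proof (grad_compC _ T w _ _ _ _ _ _ (pm_ux _ _ HJ (T w) Hw) T1 T2) as Q1.
  pose proof (grad_opp _ _ _ _ (grad_compC _ T w _ _ _ _ _ _ (pm_uy _ _ HJ (T w) Hw) T1 T2)) as Q2.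
  split; (eapply grad_eq; [eassumption| |]); unfold A1, B1, PA, PB; simpl; ring. }
(* Twice the [d_w] derivative of the pulled-back logarithm: its real part is the [x] derivative, its
   imaginary part minus the [y] derivative. *)
set (phi := fun w => (P w * T' w - RtoC 2 * ga * h w)%C).
set (A := fun w => ((A1 w * T' w + P w * Y w) - (0 * h w + RtoC 2 * ga * X w))%C).
set (B := fun w => ((B1 w * T' w + P w * (Ci * Y w)) - (0 * h w + RtoC 2 * ga * (Ci * X w)))%C).
assert (Hphi : forall w, V w -> cgrad phi w (A w) (B w)).
{ intros w Hw. unfold phi, A, B. pose proof (proj1 Hw) as Hn.
  apply cgrad_minus. apply cgrad_mult; auto. apply (cgrad_mult (fun _ => (RtoC 2 * ga)%C)); auto. apply cgrad_const. }
(* Symmetry of the mixed second derivatives. *)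
assert (SYM : forall w, fst (B w) = - snd (A w)).
{ intros w. unfold A, B, A1, B1, PA, PB. simpl. ring. }
assert (Hn2 : forall w, n w <> 0%C -> grad (fun w => ln (Cmod (n w) ^ 2)) w (fst (RtoC 2 * ga * h w)%C) (- snd (RtoC 2
  * ga * h w)%C)).
{ intros w Hn. pose proof (holo_cgrad _ _ _ (mob_den_holo ga de w)) as [N1 N2]. fold n in N1, N2.
  assert (Hp : 0 < Cmod (n w) ^ 2) by (apply pow_lt, Cmod_gt_0; auto).
  apply grad_ext with (f := fun w => ln (fst (n w) * fst (n w) + snd (n w) * snd (n w))).
  { intros q. now rewrite Cmod_sqr. }
  eapply grad_eq.
  - apply (grad_comp ln _ w _ _ (/ Cmod (n w) ^ 2) (grad_plus _ _ _ _ _ _ _ (grad_mult _ _ _ _ _ _ _ N1 N1) (grad_mult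
      _ _ _ _ _ _ _ N2 N2))).
    rewrite Cmod_sqr in *. auto_derive; [auto|field; lra].
  - unfold h, Cinv. rewrite Cmod_sqr in *. simpl. field. simpl in Hp. lra.
  - unfold h, Cinv. rewrite Cmod_sqr in *. simpl. field. simpl in Hp. lra. }
assert (Hu : forall w, V w -> grad (fun w => ju J (T w) - ln (Cmod (n w) ^ 2)) w (fst (phi w)) (- snd (phi w))).
{ intros w [Hn Hw]. destruct (HT w Hn) as [T1 T2].
  eapply grad_eq. apply grad_minus. apply (grad_compC _ T w _ _ _ _ _ _ (pm_u _ _ HJ (T w) Hw) T1 T2). apply Hn2; auto.
  unfold phi, P, dlog. simpl. ring. unfold phi, P, dlog. simpl. ring. }
exists {| ju := fun w => ju J (T w) - ln (Cmod (n w) ^ 2); jx := fun w => fst (phi w); jy := fun w => - snd (phi w);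
  jxx := fun w => fst (A w); jxy := fun w => fst (B w); jyy := fun w => - snd (B w) |}.
split; [|reflexivity].
assert (CC : forall w, V w -> fcont (fun w => fst (A w)) w /\ fcont (fun w => snd (A w)) w /\ fcont (fun w => fst (B
  w)) w /\ fcont (fun w => snd (B w)) w).
{ intros w Hw. pose proof Hw as [Hn HTw].
  set (cc := fun f : C -> C => fcont (fun w => fst (f w)) w /\ fcont (fun w => snd (f w)) w).
  assert (cm : forall f g, cc f -> cc g -> cc (fun w => f w * g w)%C).
  { intros f g [F1 F2] [G1 G2]. split; simpl.
    - apply fcont_ext_loc with (f := fun w => fst (f w) * fst (g w) + (-1) * (snd (f w) * snd (g w))) (r := 1);
        [lra|intros; ring|].
      apply fcont_plus; [|apply fcont_scal]; apply fcont_mult; auto.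
    - apply fcont_plus; apply fcont_mult; auto. }
  assert (cp : forall f g, cc f -> cc g -> cc (fun w => f w + g w)%C).
  { intros f g [F1 F2] [G1 G2]. split; simpl; apply fcont_plus; auto. }
  assert (cs : forall f g, cc f -> cc g -> cc (fun w => f w - g w)%C).
  { intros f g [F1 F2] [G1 G2]. split; simpl.
    - apply fcont_ext_loc with (f := fun w => fst (f w) + (-1) * fst (g w)) (r := 1); [lra|intros; ring|].
      apply fcont_plus; auto; apply fcont_scal; auto.
    - apply fcont_ext_loc with (f := fun w => snd (f w) + (-1) * snd (g w)) (r := 1); [lra|intros; ring|].
      apply fcont_plus; auto; apply fcont_scal; auto. }
  assert (ck : forall c, cc (fun _ => c)) by (intros c; split; apply fcont_const).
  assert (cd : forall f a b, cgrad f w a b -> cc f) by (intros f a b [F1 F2]; split; eapply grad_cont; eassumption).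
  assert (ch : cc h) by (eapply cd, Hh1; auto).
  assert (cX : cc X) by (unfold X; apply cm; auto).
  assert (cT : cc T') by (eapply cd, HT'; auto).
  assert (cY : cc Y) by (unfold Y; apply cm; auto).
  assert (cP : cc P) by (eapply cd, HP; auto).
  assert (cj : forall f, (forall p, W p -> fcont f p) -> fcont (fun w => f (T w)) w).
  { intros f Hf. eapply grad_fcont_comp; [apply HT; auto|]. auto. }
  assert (cneg : forall f, fcont f w -> fcont (fun w => - f w) w).
  { intros f Hf. apply fcont_ext_loc with (f := fun w => (-1) * f w) (r := 1); [lra|intros; ring|].
    now apply fcont_scal. }
  assert (cPA : cc PA). { split; unfold PA; cbn [fst snd]; [|apply cneg]; apply cj;
    [apply (pm_cxx _ _ HJ)|apply (pm_cxy _ _ HJ)]. }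
  assert (cPB : cc PB). { split; unfold PB; cbn [fst snd]; [|apply cneg]; apply cj;
    [apply (pm_cxy _ _ HJ)|apply (pm_cyy _ _ HJ)]. }
  assert (cR : forall f : C -> R, fcont f w -> cc (fun w => RtoC (f w))) by (intros f Hf; split; simpl; auto;
    apply fcont_const).
  assert (cA1 : cc A1). { unfold A1. apply cp; apply cm; auto; apply cR; apply cT. }
  assert (cB1 : cc B1). { unfold B1. apply cp; apply cm; auto; apply cR; try apply cneg; apply cT. }
  assert (cA : cc A). { unfold A. apply cs; apply cp; apply cm; auto. }
  assert (cB : cc B). { unfold B. apply cs; apply cp; apply cm; auto. }
  destruct cA, cB. auto. }
assert (CN : forall f w, fcont f w -> fcont (fun w => - f w) w).
{ intros f w Hf. apply fcont_ext_loc with (f := fun w => (-1) * f w) (r := 1); [lra|intros; ring|].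
  now apply fcont_scal. }
constructor; cbn [ju jx jy jxx jxy jyy]; auto.
- intros w [Hn Hw]. destruct (mob_den_open ga de w Hn) as [r1 [Hr1 K1]].
  destruct (pm_open _ _ HJ _ Hw) as [e [He Ke]].
  destruct (holo_cont T w (dt / (n w * n w))%C) with (e := e) as [r2 [Hr2 K2]]; auto. { apply mob_holo; auto. }
  exists (Rmin r1 r2). split; [now apply Rmin_pos|]. intros q Hq.
  assert (Q : Cmod (q - w) < r1 /\ Cmod (q - w) < r2) by (split_min; auto). destruct Q. split; auto.
- intros w Hw. apply Hphi, Hw.
- intros w Hw. destruct (Hphi w Hw) as [_ H2]. eapply grad_eq. apply grad_opp, H2. rewrite SYM; ring. ring.
- intros w Hw; apply CC, Hw.
- intros w Hw; apply CC, Hw.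
- intros w Hw; apply CN, CC, Hw.
- intros w [Hn Hw].
  (* [ln |mob_den|^2] is harmonic, and composition with a holomorphic map multiplies the Laplacian
     by [|T'|^2]. *)
  assert (E : fst (A w) + - snd (B w) = (jxx J (T w) + jyy J (T w)) * Cmod (T' w) ^ 2).
  { rewrite Cmod_sqr. unfold A, B, A1, B1, PA, PB. simpl. ring. }
  rewrite E, (pm_L _ _ HJ _ Hw).
  assert (Hp : 0 < Cmod (n w)) by (apply Cmod_gt_0; auto).
  assert (ET : Cmod (T' w) = / Cmod (n w) ^ 2).
  { unfold T', h. rewrite !Cmod_mult, Cmod_inv by auto. unfold dt. rewrite Hdet. field. lra. }
  rewrite ET. replace (2 * (ju J (T w) - ln (Cmod (n w) ^ 2))) with (2 * ju J (T w) + - (2 * ln (Cmod (n w) ^ 2))) by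
    ring.
  rewrite exp_plus, exp_Ropp, (exp_sq (ln _)), exp_ln by (apply pow_lt; auto). field. lra.
Qed.

Lemma plane_open_ball (p : C) r : plane_open (fun q => Cmod (q - p) < r).
Proof.
intros q Hq. exists (r - Cmod (q - p)). split; [lra|]. intros x Hx.
eapply Rle_lt_trans; [apply (Cmod_triangle_sub _ q)|]. lra.
Qed.

Lemma mob_cont al be ga de w e : Cmod (al * de - be * ga) = 1 -> mob_den ga de w <> 0%C -> 0 < e ->
  exists d, 0 < d /\ forall q, Cmod (q - w) < d ->
    mob_den ga de q <> 0%C /\ Cmod (mob al be ga de q - mob al be ga de w) < e.
Proof.
intros Hd Hn He. destruct (mob_den_open ga de w Hn) as [r [Hr K]].
destruct (holo_cont _ _ _ (mob_holo al be ga de Hd w Hn) e He) as [d [Hd' K']].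
exists (Rmin r d). split; [now apply Rmin_pos|]. intros q Hq.
assert (Q : Cmod (q - w) < r /\ Cmod (q - w) < d) by (split_min; auto). destruct Q. split; auto.
Qed.

(** * Charts of the sphere and the planar picture of a spherical metric *)

Lemma Some_inj {A} (x y : A) : Some x = Some y -> x = y.
Proof. congruence. Qed.

Lemma chart_inf_0 : chart_inf (RtoC 0) = None.
Proof. unfold chart_inf. destruct Req_EM_T as [|n]; auto. exfalso. apply n. now apply norm2_eq0. Qed.

Lemma chart_inf_n0 (w : C) : w <> 0%C -> chart_inf w = Some (Cinv w).
Proof.
intros H. unfold chart_inf. destruct Req_EM_T as [e|n].
- exfalso. apply H. now apply norm2_eq0.
- now rewrite cinv_Cinv.
Qed.

Lemma chart_open O c : open_sph O -> plane_open (fun w => O (chart c w)).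
Proof.
intros [H1 H2]. destruct c; simpl.
- intros w Hw. destruct (classic (w = 0%C)) as [E|E].
  + subst w. rewrite chart_inf_0 in Hw. destruct (H2 Hw) as [M [HM K]].
    exists (/ M). split; [now apply Rinv_0_lt_compat|]. intros q Hq.
    replace (q - 0)%C with q in Hq by ring.
    destruct (classic (q = 0%C)) as [E'|E'].
    * subst. now rewrite chart_inf_0.
    * rewrite chart_inf_n0 by auto. apply K. rewrite norm2_Cmod, sqrt_pow2 by apply Cmod_ge_0.
      rewrite Cmod_inv by auto. rewrite <- (Rinv_inv M). apply Rinv_lt_contravar; auto.
      apply Rmult_lt_0_compat; [now apply Cmod_gt_0|now apply Rinv_0_lt_compat].
  + rewrite chart_inf_n0 in Hw by auto. destruct (H1 _ Hw) as [r [Hr K]].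
    assert (Hdet : Cmod (0 * 0 - 1 * 1)%C = 1). { replace (0 * 0 - 1 * 1)%C with (- (1))%C by ring. apply Cmod_m1. }
    assert (Em : forall q, mob_den 1 0 q = q) by (intros; unfold mob_den; ring).
    assert (Eo : forall q : C, q <> 0%C -> mob 0 1 1 0 q = (/ q)%C) .
    { intros q Hq. unfold mob. rewrite Cplus_0_r, !Cmult_1_l, Cmult_0_l, Cplus_0_l. unfold Cdiv. apply Cmult_1_l. }
    destruct (mob_cont 0 1 1 0 w r Hdet) as [d [Hd Kd]]; auto. { rewrite Em; auto. }
    exists d; split; auto. intros q Hq. destruct (Kd q Hq) as [N1 N2]. rewrite Em in N1. rewrite !Eo in N2 by auto.
    rewrite chart_inf_n0 by auto. apply K. rewrite pdist_Cmod, Cmod_minus_sym. exact N2.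
- intros w Hw. destruct (H1 w Hw) as [r [Hr K]]. exists r; split; auto. intros q Hq. apply K.
  rewrite pdist_Cmod, Cmod_minus_sym. auto.
Qed.

Lemma open_sph_inter A B : open_sph A -> open_sph B -> open_sph (inter A B).
Proof.
intros [A1 A2] [B1 B2]. split.
- intros z [Ha Hb]. destruct (A1 z Ha) as [r1 [R1 K1]]. destruct (B1 z Hb) as [r2 [R2 K2]].
  exists (Rmin r1 r2). split; [now apply Rmin_pos|]. intros z' Hz. split_min. split; auto.
- intros [Ha Hb]. destruct (A2 Ha) as [M1 [R1 K1]]. destruct (B2 Hb) as [M2 [R2 K2]].
  exists (M1 + M2). split; [lra|]. intros z Hz. split; [apply K1|apply K2]; lra.
Qed.

Lemma dens_pos O rho c w : (forall p, O p -> 0 < rho p) -> O (chart c w) -> 0 < dens c rho w.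
Proof.
intros H Hw. destruct c; simpl in *; auto. unfold chart_inf in Hw. destruct Req_EM_T as [e|n]; auto.
apply Rdiv_lt_0_compat; auto. rewrite norm2_Cmod in *. pose proof (pow2_ge_0 (Cmod (w : C))). lra.
Qed.

Section Mob.
Variables al be ga de : C.
Hypothesis Hdet : (al * de - be * ga)%C = 1%C.

Definition of_plane (w : C) : Sphere :=
  if excluded_middle_informative (mob_den ga de w = 0%C) then None else Some (mob al be ga de w : Pt).
(** The modulus of the derivative of [of_plane], measured in the coordinate that [rho] uses at the
    image point: [z] at finite points, [1 / z] at infinity. *)
Definition plane_factor (w : C) : R :=
  if excluded_middle_informative (mob_den ga de w = 0%C) then / Cmod (mob_den al be w) ^ 2 else / Cmod (mob_den ga de
    w) ^ 2.
Definition plane_dens (rho : Sphere -> R) (w : C) : R := rho (of_plane w) * plane_factor w.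

(** Passage between the planar coordinate and the coordinate of [chart c]; for [c = true] the latter is [1 / z], which
    exchanges the rows of the matrix, and [of_chart] uses the adjugate matrix. *)
Definition to_chart (c : bool) : C -> C := if c then mob ga de al be else mob al be ga de.
Definition to_chart_den (c : bool) : C -> C := if c then mob_den al be else mob_den ga de.
Definition of_chart (c : bool) : C -> C := if c then mob (- be) de al (- ga) else mob de (- be) (- ga) al.
Definition of_chart_den (c : bool) : C -> C := if c then mob_den al (- ga) else mob_den (- ga) al.
(** The image of infinity under the Moebius map, hence the one point of the sphere that [of_plane]
    misses. *)
Definition pole : Sphere := if excluded_middle_informative (ga = 0%C) then None else Some (Cdiv al ga).

Lemma C1_neq0 : (1%C : C) <> 0%C.
Proof. apply Cmod_neq0. rewrite Cmod_1. lra. Qed.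

Lemma to_chart_det c : match c with true => Cmod (ga * be - de * al) | false => Cmod (al * de - be * ga) end = 1.
Proof.
destruct c; [|rewrite Hdet; apply Cmod_1].
replace (ga * be - de * al)%C with (- (al * de - be * ga))%C by ring. rewrite Hdet, Cmod_opp. apply Cmod_1.
Qed.

Lemma of_chart_det c : match c with true => Cmod (- be * - ga - de * al) | false => Cmod (de * al - - be * - ga) end =
  1.
Proof.
destruct c.
- replace (- be * - ga - de * al)%C with (- (al * de - be * ga))%C by ring. rewrite Hdet, Cmod_opp. apply Cmod_1.
- replace (de * al - - be * - ga)%C with (al * de - be * ga)%C by ring. rewrite Hdet. apply Cmod_1.
Qed.

(** A common zero of both denominators would annul the determinant. Every planar point is thus
    visible in at least one of the two charts. *)
Lemma to_chart_den_ex w : exists c, to_chart_den c w <> 0%C.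
Proof.
destruct (classic (mob_den ga de w = 0%C)) as [E|E]; [|exists false; auto].
exists true. simpl. intros E'. apply C1_neq0. rewrite <- Hdet.
replace (al * de - be * ga)%C with (al * mob_den ga de w - ga * mob_den al be w)%C by (unfold mob_den; ring).
rewrite E, E'. ring.
Qed.

Lemma to_chart_chart c w : to_chart_den c w <> 0%C -> chart c (to_chart c w) = of_plane w.
Proof.
intros H. unfold of_plane. destruct c; simpl in *.
- destruct excluded_middle_informative as [E|E].
  + assert (Z : mob ga de al be w = 0%C). { unfold mob. fold (mob_den ga de w). rewrite E. unfold Cdiv. ring. }
    rewrite Z. apply chart_inf_0.
  + rewrite chart_inf_n0.
    * f_equal. unfold mob. fold (mob_den ga de w) (mob_den al be w). field. auto.
    * unfold mob. fold (mob_den ga de w) (mob_den al be w). intros Z. apply E.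
      replace (mob_den ga de w) with ((mob_den ga de w / mob_den al be w) * mob_den al be w)%C by (field; auto).
      rewrite Z. ring.
- destruct excluded_middle_informative as [E|E]; [contradiction|reflexivity].
Qed.

Lemma to_chart_dens c rho w : to_chart_den c w <> 0%C ->
  dens c rho (to_chart c w) * / Cmod (to_chart_den c w) ^ 2 = plane_dens rho w.
Proof.
intros H. assert (P : 0 < Cmod (to_chart_den c w)) by (now apply Cmod_gt_0).
unfold plane_dens. rewrite <- (to_chart_chart c w H). unfold plane_factor. destruct c; simpl in *.
- unfold chart_inf. rewrite cinv_Cinv, norm2_Cmod.
  destruct (Req_EM_T (Cmod (mob ga de al be w) ^ 2) 0) as [E|E]; rewrite <- norm2_Cmod, norm2_eq0 in E;
  destruct excluded_middle_informative as [E'|E'].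
  + field. simpl. lra.
  + exfalso. apply E'. unfold mob in E. fold (mob_den ga de w) (mob_den al be w) in E.
    replace (mob_den ga de w) with ((mob_den ga de w / mob_den al be w) * mob_den al be w)%C by (field; auto).
    rewrite E. ring.
  + exfalso. apply E. unfold mob. fold (mob_den ga de w) (mob_den al be w). rewrite E'. unfold Cdiv. ring.
  + assert (EM : Cmod (mob ga de al be w) = Cmod (mob_den ga de w) / Cmod (mob_den al be w)) by (unfold mob;
      apply Cmod_div; auto).
    rewrite EM.
    assert (0 < Cmod (mob_den ga de w)) by (now apply Cmod_gt_0). field. lra.
- destruct excluded_middle_informative as [E'|E']; [contradiction|]. reflexivity.
Qed.

Lemma of_chart_to_chart c x : of_chart_den c x <> 0%C ->
  to_chart_den c (of_chart c x) = (/ of_chart_den c x)%C /\ to_chart c (of_chart c x) = x.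
Proof.
intros H. destruct c; simpl in *; unfold mob_den in *; unfold mob.
- assert (A : (al * ((- be * x + de) / (al * x + - ga)) + be)%C = (/ (al * x + - ga))%C).
  { transitivity ((al * de - be * ga) / (al * x + - ga))%C; [field; auto|rewrite Hdet; field; auto]. }
  split; auto. rewrite A.
  transitivity (x * (al * de - be * ga))%C; [field; auto|rewrite Hdet; ring].
- assert (A : (ga * ((de * x + - be) / (- ga * x + al)) + de)%C = (/ (- ga * x + al))%C).
  { transitivity ((al * de - be * ga) / (- ga * x + al))%C; [field; auto|rewrite Hdet; field; auto]. }
  split; auto. rewrite A.
  transitivity (x * (al * de - be * ga))%C; [field; auto|rewrite Hdet; ring].
Qed.

Lemma chart_of_chart c x : of_chart_den c x <> 0%C -> chart c x = of_plane (of_chart c x).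
Proof.
intros H. destruct (of_chart_to_chart c x H) as [A B]. rewrite <- B at 1. apply to_chart_chart. rewrite A.
apply Cmod_neq0. rewrite Cmod_inv by auto. apply Rinv_0_lt_compat. now apply Cmod_gt_0.
Qed.

Lemma of_chart_dens c rho x : of_chart_den c x <> 0%C ->
  plane_dens rho (of_chart c x) = dens c rho x * Cmod (of_chart_den c x) ^ 2.
Proof.
intros H. destruct (of_chart_to_chart c x H) as [A B].
assert (P : 0 < Cmod (of_chart_den c x)) by (now apply Cmod_gt_0).
rewrite <- (to_chart_dens c).
- rewrite A, B, Cmod_inv by auto. field. lra.
- rewrite A. apply Cmod_neq0. rewrite Cmod_inv by auto. now apply Rinv_0_lt_compat.
Qed.

Lemma of_chart_pole c x : of_chart_den c x = 0%C -> chart c x = pole.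
Proof.
intros H. unfold pole. destruct c; simpl in *; unfold mob_den in H.
- destruct excluded_middle_informative as [E|E].
  + assert (al <> 0%C). { intros Z. apply C1_neq0. rewrite <- Hdet, E, Z. ring. }
    assert (x = 0%C). { rewrite E in H. replace x with ((al * x + - 0) / al)%C by (field; auto). rewrite H.
    unfold Cdiv; ring. }
    subst x. apply chart_inf_0.
  + assert (Ex : (al * x = ga)%C). { replace ga with (ga + (al * x + - ga))%C by (rewrite H; ring). ring. }
    assert (x <> 0%C). { intros Z. apply E. rewrite <- Ex, Z. ring. }
    rewrite chart_inf_n0 by auto. f_equal. rewrite <- Ex. field. split; auto. intros Z. apply E. rewrite <- Ex, Z. ring.
- assert (Ex : (al = ga * x)%C). { replace al with (- ga * x + al + ga * x)%C by ring. rewrite H. ring. }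
  destruct excluded_middle_informative as [E|E].
  + exfalso. apply C1_neq0. rewrite <- Hdet, Ex, E. ring.
  + f_equal. rewrite Ex. field. auto.
Qed.

Lemma chart_onto p : exists c x, p = chart c x.
Proof.
destruct p as [z|].
- exists false, z. reflexivity.
- exists true, (RtoC 0). symmetry. apply chart_inf_0.
Qed.

Lemma to_chart_of_chart c w : to_chart_den c w <> 0%C ->
  of_chart_den c (to_chart c w) <> 0%C /\ of_chart c (to_chart c w) = w.
Proof.
intros H. destruct c; simpl in *; unfold mob_den in *; unfold mob.
- assert (A : (al * ((ga * w + de) / (al * w + be)) + - ga)%C = (/ (al * w + be))%C).
  { transitivity ((al * de - be * ga) / (al * w + be))%C; [field; auto|rewrite Hdet; field; auto]. }
  rewrite A. split. { apply Cmod_neq0. rewrite Cmod_inv by auto. apply Rinv_0_lt_compat. now apply Cmod_gt_0. }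
  transitivity (w * (al * de - be * ga))%C; [field; auto|rewrite Hdet; ring].
- assert (A : (- ga * ((al * w + be) / (ga * w + de)) + al)%C = (/ (ga * w + de))%C).
  { transitivity ((al * de - be * ga) / (ga * w + de))%C; [field; auto|rewrite Hdet; field; auto]. }
  rewrite A. split. { apply Cmod_neq0. rewrite Cmod_inv by auto. apply Rinv_0_lt_compat. now apply Cmod_gt_0. }
  transitivity (w * (al * de - be * ga))%C; [field; auto|rewrite Hdet; ring].
Qed.

Lemma of_plane_inj w w' : of_plane w = of_plane w' -> w = w'.
Proof.
intros H. unfold of_plane in H.
destruct (excluded_middle_informative (mob_den ga de w = 0%C)) as [E|E];
destruct (excluded_middle_informative (mob_den ga de w' = 0%C)) as [E'|E']; try discriminate.
- assert (G : ga <> 0%C). { intros Z. apply C1_neq0. rewrite <- Hdet. unfold mob_den in E. rewrite Z in *.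
    assert (de = 0%C). { rewrite <- E. ring. } rewrite H0. ring. }
  unfold mob_den in *. replace w with ((ga * w + de - de) / ga)%C by (field; auto).
  replace w' with ((ga * w' + de - de) / ga)%C by (field; auto). now rewrite E, E'.
- apply Some_inj in H. destruct (to_chart_of_chart false w E) as [_ A].
  destruct (to_chart_of_chart false w' E') as [_ A']. simpl in *.
  rewrite <- A, <- A'. f_equal. exact H.
Qed.

Variable O : Sphere -> Prop.
Hypothesis HO : open_sph O.
Hypothesis Hpole : ~ O pole.
Definition in_plane (w : C) : Prop := O (of_plane w).

Lemma of_chart_den_neq0 c x : O (chart c x) -> of_chart_den c x <> 0%C.
Proof. intros H E. apply Hpole. rewrite <- (of_chart_pole c x E). exact H. Qed.

Lemma of_plane_onto p : O p -> exists w, p = of_plane w.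
Proof.
intros H. destruct (chart_onto p) as [c [x ->]]. exists (of_chart c x). apply chart_of_chart, of_chart_den_neq0, H.
Qed.

Lemma to_chart_cont c w e : to_chart_den c w <> 0%C -> 0 < e ->
  exists d, 0 < d /\ forall q, Cmod (q - w) < d -> to_chart_den c q <> 0%C /\ Cmod (to_chart c q - to_chart c w) < e.
Proof. intros. pose proof (to_chart_det c). destruct c; simpl in *; apply mob_cont; auto. Qed.

Lemma of_chart_cont c w e : of_chart_den c w <> 0%C -> 0 < e ->
  exists d, 0 < d /\ forall q, Cmod (q - w) < d -> of_chart_den c q <> 0%C /\ Cmod (of_chart c q - of_chart c w) < e.
Proof. intros. pose proof (of_chart_det c). destruct c; simpl in *; apply mob_cont; auto. Qed.

Lemma in_plane_open : plane_open in_plane.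
Proof.
intros w Hw. destruct (to_chart_den_ex w) as [c Hc]. unfold in_plane in Hw. rewrite <- (to_chart_chart c w Hc) in Hw.
destruct (chart_open O c HO _ Hw) as [e [He K]]. destruct (to_chart_cont c w e Hc He) as [d [Hd K']].
exists d; split; auto. intros q Hq. destruct (K' q Hq) as [A B]. unfold in_plane. rewrite <- (to_chart_chart c q A).
apply K, B.
Qed.

(** Connectedness on the sphere is tested with open sets of the sphere, so a planar separation must
    be carried over to it. *)
Lemma open_transfer (A : C -> Prop) : plane_open A -> (forall w, A w -> in_plane w) -> open_sph (fun p => exists w,
  p = of_plane w /\ A w).
Proof.
intros HA HAW.
assert (KEY : forall c x w, chart c x = of_plane w -> A w -> exists d, 0 < d /\ forall y,
  Cmod (y - x) < d -> exists w', chart c y = of_plane w' /\ A w').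
{ intros c x w E Aw. assert (Hs : of_chart_den c x <> 0%C). { apply of_chart_den_neq0. rewrite E. apply HAW, Aw. }
  assert (Ew : of_chart c x = w). { apply of_plane_inj. rewrite <- chart_of_chart; auto. }
  destruct (HA w Aw) as [e [He K]]. destruct (of_chart_cont c x e Hs He) as [d [Hd K']].
  exists d; split; auto. intros y Hy. destruct (K' y Hy) as [B1 B2]. exists (of_chart c y).
  split; [now apply chart_of_chart|].
  apply K. now rewrite <- Ew. }
split.
- intros z [w [E Aw]]. destruct (KEY false z w E Aw) as [d [Hd K]]. exists d; split; auto.
  intros z' Hz. apply (K z'). rewrite Cmod_minus_sym, <- pdist_Cmod. auto.
- intros [w [E Aw]]. destruct (KEY true (RtoC 0) w) as [d [Hd K]]; auto. { etransitivity; [exact chart_inf_0|exact E]. }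
  exists (/ d). split; [now apply Rinv_0_lt_compat|]. intros z Hz.
  rewrite norm2_Cmod, sqrt_pow2 in Hz by apply Cmod_ge_0.
  assert (0 < / d) by (now apply Rinv_0_lt_compat).
  assert (Hz0 : (z : C) <> 0%C) by (apply Cmod_neq0; lra).
  assert (Hi : (/ (z : C))%C <> 0%C). { apply Cmod_neq0. rewrite Cmod_inv by auto. apply Rinv_0_lt_compat; lra. }
  destruct (K (/ (z : C))%C) as [w' [E' A']].
  { replace (/ (z : C) - 0)%C with (/ (z : C))%C by ring. rewrite Cmod_inv by auto.
    rewrite <- (Rinv_inv d). apply Rinv_lt_contravar; auto. apply Rmult_lt_0_compat; lra. }
  exists w'. split; auto. rewrite <- E'. simpl. rewrite chart_inf_n0 by auto. f_equal.
  apply injective_projections; (match goal with |- ?f z = _ => change (f z) with (f (z : C)) end); f_equal; field; auto.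
Qed.

Lemma in_plane_connected : connected_sph O -> plane_connected in_plane.
Proof.
intros HC A B HA HB HU HD.
destruct (HC (fun p => exists w, p = of_plane w /\ A w) (fun p => exists w, p = of_plane w /\ B w)) as [H|H].
- apply open_transfer; auto. intros w Hw. apply HU; auto.
- apply open_transfer; auto. intros w Hw. apply HU; auto.
- intros p. split.
  + intros Hp. destruct (of_plane_onto p Hp) as [w ->]. destruct (proj1 (HU w) Hp); [left|right]; exists w; auto.
  + intros [[w [-> Hw]]|[w [-> Hw]]]; apply HU; auto.
- intros p [[w [E Hw]] [w' [E' Hw']]]. assert (w = w') by (apply of_plane_inj; congruence). subst. apply (HD w'). auto.
- left. intros w Hw. apply (H (of_plane w)). exists w; auto.
- right. intros w Hw. apply (H (of_plane w)). exists w; auto.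
Qed.

Variable rho : Sphere -> R.
Hypothesis Hconf : conformal_metric_curv_m1 O rho.

Lemma plane_dens_pos w : in_plane w -> 0 < plane_dens rho w.
Proof.
intros Hw. destruct (to_chart_den_ex w) as [c Hc]. rewrite <- (to_chart_dens c rho w Hc).
apply Rmult_lt_0_compat. apply (dens_pos O). apply Hconf. rewrite to_chart_chart; auto.
apply Rinv_0_lt_compat, pow_lt. now apply Cmod_gt_0.
Qed.

(** Near each point one of the charts is available; there [C2_jet] gives a jet, [mob_jet] moves it
    to the plane, and [jet_patch] glues. *)
Lemma planar_pm : exists J, planar_metric in_plane J /\ forall w, ju J w = ln (plane_dens rho w).
Proof.
apply jet_patch; [apply in_plane_open|].
intros w Hw. destruct (to_chart_den_ex w) as [c Hc].
destruct Hconf as [Hpos HC]. destruct (HC c) as [C2 CV].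
destruct (C2_jet (dens c rho) (fun x => O (chart c x)) (chart_open O c HO)) as [J [HJ EJ]]; auto.
{ intros p Hp. apply (dens_pos O); auto. }
assert (HM : exists J', planar_metric (fun w => to_chart_den c w <> 0%C /\ O (chart c (to_chart c w))) J' /\
   forall w, ju J' w = ju J (to_chart c w) - ln (Cmod (to_chart_den c w) ^ 2)).
{ pose proof (to_chart_det c) as Hd. destruct c; simpl in *.
  - apply (mob_jet ga de al be (fun x => O (chart_inf x)) J); auto.
  - apply (mob_jet al be ga de (fun x => O (Some x)) J); auto. }
destruct HM as [J' [HJ' EJ']].
assert (Hw' : to_chart_den c w <> 0%C /\ O (chart c (to_chart c w))) by (split; auto; rewrite to_chart_chart; auto).
destruct (pm_open _ _ HJ' w Hw') as [r [Hr K]].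
exists r, J'. split; auto. split.
- eapply pm_sub; [exact HJ'|apply plane_open_ball|]. auto.
- intros q Hq. destruct (K q Hq) as [Q1 Q2]. rewrite EJ', EJ, <- (to_chart_dens c rho q Q1).
  assert (0 < Cmod (to_chart_den c q)) by (now apply Cmod_gt_0).
  rewrite ln_mult, ln_Rinv; auto. apply pow_lt; auto.
  apply (dens_pos O); auto. apply Rinv_0_lt_compat, pow_lt; auto.
Qed.
End Mob.

(** * Path lengths and the transfer of completeness *)

Lemma path_trans O rho p q L : path_len O rho p q L -> forall q' L',
  path_len O rho q q' L' -> path_len O rho p q' (L + L').
Proof.
induction 1; intros q' L' H'.
- now rewrite Rplus_0_l.
- rewrite Rplus_assoc. eapply path_cons; eauto.
Qed.

Lemma vcont_const c t : vcont (fun _ => c) t.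
Proof. exact (vcont_vder _ _ _ (vder_const c t)). Qed.

Lemma vcont_mult X Y t : vcont X t -> vcont Y t -> vcont (fun s => X s * Y s)%C t.
Proof.
intros H K e He. set (M := Cmod (X t) + Cmod (Y t) + 1).
pose proof (Cmod_ge_0 (X t)). pose proof (Cmod_ge_0 (Y t)). assert (HM : 1 <= M) by (unfold M; lra).
destruct (H (Rmin 1 (e / (4 * M)))) as [d1 [Hd1 K1]]. { apply Rmin_pos; [lra|apply Rdiv_lt_0_compat; lra]. }
destruct (K (e / (4 * M))) as [d2 [Hd2 K2]]. { apply Rdiv_lt_0_compat; lra. }
exists (Rmin d1 d2); split; [now apply Rmin_pos|]. intros h Hh.
assert (Q : Rabs (h - t) < d1 /\ Rabs (h - t) < d2) by (split_min; auto). destruct Q as [Q1 Q2].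
specialize (K1 h Q1). specialize (K2 h Q2).
assert (Q : Cmod (X h - X t) < 1 /\ Cmod (X h - X t) < e / (4 * M)) by (split_min; auto). destruct Q as [Q3 Q4].
replace (X h * Y h - X t * Y t)%C with (X h * (Y h - Y t) + (X h - X t) * Y t)%C by ring.
eapply Rle_lt_trans; [apply Cmod_triangle|]. rewrite !Cmod_mult.
assert (XM : Cmod (X h) <= M). { eapply Rle_trans; [apply (Cmod_le_add _ (X t))|]. unfold M; lra. }
assert (YM : Cmod (Y t) <= M) by (unfold M; lra).
assert (Cmod (X h) * Cmod (Y h - Y t) <= M * (e / (4 * M))) by (apply Rmult_le_compat; try apply Cmod_ge_0; lra).
assert (Cmod (X h - X t) * Cmod (Y t) <= e / (4 * M) * M) by (apply Rmult_le_compat; try apply Cmod_ge_0; lra).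
replace (M * (e / (4 * M))) with (e / 4) in * by (field; lra).
replace (e / (4 * M) * M) with (e / 4) in * by (field; lra). lra.
Qed.

Lemma vcont_comp X (f : R -> R) t l : is_derive f t l -> vcont X (f t) -> vcont (fun s => X (f s)) t.
Proof.
intros H K e He. destruct (K e He) as [d [Hd K']]. destruct (is_derive_cont _ _ _ H d Hd) as [d' [Hd' K'']].
exists d'. split; auto.
Qed.

Lemma vder_comp X (f : R -> R) t l m : is_derive f t l -> vder X (f t) m -> vder (fun s => X (f s)) t (m * RtoC l)%C.
Proof.
intros H [K1 K2]. split.
- eapply is_derive_eq. apply (is_derive_comp_R (fun s => fst (X s)) f t l _ H K1). simpl; req; ring.
- eapply is_derive_eq. apply (is_derive_comp_R (fun s => snd (X s)) f t l _ H K2). simpl; req; ring.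
Qed.

Lemma cont_of_vcont (f : C -> R) X t : fcont f (X t) -> vcont X t -> continuity_pt (fun s => f (X s)) t.
Proof.
intros H K e He. destruct (H e He) as [d [Hd H']]. destruct (K d Hd) as [d' [Hd' K']].
exists d'. split; auto. intros x [_ Hx]. simpl in *. unfold Rdist in *. apply H', K', Hx.
Qed.

Lemma fcont_Cmod p : fcont Cmod p.
Proof.
intros e He. exists e; split; auto. intros q Hq. eapply Rle_lt_trans; [|apply Hq].
pose proof (Cmod_le_add q p). pose proof (Cmod_le_add p q). rewrite (Cmod_minus_sym p q) in H0. apply Rabs_le; lra.
Qed.

Lemma sqrt_Cmod (z : C) : sqrt (fst z * fst z + snd z * snd z) = Cmod z.
Proof. rewrite <- Cmod_sqr. apply sqrt_pow2, Cmod_ge_0. Qed.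

Section Transfer.
Variables al be ga de : C.
Hypothesis Hdet : (al * de - be * ga)%C = 1%C.
Variables (O : Sphere -> Prop) (rho : Sphere -> R).
Hypothesis HO : open_sph O.
Hypothesis Hpole : ~ O (pole al ga).
Hypothesis Hconf : conformal_metric_curv_m1 O rho.
Notation of_plane := (of_plane al be ga de).
Notation to_chart := (to_chart al be ga de).
Notation of_chart := (of_chart al be ga de).
Notation to_chart_den := (to_chart_den al be ga de).
Notation of_chart_den := (of_chart_den al ga).
Notation plane_dens := (plane_dens al be ga de rho).
Notation in_plane := (in_plane al be ga de O).

Lemma to_chart_holo c : exists k, Cmod k = 1 /\ forall w,
  to_chart_den c w <> 0%C -> holo (to_chart c) w (k / (to_chart_den c w * to_chart_den c w))%C.
Proof.
pose proof (to_chart_det al be ga de Hdet c) as D. destruct c; simpl in *.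
- exists (ga * be - de * al)%C. split; auto. intros; apply mob_holo; auto.
- exists (al * de - be * ga)%C. split; auto. intros; apply mob_holo; auto.
Qed.

Lemma of_chart_holo c : exists k, Cmod k = 1 /\ forall w,
  of_chart_den c w <> 0%C -> holo (of_chart c) w (k / (of_chart_den c w * of_chart_den c w))%C.
Proof.
pose proof (of_chart_det al be ga de Hdet c) as D. destruct c; simpl in *.
- exists (- be * - ga - de * al)%C. split; auto. intros; apply mob_holo; auto.
- exists (de * al - - be * - ga)%C. split; auto. intros; apply mob_holo; auto.
Qed.

Lemma to_chart_den_holo c w : exists g, holo (to_chart_den c) w g.
Proof. destruct c; eexists; apply mob_den_holo. Qed.

Lemma dens_fcont c x : O (chart c x) -> fcont (dens c rho) x.
Proof.
intros H. destruct Hconf as [_ HC]. destruct (HC c) as [[fx [fy [fxx [fxy [fyx [fyy [_ [_ [_ [_ [_ [_ [C0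
  _]]]]]]]]]]]]] _].
eapply cont_on_fcont; [exact C0|exact H].
Qed.

(** The requirement of [segment_ok] that paths be differentiable on the whole line is met by a cosine
  reparametrization. *)
Lemma seg_path (g dg : R -> C) c s t K : 0 <= K ->
  (forall x, Rmin s t <= x <= Rmax s t -> to_chart_den c (g x) <> 0%C /\ in_plane (g x) /\ vder g x (dg x) /\ vcont dg
    x /\ plane_dens (g x) * Cmod (dg x) <= K) ->
  exists L, path_len O rho (of_plane (g s)) (of_plane (g t)) L /\ L <= 2 * K * Rabs (t - s).
Proof.
intros HK H.
(* It runs from [s] to [t] on [[0, 1]] and never leaves the interval between them. Its speed is at
   most [PI / 2 * |t - s|], bounded below by using [PI <= 4]; this is the factor 2 in the length. *)
set (sg := fun x => s + (t - s) * ((1 - cos (PI * x)) / 2)).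
set (sg' := fun x => (t - s) * (PI * sin (PI * x) / 2)).
assert (Hsg : forall x, is_derive sg x (sg' x)).
{ intros x. unfold sg, sg'. auto_derive; auto. field. }
assert (Hin : forall x, Rmin s t <= sg x <= Rmax s t).
{ intros x. pose proof (COS_bound (PI * x)) as B. unfold sg. set (y := (1 - cos (PI * x)) / 2).
  assert (0 <= y <= 1) by (unfold y; lra). unfold Rmin, Rmax; repeat destruct Rle_dec; nra. }
assert (S0 : sg 0 = s). { unfold sg. rewrite Rmult_0_r, cos_0. field. }
assert (S1 : sg 1 = t). { unfold sg. rewrite Rmult_1_r, cos_PI. field. }
destruct (to_chart_holo c) as [k [Hk HT]].
set (gm := fun x => to_chart c (g (sg x))).
set (D := fun x => (k * (/ to_chart_den c (g (sg x)) * / to_chart_den c (g (sg x))) * (dg (sg x) * RtoC (sg' x)))%C).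
assert (Dg : forall x, vder (fun y => g (sg y)) x (dg (sg x) * RtoC (sg' x))%C).
{ intros x. apply vder_comp; auto. apply H, Hin. }
assert (Dgm : forall x, vder gm x (D x)).
{ intros x. destruct (H _ (Hin x)) as [N1 _]. eapply vder_eq.
  apply (holo_curve (to_chart c) _ (fun y => g (sg y)) x _ (HT _ N1) (Dg x)).
  unfold D. field. auto. }
assert (KD : forall x, vcont D x).
{ intros x. destruct (H _ (Hin x)) as [N1 [_ [_ [K1 _]]]]. destruct (to_chart_den_holo c (g (sg x))) as [gn Hgn].
  assert (Kn : vcont (fun y => / to_chart_den c (g (sg y)))%C x).
  { eapply vcont_vder. apply (vder_inv (fun y => to_chart_den c (g (sg y)))); [exact N1|].
    apply (holo_curve (to_chart_den c) _ (fun y => g (sg y)) x _ Hgn (Dg x)). }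
  unfold D. apply vcont_mult. apply vcont_mult; [apply vcont_const|apply vcont_mult; auto].
  apply vcont_mult. apply (vcont_comp dg sg x _ (Hsg x) K1).
  apply (vcont_vder _ _ (RtoC (Derive sg' x))). apply vder_RtoC. apply Derive_correct. unfold sg'. auto_derive; auto. }
assert (Ogm : forall x, O (chart c (gm x))).
{ intros x. destruct (H _ (Hin x)) as [N1 [W1 _]]. unfold gm. rewrite to_chart_chart; auto. }
set (F := fun x => dens c rho (fst (gm x), snd (gm x)) * sqrt (fst (D x) * fst (D x) + snd (D x) * snd (D x))).
assert (EF : forall x, F x = dens c rho (gm x) * Cmod (D x)).
{ intros x. unfold F. rewrite sqrt_Cmod. destruct (gm x); reflexivity. }
assert (CF : forall x, 0 <= x <= 1 -> continuity_pt F x).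
{ intros x _. apply (continuity_pt_ext (fun x => dens c rho (gm x) * Cmod (D x))). { intros; now rewrite EF. }
  apply continuity_pt_mult.
  - apply (cont_of_vcont (dens c rho) gm). apply dens_fcont, Ogm. eapply vcont_vder, Dgm.
  - apply (cont_of_vcont Cmod D). apply fcont_Cmod. apply KD. }
set (pr := continuity_implies_RiemannInt Rle_0_1 CF).
assert (BF : forall x, F x <= 2 * K * Rabs (t - s)).
{ intros x. destruct (H _ (Hin x)) as [N1 [W1 [_ [_ B1]]]]. rewrite EF.
  assert (ED : dens c rho (gm x) = plane_dens (g (sg x)) * Cmod (to_chart_den c (g (sg x))) ^ 2).
  { rewrite <- (to_chart_dens al be ga de c rho (g (sg x)) N1). unfold gm.
    assert (0 < Cmod (to_chart_den c (g (sg x)))) by (now apply Cmod_gt_0). field. lra. }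
  rewrite ED. unfold D. rewrite !Cmod_mult, !Cmod_inv, Hk, Cmod_R by auto.
  assert (0 < Cmod (to_chart_den c (g (sg x)))) by (now apply Cmod_gt_0).
  replace (plane_dens (g (sg x)) * Cmod (to_chart_den c (g (sg x))) ^ 2 * (1 * (/ Cmod (to_chart_den c (g (sg x))) * /
    Cmod (to_chart_den c (g (sg x)))) * (Cmod (dg (sg x)) * Rabs (sg' x))))
   with ((plane_dens (g (sg x)) * Cmod (dg (sg x))) * Rabs (sg' x)) by (field; lra).
  assert (Rabs (sg' x) <= 2 * Rabs (t - s)).
  { unfold sg'. rewrite Rabs_mult. rewrite Rmult_comm. apply Rmult_le_compat_r; [apply Rabs_pos|].
    unfold Rdiv. rewrite !Rabs_mult, (Rabs_pos_eq PI), (Rabs_pos_eq (/ 2)) by (pose proof PI_RGT_0; lra).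
    assert (Rabs (sin (PI * x)) <= 1) by (apply Rabs_le, SIN_bound). pose proof PI_4. pose proof PI_RGT_0.
    pose proof (Rabs_pos (sin (PI * x))). nra. }
  pose proof (plane_dens_pos al be ga de Hdet O rho Hconf _ W1). pose proof (Cmod_ge_0 (dg (sg x))).
  pose proof (Rabs_pos (sg' x)).
  assert (0 <= plane_dens (g (sg x)) * Cmod (dg (sg x))) by (apply Rmult_le_pos; lra).
  replace (2 * K * Rabs (t - s)) with (K * (2 * Rabs (t - s))) by ring. apply Rmult_le_compat; auto. }
exists (RiemannInt pr + 0). split.
- destruct (H _ (Hin 0)) as [N0 _]. destruct (H _ (Hin 1)) as [N1 _].
  assert (E0 : of_plane (g s) = chart c (fst (gm 0), snd (gm 0))).
  { rewrite <- (to_chart_chart al be ga de c (g s)). 2: { now rewrite <- S0. } unfold gm. rewrite S0.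
    now destruct (to_chart c (g s)). }
  assert (E1 : of_plane (g t) = chart c (fst (gm 1), snd (gm 1))).
  { rewrite <- (to_chart_chart al be ga de c (g t)). 2: { now rewrite <- S1. } unfold gm. rewrite S1.
    now destruct (to_chart c (g t)). }
  rewrite E0, E1.
  apply (path_cons O rho c (fun x => fst (gm x)) (fun x => snd (gm x)) (fun x => fst (D x)) (fun x => snd (D x)));
    [|apply path_nil].
  split; [|split; [|split; [|split; [|split]]]].
  + intros x. apply is_derive_Reals, Dgm.
  + intros x. apply is_derive_Reals, Dgm.
  + intros x. apply continuity_pt_filterlim, vcont_fst, KD.
  + intros x. apply continuity_pt_filterlim, vcont_snd, KD.
  + intros x _. pose proof (Ogm x) as Q. destruct (gm x). exact Q.
  + exists pr. reflexivity.
- rewrite Rplus_0_r.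
  pose proof (RiemannInt_P14 0 1 (2 * K * Rabs (t - s))) as prc.
  eapply Rle_trans; [apply (RiemannInt_P19 pr prc Rle_0_1)|].
  + intros x _. apply BF.
  + rewrite RiemannInt_P15. lra.
Qed.

(** The curve may need both charts. Compactness gives a step size [r] such that every piece shorter
    than [r] fits into one of them, and the pieces are concatenated. *)
Lemma curve_path (g dg : R -> C) T K : 0 <= K ->
  (forall x, 0 <= x < T -> in_plane (g x) /\ vder g x (dg x) /\ vcont dg x /\ plane_dens (g x) * Cmod (dg x) <= K) ->
  forall s t, 0 <= s < T -> 0 <= t < T -> exists L,
    path_len O rho (of_plane (g s)) (of_plane (g t)) L /\ L <= 2 * K * Rabs (t - s).
Proof.
intros HK H s t Hs Ht. set (T1 := Rmax s t).
assert (HT1 : 0 <= T1 < T) by (unfold T1, Rmax; destruct Rle_dec; lra).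
destruct (uniform_on_compact (fun x r => exists c, forall y,
  0 <= y <= T1 -> Rabs (y - x) < r -> to_chart_den c (g y) <> 0%C) T1) as [r [Hr HU]].
{ intros x r r' [c Hc] Hrr. exists c. intros y Hy Hyx. apply Hc; auto. lra. }
{ intros x Hx. destruct (to_chart_den_ex al be ga de Hdet (g x)) as [c Hc].
  destruct (to_chart_cont al be ga de Hdet c (g x) 1 Hc Rlt_0_1) as [e [He Ke]].
  destruct (H x ltac:(lra)) as [_ [Dx _]]. destruct (vder_cont _ _ _ Dx e He) as [d [Hd Kd]].
  exists (d / 2). split; [lra|]. intros x' Hx' Hxx. exists c. intros y Hy Hyx.
  apply Ke, Kd. replace (y - x) with ((y - x') + (x' - x)) by ring. eapply Rle_lt_trans; [apply Rabs_triang|]. lra. }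
assert (LOC : forall x y, 0 <= x <= T1 -> 0 <= y <= T1 -> Rabs (y - x) < r ->
   exists L, path_len O rho (of_plane (g x)) (of_plane (g y)) L /\ L <= 2 * K * Rabs (y - x)).
{ intros x y Hx Hy Hxy. destruct (HU x Hx) as [c Hc]. apply (seg_path g dg c x y K HK).
  intros z Hz. assert (0 <= z <= T1) by (revert Hz; unfold Rmin, Rmax; repeat destruct Rle_dec; lra).
  destruct (H z ltac:(lra)) as [A [B [D E]]]. split; auto. apply Hc; auto.
  eapply Rle_lt_trans; [|apply Hxy]. eapply between_abs; [exact Hz|lra]. }
(* Steps of half the size [r], since [LOC] asks for a strict inequality; at each stage the last of
   [n + 1] equal pieces is split off. *)
assert (IND : forall n x y, 0 <= x <= T1 -> 0 <= y <= T1 -> Rabs (y - x) <= INR n * (r / 2) ->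
   exists L, path_len O rho (of_plane (g x)) (of_plane (g y)) L /\ L <= 2 * K * Rabs (y - x)).
{ induction n; intros x y Hx Hy Hxy.
  - apply LOC; auto. simpl in Hxy. lra.
  - rewrite S_INR in Hxy. pose proof (pos_INR n) as Pn.
    set (k := INR n / (INR n + 1)). assert (Hk : 0 <= k <= 1).
    { unfold k. split. apply Rmult_le_pos; auto. left; apply Rinv_0_lt_compat; lra.
      apply Rmult_le_reg_r with (INR n + 1); [lra|]. unfold Rdiv. rewrite Rmult_assoc, Rinv_l; lra. }
    set (z := x + (y - x) * k). assert (Hz : 0 <= z <= T1) by (unfold z; nra).
    assert (E1 : Rabs (z - x) = Rabs (y - x) * k).
    { unfold z. replace (x + (y - x) * k - x) with ((y - x) * k) by ring. rewrite Rabs_mult, (Rabs_pos_eq k); lra. }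
    assert (E2 : Rabs (y - z) = Rabs (y - x) * (1 - k)).
    { unfold z. replace (y - (x + (y - x) * k)) with ((y - x) * (1 - k)) by ring.
      rewrite Rabs_mult, (Rabs_pos_eq (1 - k)); lra. }
    destruct (IHn x z Hx Hz) as [L1 [P1 B1]].
    { rewrite E1. apply Rle_trans with ((INR n + 1) * (r / 2) * k). apply Rmult_le_compat_r; lra. unfold k.
      right; field; lra. }
    destruct (LOC z y Hz Hy) as [L2 [P2 B2]].
    { rewrite E2. apply Rle_lt_trans with ((INR n + 1) * (r / 2) * (1 - k)). apply Rmult_le_compat_r; lra.
      unfold k. replace ((INR n + 1) * (r / 2) * (1 - INR n / (INR n + 1))) with (r / 2) by (field; lra). lra. }
    exists (L1 + L2). split. eapply path_trans; eauto. rewrite E1 in B1. rewrite E2 in B2.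
    replace (2 * K * Rabs (y - x)) with (2 * K * (Rabs (y - x) * k) + 2 * K * (Rabs (y - x) * (1 - k))) by ring. lra. }
destruct (INR_unbounded (Rabs (t - s) / (r / 2))) as [n Hn].
apply (IND n).
- unfold T1, Rmax; destruct Rle_dec; lra.
- unfold T1, Rmax; destruct Rle_dec; lra.
- apply Rmult_lt_compat_r with (r := r / 2) in Hn; [|lra].
  replace (Rabs (t - s) / (r / 2) * (r / 2)) with (Rabs (t - s)) in Hn by (field; lra). lra.
Qed.

Lemma segment_ge0 c gx gy dx dy L : segment_ok O rho c gx gy dx dy L -> 0 <= L.
Proof.
intros [_ [_ [_ [_ [HOc [pr <-]]]]]].
pose proof (RiemannInt_P14 0 1 0) as prc.
assert (E : RiemannInt prc = 0) by (rewrite RiemannInt_P15; ring).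
apply Rle_trans with (RiemannInt prc); [rewrite E; lra|].
apply RiemannInt_P19; [lra|]. intros x Hx. unfold fct_cte. apply Rmult_le_pos; [|apply sqrt_pos].
left. apply (dens_pos O). apply Hconf. apply HOc. lra.
Qed.

(** A segment which ends near [P] cannot leave a ball where the density is at least [m] without being long. *)
Lemma segment_local c gx gy dx dy L1 L2 P r m X1 : 0 < r -> 0 < m ->
  (forall w, Cmod (w - P) < r -> in_plane w /\ m <= plane_dens w) ->
  segment_ok O rho c gx gy dx dy L1 -> chart c (gx 1,
    gy 1) = of_plane X1 -> m * Cmod (X1 - P) <= L2 -> L1 + L2 < m * r ->
  exists X0, chart c (gx 0, gy 0) = of_plane X0 /\ m * Cmod (X0 - P) <= L1 + L2.
Proof.
intros Hr Hm HB Hseg E1 HX1 HL. pose proof (segment_ge0 _ _ _ _ _ _ Hseg) as L10.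
destruct Hseg as [Dx [Dy [Cx [Cy [HOc [pr Epr]]]]]].
set (ga' := fun t => (gx t, gy t) : C). set (D := fun t => (dx t, dy t) : C).
assert (Dga : forall t, vder ga' t (D t)). { intros t. split; cbn [fst snd ga' D]; apply is_derive_Reals; auto. }
assert (KD : forall t, vcont D t).
{ intros t e He. destruct (Cx t (e/2)) as [d1 [Hd1 K1]]; [lra|]. destruct (Cy t (e/2)) as [d2 [Hd2 K2]]; [lra|].
  exists (Rmin d1 d2). split; [now apply Rmin_pos|]. intros h Hh.
  destruct (Req_dec h t) as [->|Hn]. { replace (D t - D t)%C with (RtoC 0) by ring. now rewrite Cmod_0. }
  assert (Q : Rabs (h - t) < d1 /\ Rabs (h - t) < d2) by (split_min; auto). destruct Q as [Q1 Q2].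
  eapply Rle_lt_trans; [apply Cmod_le_sum|]. rewrite fst_minus, snd_minus. cbn [fst snd D].
  assert (Rabs (dx h - dx t) < e/2). { apply K1. repeat split; auto. }
  assert (Rabs (dy h - dy t) < e/2). { apply K2. repeat split; auto. }
  lra. }
set (f := fun t => dens c rho (ga' t) * Cmod (D t)).
(* The segment is known to lie in [O] only for times in [[0, 1]]; clamping extends the integrand
   continuously to the line. *)
set (cl := fun t => Rmax 0 (Rmin 1 t)).
assert (cl_in : forall t, 0 <= cl t <= 1). { intros; unfold cl, Rmax, Rmin; repeat destruct Rle_dec; lra. }
assert (cl_id : forall t, 0 <= t <= 1 -> cl t = t). { intros; unfold cl, Rmax, Rmin; repeat destruct Rle_dec; lra. }
assert (cl_lip : forall t s, Rabs (cl t - cl s) <= Rabs (t - s)).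
{ intros t s; unfold cl, Rmax, Rmin, Rabs; repeat destruct Rle_dec; repeat destruct Rcase_abs; lra. }
assert (Cf : forall t, 0 <= t <= 1 -> continuity_pt f t).
{ intros t Ht. apply continuity_pt_mult.
  - apply (cont_of_vcont (dens c rho) ga'). apply dens_fcont. apply (HOc t Ht). eapply vcont_vder, Dga.
  - apply (cont_of_vcont Cmod D). apply fcont_Cmod. apply KD. }
assert (f0 : forall t, 0 <= t <= 1 -> 0 <= f t).
{ intros t Ht. apply Rmult_le_pos; [|apply Cmod_ge_0]. left. apply (dens_pos O). apply Hconf. apply (HOc t Ht). }
set (fc := fun t => f (cl t)).
assert (Cfc : forall t, continuous fc t).
{ intros t. apply continuity_pt_filterlim. intros e He. destruct (Cf (cl t) (cl_in t) e He) as [d [Hd K]].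
  exists d. split; auto. intros x [_ Hx]. simpl in *. unfold Rdist in *. unfold fc.
  destruct (Req_dec (cl t) (cl x)) as [Eq|Ne]. { rewrite Eq, Rminus_diag, Rabs_R0. auto. }
  apply K. split. split; auto; exact I. unfold Rdist. eapply Rle_lt_trans; [apply cl_lip|exact Hx]. }
set (A := fun t => RInt fc 0 t).
assert (DA : forall t, is_derive A t (fc t)).
{ intros t. apply (is_derive_RInt fc A 0 t).
  - exists (mkposreal 1 Rlt_0_1). intros y _. apply (@RInt_correct R_CompleteNormedModule), ex_RInt_cont. auto.
  - apply Cfc. }
assert (A0 : A 0 = 0) by (apply (RInt_point 0 fc)).
assert (A1 : A 1 = L1).
{ unfold A. rewrite <- Epr. rewrite <- RInt_Reals. apply RInt_ext. intros x Hx.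
  rewrite Rmin_left, Rmax_right in Hx by lra.
  unfold fc. rewrite cl_id by lra. unfold f. now rewrite <- sqrt_Cmod. }
assert (Amon : forall t, 0 <= t <= 1 -> 0 <= A t).
{ intros t Ht. destruct (Req_dec t 0) as [->|]; [lra|]. destruct (is_derive_MVT A fc 0 t) as [y [Hy Ey]]; [lra|auto|].
  assert (0 <= fc y) by (apply f0, cl_in). nra. }
destruct (of_chart_holo c) as [k [Hk HS]].
assert (Hsd : forall t, 0 <= t <= 1 -> of_chart_den c (ga' t) <> 0%C). { intros t Ht.
apply (of_chart_den_neq0 al be ga de Hdet O Hpole). apply (HOc t Ht). }
(* Traversed backwards, because it is the end of the segment whose distance to [P] is known. *)
set (X := fun t => of_chart c (ga' (1 - t))).
set (X' := fun t : R => (k / (of_chart_den c (ga' (1 - t)%R) * of_chart_den c (ga' (1 - t)%R)) * (D (1 - t)%R * RtoC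
  (-1)))%C).
assert (DX : forall t, 0 <= t <= 1 -> vder X t (X' t)).
{ intros t Ht. apply (holo_curve (of_chart c) _ (fun t => ga' (1 - t)) t). apply HS, Hsd; lra.
  apply (vder_comp ga' (fun t => 1 - t)); auto. auto_derive; auto. }
assert (EX : forall t, 0 <= t <= 1 -> plane_dens (X t) * Cmod (X' t) = f (1 - t)).
{ intros t Ht. assert (Hs := Hsd (1 - t) ltac:(lra)). unfold X, X'. rewrite (of_chart_dens al be ga de Hdet) by auto.
  unfold f.
  rewrite !Cmod_mult, Cmod_div, Cmod_mult, Hk, Cmod_R by (auto; apply Cmult_neq_0; auto).
  replace (Rabs (-1)) with 1 by (rewrite Rabs_left; lra).
  assert (0 < Cmod (of_chart_den c (ga' (1 - t)))) by (now apply Cmod_gt_0). field. lra. }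
assert (EX1 : X 0 = X1).
{ apply (of_plane_inj al be ga de Hdet). rewrite <- E1. unfold X. rewrite Rminus_0_r. symmetry.
  apply (chart_of_chart al be ga de Hdet). apply Hsd; lra. }
exists (X 1). split.
{ unfold X. replace (1 - 1) with 0 by ring. apply (chart_of_chart al be ga de Hdet). apply Hsd; lra. }
apply le_epsilon. intros e0 He0.
(* The distance to [P] is smoothed to [sqrt (|X - P|^2 + eta^2)], differentiable also at [P]; [eta]
   is small enough for the length bound to stay below [m * r]. *)
set (eta := Rmin (e0 / m) ((m * r - (L1 + L2)) / (2 * m))).
assert (Heta : 0 < eta). { unfold eta. apply Rmin_pos; apply Rdiv_lt_0_compat; lra. }
assert (Heta1 : m * eta <= e0 /\ m * eta < m * r - (L1 + L2)).
{ assert (eta <= e0 / m) by apply Rmin_l. assert (eta <= (m * r - (L1 + L2)) / (2 * m)) by apply Rmin_r.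
  split. apply Rle_trans with (m * (e0 / m)). apply Rmult_le_compat_l; lra. right; field; lra.
  apply Rle_lt_trans with (m * ((m * r - (L1 + L2)) / (2 * m))). apply Rmult_le_compat_l; lra.
  replace (m * ((m * r - (L1 + L2)) / (2 * m))) with ((m * r - (L1 + L2)) / 2) by (field; lra). lra. }
destruct Heta1 as [He1 He2].
set (v := fun t => Cmod (X t - P) ^ 2 + eta ^ 2).
assert (Hv : forall t, 0 < v t). { intros t. unfold v. pose proof (pow2_ge_0 (Cmod (X t - P))).
assert (0 < eta ^ 2) by (apply pow_lt; auto). lra. }
set (v' := fun t => 2 * (fst (X t - P)%C * fst (X' t) + snd (X t - P)%C * snd (X' t))).
assert (Dv : forall t, 0 <= t <= 1 -> is_derive v t (v' t)).
{ intros t Ht. eapply is_derive_eq. apply is_derive_plus_R; [|apply is_derive_const_R].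
  apply (is_derive_Cmod2 (fun t => X t - P)%C t (X' t)). eapply vder_eq.
  apply vder_minus; [apply DX; auto|apply vder_const]. ring.
  unfold v'. req. ring. }
assert (Hge : forall t, Cmod (X t - P) <= sqrt (v t)).
{ intros t. rewrite <- (sqrt_pow2 (Cmod (X t - P))) by apply Cmod_ge_0. apply sqrt_le_1_alt. unfold v.
  pose proof (pow2_ge_0 eta). lra. }
assert (H0le : sqrt (v 0) <= Cmod (X1 - P) + eta).
{ apply Rsqr_incr_0_var. 2: { pose proof (Cmod_ge_0 (X1 - P)); lra. }
  rewrite Rsqr_sqrt by (left; apply Hv). unfold v, Rsqr. rewrite EX1. pose proof (Cmod_ge_0 (X1 - P)). nra. }
set (H := fun t => A 1 - A (1 - t)).
(* Growth of the smoothed distance, weighted by [m], minus the length covered so far. Its derivative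
   is known to be nonpositive only inside the ball, and [phi <= 0] keeps the curve there: the
   situation of [nonpos_persist]. *)
set (phi := fun t => m * sqrt (v t) - m * sqrt (v 0) - H t).
set (phi' := fun t => m * (/ (2 * sqrt (v t)) * v' t) - fc (1 - t)).
assert (Dphi : forall t, 0 <= t <= 1 -> is_derive phi t (phi' t)).
{ intros t Ht. eapply is_derive_eq. apply is_derive_minus_R. apply is_derive_minus_R.
  - apply is_derive_scal_R. apply (is_derive_comp_R sqrt v); [apply Dv; auto|].
    apply is_derive_Reals, derivable_pt_lim_sqrt, Hv.
  - apply is_derive_const_R.
  - apply is_derive_minus_R; [apply is_derive_const_R|]. apply (is_derive_comp_R A (fun t => 1 - t)); [|apply DA].
    instantiate (1 := -1). auto_derive; auto.
  - unfold phi'. req. ring. }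
assert (HH : forall t, 0 <= t <= 1 -> H t <= L1). { intros t Ht. unfold H. rewrite A1.
specialize (Amon (1 - t) ltac:(lra)). lra. }
assert (PH : forall t, 0 <= t <= 1 -> phi t <= 0).
{ apply (nonpos_persist phi phi' 1); auto.
  - unfold phi, H. replace (1 - 0) with 1 by ring. lra.
  - intros t Ht Pt.
    assert (In : Cmod (X t - P) < r).
    { apply Rmult_lt_reg_l with m; auto. specialize (HH t Ht). unfold phi in Pt.
      assert (m * Cmod (X t - P) <= m * sqrt (v t)) by (apply Rmult_le_compat_l; [lra|apply Hge]).
      assert (m * sqrt (v 0) <= m * (Cmod (X1 - P) + eta)) by (apply Rmult_le_compat_l; lra). lra. }
    destruct (vder_cont _ _ _ (DX t Ht) (r - Cmod (X t - P))) as [d [Hd Kd]]; [lra|].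
    exists d; split; auto. intros s Hs Hs1. specialize (Kd s ltac:(apply Rabs_def1; lra)).
    assert (Ins : Cmod (X s - P) < r). { eapply Rle_lt_trans; [apply (Cmod_triangle_sub _ (X t))|]. lra. }
    destruct (HB (X s) Ins) as [_ Bs].
    unfold phi'. assert (Efc : fc (1 - s) = plane_dens (X s) * Cmod (X' s)). { unfold fc. rewrite cl_id by lra.
    rewrite EX by lra. reflexivity. }
    rewrite Efc.
    pose proof (dot_le (X s - P) (X' s)) as DL. specialize (Hge s). pose proof (Cmod_ge_0 (X' s)) as X0.
    assert (SP : 0 < sqrt (v s)) by apply sqrt_lt_R0, Hv.
    assert (Q : / (2 * sqrt (v s)) * v' s <= Cmod (X' s)).
    { apply Rmult_le_reg_l with (2 * sqrt (v s)); [lra|]. rewrite <- Rmult_assoc, Rinv_r, Rmult_1_l by lra. unfold v'.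
      assert (Cmod (X s - P) * Cmod (X' s) <= sqrt (v s) * Cmod (X' s)) by (apply Rmult_le_compat_r; auto). lra. }
    assert (m * (/ (2 * sqrt (v s)) * v' s) <= m * Cmod (X' s)) by (apply Rmult_le_compat_l; lra).
    assert (m * Cmod (X' s) <= plane_dens (X s) * Cmod (X' s)) by (apply Rmult_le_compat_r; auto). lra. }
specialize (PH 1 ltac:(lra)). unfold phi in PH. specialize (HH 1 ltac:(lra)). specialize (Hge 1).
assert (m * Cmod (X 1 - P) <= m * sqrt (v 1)) by (apply Rmult_le_compat_l; lra).
assert (m * sqrt (v 0) <= m * (Cmod (X1 - P) + eta)) by (apply Rmult_le_compat_l; lra). lra.
Qed.

(** Induction from the end of the path, which is at [P]: the estimate for the remaining segments is
    the hypothesis of [segment_local] for the first one. *)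
Lemma path_local P r m : 0 < r -> 0 < m -> (forall w, Cmod (w - P) < r -> in_plane w /\ m <= plane_dens w) ->
  forall x q L, path_len O rho x q L -> q = of_plane P -> L < m * r -> exists X,
    x = of_plane X /\ m * Cmod (X - P) <= L.
Proof.
intros Hr Hm HB x q L H. induction H as [p|c gx gy dx dy L1 q L2 Hs Hp IH]; intros Eq HL.
- exists P. split; auto. replace (P - P)%C with (RtoC 0) by ring. rewrite Cmod_0. lra.
- pose proof (segment_ge0 _ _ _ _ _ _ Hs). destruct IH as [X1 [E1 B1]]; auto; [lra|].
  exact (segment_local c gx gy dx dy L1 L2 P r m X1 Hr Hm HB Hs E1 B1 HL).
Qed.

(** Points sampled on the curve form a Cauchy sequence for the path distance because the speed is
    bounded. Near the limit [P] the density is bounded below, so convergence in path distance is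
    convergence in the plane. *)
Lemma complete_transfer : complete_metric O rho -> curve_complete in_plane (fun w => ln (plane_dens w)).
Proof.
intros HC g dg T K HT H.
assert (H' : forall x, 0 <= x < T -> in_plane (g x) /\ vder g x (dg x) /\ vcont dg x /\ plane_dens (g x) * Cmod (dg x)
  <= K).
{ intros x Hx. destruct (H x Hx) as [A [B [D E]]].
  rewrite exp_ln in E by (apply (plane_dens_pos al be ga de Hdet O rho Hconf); auto). auto. }
assert (HK : 0 <= K).
{ destruct (H' 0 ltac:(lra)) as [A [_ [_ E]]]. pose proof (plane_dens_pos al be ga de Hdet O rho Hconf _ A).
  pose proof (Cmod_ge_0 (dg 0)).
  eapply Rle_trans; [|apply E]. apply Rmult_le_pos; lra. }
(* Sampling times in [[0, T)] tending to [T], the first one being 0. *)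
set (tn := fun n : nat => T - T / (INR n + 1)).
assert (Hin : forall n, 0 < / (INR n + 1) <= 1).
{ intros n. pose proof (pos_INR n). split. apply Rinv_0_lt_compat; lra. rewrite <- Rinv_1.
  apply Rinv_le_contravar; lra. }
assert (Htn : forall n, 0 <= tn n < T). { intros n. unfold tn, Rdiv. destruct (Hin n). nra. }
assert (Hsm : forall e, 0 < e -> exists N, forall n, (N <= n)%nat -> T / (INR n + 1) < e).
{ intros e He. destruct (archimed_cor1 (e / T)) as [N [HN HN0]]. { apply Rdiv_lt_0_compat; lra. }
  exists N. intros n Hn. apply Rlt_le_trans with (T * (e / T)); [|right; field; lra]. unfold Rdiv at 1.
  apply Rmult_lt_compat_l; auto.
  eapply Rle_lt_trans; [|apply HN]. apply Rinv_le_contravar. apply lt_0_INR; lia. apply le_INR in Hn. lra. }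
destruct (HC (fun n => of_plane (g (tn n)))) as [p [Op Hp]].
{ intros n. apply H', Htn. }
{ intros e He. destruct (Hsm (e / (2 * K + 1))) as [N HN]. { apply Rdiv_lt_0_compat; lra. }
  exists N. intros a b Ha Hb. destruct (curve_path g dg T K HK H' (tn a) (tn b) (Htn a) (Htn b)) as [L [P1 P2]].
  exists L. split; auto. eapply Rle_lt_trans; [apply P2|].
  assert (Rabs (tn b - tn a) < e / (2 * K + 1)).
  { specialize (HN a Ha) as Na. specialize (HN b Hb) as Nb. unfold tn.
    assert (0 < T / (INR a + 1)) by (unfold Rdiv; destruct (Hin a); nra).
    assert (0 < T / (INR b + 1)) by (unfold Rdiv; destruct (Hin b); nra).
    apply Rabs_def1; lra. }
  apply Rle_lt_trans with (2 * K * (e / (2 * K + 1))). apply Rmult_le_compat_l; lra.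
  assert (0 < e / (2 * K + 1)) by (apply Rdiv_lt_0_compat; lra).
  apply Rlt_le_trans with ((2 * K + 1) * (e / (2 * K + 1))); [lra|]. right; field; lra. }
destruct (of_plane_onto al be ga de Hdet O Hpole p Op) as [P EP]. subst p.
exists P. split; [exact Op|].
destruct (planar_pm al be ga de Hdet O HO rho Hconf) as [J [HJ EJ]].
destruct (pm_open _ _ HJ P Op) as [r1 [Hr1 K1]].
destruct (grad_cont _ _ _ _ (pm_u _ _ HJ P Op) 1 Rlt_0_1) as [r2 [Hr2 K2]].
set (r := Rmin r1 r2). assert (Hr : 0 < r) by (now apply Rmin_pos).
set (m := exp (ju J P - 1)). assert (Hm : 0 < m) by apply exp_pos.
assert (HB : forall w, Cmod (w - P) < r -> in_plane w /\ m <= plane_dens w).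
{ intros w Hw. assert (Q : Cmod (w - P) < r1 /\ Cmod (w - P) < r2) by (unfold r in Hw; split_min; auto).
  destruct Q as [Q1 Q2].
  assert (Ww : in_plane w) by auto. split; auto. specialize (K2 w Q2). apply Rabs_def2 in K2.
  rewrite <- (exp_ln (plane_dens w)) by (apply (plane_dens_pos al be ga de Hdet O rho Hconf); auto). rewrite <- EJ.
  apply exp_le. lra. }
intros e eta He Heta.
(* Below [m * r] the path stays in the ball where the density is at least [m]; below [m * e] its
   starting point is within [e] of [P]. *)
destruct (Hp (m * Rmin e r)) as [N1 HN1]. { apply Rmult_lt_0_compat; auto. now apply Rmin_pos. }
destruct (Hsm eta Heta) as [N2 HN2].
set (n := (N1 + N2)%nat). exists (tn n). split; [apply Htn|]. split.
- specialize (HN2 n ltac:(unfold n; lia)). pose proof (Htn n). unfold tn in *. lra.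
- destruct (HN1 n ltac:(unfold n; lia)) as [L [P1 P2]].
  assert (Rmin e r <= e /\ Rmin e r <= r) as [Q1 Q2] by (split; [apply Rmin_l|apply Rmin_r]).
  destruct (path_local P r m Hr Hm HB _ _ _ P1 eq_refl) as [X [EX BX]]. { eapply Rlt_le_trans; [apply P2|].
  apply Rmult_le_compat_l; lra. }
  apply (of_plane_inj al be ga de Hdet) in EX. rewrite EX. apply Rmult_lt_reg_l with m; auto.
  eapply Rle_lt_trans; [apply BX|]. eapply Rlt_le_trans; [apply P2|]. apply Rmult_le_compat_l; lra.
Qed.
End Transfer.

Lemma curve_complete_ext W u u' : (forall w, u w = u' w) -> curve_complete W u -> curve_complete W u'.
Proof.
intros E H g dg T K HT HG. apply (H g dg T K HT). intros t Ht. rewrite E. auto.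
Qed.

Lemma ln_quot a b c d : 0 < a -> 0 < b -> 0 < c -> 0 < d ->
  ln a + ln b - (ln c + ln d) = ln ((a * b) / (c * d)).
Proof.
intros. unfold Rdiv. rewrite ln_mult, ln_mult, ln_Rinv, ln_mult; auto; try apply Rmult_lt_0_compat; auto.
apply Rinv_0_lt_compat, Rmult_lt_0_compat; auto.
Qed.

(** * Return to the sphere *)

(** All four planar densities carry the same [plane_factor], which cancels in the quotient, so the
    statement is a translation of the planar one. *)
Lemma theorem1_of_moebius al be ga de (O1 O2 : Sphere -> Prop) (l1 l2 lU lI : Sphere -> R) :
  (al * de - be * ga)%C = 1%C -> ~ union O1 O2 (pole al ga) ->
    domain O1 -> domain O2 -> open_sph (union O1 O2) ->
    hyperbolic_metric O1 l1 -> hyperbolic_metric O2 l2 ->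
    hyperbolic_metric (union O1 O2) lU -> hyperbolic_metric (inter O1 O2) lI ->
    (forall z, inter O1 O2 z -> 1 <= (l1 z * l2 z) / (lU z * lI z)) /\
    (forall z, inter O1 O2 z -> (l1 z * l2 z) / (lU z * lI z) = 1 ->
       (subset O1 O2 \/ subset O2 O1) /\
       (forall w, inter O1 O2 w -> (l1 w * l2 w) / (lU w * lI w) = 1)).
Proof.
intros Hdet Hp [Op1 [Cn1 _]] [Op2 [Cn2 _]] OpU [M1 C1] [M2 C2] [MU _] [MI CI].
assert (Hp1 : ~ O1 (pole al ga)) by (intros H; apply Hp; now left).
assert (Hp2 : ~ O2 (pole al ga)) by (intros H; apply Hp; now right).
assert (HpI : ~ inter O1 O2 (pole al ga)) by (intros [H _]; auto).
pose proof (open_sph_inter O1 O2 Op1 Op2) as OpI.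
destruct (planar_pm al be ga de Hdet O1 Op1 l1 M1) as [J1 [H1 E1]].
destruct (planar_pm al be ga de Hdet O2 Op2 l2 M2) as [J2 [H2 E2]].
destruct (planar_pm al be ga de Hdet (union O1 O2) OpU lU MU) as [JU [HU EU]].
destruct (planar_pm al be ga de Hdet (inter O1 O2) OpI lI MI) as [JI [HI EI]].
pose proof (curve_complete_ext _ _ _ (fun w => eq_sym (E1 w)) (complete_transfer al be ga de Hdet O1 l1 Op1 Hp1 M1
  C1)) as K1.
pose proof (curve_complete_ext _ _ _ (fun w => eq_sym (E2 w)) (complete_transfer al be ga de Hdet O2 l2 Op2 Hp2 M2
  C2)) as K2.
pose proof (curve_complete_ext _ _ _ (fun w => eq_sym (EI w)) (complete_transfer al be ga de Hdet (inter O1 O2) lI OpI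
  HpI MI CI)) as KI.
pose proof (in_plane_connected al be ga de Hdet O1 Hp1 Cn1) as N1.
pose proof (in_plane_connected al be ga de Hdet O2 Hp2 Cn2) as N2.
set (W1 := in_plane al be ga de O1) in *. set (W2 := in_plane al be ga de O2) in *.
change (in_plane al be ga de (union O1 O2)) with (fun p => W1 p \/ W2 p) in HU.
change (in_plane al be ga de (inter O1 O2)) with (fun p => W1 p /\ W2 p) in HI, KI.
assert (QUO : forall w, W1 w -> W2 w ->
  exp (ju J1 w + ju J2 w - (ju JU w + ju JI w)) = (l1 (of_plane al be ga de w) * l2 (of_plane al be ga de w)) / (lU
    (of_plane al be ga de w) * lI (of_plane al be ga de w))).
{ intros w A B. rewrite E1, E2, EU, EI.
  pose proof (plane_dens_pos al be ga de Hdet O1 l1 M1 w A) as P1.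
  pose proof (plane_dens_pos al be ga de Hdet O2 l2 M2 w B) as P2.
  pose proof (plane_dens_pos al be ga de Hdet (union O1 O2) lU MU w (or_introl A)) as PU.
  pose proof (plane_dens_pos al be ga de Hdet (inter O1 O2) lI MI w (conj A B)) as PI.
  rewrite ln_quot, exp_ln; auto.
  2: { apply Rdiv_lt_0_compat; apply Rmult_lt_0_compat; auto. }
  unfold plane_dens in *.
  assert (Hj : plane_factor al be ga de w <> 0). { intros Z. rewrite Z in P1. lra. }
  assert (lU (of_plane al be ga de w) <> 0). { intros Z. rewrite Z in PU. lra. }
  assert (lI (of_plane al be ga de w) <> 0). { intros Z. rewrite Z in PI. lra. }
  field. auto. }
assert (ON : forall z, inter O1 O2 z -> exists w, z = of_plane al be ga de w /\ W1 w /\ W2 w).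
{ intros z Hz. destruct (of_plane_onto al be ga de Hdet _ HpI z Hz) as [w ->]. exists w. split; auto. }
assert (EQ1 : forall w, W1 w -> W2 w -> ju JI w + ju JU w = ju J1 w + ju J2 w ->
   (l1 (of_plane al be ga de w) * l2 (of_plane al be ga de w)) / (lU (of_plane al be ga de w) * lI (of_plane al be ga
     de w)) = 1).
{ intros w A B E. rewrite <- QUO by auto. replace (ju J1 w + ju J2 w - (ju JU w + ju JI w)) with 0 by lra.
  apply exp_0. }
split.
- intros z Hz. destruct (ON z Hz) as [w [-> [A B]]]. rewrite <- QUO by auto.
  pose proof (planar_product_le W1 W2 J1 J2 JI JU H1 H2 HI HU K1 K2 w (conj A B)).
  rewrite <- exp_0. apply exp_le. lra.
- intros z Hz Ez. destruct (ON z Hz) as [w [-> [A B]]].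
  rewrite <- QUO in Ez by auto.
  assert (Es : ju JI w + ju JU w = ju J1 w + ju J2 w).
  { rewrite <- exp_0 in Ez. apply exp_inv in Ez. lra. }
  destruct (union_metric_eq_at W1 W2 J1 J2 JI JU H1 H2 HI HU K1 K2 w (conj A B) Es) as [Ep|Ep].
  + destruct (equality_subset W1 W2 J1 J2 JI JU w H1 H2 HI HU K1 K2 KI N1 N2 A B Ep) as [S Q].
    split.
    * right. intros p Hpp. destruct (of_plane_onto al be ga de Hdet _ Hp2 p Hpp) as [x ->]. apply (S x Hpp).
    * intros y Hy. destruct (ON y Hy) as [x [-> [X Y]]]. apply EQ1; auto.
  (* The two sets exchange their roles; union and intersection have to be rewritten in the opposite
     order. *)
  + assert (HU' : planar_metric (fun p => W2 p \/ W1 p) JU).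
    { eapply pm_sub; [exact HU| |]. intros p Hpp. destruct (pm_open _ _ HU p) as [r [Hr Kr]]; [tauto|].
      exists r; split; auto. intros q Hq. destruct (Kr q Hq); tauto. tauto. }
    assert (HI' : planar_metric (fun p => W2 p /\ W1 p) JI).
    { eapply pm_sub; [exact HI| |]. intros p Hpp. destruct (pm_open _ _ HI p) as [r [Hr Kr]]; [tauto|].
      exists r; split; auto. intros q Hq. destruct (Kr q Hq); tauto. tauto. }
    assert (KI' : curve_complete (fun p => W2 p /\ W1 p) (ju JI)).
    { intros g dg T K HT HG. destruct (KI g dg T K HT) as [P [WP HP]]. { intros t Ht. destruct (HG t Ht) as [[? ?] ?].
      tauto. }
      exists P. tauto. }
    destruct (equality_subset W2 W1 J2 J1 JI JU w H2 H1 HI' HU' K2 K1 KI' N2 N1 B A Ep) as [S Q].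
    split.
    * left. intros p Hpp. destruct (of_plane_onto al be ga de Hdet _ Hp1 p Hpp) as [x ->]. apply (S x Hpp).
    * intros y Hy. destruct (ON y Hy) as [x [-> [X Y]]]. apply EQ1; auto. rewrite (Q x Y X). ring.
Qed.

Theorem theorem1 :
  forall (O1 O2 : Sphere -> Prop) (l1 l2 lU lI : Sphere -> R),
    domain O1 -> domain O2 ->
    (exists p, inter O1 O2 p) ->
    hyperbolic (union O1 O2) ->
    hyperbolic_metric O1 l1 -> hyperbolic_metric O2 l2 ->
    hyperbolic_metric (union O1 O2) lU -> hyperbolic_metric (inter O1 O2) lI ->
    (forall z, inter O1 O2 z -> 1 <= (l1 z * l2 z) / (lU z * lI z)) /\
    (forall z, inter O1 O2 z -> (l1 z * l2 z) / (lU z * lI z) = 1 ->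
       (subset O1 O2 \/ subset O2 O1) /\
       (forall w, inter O1 O2 w -> (l1 w * l2 w) / (lU w * lI w) = 1)).
Proof.
intros O1 O2 l1 l2 lU lI D1 D2 _ [OpU [a [_ [_ [_ [_ [_ [Ha _]]]]]]]] H1 H2 HU HI.
destruct a as [a|].
(* The map [w -> a - 1 / w] sends infinity to the omitted point [a]. *)
- apply (theorem1_of_moebius (a : C) (- (1))%C 1%C 0%C); auto.
  + ring.
  + intros H. apply Ha. unfold pole in H. destruct excluded_middle_informative as [E|E].
    * exfalso. apply C1_neq0. exact E.
    * assert (Ea : forall x : C, (x / 1)%C = x) by (intros; field; exact E). rewrite (Ea a) in H. exact H.
(* The omitted point is infinity itself, and the identity serves. *)
- apply (theorem1_of_moebius 1%C 0%C 0%C 1%C); auto.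
  + ring.
  + intros H. apply Ha. unfold pole in H. destruct excluded_middle_informative as [E|E]; [exact H|]. exfalso.
    now apply E.
Qed.
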